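(* Let $d\ge 1$. (i) If $-1<s<0$ then the operators $\mathbb{E}_N$, $N\ge0$, have uniformly bounded extensions to $B^{s}_{\infty, q}(\mathbb{R}^d)$, for all $0<q\le \infty$. (ii) If $s=0$ then $\mathbb{E}_N$ admits a bounded extension to $B^0_{\infty,q}(\mathbb{R}^d)$ if and only if $q=\infty$. Moreover, $\sup_N\|\mathbb{E}_N\|_{B^0_{\infty,\infty} \to B^0_{\infty,\infty} }<\infty$. (iii) If $s=-1$ then $\sup_N\|\mathbb{E}_N\|_{B^{-1}_{\infty,q} \to B^{-1}_{\infty,q} }=\infty$, for all $0<q\leq\infty$.
   Context: $B^s_{p,q}(\mathbb{R}^d)$ is the usual inhomogeneous Besov space. The dyadic averaging operators are defined, with $I_{N,\mu}=2^{-N}(\mu+[0,1)^d)$, by $$\mathbb{E}_Nf(x)=\sum_{\mu\in\mathbb{Z}^d}\mathbf{1}_{I_{N,\mu}}(x)\,2^{Nd}\int_{I_{N,\mu}}f(y)\,dy,\qquad f\in L^1_{loc}(\mathbb{R}^d),\ N\in\mathbb{N}_0.$$ Extensions are from the Schwartz class $\mathcal{S}(\mathbb{R}^d)$. In the positive cases, $\mathbb{E}_N$ acts on $f\in B^s_{\infty,q}$ by $\mathbb{E}_Nf=\sum_{j\ge0}\mathbb{E}_N[f_j]$, where $\widehat{f_0}=\eta_0\widehat f$, $\widehat{f_j}=(\eta_0(2^{-j}\cdot)-\eta_0(2^{-j+1}\cdot))\widehat f$ for $j\ge1$, and $\eta_0\in C_c^\infty(\mathbb{R}^d)$ is supported in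 $\{|\xi|<3/8\}$ with $\eta_0=1$ on $\{|\xi|\le1/4\}$. If no bounded extension exists the operator norm is understood to be $+\infty$. *)

(* Defs.v *)
From HB Require Import structures.
From mathcomp Require Import all_boot all_order all_algebra.
From mathcomp Require Import complex.
From mathcomp Require Import all_classical all_reals all_analysis.

Set Implicit Arguments.
Unset Strict Implicit.
Unset Printing Implicit Defensive.

Import Order.TTheory GRing.Theory Num.Theory.
Import numFieldNormedType.Exports.
Import ComplexField.Normc.

Local Open Scope classical_set_scope.
Local Open Scope ring_scope.
Local Open Scope complex_scope.

(* Row vectors carry the sigma-algebra generated by the coordinates, which is
   the Borel sigma-algebra of R^n. *)
Definition rV_display : measure_display.
Proof. exact: default_measure_display. Qed.

Section measurable_rV.
Context {R : realType} {n : nat}.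

Let coord : 'I_n -> 'rV[R]_n -> measurableTypeR R := fun i x => x ord0 i.

Let rV_set0 : g_sigma_preimage coord set0.
Proof. exact: sigma_algebra0. Qed.

Let rV_setC A : g_sigma_preimage coord A -> g_sigma_preimage coord (~` A).
Proof. exact: sigma_algebraC. Qed.

Let rV_bigcup (F : _^nat) : (forall i, g_sigma_preimage coord (F i)) ->
  g_sigma_preimage coord (\bigcup_i (F i)).
Proof. exact: sigma_algebra_bigcup. Qed.

HB.instance Definition _ := @isMeasurable.Build rV_display
  'rV[R]_n (g_sigma_preimage coord) rV_set0 rV_setC rV_bigcup.

Lemma measurable_rV_coord (i : 'I_n) :
  measurable_fun [set: 'rV[R]_n] (fun x => x ord0 i : measurableTypeR R).
Proof.
move=> _ Y mY; rewrite setTI; apply: sub_sigma_algebra => /=.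
rewrite -bigcup_seq/=; exists i => /=; first by rewrite mem_index_enum.
by exists Y => //; rewrite setTI.
Qed.

Lemma measurable_fun_rV d (S : measurableType d) (f : S -> 'rV[R]_n) :
  (forall i, measurable_fun [set: S] (fun x => f x ord0 i : measurableTypeR R)) ->
  measurable_fun [set: S] f.
Proof.
move=> mf _ Y mY; rewrite setTI.
pose G := [set A : set 'rV[R]_n | measurable (f @^-1` A)].
suff : g_sigma_preimage coord `<=` G by apply.
apply: smallest_sub.
  split=> [|A|F mF]; rewrite /G/=.
  - by rewrite preimage_set0.
  - by move=> mA; rewrite setTD preimage_setC; exact: measurableC.
  - by rewrite preimage_bigcup; apply: bigcup_measurable => k _; exact: mF.
rewrite -bigcup_seq/=; apply: bigcup_sub => i _ A [B mB <-]; rewrite /G/=.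
by have := mf i measurableT B mB; rewrite !setTI.
Qed.

End measurable_rV.

Section row_cons.
Context {R : realType} {n : nat}.

Definition row_cons (p : measurableTypeR R * 'rV[R]_n) : 'rV[R]_n.+1 :=
  row_mx (const_mx p.1 : 'rV[R]_1) p.2.

Definition row_uncons (x : 'rV[R]_n.+1) : measurableTypeR R * 'rV[R]_n :=
  (x ord0 ord0, \row_j x ord0 (lift ord0 j)).

Lemma row_consK : cancel row_cons row_uncons.
Proof.
move=> [a y]; rewrite /row_uncons /row_cons; congr pair.
  rewrite mxE; case: splitP => [j _|j]; first by rewrite mxE.
  by move=> /= /eqP; rewrite add1n.
apply/rowP => j; rewrite !mxE; case: splitP => [k /=|k /=].
  by move=> H; have := ltn_ord k; rewrite -H.
by rewrite /bump/= => /addnI/val_inj ->.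
Qed.

Lemma measurable_row_cons : measurable_fun setT row_cons.
Proof.
apply: measurable_fun_rV => i.
rewrite /row_cons; under eq_fun do rewrite mxE.
case: (splitP _) => j _.
- by under eq_fun do rewrite mxE; exact: measurable_fst.
- exact: (measurableT_comp (measurable_rV_coord j) measurable_snd).
Qed.

Lemma measurable_row_uncons : measurable_fun setT row_uncons.
Proof.
apply/measurable_fun_pairP; split; first exact: measurable_rV_coord.
apply: measurable_fun_rV => j /=.
under eq_fun do rewrite mxE; exact: measurable_rV_coord.
Qed.

End row_cons.

Lemma product_sigma_finite d1 d2 (T1 : measurableType d1)
    (T2 : measurableType d2) (R : realType)
    (m1 : {sigma_finite_measure set T1 -> \bar R})
    (m2 : {sigma_finite_measure set T2 -> \bar R}) :
  sigma_finite setT (m1 \x m2)%E.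
Proof.
have /sigma_finiteP[F [TF ndF Foo]] := sigma_finiteT m1.
have /sigma_finiteP[G [TG ndG Goo]] := sigma_finiteT m2.
exists (fun n => F n `*` G n).
 rewrite -setXTT TF TG predeqE => -[x y]; split.
    move=> [/= [n _ Fnx] [k _ Gky]]; exists (maxn n k) => //; split.
    - by move: x Fnx; exact/subsetPset/ndF/leq_maxl.
    - by move: y Gky; exact/subsetPset/ndG/leq_maxr.
  by move=> [n _ []/= ? ?]; split; exists n.
move=> k; have [? ?] := Foo k; have [? ?] := Goo k.
split; first exact: measurableX.
by rewrite product_measure1E// lte_mul_pinfty// ge0_fin_numE.
Qed.

Section lebesgue_rV.
Local Open Scope ereal_scope.
Context {R : realType}.

Section step.
Context {n : nat}.
Variable m : {sigma_finite_measure set 'rV[R]_n -> \bar R}.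

Definition lebesgue_rV_step : set 'rV[R]_n.+1 -> \bar R :=
  pushforward (@lebesgue_measure R \x m) row_cons.

Let mrow_cons (A : set 'rV[R]_n.+1) :
  measurable A -> measurable (row_cons @^-1` A).
Proof.
by move=> mA; rewrite -[X in measurable X]setTI; exact: measurable_row_cons.
Qed.

Let step0 : lebesgue_rV_step set0 = 0.
Proof. by rewrite /lebesgue_rV_step /pushforward preimage_set0 measure0. Qed.

Let step_ge0 A : 0 <= lebesgue_rV_step A.
Proof. exact: (measure_ge0 (@lebesgue_measure R \x m)). Qed.

Let step_sigma_additive : semi_sigma_additive lebesgue_rV_step.
Proof.
move=> F mF tF mUF; rewrite /lebesgue_rV_step /pushforward preimage_bigcup.
apply: measure_semi_sigma_additive.
- by move=> k; exact: mrow_cons.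
- apply/trivIsetP => /= i j _ _ ij; rewrite -preimage_setI.
  by move/trivIsetP : tF => /(_ _ _ _ _ ij) ->//; rewrite preimage_set0.
- by rewrite -preimage_bigcup; exact: mrow_cons.
Qed.

HB.instance Definition _ := isMeasure.Build _ _ _ lebesgue_rV_step
  step0 step_ge0 step_sigma_additive.

Let step_sigma_finite : sigma_finite setT lebesgue_rV_step.
Proof.
have [F FT Foo] := product_sigma_finite (@lebesgue_measure R) m.
exists (fun k => row_uncons @^-1` F k).
  by rewrite -preimage_bigcup -FT preimage_setT.
move=> k; have [mF Ffin] := Foo k; split.
  by rewrite -[X in measurable X]setTI; exact: measurable_row_uncons.
rewrite /lebesgue_rV_step /pushforward -comp_preimage.
by rewrite (_ : _ \o _ = id) //; apply/funext => p /=; rewrite row_consK.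
Qed.

HB.instance Definition _ := Measure_isSigmaFinite.Build _ _ _ lebesgue_rV_step
  step_sigma_finite.

End step.

Fixpoint lebesgue_rV n : {sigma_finite_measure set 'rV[R]_n -> \bar R} :=
  match n with
  | 0 => @dirac _ 'rV[R]_0 0%R R
  | n'.+1 => lebesgue_rV_step (lebesgue_rV n')
  end.

End lebesgue_rV.

Section integration.
Context {R : realType} {d : nat}.
Implicit Types (f g h : 'rV[R]_d -> R[i]) (x xi : 'rV[R]_d) (D : set 'rV[R]_d).

Notation mu := (lebesgue_rV (R := R) d).

Definition cmeasurable f : Prop :=
  measurable_fun setT (fun x => complex.Re (f x)) /\
  measurable_fun setT (fun x => complex.Im (f x)).

Definition cintegrable D f : Prop :=
  mu.-integrable D (fun x => (complex.Re (f x))%:E) /\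
  mu.-integrable D (fun x => (complex.Im (f x))%:E).

Definition cintegral D f : R[i] :=
  (\int[mu]_(x in D) complex.Re (f x)) +i* (\int[mu]_(x in D) complex.Im (f x)).

Definition dotp x xi : R := \sum_(i < d) x ord0 i * xi ord0 i.

Definition enorm x : R := Num.sqrt (dotp x x).

Definition expi (t : R) : R[i] := cos t +i* sin t.

Definition fourier f : 'rV[R]_d -> R[i] := fun xi =>
  cintegral setT (fun x => f x * expi (- (2 * pi * dotp x xi))).

Definition inv_fourier f : 'rV[R]_d -> R[i] := fun x =>
  cintegral setT (fun xi => f xi * expi (2 * pi * dotp x xi)).

End integration.

Section schwartz.
Context {R : realType} {d : nat}.
Implicit Types (f g : 'rV[R]_d -> R[i]) (x : 'rV[R]_d) (l : seq 'I_d).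

Definition pderivs l (f : 'rV[R]_d -> R) : 'rV[R]_d -> R :=
  foldr (fun i (h : 'rV[R]_d -> R) x => 'D_(delta_mx ord0 i) h x) f l.

Definition cpderivs l f : 'rV[R]_d -> R[i] := fun x =>
  pderivs l (fun y => complex.Re (f y)) x
    +i* pderivs l (fun y => complex.Im (f y)) x.

(* C^oo in the real sense: all iterated partial derivatives of the real and
   imaginary parts are everywhere (Frechet) differentiable. *)
Definition csmooth f : Prop := forall l x,
  differentiable (pderivs l (fun y => complex.Re (f y))) x /\
  differentiable (pderivs l (fun y => complex.Im (f y))) x.

Definition schwartz_norm (m : nat) f : \bar R :=
  ereal_sup [set r | exists l x, (size l <= m)%N /\
    r = ((1 + enorm x) ^+ m * normc (cpderivs l f x))%:E].

Definition schwartz f : Prop :=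
  csmooth f /\ forall m, (schwartz_norm m f < +oo)%E.

End schwartz.

(* A distribution is given by its values on Schwartz functions: values at other
   arguments are junk, hence deq below is the equality of distributions. *)
Definition functional (R : realType) (d : nat) : Type :=
  ('rV[R]_d -> R[i]) -> R[i].

Section distributions.
Context {R : realType} {d : nat}.
Implicit Types (u v : functional R d) (f g h eta : 'rV[R]_d -> R[i]).

Notation mu := (lebesgue_rV (R := R) d).

Definition deq u v : Prop := forall g, schwartz g -> u g = v g.

Definition tempered u : Prop :=
  (forall (a : R[i]) f g, schwartz f -> schwartz g ->
    u (fun x => a * f x + g x) = a * u f + u g) /\
  (exists (m : nat) (C : R), forall g, schwartz g ->
    ((normc (u g))%:E <= C%:E * schwartz_norm m g)%E).

Definition dist_of h : functional R d := fun g =>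
  cintegral setT (fun x => h x * g x).

Definition represents h u : Prop :=
  [/\ cmeasurable h,
      forall g, schwartz g -> cintegrable setT (fun x => h x * g x)
    & deq (dist_of h) u].

Definition dfourier u : functional R d := fun g => u (fourier g).

Definition dinv_fourier u : functional R d := fun g => u (inv_fourier g).

Definition dmul eta u : functional R d := fun g => u (fun xi => eta xi * g xi).

(* The L^p quasi-norm of a distribution, +oo when it is not a function in L^p.
   All the functions representing u agree almost everywhere. *)
Definition dist_Lnorm (p : \bar R) u : \bar R :=
  ereal_inf [set Lnorm mu p (fun x => (normc (h x))%:E)
            | h in [set h | represents h u]].

End distributions.

Section besov.
Context {R : realType} {d : nat}.
Variable eta0 : 'rV[R]_d -> R[i].
Implicit Types (p q : \bar R) (s : R) (u v : functional R d).

Definition lp_cutoff : Prop :=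
  [/\ csmooth eta0,
      closure [set xi | eta0 xi != 0] `<=` [set xi | enorm xi < 3 / 8]
    & forall xi, enorm xi <= 4^-1 -> eta0 xi = 1].

Definition lp_eta (j : nat) : 'rV[R]_d -> R[i] := fun xi =>
  if j is k.+1 then eta0 (2 ^- j *: xi) - eta0 (2 ^- k *: xi) else eta0 xi.

Definition lp_piece (j : nat) u : functional R d :=
  dinv_fourier (dmul (lp_eta j) (dfourier u)).

Definition besov_norm s p q u : \bar R :=
  (Lnorm counting q (fun j : nat =>
     (2 `^ (j%:R * s))%:E * dist_Lnorm p (lp_piece j u)))%E.

Definition besov s p q : set (functional R d) :=
  [set u | tempered u /\ (besov_norm s p q u < +oo)%E].

End besov.

Section averaging.
Context {R : realType} {d : nat}.
Implicit Types (f : 'rV[R]_d -> R[i]).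

Definition dyadic_cube (N : nat) (mu : 'rV[int]_d) : set 'rV[R]_d :=
  [set x | forall i, 2 ^- N * (mu ord0 i)%:~R <= x ord0 i
                       < 2 ^- N * ((mu ord0 i)%:~R + 1)].

(* For each x a single cube contributes to the sum. *)
Definition dyadic_avg (N : nat) f : 'rV[R]_d -> R[i] := fun x =>
  \sum_(mu \in [set: 'rV[int]_d])
     (\1_(dyadic_cube N mu) x)%:C * (2 ^+ (N * d) * cintegral (dyadic_cube N mu) f).

End averaging.

Section extensions.
Context {R : realType} {d : nat}.
Variable eta0 : 'rV[R]_d -> R[i].
Variables (s : R) (p q : \bar R).
Implicit Types (N : nat) (T : functional R d -> functional R d).

Notation B := (besov eta0 s p q).

Definition is_extension N T : Prop :=
  [/\ forall u, B u -> tempered (T u),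
      forall u v, B u -> B v -> deq u v -> deq (T u) (T v),
      forall (a : R[i]) u v, B u -> B v ->
        deq (T (fun g => a * u g + v g)) (fun g => a * T u g + T v g)
    & forall f, schwartz f -> deq (T (dist_of f)) (dist_of (dyadic_avg N f))].

Definition op_norm T : \bar R :=
  ereal_sup [set besov_norm eta0 s p q (T u)
            | u in [set u | B u /\ (besov_norm eta0 s p q u <= 1)%E]].

Definition admits_bounded_extension N : Prop :=
  exists T, is_extension N T /\ (op_norm T < +oo)%E.

(* Schwartz functions need not be dense in B, so extensions need not be unique:
   this is the least norm of an extension, +oo if none is bounded. *)
Definition avg_norm N : \bar R :=
  ereal_inf [set op_norm T | T in [set T | is_extension N T]].

(* T u = \sum_(j >= 0) E_N[u_j], converging in the sense of distributions.
   Representatives h j of the pieces exist, since besov_norm u is finite, and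
   their averages over cubes do not depend on the choice. *)
Definition acts_by_series N T : Prop :=
  forall u, B u -> forall h : nat -> 'rV[R]_d -> R[i],
    (forall j, represents (h j) (lp_piece eta0 j u)) ->
    forall g, schwartz g ->
      (fun n => normc (\sum_(j < n) dist_of (dyadic_avg N (h j)) g - T u g))
        @ \oo --> (0 : R).

Definition uniformly_bounded_extensions : Prop :=
  exists T : nat -> functional R d -> functional R d,
    (forall N, is_extension N (T N) /\ acts_by_series N (T N)) /\
    (ereal_sup [set op_norm (T N) | N in [set: nat]] < +oo)%E.

End extensions.

(* Main.v *)
From HB Require Import structures.
Require Import Defs.
From mathcomp Require Import all_boot all_order all_algebra.
From mathcomp Require Import complex ring lra.
From mathcomp Require Import all_classical all_reals all_analysis measurable_realfun zify.

(** The proof works with bounded functions throughout: a distribution whose pieces have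
    finite sup-norm is given piece by piece by bounded functions ([brep]), and Fourier
    multipliers act on these by convolution with integrable kernels. Let [E] be the
    averaging operator over the cubes of side [2^-N]; it is an integral operator with
    symmetric kernel, and [E E = E].

    Positive results ([avg_main], [avg_uniformly_bounded]). Let [h] be the piece of [u] of
    frequency [2^j]. The pieces of [E h] of frequency [2^k] are estimated by pairing [E h]
    with kernels [G] of scale [2^-k]. If [j > N], then [h] is a convolution with a kernel
    of mean zero, which is paired with the function [E G], on which small shifts act in a
    Lipschitz way in L^1; this gains [2^(N - j)]. If [j <= N], then
    <(E - 1) h, G> = - <(E - 1) h, (E - 1) G>, because [E] is symmetric and idempotent,
    and the smoothness of [h] gains [2^(j - N)]. In both cases one gains moreover
    [2^(k - N)] for [k <= N], by the smoothness of [G]. The blocks [h] with [j <= N], which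
    were subtracted from their averages, add up to the low frequencies of [u] and cost
    nothing. For [-1 < s <= 0] the sum over [j] of [2^(- j s) 2^-|j - N|] is of order
    [2^(- N s)]; after multiplication with [2^(k s)] and the gain in [k] there remains a
    sequence in [k] that decays geometrically away from [N] if [s < 0], and is bounded if
    [s = 0]. It belongs to l^q uniformly in [N] if [s < 0] or [q = oo].

    The averages do not depend on the representatives of the pieces, as test functions
    approximate the indicator functions of cubes ([du_bois_reymond]); so the sum of the
    averaged pieces is a well-defined linear extension.

    The case [s = 0], [q < oo] ([no_bounded_extension]). The average of a smooth bump
    inside one cube is a multiple of the indicator function of this cube. Near a face it
    looks like the indicator function of a half-space at all small scales, so that its
    pieces do not tend to zero, as a test function with frequencies in an annulus shows.

    The case [s = -1] ([extension_blowup]). Let [a] be a sum of [K] atoms of frequencies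
    [2, 4, ..., 2^K] that are spread out in space, such that [a] is bounded uniformly in
    [K]. Multiply [a] by characters in the i-th variable, with frequencies
    [7 * 2^(N + m)] for [m < K], and add the i-th derivatives of the products. By the
    choice of the frequencies every summand is a piece of the sum, whose norm is of order
    [K^(1/q)], independently of [N]. Since the average of a derivative depends only on the
    values on the faces orthogonal to the i-th axis ([avg_cD0]), where the characters are
    1, the average of the sum is [K] times the average of the derivative of [a]. For large
    [N] the latter is almost the derivative of [a] itself, whose norm is of order
    [K^(1/q)], too. So the norms of the operators are at least of order [K], whatever the
    extension.

    This requires the inversion formula for Schwartz functions; it is proved with the Abel
    kernel. *)

Set Implicit Arguments.
Unset Strict Implicit.
Unset Printing Implicit Defensive.

Import Order.TTheory GRing.Theory Num.Theory.
Import numFieldNormedType.Exports.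
Import ComplexField.Normc.

Local Open Scope classical_set_scope.
Local Open Scope ring_scope.
Local Open Scope complex_scope.
Notation cRe := complex.Re.
Notation cIm := complex.Im.

(** * Complex numbers *)

Section complex_modulus.
Context {R : realType}.
Implicit Types (z w : R[i]) (r : R).

Lemma cRe_add z w : cRe (z + w) = cRe z + cRe w. Proof. by case: z w => [? ?] []. Qed.
Lemma cIm_add z w : cIm (z + w) = cIm z + cIm w. Proof. by case: z w => [? ?] []. Qed.
Lemma cRe_opp z : cRe (- z) = - cRe z. Proof. by case: z. Qed.
Lemma cIm_opp z : cIm (- z) = - cIm z. Proof. by case: z. Qed.
Lemma cRe_mul z w : cRe (z * w) = cRe z * cRe w - cIm z * cIm w.
Proof. by case: z w => [? ?] []. Qed.
Lemma cIm_mul z w : cIm (z * w) = cRe z * cIm w + cIm z * cRe w.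
Proof. by case: z w => [? ?] []. Qed.

Definition cReIm := (cRe_add, cIm_add, cRe_opp, cIm_opp, cRe_mul, cIm_mul).

Lemma complex_ext z w : cRe z = cRe w -> cIm z = cIm w -> z = w.
Proof. by case: z w => [? ?] [? ?] /= -> ->. Qed.

Lemma cRe_sum (I : Type) (s : seq I) (P : pred I) (F : I -> R[i]) :
  cRe (\sum_(i <- s | P i) F i) = \sum_(i <- s | P i) cRe (F i).
Proof. by elim/big_rec2 : _ => // i ? z _ <-; rewrite cRe_add. Qed.

Lemma cIm_sum (I : Type) (s : seq I) (P : pred I) (F : I -> R[i]) :
  cIm (\sum_(i <- s | P i) F i) = \sum_(i <- s | P i) cIm (F i).
Proof. by elim/big_rec2 : _ => // i ? z _ <-; rewrite cIm_add. Qed.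

Lemma normcE' z : normc z = Num.sqrt (cRe z ^+ 2 + cIm z ^+ 2).
Proof. by case: z. Qed.

Lemma normc_ge0 z : 0 <= normc z.
Proof. by rewrite normcE' sqrtr_ge0. Qed.

Lemma normc_cRe z : `|cRe z| <= normc z.
Proof.
by rewrite normcE' -sqrtr_sqr ler_sqrt ?lerDl ?sqr_ge0// addr_ge0// sqr_ge0.
Qed.

Lemma normc_cIm z : `|cIm z| <= normc z.
Proof.
by rewrite normcE' -sqrtr_sqr ler_sqrt ?lerDr ?sqr_ge0// addr_ge0// sqr_ge0.
Qed.

Lemma normc_le z : normc z <= `|cRe z| + `|cIm z|.
Proof.
rewrite normcE' -[leRHS]ger0_norm ?addr_ge0// -sqrtr_sqr ler_sqrt ?sqr_ge0//.
by rewrite sqrrD !real_normK ?num_real// lerD2r lerDl mulrn_wge0.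

Qed.

Lemma normcR r : normc (r%:C) = `|r|.
Proof. by rewrite normcE' /= expr0n/= addr0 sqrtr_sqr. Qed.

Lemma normcB z w : normc (z - w) = normc (w - z).
Proof. by rewrite -normcN opprB. Qed.

Lemma normc_eq0 z : normc z = 0 -> z = 0.
Proof. exact: eq0_normc. Qed.

Lemma normc_zero : normc (0 : R[i]) = 0.
Proof. exact: normc0. Qed.

Lemma normc_one : normc (1 : R[i]) = 1.
Proof. exact: normc1. Qed.

Lemma le_normc_sum (I : Type) (s : seq I) (P : pred I) (F : I -> R[i]) :
  normc (\sum_(i <- s | P i) F i) <= \sum_(i <- s | P i) normc (F i).
Proof.
elim/big_rec2 : _ => [|i x z _ h]; first by rewrite normc_zero.
by rewrite (le_trans (le_normcD _ _))// lerD2l.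
Qed.

Lemma cRe_real r z : cRe (r%:C * z) = r * cRe z.
Proof. by rewrite !cReIm /= mul0r subr0. Qed.
Lemma cIm_real r z : cIm (r%:C * z) = r * cIm z.
Proof. by rewrite !cReIm /= mul0r addr0. Qed.

Lemma expiD (s t : R) : expi (s + t) = expi s * expi t.
Proof. by apply: complex_ext; rewrite !cReIm /= ?cosD ?sinD//; ring. Qed.

Lemma expi0 : expi (0 : R) = 1.
Proof. by rewrite /expi cos0 sin0. Qed.

Lemma normc_expi (t : R) : normc (expi t) = 1.
Proof. by rewrite normcE' /= cos2Dsin2 sqrtr1. Qed.

End complex_modulus.

(** * Integration of complex functions *)

Section complex_integral.
Context d (T : measurableType d) (R : realType).
Variable mu : {measure set T -> \bar R}.
Implicit Types (f g h : T -> R[i]) (c : R[i]).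

Definition cmeas f : Prop :=
  measurable_fun setT (fun x => cRe (f x)) /\
  measurable_fun setT (fun x => cIm (f x)).

Definition norm1 f : \bar R := (\int[mu]_x (normc (f x))%:E)%E.

Definition L1 f : Prop := cmeas f /\ (norm1 f < +oo)%E.

Definition cI f : R[i] :=
  (\int[mu]_x cRe (f x)) +i* (\int[mu]_x cIm (f x)).

Lemma cmeas_cst c : cmeas (fun=> c).
Proof. by split; exact: measurable_cst. Qed.

Lemma cmeasD f g : cmeas f -> cmeas g -> cmeas (fun x => f x + g x).
Proof.
move=> [f1 f2] [g1 g2]; split.
  by under eq_fun do (rewrite cRe_add); exact: measurable_funD.
by under eq_fun do (rewrite cIm_add); exact: measurable_funD.
Qed.

Lemma cmeasN f : cmeas f -> cmeas (fun x => - f x).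
Proof.
move=> [f1 f2]; split.
  by under eq_fun do (rewrite cRe_opp); exact: measurableT_comp.
by under eq_fun do (rewrite cIm_opp); exact: measurableT_comp.
Qed.

Lemma cmeasB f g : cmeas f -> cmeas g -> cmeas (fun x => f x - g x).
Proof. by move=> mf mg; apply: cmeasD => //; exact: cmeasN. Qed.

Lemma cmeasM f g : cmeas f -> cmeas g -> cmeas (fun x => f x * g x).
Proof.
move=> [f1 f2] [g1 g2]; split.
  by under eq_fun do (rewrite cRe_mul); apply: measurable_funB; exact: measurable_funM.
by under eq_fun do (rewrite cIm_mul); apply: measurable_funD; exact: measurable_funM.
Qed.

Lemma cmeas_sum (I : Type) (s : seq I) (F : I -> T -> R[i]) :
  (forall i, cmeas (F i)) -> cmeas (fun x => \sum_(i <- s) F i x).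
Proof.
move=> mF; split.
  under eq_fun do (rewrite cRe_sum); apply: measurable_sum => i; exact: (mF i).1.
under eq_fun do (rewrite cIm_sum); apply: measurable_sum => i; exact: (mF i).2.
Qed.

Lemma cmeasR (f : T -> R) : measurable_fun setT f -> cmeas (fun x => (f x)%:C).
Proof. by move=> mf; split => //=; exact: measurable_cst. Qed.

Lemma cmeas_normc f : cmeas f -> measurable_fun setT (fun x => normc (f x)).
Proof.
move=> [f1 f2]; under eq_fun do rewrite normcE'.
apply: measurableT_comp.
  by apply: continuous_measurable_fun => x; exact: sqrt_continuous.
by apply: measurable_funD; exact: measurable_funX.
Qed.

Lemma cmeas_Enormc f : cmeas f -> measurable_fun setT (fun x => (normc (f x))%:E : \bar R).
Proof. by move=> mf; apply/measurable_EFinP; exact: cmeas_normc. Qed.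

Lemma cmeas_lim (f_ : nat -> T -> R[i]) f : (forall n, cmeas (f_ n)) ->
  (forall x, (fun n => normc (f_ n x - f x)) @ \oo --> (0 : R)) -> cmeas f.
Proof.
move=> mf_ ff.
have cv (p : R[i] -> R) : (forall z, `|p z| <= normc z) ->
   (forall z w, p (z - w) = p z - p w) ->
   forall x, (fun n => p (f_ n x)) @ \oo --> p (f x).
  move=> pn pB x; apply/cvgrPdist_lt => e e0.
  have /cvgrPdist_lt/(_ _ e0) := ff x; apply: filterS => n.
  rewrite sub0r normrN ger0_norm ?normc_ge0// => /(le_lt_trans _); apply.
  by rewrite normcB -pB.
split.
  apply: (@measurable_fun_cvg _ _ _ setT (fun n x => cRe (f_ n x))).
    by move=> n; exact: (mf_ n).1.
  by move=> x _; apply: (cv (@cRe R)); [exact: normc_cRe|move=> *; rewrite cRe_add cRe_opp].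
apply: (@measurable_fun_cvg _ _ _ setT (fun n x => cIm (f_ n x))).
  by move=> n; exact: (mf_ n).2.
by move=> x _; apply: (cv (@cIm R)); [exact: normc_cIm|move=> *; rewrite cIm_add cIm_opp].
Qed.

Lemma norm1_ge0 f : (0 <= norm1 f)%E.
Proof. by apply: integral_ge0 => x _; rewrite lee_fin normc_ge0. Qed.

Lemma le_norm1 f g : cmeas f -> cmeas g ->
  (forall x, normc (f x) <= normc (g x)) -> (norm1 f <= norm1 g)%E.
Proof.
move=> mf mg fg; apply: ge0_le_integral => //.
- by move=> x _; rewrite lee_fin normc_ge0.
- exact: cmeas_Enormc.
- exact: cmeas_Enormc.
- by move=> x _; rewrite lee_fin.
Qed.

Lemma norm1D f g : cmeas f -> cmeas g ->
  (norm1 (fun x => f x + g x)%R <= norm1 f + norm1 g)%E.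
Proof.
move=> mf mg; rewrite -ge0_integralD//.
- apply: ge0_le_integral => //.
  + by move=> x _; rewrite lee_fin normc_ge0.
  + exact/cmeas_Enormc/cmeasD.
  + by apply: emeasurable_funD; exact: cmeas_Enormc.
  + by move=> x _; rewrite -EFinD lee_fin le_normcD.
- by move=> x _; rewrite lee_fin normc_ge0.
- exact: cmeas_Enormc.
- by move=> x _; rewrite lee_fin normc_ge0.
- exact: cmeas_Enormc.
Qed.

Lemma norm1Z c f : cmeas f -> norm1 (fun x => c * f x) = ((normc c)%:E * norm1 f)%E.
Proof.
move=> mf; rewrite /norm1; under eq_integral do rewrite normcM EFinM.
rewrite ge0_integralZl//; first exact: cmeas_Enormc.
  by move=> x _; rewrite lee_fin normc_ge0.
by rewrite lee_fin normc_ge0.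
Qed.

Lemma norm1N f : norm1 (fun x => - f x) = norm1 f.
Proof. by apply: eq_integral => x _; rewrite normcN. Qed.

Lemma norm1B f g : cmeas f -> cmeas g ->
  (norm1 (fun x => f x - g x)%R <= norm1 f + norm1 g)%E.
Proof.
by move=> mf mg; rewrite -(norm1N g); apply: norm1D => //; exact: cmeasN.
Qed.

Lemma L1_dom f (k : T -> R) : cmeas f -> measurable_fun setT k ->
  (forall x, normc (f x) <= k x) -> (\int[mu]_x (k x)%:E < +oo)%E -> L1 f.
Proof.
move=> mf mk fk koo; split=> //; apply: le_lt_trans koo.
apply: ge0_le_integral => //.
- by move=> x _; rewrite lee_fin normc_ge0.
- exact: cmeas_Enormc.
- exact/measurable_EFinP.
- by move=> x _; rewrite lee_fin.
Qed.

Lemma L1_le f g : cmeas f -> L1 g -> (forall x, normc (f x) <= normc (g x)) -> L1 f.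
Proof.
by move=> mf [mg goo] fg; split=> //; apply: le_lt_trans goo; exact: le_norm1.
Qed.

Lemma L1_leZ f g (c : R) : cmeas f -> L1 g ->
  (forall x, normc (f x) <= c * normc (g x)) -> L1 f.
Proof.
move=> mf [mg goo] fg; split=> //.
have : (norm1 (fun x => (c%:C * g x)%R) < +oo)%E.
  by rewrite norm1Z// lte_mul_pinfty// lee_fin normc_ge0.
apply: le_lt_trans; apply: le_norm1 => //; first exact/cmeasM/mg/cmeas_cst.
move=> x; rewrite normcM normcR (le_trans (fg x))// ler_wpM2r ?normc_ge0//.
exact: ler_norm.
Qed.

Lemma L1D f g : L1 f -> L1 g -> L1 (fun x => f x + g x).
Proof.
move=> [mf foo] [mg goo]; split; first exact: cmeasD.
by apply: le_lt_trans (norm1D mf mg) _; rewrite lte_add_pinfty.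
Qed.

Lemma L1N f : L1 f -> L1 (fun x => - f x).
Proof. by move=> [mf foo]; split; [exact: cmeasN | rewrite norm1N]. Qed.

Lemma L1B f g : L1 f -> L1 g -> L1 (fun x => f x - g x).
Proof. by move=> mf mg; apply: L1D => //; exact: L1N. Qed.

Lemma L1Z c f : L1 f -> L1 (fun x => c * f x).
Proof.
move=> [mf foo]; split; first exact/cmeasM/mf/cmeas_cst.
by rewrite norm1Z// lte_mul_pinfty// lee_fin normc_ge0.
Qed.

Lemma L10 : L1 (fun=> 0).
Proof.
split; first exact: cmeas_cst.
by rewrite /norm1; under eq_integral do (rewrite normc_zero); rewrite integral0.
Qed.

Lemma L1_sum (I : Type) (s : seq I) (F : I -> T -> R[i]) :
  (forall i, L1 (F i)) -> L1 (fun x => \sum_(i <- s) F i x).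
Proof.
move=> LF; elim: s => [|i s ih].
  by under eq_fun do (rewrite big_nil); exact: L10.
by under eq_fun do (rewrite big_cons); exact: L1D.
Qed.

Lemma L1Mb f g (c : R) : L1 f -> cmeas g -> (forall x, normc (g x) <= c) ->
  L1 (fun x => g x * f x).
Proof.
move=> Lf mg gc; apply: (@L1_leZ _ f c) => //; first exact/cmeasM/Lf.1.
by move=> x; rewrite normcM ler_wpM2r ?normc_ge0.
Qed.

Lemma L1_integrable f : L1 f ->
  mu.-integrable setT (fun x => (cRe (f x))%:E) /\
  mu.-integrable setT (fun x => (cIm (f x))%:E).
Proof.
move=> [mf foo].
have H (p : R[i] -> R) : (forall z, `|p z| <= normc z) ->
    measurable_fun setT (fun x => p (f x)) ->
    mu.-integrable setT (fun x => (p (f x))%:E).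
  move=> pn mp; apply/integrableP; split; first exact/measurable_EFinP.
  apply: le_lt_trans foo; apply: ge0_le_integral => //.
  - by apply: measurableT_comp => //; exact/measurable_EFinP.
  - exact: cmeas_Enormc.
  - by move=> x _; rewrite /= lee_fin.
by split; apply: H; [exact: normc_cRe|exact: mf.1|exact: normc_cIm|exact: mf.2].
Qed.

Lemma integrable_L1 f :
  mu.-integrable setT (fun x => (cRe (f x))%:E) ->
  mu.-integrable setT (fun x => (cIm (f x))%:E) -> L1 f.
Proof.
move=> i1 i2; have /integrableP[/measurable_EFinP m1 _] := i1.
have /integrableP[/measurable_EFinP m2 _] := i2.
apply: (@L1_dom _ (fun x => `|cRe (f x)| + `|cIm (f x)|)) => //.
- by apply: measurable_funD; exact: measurableT_comp.
- by move=> x; exact: normc_le.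
- under eq_integral do rewrite EFinD.
  rewrite ge0_integralD//; last 2 first.
  + by apply/measurable_EFinP; exact: measurableT_comp.
  + by apply/measurable_EFinP; exact: measurableT_comp.
  by rewrite lte_add_pinfty//; [have /integrableP[] := i1|have /integrableP[] := i2].
Qed.

Lemma eq_cI f g : f =1 g -> cI f = cI g.
Proof. by move=> fg; rewrite /cI; congr (_ +i* _); apply: eq_Rintegral => x _; rewrite fg. Qed.

Lemma cID f g : L1 f -> L1 g -> cI (fun x => f x + g x) = cI f + cI g.
Proof.
move=> /L1_integrable[f1 f2] /L1_integrable[g1 g2].
apply: complex_ext; rewrite ?cReIm /=.
  by under eq_Rintegral do rewrite cRe_add; rewrite RintegralD.
by under eq_Rintegral do rewrite cIm_add; rewrite RintegralD.
Qed.

Lemma cIZ c f : L1 f -> cI (fun x => c * f x) = c * cI f.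
Proof.
move=> /L1_integrable[f1 f2].
apply: complex_ext; rewrite ?cReIm /=.
  under eq_Rintegral do rewrite cRe_mul.
  rewrite RintegralB//; first by rewrite !RintegralZl.
    exact: (@integrableZl _ _ _ mu _ measurableT (cRe c) _ f1).
  exact: (@integrableZl _ _ _ mu _ measurableT (cIm c) _ f2).
under eq_Rintegral do rewrite cIm_mul.
rewrite RintegralD//; first by rewrite !RintegralZl.
  exact: (@integrableZl _ _ _ mu _ measurableT (cRe c) _ f2).
exact: (@integrableZl _ _ _ mu _ measurableT (cIm c) _ f1).
Qed.

Lemma cI0 : cI (fun=> 0) = 0.
Proof. by apply: complex_ext => /=; rewrite /Rintegral integral0. Qed.

Lemma cIN f : L1 f -> cI (fun x => - f x) = - cI f.
Proof.
by move=> Lf; rewrite -mulN1r -cIZ//; apply: eq_cI => x; rewrite mulN1r.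
Qed.

Lemma cIB f g : L1 f -> L1 g -> cI (fun x => f x - g x) = cI f - cI g.
Proof. by move=> Lf Lg; rewrite cID ?cIN//; exact: L1N. Qed.

Lemma cI_sum (I : Type) (s : seq I) (F : I -> T -> R[i]) : (forall i, L1 (F i)) ->
  cI (fun x => \sum_(i <- s) F i x) = \sum_(i <- s) cI (F i).
Proof.
move=> LF; elim: s => [|i s ih].
  by rewrite big_nil; under eq_fun do (rewrite big_nil); exact: cI0.
rewrite big_cons -ih -cID//; last exact: L1_sum.
by apply: eq_cI => x; rewrite big_cons.
Qed.

(** Real and imaginary parts are estimated separately, whence the factor 2. *)
Lemma normc_cI f : L1 f -> ((normc (cI f))%:E <= 2%:E * norm1 f)%E.
Proof.
move=> Lf; have [f1 f2] := L1_integrable Lf.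
have -> : (2%:E = 1 + 1 :> \bar R)%E by rewrite -EFinD.
rewrite ge0_muleDl// mul1e.
apply: (@le_trans _ _ (`|\int[mu]_x cRe (f x)| + `|\int[mu]_x cIm (f x)|)%:E).
  by rewrite lee_fin; exact: normc_le.
rewrite EFinD !EFin_normr_Rintegral//.
have H (p : R[i] -> R) : (forall z, `|p z| <= normc z) ->
    mu.-integrable setT (fun x => (p (f x))%:E) ->
    (`| \int[mu]_x (p (f x))%:E | <= norm1 f)%E.
  move=> pn /integrableP[mp _]; apply: le_trans (le_abse_integral _ _ _) _ => //.
  apply: ge0_le_integral => //.
  - exact: measurableT_comp.
  - by apply: cmeas_Enormc; exact: Lf.1.
  - by move=> x _; rewrite /= lee_fin.
by apply: leeD; apply: H => //; [exact: normc_cRe|exact: normc_cIm].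
Qed.

Lemma normc_cI_le f (c : R) : L1 f -> (norm1 f <= c%:E)%E -> normc (cI f) <= 2 * c.
Proof.
move=> Lf fc; rewrite -lee_fin (le_trans (normc_cI Lf))// EFinM.
by rewrite lee_pmul2l.
Qed.

Lemma cI_cvg (f_ : nat -> T -> R[i]) f (g : T -> R[i]) :
  (forall n, cmeas (f_ n)) -> cmeas f -> L1 g ->
  (forall n x, normc (f_ n x) <= normc (g x)) ->
  (forall x, (fun n => normc (f_ n x - f x)) @ \oo --> (0 : R)) ->
  (fun n => normc (cI (f_ n) - cI f)) @ \oo --> (0 : R).
Proof.
move=> mf_ mf Lg fg ff.
have Lf_ n : L1 (f_ n) by exact: L1_le (fg n).
have nf x : normc (f x) <= normc (g x).
  apply/ler_addgt0Pr => e e0.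
  have /cvgrPdist_lt/(_ _ e0)[n _ /(_ n (leqnn n))] := ff x.
  rewrite sub0r normrN ger0_norm ?normc_ge0// => /ltW h.
  rewrite -(subrK (f_ n x) (f x)) (le_trans (le_normcD _ _))// addrC lerD//.
  by rewrite normcB.
have Lf : L1 f by exact: L1_le nf.
have D1 : (fun n => norm1 (fun x => f_ n x - f x)) @ \oo --> (0 : \bar R).
  have := @dominated_convergence _ _ _ mu setT measurableT
    (fun n x => (normc (f_ n x - f x))%:E) (cst 0%E) (fun x => (2 * normc (g x))%:E).
  case.
  - by move=> n; apply: cmeas_Enormc; exact: cmeasB.
  - exact: measurable_cst.
  - apply: aeW => x _; apply/fine_cvgP; split; first exact: nearW.
    exact: ff.
  - apply/integrableP; split.
      by apply/measurable_EFinP/measurable_funM => //; exact/cmeas_normc/Lg.1.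
    under eq_integral do rewrite gee0_abs ?lee_fin ?mulr_ge0 ?normc_ge0// EFinM.
    rewrite ge0_integralZl//; last 2 first.
    + by apply: cmeas_Enormc; exact: Lg.1.
    + by move=> x _; rewrite lee_fin normc_ge0.
    by rewrite lte_mul_pinfty//; exact: Lg.2.
  - apply: aeW => x n _ /=; rewrite lee_fin ger0_norm ?normc_ge0//.
    rewrite (le_trans (le_normcD _ _))// normcN mulr_natl mulr2n.
    by rewrite lerD.
  by move=> _ _; rewrite integral0.
apply/cvgrPdist_le => e e0.
have /fine_cvgP[_ /cvgrPdist_le] := D1.
have e20 : 0 < e / 2 by rewrite divr_gt0.
move=> /(_ _ e20); apply: filterS => n.
rewrite !sub0r !normrN => h.
rewrite [leLHS]ger0_norm ?normc_ge0// -cIB// (le_trans (@normc_cI_le _ (e/2) _ _))//.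
- exact: L1B.
- have [_ fin] : L1 (fun x => f_ n x - f x) by exact: L1B.
  rewrite -(@fineK _ (norm1 _)) ?ge0_fin_numE ?norm1_ge0// lee_fin.
  by rewrite (le_trans (ler_norm _)).
- by rewrite mulrC divfK.
Qed.

End complex_integral.

Section complex_fubini.
Context d1 d2 (T1 : measurableType d1) (T2 : measurableType d2) (R : realType).
Variables (m1 : {sigma_finite_measure set T1 -> \bar R}).
Variables (m2 : {sigma_finite_measure set T2 -> \bar R}).
Variable F : T1 * T2 -> R[i].
Hypothesis mF : cmeas F.

Lemma cmeas_pair1 x : cmeas (fun y => F (x, y)).
Proof.
split; first exact: (measurableT_comp mF.1 (@pair1_measurable _ _ _ _ _)).
exact: (measurableT_comp mF.2 (@pair1_measurable _ _ _ _ _)).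
Qed.

Lemma cmeas_pair2 y : cmeas (fun x => F (x, y)).
Proof.
split; first exact: (measurableT_comp mF.1 (@pair2_measurable _ _ _ _ _)).
exact: (measurableT_comp mF.2 (@pair2_measurable _ _ _ _ _)).
Qed.

Lemma norm1_fubini :
  (\int[m1]_x norm1 m2 (fun y => F (x, y)) =
   \int[m2]_y norm1 m1 (fun x => F (x, y)))%E.
Proof.
rewrite /norm1 (fubini_tonelli (fun p => (normc (F p))%:E))//.
  exact: cmeas_Enormc.
by move=> p; rewrite lee_fin normc_ge0.
Qed.

Lemma measurable_norm1_fubini :
  measurable_fun setT (fun x => norm1 m2 (fun y => F (x, y))).
Proof.
apply: (measurable_fun_fubini_tonelli_F (fun p => (normc (F p))%:E)) => //.
  exact: cmeas_Enormc.
by move=> p; rewrite lee_fin normc_ge0.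
Qed.

Hypothesis F1 : forall x, L1 m2 (fun y => F (x, y)).

Lemma cmeas_cI : cmeas (fun x => cI m2 (fun y => F (x, y))).
Proof.
have H (p : R[i] -> R) (mp : measurable_fun setT (fun z => p (F z))) :
    measurable_fun setT (fun x => fine (\int[m2]_y (p (F (x, y)))%:E)).
  apply: measurableT_comp => //.
  rewrite [X in measurable_fun _ X](_ : _ = fun x =>
    (\int[m2]_y ((fun z => (p (F z))%:E)^\+) (x, y) -
     \int[m2]_y ((fun z => (p (F z))%:E)^\-) (x, y))%E); last first.
    apply/funext => x; rewrite integralE; congr (_ - _)%E;
      by apply: eq_integral => y _; rewrite ?funeposE ?funenegE.
  apply: emeasurable_funB.
  - apply: measurable_fun_fubini_tonelli_F => //.
    by apply: measurable_funepos; exact/measurable_EFinP.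
  - apply: measurable_fun_fubini_tonelli_F => //.
    by apply: measurable_funeneg; exact/measurable_EFinP.
by split; apply: H; [exact: mF.1|exact: mF.2].
Qed.

Hypothesis F2 : forall y, L1 m1 (fun x => F (x, y)).
Hypothesis F12 : (\int[m1]_x norm1 m2 (fun y => F (x, y)) < +oo)%E.

Lemma cI_fubini : cI m1 (fun x => cI m2 (fun y => F (x, y))) =
  cI m2 (fun y => cI m1 (fun x => F (x, y))).
Proof.
have H (p : R[i] -> R) (pn : forall z, `|p z| <= normc z)
    (mp : measurable_fun setT (fun z => p (F z)))
    (i1 : forall x, m2.-integrable setT (fun y => (p (F (x, y)))%:E))
    (i2 : forall y, m1.-integrable setT (fun x => (p (F (x, y)))%:E)) :
    \int[m1]_x (\int[m2]_y p (F (x, y))) = \int[m2]_y (\int[m1]_x p (F (x, y))).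
  rewrite /Rintegral; congr fine.
  under eq_integral do rewrite fineK ?integrable_fin_num//.
  under [RHS]eq_integral do rewrite fineK ?integrable_fin_num//.
  apply: (@Fubini _ _ _ _ _ m1 m2 (fun z => (p (F z))%:E)).
  apply/integrable12ltyP; first exact/measurable_EFinP.
  apply: le_lt_trans F12; apply: ge0_le_integral => //.
  - by move=> x _; exact: integral_ge0.
  - apply: (measurable_fun_fubini_tonelli_F (fun z => `|(p (F z))%:E|%E)) => //.
    by apply: measurableT_comp => //; exact/measurable_EFinP.
  - exact: measurable_norm1_fubini.
  - move=> x _; apply: ge0_le_integral => //.
    + by have /measurable_int h := i1 x; exact: measurableT_comp.
    + by apply: cmeas_Enormc; exact: cmeas_pair1.
    + by move=> y _; rewrite lee_fin.
by apply: complex_ext; rewrite /cI /=; apply: H;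
  [exact: normc_cRe|exact: mF.1|move=> x; exact: (L1_integrable (F1 x)).1
  |move=> x; exact: (L1_integrable (F2 x)).1|
   exact: normc_cIm|exact: mF.2|move=> x; exact: (L1_integrable (F1 x)).2
  |move=> x; exact: (L1_integrable (F2 x)).2].
Qed.

End complex_fubini.
(** * Lebesgue measure on row vectors *)

Section change_of_variable_line.
Context {R : realType}.
Notation lam := (@lebesgue_measure R).

Lemma measurable_affine (r c : R) :
  measurable_fun setT (fun x : measurableTypeR R => r * x + c : measurableTypeR R).
Proof.
apply: measurable_funD => //; apply: measurable_funM => //; exact: measurable_id.
Qed.


(** Both sides are measures in [A], so half-open intervals suffice. *)
Lemma lebesgue_measure_affine (r c : R) (A : set (measurableTypeR R)) :
  r != 0 -> measurable A ->
  lam A = (`|r|%:E * lam ((fun x => (r * x + c)%R) @^-1` A))%E.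
Proof.
move=> r0 mA.
pose phi := fun x : measurableTypeR R => (r * x + c : measurableTypeR R)%R.
have mphi : measurable_fun setT phi by exact: measurable_affine.
pose k : {nonneg R} := (NngNum (normr_ge0 r)).
pose nu : {measure set (measurableTypeR R) -> \bar R} := pushforward lam phi.
apply: (@lebesgue_measure_unique R (mscale k (nu mphi))) => //= _ [[a b]] _ <-.
rewrite /mscale /= /pushforward.
have -> : phi @^-1` `]a, b] = if 0 < r then `](a - c) / r, (b - c) / r]%classic
    else `[(b - c) / r, (a - c) / r[%classic.
  apply/seteqP; split=> x /=; rewrite !in_itv/=; case: ifPn => rs /=;
    rewrite ?in_itv/=.
  - by rewrite ltr_pdivrMr// ler_pdivlMr// ltrBlDr lerBrDr [x * r]mulrC.
  - have {}rs : r < 0 by rewrite lt_neqAle r0/= leNgt.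
    by rewrite ltr_ndivlMr// ler_ndivrMr// ltrBlDr lerBrDr [x * r]mulrC andbC.
  - by rewrite ltr_pdivrMr// ler_pdivlMr// ltrBlDr lerBrDr [x * r]mulrC.
  - have {}rs : r < 0 by rewrite lt_neqAle r0/= leNgt.
    by rewrite ltr_ndivlMr// ler_ndivrMr// ltrBlDr lerBrDr [x * r]mulrC andbC.
case: ifPn => rs; rewrite !lebesgue_measure_itv/= !lte_fin.
  rewrite ltr_pM2r ?invr_gt0// ltrD2r; case: ifPn => ab; last by rewrite mule0.
  rewrite -!EFinD -EFinM gtr0_norm//; congr EFin; field.
  by rewrite gt_eqF.
have {}rs : r < 0 by rewrite lt_neqAle r0/= leNgt.
rewrite ltr_nM2r ?invr_lt0// ltrD2r; case: ifPn => ab; last by rewrite mule0.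
rewrite -!EFinD -EFinM ltr0_norm//; congr EFin; field.
by rewrite lt_eqF.
Qed.

Lemma ge0_integral_affine_line (r c : R) (f : measurableTypeR R -> \bar R) :
  r != 0 -> measurable_fun setT f -> (forall x, 0 <= f x)%E ->
  (\int[lam]_x f (r * x + c)%R = `|r|^-1%:E * \int[lam]_x f x)%E.
Proof.
move=> r0 mf f0.
have mphi := measurable_affine r c.
rewrite [X in (_ * X)%E](_ : _ = `|r|%:E *
    \int[lam]_x (f \o (fun x => (r * x + c)%R)) x)%E; last first.
  have := ge0_integral_pushforward mphi lam measurableT mf (fun x _ => f0 x).
  rewrite preimage_setT => <-.
  pose k : {nonneg R} := (NngNum (normr_ge0 r)).
  rewrite -(@ge0_integral_mscale _ _ _ _ setT measurableT k)//.
  by apply: eq_measure_integral => A mA _; exact: lebesgue_measure_affine.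
rewrite muleA -EFinM mulVf ?mul1e//.
by rewrite normr_eq0.
Qed.

End change_of_variable_line.

Section row_vectors.
Context {R : realType}.
Notation lam := (@lebesgue_measure R).

Lemma row_cons0 n (a : R) (y : 'rV[R]_n) : row_cons (a, y) ord0 ord0 = a.
Proof. by have [] := row_consK (a, y). Qed.

Lemma row_consS n (a : R) (y : 'rV[R]_n) j :
  row_cons (a, y) ord0 (lift ord0 j) = y ord0 j.
Proof.
by have := row_consK (a, y) => /(congr1 snd)/rowP/(_ j); rewrite /row_uncons/= mxE.
Qed.

Lemma row_ext n (x y : 'rV[R]_n.+1) : x ord0 ord0 = y ord0 ord0 ->
  (forall j, x ord0 (lift ord0 j) = y ord0 (lift ord0 j)) -> x = y.
Proof.
move=> h0 hS; apply/rowP => i.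
by case: (unliftP ord0 i) => [j ->|->].
Qed.

Lemma rV_norm_le n (x : 'rV[R]_n) (c : R) : 0 <= c ->
  (forall i, `|x ord0 i| <= c) -> `|x| <= c.
Proof.
move=> c0 h; rewrite /Num.norm/= mx_normrE; apply: bigmax_le => // -[i j] _ /=.
by rewrite ord1.
Qed.

Lemma rV_coord_le n (x : 'rV[R]_n) i : `|x ord0 i| <= `|x|.
Proof.
rewrite [leRHS]/Num.norm/= mx_normrE.
exact: (le_bigmax _ (fun ij : 'I_1 * 'I_n => `|x ij.1 ij.2|) (ord0, i)).
Qed.

Lemma rV0_eq (x y : 'rV[R]_0) : x = y.
Proof. by apply/rowP; case. Qed.

Lemma rV_affineE n (r : R) (x z : 'rV[R]_n) i :
  (r *: x + z) ord0 i = r * x ord0 i + z ord0 i.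
Proof. by rewrite !mxE. Qed.

Lemma measurable_rV_affine n (r : R) (z : 'rV[R]_n) :
  measurable_fun setT (fun x : 'rV[R]_n => r *: x + z).
Proof.
apply: measurable_fun_rV => i; under eq_fun do rewrite !mxE.
apply: measurable_funD => //; apply: measurable_funM => //.
exact: measurable_rV_coord.
Qed.

Lemma ge0_integral_rVS n (f : 'rV[R]_n.+1 -> \bar R) :
  measurable_fun setT f -> (forall x, 0 <= f x)%E ->
  (\int[lebesgue_rV n.+1]_x f x =
   \int[lam]_a \int[lebesgue_rV n]_y f (row_cons (a, y)))%E.
Proof.
move=> mf f0.
have mfc : measurable_fun setT (fun p => f (row_cons (R := R) (n := n) p)).
  exact: (measurableT_comp mf measurable_row_cons).
rewrite -(fubini_tonelli1 (fun p => f (row_cons (R := R) (n := n) p)))//=.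
by rewrite (ge0_integral_pushforward measurable_row_cons)// preimage_setT.
Qed.

Lemma ge0_integral_rV0 (f : 'rV[R]_0 -> \bar R) :
  measurable_fun setT f -> (\int[lebesgue_rV 0]_x f x = f 0%R)%E.
Proof. by move=> mf; rewrite integral_dirac// diracT mul1e. Qed.

(** One coordinate at a time, by Tonelli. *)
Lemma ge0_integral_affine n (r : R) (z : 'rV[R]_n) (f : 'rV[R]_n -> \bar R) :
  r != 0 -> measurable_fun setT f -> (forall x, 0 <= f x)%E ->
  (\int[lebesgue_rV n]_x f (r *: x + z)%R =
    (`|r| ^- n)%:E * \int[lebesgue_rV n]_x f x)%E.
Proof.
move=> r0; elim: n z f => [|n ih] z f mf f0.
  rewrite !ge0_integral_rV0//; last exact: (measurableT_comp mf (measurable_rV_affine _ _)).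
  by rewrite expr0 invr1 mul1e; congr f; exact: rV0_eq.
rewrite !ge0_integral_rVS//; last exact: (measurableT_comp mf (measurable_rV_affine _ _)).
have mfc : measurable_fun setT (fun p => f (row_cons (R := R) (n := n) p)).
  exact: (measurableT_comp mf measurable_row_cons).
pose G (a : measurableTypeR R) := (\int[lebesgue_rV n]_y f (row_cons (a, y)))%E.
have mG : measurable_fun setT G.
  exact: (measurable_fun_fubini_tonelli_F (fun p => f (row_cons p))).
have G0 a : (0 <= G a)%E by exact: integral_ge0.
transitivity (\int[lam]_a ((`|r| ^- n)%:E * G (r * a + z ord0 ord0)%R))%E.
  apply: eq_integral => a _.
  rewrite /G -(ih (row_uncons z).2); last 2 first.
  - exact: (@measurableT_comp _ _ _ _ _ _ _ _ _ mfc (@pair1_measurable _ _ _ _ _)).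
  - by [].
  apply: eq_integral => y _; congr f; apply: row_ext => [|j].
    by rewrite rV_affineE !row_cons0.
  by rewrite rV_affineE !row_consS rV_affineE !mxE.
rewrite ge0_integralZl; last 4 first.
- exact: measurableT.
- exact: (measurableT_comp mG (measurable_affine _ _)).
- by move=> x _; exact: G0.
- by rewrite lee_fin invr_ge0 exprn_ge0.
rewrite ge0_integral_affine_line// muleA -EFinM; congr (_%:E * _)%E.
by rewrite -invfM -exprSr.
Qed.


Lemma L1_rV_affine n (r : R) (z : 'rV[R]_n) (f : 'rV[R]_n -> R[i]) :
  r != 0 -> L1 (lebesgue_rV n) f -> L1 (lebesgue_rV n) (fun x => f (r *: x + z)).
Proof.
move=> r0 [mf foo]; split; first split.
- exact: (measurableT_comp mf.1 (measurable_rV_affine _ _)).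
- exact: (measurableT_comp mf.2 (measurable_rV_affine _ _)).
rewrite /norm1 (@ge0_integral_affine n r z (fun x => (normc (f x))%:E))//.
- by rewrite lte_mul_pinfty// lee_fin invr_ge0 exprn_ge0.
- exact: cmeas_Enormc.
- by move=> x; rewrite lee_fin normc_ge0.
Qed.

Lemma norm1_affine n (r : R) (z : 'rV[R]_n) (f : 'rV[R]_n -> R[i]) :
  r != 0 -> cmeas f ->
  norm1 (lebesgue_rV n) (fun x => f (r *: x + z)) =
    ((`|r| ^- n)%:E * norm1 (lebesgue_rV n) f)%E.
Proof.
move=> r0 mf; rewrite /norm1.
rewrite (@ge0_integral_affine n r z (fun x => (normc (f x))%:E))//.
- exact: cmeas_Enormc.
- by move=> x; rewrite lee_fin normc_ge0.
Qed.

Lemma cI_affine n (r : R) (z : 'rV[R]_n) (f : 'rV[R]_n -> R[i]) :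
  r != 0 -> L1 (lebesgue_rV n) f ->
  cI (lebesgue_rV n) (fun x => f (r *: x + z)) =
    (`|r| ^- n)%:C * cI (lebesgue_rV n) f.
Proof.
move=> r0 Lf; have [i1 i2] := L1_integrable Lf.
have H (p : R[i] -> R) : measurable_fun setT (fun x => p (f x)) ->
    (lebesgue_rV n).-integrable setT (fun x => (p (f x))%:E) ->
    \int[lebesgue_rV n]_x p (f (r *: x + z)) =
    `|r| ^- n * \int[lebesgue_rV n]_x p (f x).
  move=> mp ip; rewrite /Rintegral.
  have mpe : measurable_fun setT (fun x => (p (f x))%:E : \bar R).
    exact/measurable_EFinP.
  have cX (c : R) (X : \bar R) : X \is a fin_num -> c * fine X = fine (c%:E * X)%E.
    by move=> Xf; rewrite fineM.
  rewrite cX; last exact: integrable_fin_num.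
  rewrite integralE; congr fine; rewrite [X in (_ * X)%E]integralE muleBr//; last first.
    by apply: fin_num_adde_defl; rewrite fin_numN; exact: integrable_neg_fin_num.
  congr (_ - _)%E.
    rewrite -(@ge0_integral_affine n r z)//; last exact: measurable_funepos.
    by apply: eq_integral => x _; rewrite !funeposE.
  rewrite -(@ge0_integral_affine n r z)//; last exact: measurable_funeneg.
  by apply: eq_integral => x _; rewrite !funenegE.
apply: complex_ext; rewrite /cI /= ?mul0r ?subr0 ?addr0.
  by apply: (H (@complex.Re R)) => //; exact: Lf.1.1.
by apply: (H (@complex.Im R)) => //; exact: Lf.1.2.
Qed.

Lemma cI_shift n (z : 'rV[R]_n) (f : 'rV[R]_n -> R[i]) :
  L1 (lebesgue_rV n) f ->
  cI (lebesgue_rV n) (fun x => f (x + z)) = cI (lebesgue_rV n) f.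
Proof.
move=> Lf; have := cI_affine z (oner_neq0 _) Lf.
rewrite normr1 expr1n invr1 mul1r => <-.
by apply: eq_cI => x; rewrite scale1r.
Qed.

Lemma norm1_shift n (z : 'rV[R]_n) (f : 'rV[R]_n -> R[i]) : cmeas f ->
  norm1 (lebesgue_rV n) (fun x => f (x + z)) = norm1 (lebesgue_rV n) f.
Proof.
move=> mf; have := norm1_affine z (oner_neq0 _) mf.
rewrite normr1 expr1n invr1 mul1e => <-.
by congr norm1; apply/funext => x; rewrite scale1r.
Qed.

Lemma cmeas_affine n (r : R) (z : 'rV[R]_n) (f : 'rV[R]_n -> R[i]) :
  cmeas f -> cmeas (fun x : 'rV[R]_n => f (r *: x + z)).
Proof.
move=> mf; split.
- exact: (measurableT_comp mf.1 (measurable_rV_affine _ _)).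
- exact: (measurableT_comp mf.2 (measurable_rV_affine _ _)).
Qed.

End row_vectors.

(** * Dyadic cubes *)

Section dyadic_index.
Context {R : realType} {n : nat}.
Implicit Types (x y : 'rV[R]_n) (N : nat) (m : 'rV[int]_n).

Definition cube_index N x : 'rV[int]_n := \row_i Num.floor (2 ^+ N * x ord0 i).

Lemma dyadic_cubeE N m : dyadic_cube N m = [set x | cube_index N x = m].
Proof.
have p0 : 0 < 2 ^+ N :> R by rewrite exprn_gt0.
apply/seteqP; split=> x /=.
  move=> h; apply/rowP => i; rewrite mxE; apply/floor_def.
  by have := h i; rewrite ler_pdivrMl// ltr_pdivlMl// intrD.
move=> <- i; rewrite mxE ler_pdivrMl// ltr_pdivlMl//.
by rewrite floor_le -intrD1 floorD1_gt.
Qed.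

Lemma measurable_countable_fiber d (T : measurableType d) (C : countType)
    (phi : T -> C) d' (T' : measurableType d') (g : C -> T') :
  (forall c, measurable [set x : T | phi x = c]) ->
  measurable_fun setT (fun x : T => g (phi x)).
Proof.
move=> mphi _ Y mY; rewrite setTI.
rewrite (_ : _ @^-1` _ = \bigcup_(k in [set k | exists2 c, unpickle k = Some c
    & Y (g c)]) [set x | unpickle k = Some (phi x)]); last first.
  apply/seteqP; split=> x /=.
    by move=> Yx; exists (pickle (phi x)) => /=; rewrite ?pickleK//; exists (phi x); rewrite ?pickleK.
  by move=> [k /= [c -> Yc]] [<-].
apply: bigcup_measurable => k [c kc _].
rewrite (_ : [set _ | _] = [set x | phi x = c])//.
by apply/seteqP; split=> x /=; rewrite kc; [move=> [<-]|move=> ->].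
Qed.

Lemma measurable_cube N m : measurable [set x : 'rV[R]_n | cube_index N x = m].
Proof.
rewrite (_ : [set _ | _] = \bigcap_(i in [set: 'I_n])
    ((fun x : 'rV[R]_n => x ord0 i : measurableTypeR R) @^-1`
      `[2 ^- N * (m ord0 i)%:~R, 2 ^- N * ((m ord0 i)%:~R + 1)[)); last first.
  rewrite -dyadic_cubeE; apply/seteqP; split=> x /= h i; first by rewrite /= in_itv/=.
  by have := h i I; rewrite /= in_itv.
apply: fin_bigcap_measurable; first exact: finite_finset.
move=> i _; rewrite -[X in measurable X]setTI.
apply: measurable_rV_coord => //; exact: measurable_itv.
Qed.

Lemma measurable_cube_index N d' (T' : measurableType d') (g : 'rV[int]_n -> T') :
  measurable_fun setT (fun x => g (cube_index N x)).
Proof. by apply: measurable_countable_fiber => c; exact: measurable_cube. Qed.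

Lemma measurable_cube_index2 N d' (T' : measurableType d')
    (g : 'rV[int]_n * 'rV[int]_n -> T') :
  measurable_fun setT (fun p : 'rV[R]_n * 'rV[R]_n =>
    g (cube_index N p.1, cube_index N p.2)).
Proof.
apply: (@measurable_countable_fiber _ _ _
  (fun p : 'rV[R]_n * 'rV[R]_n => (cube_index N p.1, cube_index N p.2))).
move=> [a b]; rewrite (_ : [set _ | _] = [set x | cube_index N x = a] `*`
  [set x | cube_index N x = b]).
  by apply: measurableX; exact: measurable_cube.
by apply/seteqP; split=> x /= => [[-> ->]//|[-> ->]].
Qed.

(** The coordinates generate the Borel sets: a continuous function is the limit
    of its values at the corners of smaller and smaller dyadic cubes. *)
Lemma continuous_measurable_rV (f : 'rV[R]_n -> R) :
  continuous f -> measurable_fun setT f.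
Proof.
move=> cf.
pose corner N (m : 'rV[int]_n) : 'rV[R]_n := \row_i (2 ^- N * (m ord0 i)%:~R).
apply: (@measurable_fun_cvg _ _ _ setT (fun N x => f (corner N (cube_index N x)))).
  by move=> N; exact: (measurable_cube_index N (fun m => f (corner N m))).
move=> x _; apply: (@continuous_cvg _ _ _ _ _ _ f); first exact: cf.
apply/cvgrPdist_le => e e0.
have h0 : (fun N => (2^-1 : R) ^+ N) @ \oo --> (0 : R).
  by apply: cvg_expr; rewrite ger0_norm// invf_lt1// ltr1n.
have /cvgrPdist_le/(_ _ e0) := h0; apply: filterS => N.
rewrite sub0r normrN ger0_norm ?exprn_ge0// => hN.
apply: rV_norm_le => [|j]; first exact: ltW.
rewrite !mxE.
have p0 : 0 < 2 ^+ N :> R by rewrite exprn_gt0.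
set t := x ord0 j; have -> : t - 2 ^- N * (Num.floor (2 ^+ N * t))%:~R =
   2 ^- N * (2 ^+ N * t - (Num.floor (2 ^+ N * t))%:~R).
  by rewrite mulrBr mulKf// gt_eqF.
rewrite ger0_norm; last first.
  by apply: mulr_ge0; [rewrite invr_ge0 ltW|rewrite subr_ge0 floor_le].
apply: le_trans hN; rewrite exprVn -[leRHS]mulr1 ler_wpM2l ?invr_ge0 ?ltW//.
by rewrite ltrBlDl; have := floorD1_gt (2 ^+ N * t); rewrite intrD1 addrC.
Qed.

End dyadic_index.


(** * Boxes and integrable weights *)

Section box_and_weight.
Context {R : realType}.
Notation lam := (@lebesgue_measure R).

(** Integrals of products of one-variable functions split; this gives volumes of
    boxes and the integrability of the weight below. *)
Lemma ge0_integral_rV_prod n (f : 'I_n -> measurableTypeR R -> R) :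
  (forall i, measurable_fun setT (f i)) -> (forall i t, 0 <= f i t) ->
  (\int[lebesgue_rV n]_x (\prod_i f i (x ord0 i))%:E =
   \prod_i \int[lam]_t (f i t)%:E)%E.
Proof.
elim: n f => [|n ih] f mf f0.
  rewrite ge0_integral_rV0 ?big_ord0//.
  by under eq_fun do (rewrite big_ord0); exact: measurable_cst.
have mprod k (g : 'I_k -> measurableTypeR R -> R) :
    (forall i, measurable_fun setT (g i)) ->
    measurable_fun setT (fun x : 'rV[R]_k => (\prod_i g i (x ord0 i))%:E : \bar R).
  move=> mg; apply/measurable_EFinP; apply: measurable_prod => i _.
  exact: (measurableT_comp (mg i) (measurable_rV_coord i)).
rewrite ge0_integral_rVS; last 2 first.
- exact: mprod.
- by move=> x; rewrite lee_fin prodr_ge0.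
rewrite big_ord_recl -(ih (fun i => f (lift ord0 i)))//.
transitivity (\int[lam]_a ((f ord0 a)%:E *
  \int[lebesgue_rV n]_y (\prod_i f (lift ord0 i) (y ord0 i))%:E)%E)%E.
  apply: eq_integral => a _; rewrite -ge0_integralZl; last 4 first.
  - exact: measurableT.
  - by apply: (mprod _ (fun i => f (lift ord0 i))).
  - by move=> y _; rewrite lee_fin prodr_ge0.
  - by rewrite lee_fin.
  apply: eq_integral => y _; rewrite big_ord_recl row_cons0 EFinM.
  by congr (_ * _%:E)%E; apply: eq_bigr => i _; rewrite row_consS.
rewrite ge0_integralZr//.
- exact/measurable_EFinP.
- by move=> a _; rewrite lee_fin.
- by apply: integral_ge0 => y _; rewrite lee_fin prodr_ge0.
Qed.

Lemma box_volume n (a b : 'I_n -> R) : (forall i, a i <= b i) ->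
  lebesgue_rV n [set x : 'rV[R]_n | forall i, a i <= x ord0 i < b i] =
   (\prod_i (b i - a i))%:E.
Proof.
move=> ab.
have bE : [set x : 'rV[R]_n | forall i, a i <= x ord0 i < b i] =
   \bigcap_(i in [set: 'I_n]) ((fun x : 'rV[R]_n => x ord0 i : measurableTypeR R) @^-1`
      `[a i, b i[).
  by apply/seteqP; split=> x /= h i; [rewrite /= in_itv/=|have := h i I; rewrite /= in_itv].
have mb : measurable [set x : 'rV[R]_n | forall i, a i <= x ord0 i < b i].
  rewrite bE; apply: fin_bigcap_measurable; first exact: finite_finset.
  move=> i _; rewrite -[X in measurable X]setTI.
  apply: measurable_rV_coord => //; exact: measurable_itv.
rewrite -[LHS]mul1e -(integral_cst _ mb)// integral_mkcond.
transitivity (\int[lebesgue_rV n]_x (\prod_i \1_(`[a i, b i[) (x ord0 i))%:E)%E.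
  apply: eq_integral => x _; rewrite patchE; case: ifPn => xb.
    rewrite big1// => i _; rewrite indicE mem_set//= in_itv/=.
    by move/set_mem : xb => /(_ i).
  have /existsNP[i /negP xi] : ~ forall i, a i <= x ord0 i < b i.
    by move=> h; move/negP : xb; apply; rewrite inE.
  rewrite (bigD1 i)//= indicE memNset ?mul0r//= in_itv/=.
  exact/negP.
rewrite (@ge0_integral_rV_prod n (fun i t => \1_(`[a i, b i[) t))//.
rewrite -prodEFin; apply: eq_bigr => i _.
rewrite integral_indic ?setIT; [|exact: measurableT|exact: measurable_itv].
  etransitivity; first exact: (lebesgue_measure_itv `[a i, b i[).
  rewrite /= lte_fin.
  case: ifPn => //; rewrite -leNgt => ba.
  by rewrite (le_anti (introT andP (conj (ab i) ba))) subrr.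
by move=> i; apply: measurable_indic; exact: measurable_itv.
Qed.

(** Integrable, as a product of one-variable densities; rapidly decreasing
    functions are dominated by it, see [rapid_weight]. *)
Definition weight n (x : 'rV[R]_n) : R := \prod_i (1 + x ord0 i ^+ 2)^-1.

Lemma weight_gt0 n (x : 'rV[R]_n) : 0 < weight x.
Proof. by apply: prodr_gt0 => i _; rewrite invr_gt0 ltr_pwDl// sqr_ge0. Qed.

Lemma integral_oneDsqr :
  (\int[lam]_t ((1 + t ^+ 2)^-1)%:E = pi%:E :> \bar R)%E.
Proof.
rewrite (@ge0_symfun_integralT _ (fun t => (1 + t ^+ 2)^-1)).
- have := @integral0y_oneDsqr R; rewrite set_itvcy /oneDsqr => ->.
  by rewrite -EFinM mulrC divfK.
- by move=> t; rewrite invr_ge0 addr_ge0// sqr_ge0.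
- exact: continuous_oneDsqrV.
- by move=> t; rewrite /= sqrrN.
Qed.

Lemma measurable_oneDsqrV :
  measurable_fun setT (fun t : measurableTypeR R => (1 + t ^+ 2)^-1).
Proof. by apply: (@continuous_measurable_fun R); exact: continuous_oneDsqrV. Qed.

Lemma measurable_weight n : measurable_fun setT (@weight n).
Proof.
apply: measurable_prod => i _.
apply: (measurableT_comp measurable_oneDsqrV (measurable_rV_coord i)).
Qed.

Lemma integral_weight n :
  (\int[lebesgue_rV n]_x (weight x)%:E = (pi ^+ n)%:E :> \bar R)%E.
Proof.
rewrite (@ge0_integral_rV_prod n (fun i t => (1 + t ^+ 2)^-1)).
- under eq_bigr do rewrite integral_oneDsqr.
  by rewrite prodEFin prodr_const card_ord.
- by move=> i; exact: measurable_oneDsqrV.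
- by move=> i t; rewrite invr_ge0 addr_ge0// sqr_ge0.
Qed.

Lemma L1_weight n : L1 (lebesgue_rV n) (fun x => (weight x)%:C).
Proof.
split; first by apply: cmeasR; exact: measurable_weight.
rewrite /norm1; under eq_integral do rewrite normcR ger0_norm ?(ltW (weight_gt0 _))//.
by rewrite integral_weight ltry.
Qed.

Lemma L1_weight_dom n (f : 'rV[R]_n -> R[i]) (c : R) : cmeas f ->
  (forall x, normc (f x) <= c * weight x) -> L1 (lebesgue_rV n) f.
Proof.
move=> mf fc; apply: (L1_leZ mf (L1_weight n) (c := c)) => x.
by rewrite normcR ger0_norm ?(ltW (weight_gt0 _)).
Qed.

Lemma weight_shift n (x z : 'rV[R]_n) : `|z| <= 1 ->
  weight (x + z) <= 3 ^+ n * weight x.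
Proof.
move=> z1; rewrite -[n in 3 ^+ n]card_ord -prodr_const -big_split/=.
apply: ler_prod => i _; rewrite mxE; set a := x _ _; set b := z _ _.
have b1 : `|b| <= 1 by exact: le_trans (rV_coord_le _ _) z1.
have b2 : b ^+ 2 <= 1 by rewrite -real_normK ?num_real// expr_le1.
have p1 : 0 < 1 + (a + b) ^+ 2 by rewrite ltr_pwDl// sqr_ge0.
have p2 : 0 < 1 + a ^+ 2 by rewrite ltr_pwDl// sqr_ge0.
rewrite invr_ge0 (ltW p1)/= -[leRHS]invrK lef_pV2 ?posrE ?invr_gt0 ?mulr_gt0 ?invr_gt0//.
rewrite invfM invrK mulrC ler_pdivrMr//.
by have := sqr_ge0 (a + 2 * b); nra.
Qed.

End box_and_weight.

(** * Schwartz functions *)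

Section schwartz_calculus.
Context {R : realType} {d : nat}.
Implicit Types (f g h : 'rV[R]_d -> R[i]) (x z : 'rV[R]_d) (i j : 'I_d).

Notation e_ i := (delta_mx ord0 i : 'rV[R]_d).

Definition cD i f : 'rV[R]_d -> R[i] := fun x =>
  'D_(e_ i) (fun y => cRe (f y)) x +i* 'D_(e_ i) (fun y => cIm (f y)) x.

Definition cdiff f : Prop := forall x,
  differentiable (fun y => cRe (f y)) x /\ differentiable (fun y => cIm (f y)) x.

Lemma cpderivs_nil f : cpderivs [::] f = f.
Proof. by apply/funext => x; apply: complex_ext. Qed.

Lemma cpderivs_rcons l i f : cpderivs (rcons l i) f = cpderivs l (cD i f).
Proof. by rewrite /cpderivs /pderivs !foldr_rcons. Qed.

Lemma enorm_ge0 x : 0 <= enorm x. Proof. exact: sqrtr_ge0. Qed.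

Lemma sqr_enorm x : enorm x ^+ 2 = \sum_i x ord0 i ^+ 2.
Proof.
rewrite sqr_sqrtr /dotp; first by apply: eq_bigr => i _; rewrite expr2.
by apply: sumr_ge0 => i _; rewrite -expr2 sqr_ge0.
Qed.

Lemma coord_le_enorm x i : `|x ord0 i| <= enorm x.
Proof.
rewrite -(@ler_pXn2r _ 2)// ?nnegrE ?enorm_ge0// sqr_enorm real_normK ?num_real//.
by rewrite (bigD1 i)//= lerDl sumr_ge0// => j _; rewrite sqr_ge0.
Qed.

Lemma norm_le_enorm x : `|x| <= enorm x.
Proof. by apply: rV_norm_le => [|i]; [exact: enorm_ge0|exact: coord_le_enorm]. Qed.

Lemma enorm_le_norm x : enorm x <= (1 + d%:R) * `|x|.
Proof.
have d0 : 0 <= (1 + d%:R : R) by rewrite addr_ge0.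
rewrite -(@ler_pXn2r _ 2)// ?nnegrE ?enorm_ge0 ?mulr_ge0// sqr_enorm.
apply: (@le_trans _ _ (\sum_(i < d) `|x| ^+ 2)).
  apply: ler_sum => i _; rewrite -[leLHS]real_normK ?num_real//.
  by rewrite ler_pXn2r ?nnegrE// rV_coord_le.
rewrite sumr_const card_ord -[leLHS]mulr_natl exprMn ler_wpM2r ?sqr_ge0//.
have : 0 <= d%:R :> R by []. by nra.
Qed.

Lemma enormZ (r : R) x : enorm (r *: x) = `|r| * enorm x.
Proof.
apply/eqP; rewrite -(@eqrXn2 _ 2)// ?mulr_ge0 ?enorm_ge0// exprMn !sqr_enorm.
rewrite mulr_sumr; apply/eqP; apply: eq_bigr => i _.
by rewrite mxE exprMn real_normK ?num_real.
Qed.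

(** The sup norm replaces the Euclidean norm of [schwartz_norm]: by
    [enorm_le_norm] only constants change. *)
Definition rapid f : Prop := forall m, exists c : R, forall x,
  (1 + `|x|) ^+ m * normc (f x) <= c.

(** The Schwartz class is the largest class of differentiable, rapidly
    decreasing functions that is stable under partial derivatives, so membership
    follows from exhibiting such a class. *)
Lemma schwartz_coind (P : ('rV[R]_d -> R[i]) -> Prop) :
  (forall f, P f -> cdiff f) -> (forall f, P f -> rapid f) ->
  (forall f i, P f -> P (cD i f)) -> forall f, P f -> schwartz f.
Proof.
move=> Pd Pr PD f Pf.
have Pl l : P (cpderivs l f).
  elim: l => [|i l]; last exact: PD.
  by rewrite cpderivs_nil.
split=> [l x|m]; first exact: (Pd _ (Pl l)).
have /choice[c cP] : forall l, exists c : R, forall x,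
    (1 + enorm x) ^+ m * normc (cpderivs l f x) <= c.
  move=> l; have [c cP] := Pr _ (Pl l) m.
  exists ((1 + d%:R) ^+ m * c) => x.
  apply: le_trans (_ : ((1 + d%:R) * (1 + `|x|)) ^+ m * normc (cpderivs l f x) <= _).
    rewrite ler_wpM2r ?normc_ge0// lerXn2r ?nnegrE ?addr_ge0 ?enorm_ge0 ?mulr_ge0 ?addr_ge0//.
    have := enorm_le_norm x; have : 0 <= d%:R :> R by []. by lra.
  by rewrite exprMn -mulrA ler_wpM2l// exprn_ge0// addr_ge0.
have [c0 c0P] : exists c0 : R, forall l, (size l <= m)%N -> c l <= c0.
  exists (\sum_(k < m.+1) \sum_(t : k.-tuple 'I_d) `|c t|) => l lm.
  rewrite (bigD1 (Ordinal (lm : (size l < m.+1)%N)))//=.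
  rewrite (bigD1 (in_tuple l))//= -addrA.
  apply: (le_trans (ler_norm _)); rewrite lerDl addr_ge0 ?sumr_ge0//.
  by move=> k _; rewrite sumr_ge0.
apply: (@le_lt_trans _ _ c0%:E); last exact: ltry.
apply: ge_ereal_sup => _ [l [x [lm ->]]]; rewrite lee_fin.
exact: le_trans (cP l x) (c0P l lm).
Qed.

Lemma schwartz_diff f : schwartz f -> cdiff f.
Proof. by move=> [sf _] x; exact: (sf [::]). Qed.

Lemma schwartz_normP f l m x : (size l <= m)%N ->
  (((1 + enorm x) ^+ m * normc (cpderivs l f x))%:E <= schwartz_norm m f)%E.
Proof. by move=> lm; apply: ereal_sup_ubound; exists l, x. Qed.

Lemma schwartz_norm_ge0 f m : (0 <= schwartz_norm m f)%E.
Proof.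
apply: le_trans (schwartz_normP f 0 (l := [::]) (m := m) isT).
by rewrite lee_fin mulr_ge0 ?normc_ge0// exprn_ge0// addr_ge0 ?enorm_ge0.
Qed.

Lemma schwartz_rapid f : schwartz f -> rapid f.
Proof.
move=> [_ nf] m; exists (fine (schwartz_norm m f)) => x.
rewrite -lee_fin fineK ?ge0_fin_numE ?schwartz_norm_ge0//.
apply: le_trans (schwartz_normP f x (l := [::]) (m := m) isT).
rewrite cpderivs_nil lee_fin; apply: ler_wpM2r; first exact: normc_ge0.
rewrite lerXn2r ?nnegrE ?addr_ge0 ?enorm_ge0//.
by rewrite lerD2l norm_le_enorm.
Qed.

Lemma schwartz_cD f i : schwartz f -> schwartz (cD i f).
Proof.
move=> [sf nf]; split=> [l x|m].
  by have := sf (rcons l i) x; rewrite /pderivs !foldr_rcons.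
apply: le_lt_trans (nf m.+1).
apply: ge_ereal_sup => _ [l [x [lm ->]]]; rewrite -cpderivs_rcons.
apply: le_trans (schwartz_normP f x (l := rcons l i) (m := m.+1) _).
  rewrite lee_fin; apply: ler_wpM2r; first exact: normc_ge0.
  rewrite exprS ler_peMl//.
    by rewrite exprn_ge0// addr_ge0// enorm_ge0.
  by rewrite lerDl enorm_ge0.
by rewrite size_rcons.
Qed.

Lemma cdiff_continuous f : cdiff f ->
  continuous (fun y => cRe (f y)) /\ continuous (fun y => cIm (f y)).
Proof.
by move=> df; split=> x; [have [/differentiable_continuous] := df x|
  have [_ /differentiable_continuous] := df x].
Qed.

Lemma cdiff_cmeas f : cdiff f -> cmeas f.
Proof.
by move=> /cdiff_continuous[c1 c2]; split; exact: continuous_measurable_rV.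
Qed.

Lemma schwartz_cmeas f : schwartz f -> cmeas f.
Proof. by move=> /schwartz_diff/cdiff_cmeas. Qed.

Lemma weight_ge_norm x : (1 + `|x|) ^+ (2 * d) * weight x >= 1.
Proof.
rewrite exprM -[d in _ ^+ d]card_ord -prodr_const -big_split/=.
have {1}-> : 1 = \prod_(i < d) (1 : R) by rewrite big1.
apply: ler_prod => i _; rewrite ler01/=.
have p : 0 < 1 + x ord0 i ^+ 2 by rewrite ltr_pwDl// sqr_ge0.
rewrite ler_pdivlMr// mul1r.
have := rV_coord_le x i; rewrite -[x ord0 i ^+ 2]real_normK ?num_real//.
have := normr_ge0 (x ord0 i); have := normr_ge0 x.
by move: `|x| `|_ i| => a b; nra.
Qed.

Lemma rapid_weight f : rapid f -> exists c : R, forall x, normc (f x) <= c * weight x.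
Proof.
move=> /(_ (2 * d)%N)[c cP]; exists c => x.
apply: le_trans (_ : (1 + `|x|) ^+ (2 * d) * weight x * normc (f x) <= _).
  by rewrite ler_peMl ?normc_ge0// weight_ge_norm.
by rewrite mulrAC ler_wpM2r// ltW// weight_gt0.
Qed.

Lemma schwartz_weight f : schwartz f ->
  exists c : R, forall x, normc (f x) <= c * weight x.
Proof. by move=> /schwartz_rapid/rapid_weight. Qed.

Lemma schwartz_L1 f : schwartz f -> L1 (lebesgue_rV d) f.
Proof.
move=> sf; have [c cP] := schwartz_weight sf.
exact: L1_weight_dom (schwartz_cmeas sf) cP.
Qed.

Lemma schwartz_bounded f : schwartz f -> exists c : R, forall x, normc (f x) <= c.
Proof.
move=> /schwartz_rapid/(_ 0%N)[c cP]; exists c => x.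
by have := cP x; rewrite expr0 mul1r.
Qed.

Lemma cdiffD f g : cdiff f -> cdiff g -> cdiff (fun x => f x + g x).
Proof.
move=> df dg x; have [f1 f2] := df x; have [g1 g2] := dg x; split.
  by under eq_fun do (rewrite cRe_add); exact: differentiableD.
by under eq_fun do (rewrite cIm_add); exact: differentiableD.
Qed.

Lemma cDD f g i : cdiff f -> cdiff g ->
  cD i (fun x => f x + g x) = fun x => cD i f x + cD i g x.
Proof.
move=> df dg; apply/funext => x; have [f1 f2] := df x; have [g1 g2] := dg x.
apply: complex_ext; rewrite !cReIm /=.
  by under eq_fun do (rewrite cRe_add); rewrite deriveD//; exact: diff_derivable.
by under eq_fun do (rewrite cIm_add); rewrite deriveD//; exact: diff_derivable.
Qed.

Lemma cdiffM f g : cdiff f -> cdiff g -> cdiff (fun x => f x * g x).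
Proof.
move=> df dg x; have [f1 f2] := df x; have [g1 g2] := dg x; split.
  by under eq_fun do (rewrite cRe_mul); apply: differentiableB; exact: differentiableM.
by under eq_fun do (rewrite cIm_mul); apply: differentiableD; exact: differentiableM.
Qed.

Let derive_mulD (a b c k : 'rV[R]_d -> R) x v :
  derivable a x v -> derivable b x v -> derivable c x v -> derivable k x v ->
  'D_v (fun y => a y * b y + c y * k y) x =
  (a x * 'D_v b x + b x * 'D_v a x) + (c x * 'D_v k x + k x * 'D_v c x).
Proof.
move=> da db dc dk.
have h1 := derivableM da db; have h2 := derivableM dc dk.
have := deriveD h1 h2; rewrite (deriveM da db) (deriveM dc dk) => <-.
by [].
Qed.

Let derive_mulB (a b c k : 'rV[R]_d -> R) x v :
  derivable a x v -> derivable b x v -> derivable c x v -> derivable k x v ->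
  'D_v (fun y => a y * b y - c y * k y) x =
  (a x * 'D_v b x + b x * 'D_v a x) - (c x * 'D_v k x + k x * 'D_v c x).
Proof.
move=> da db dc dk.
have h1 := derivableM da db; have h2 := derivableM dc dk.
have := deriveB h1 h2; rewrite (deriveM da db) (deriveM dc dk) => <-.
by [].
Qed.

Lemma cDM f g i : cdiff f -> cdiff g ->
  cD i (fun x => f x * g x) = fun x => cD i f x * g x + f x * cD i g x.
Proof.
move=> df dg; apply/funext => x; have [f1 f2] := df x; have [g1 g2] := dg x.
have [f1' f2'] := (diff_derivable (v := e_ i) f1, diff_derivable (v := e_ i) f2).
have [g1' g2'] := (diff_derivable (v := e_ i) g1, diff_derivable (v := e_ i) g2).
apply: complex_ext; rewrite !cReIm /=.
  under eq_fun do (rewrite cRe_mul).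
  by rewrite derive_mulB//; ring.
under eq_fun do (rewrite cIm_mul).
by rewrite derive_mulD//; ring.
Qed.

(** Multipliers of the Schwartz class: all derivatives have polynomial growth.
    This is again coinductive: some stable class contains the function. *)
Definition slow h : Prop := exists P : ('rV[R]_d -> R[i]) -> Prop,
  [/\ P h, forall f, P f -> cdiff f,
      forall f, P f -> exists (m : nat) (c : R), 0 <= c /\ forall x, normc (f x) <= c * (1 + `|x|) ^+ m
    & forall f i, P f -> P (cD i f)].

Lemma slow_cD h i : slow h -> slow (cD i h).
Proof. by move=> [P [Ph Pd Pg PD]]; exists P; split=> //; exact: PD. Qed.

(** Leibniz' rule leads out of the set of products [h * f], but not out of the
    set of their sums. *)
Inductive slow_schwartz_sum : ('rV[R]_d -> R[i]) -> Prop :=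
| SSSmul h f : slow h -> schwartz f -> slow_schwartz_sum (fun x => h x * f x)
| SSSadd f g : slow_schwartz_sum f -> slow_schwartz_sum g ->
    slow_schwartz_sum (fun x => f x + g x).

Lemma slow_diff h : slow h -> cdiff h.
Proof. by move=> [P [Ph Pd _ _]]; exact: Pd. Qed.

Lemma schwartz_SSS f : slow_schwartz_sum f -> schwartz f.
Proof.
have dS f' : slow_schwartz_sum f' -> cdiff f'.
  by elim=> [h g sh sg|g1 g2 _ ? _ ?]; [apply: cdiffM; [exact: slow_diff|exact: schwartz_diff]|exact: cdiffD].
apply: schwartz_coind => // {f}.
- move=> f; elim=> [h g sh sg|g1 g2 _ h1 _ h2] m.
    case: sh => P [Ph _ /(_ _ Ph)[k [c [c0 cP]]] _].
    have [c' c'P] := schwartz_rapid sg (m + k)%N.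
    exists (c * c') => x; rewrite normcM.
    apply: le_trans (_ : (1 + `|x|) ^+ m * ((c * (1 + `|x|) ^+ k) * normc (g x)) <= _).
      by rewrite ler_wpM2l ?exprn_ge0 ?addr_ge0// ler_wpM2r ?normc_ge0.
    have -> : (1 + `|x|) ^+ m * (c * (1 + `|x|) ^+ k * normc (g x)) =
      c * ((1 + `|x|) ^+ (m + k) * normc (g x)) by rewrite exprD; ring.
    by rewrite ler_wpM2l.
  have [c1 c1P] := h1 m; have [c2 c2P] := h2 m; exists (c1 + c2) => x.
  apply: le_trans (lerD (c1P x) (c2P x)); rewrite -mulrDr.
  by apply: ler_wpM2l; [rewrite exprn_ge0// addr_ge0|exact: le_normcD].
- move=> f i; elim=> [h g sh sg|g1 g2 s1 h1 s2 h2].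
    rewrite cDM; [|exact: slow_diff|exact: schwartz_diff].
    apply: SSSadd; apply: SSSmul => //; [exact: slow_cD|exact: schwartz_cD].
  by rewrite cDD; [exact: SSSadd|exact: dS|exact: dS].
Qed.

Lemma schwartzM_slow h f : slow h -> schwartz f -> schwartz (fun x => h x * f x).
Proof. by move=> sh sf; apply/schwartz_SSS; exact: SSSmul. Qed.

Lemma schwartz_slow f : schwartz f -> slow f.
Proof.
move=> sf; exists schwartz; split=> //.
- exact: schwartz_diff.
- move=> g /schwartz_bounded[c cP]; exists 0%N, c; split=> [|x].
    exact: le_trans (normc_ge0 _) (cP 0).
  by rewrite expr0 mulr1.
- by move=> g i; exact: schwartz_cD.
Qed.

Lemma cdiff_cst (c : R[i]) : cdiff (fun=> c).
Proof. by split; exact: differentiable_cst. Qed.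

Lemma cD_cst (c : R[i]) i : cD i (fun=> c) = fun=> 0.
Proof. by apply/funext => x; rewrite /cD !derive_cst. Qed.

Lemma slow_cst (c : R[i]) : slow (fun=> c).
Proof.
exists (fun f => exists c, f = fun=> c); split; first by exists c.
- by move=> _ [a ->]; exact: cdiff_cst.
- move=> _ [a ->]; exists 0%N, (normc a); split=> [|x]; first exact: normc_ge0.
  by rewrite expr0 mulr1.
- by move=> _ i [a ->]; exists 0; rewrite cD_cst.
Qed.

Lemma schwartzZ (c : R[i]) f : schwartz f -> schwartz (fun x => c * f x).
Proof. by apply: schwartzM_slow; exact: slow_cst. Qed.

Lemma schwartzM f g : schwartz f -> schwartz g -> schwartz (fun x => f x * g x).
Proof. by move=> sf; apply: schwartzM_slow; exact: schwartz_slow. Qed.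

Lemma schwartzD f g : schwartz f -> schwartz g -> schwartz (fun x => f x + g x).
Proof.
move=> sf sg; apply: schwartz_SSS; apply: SSSadd.
  by rewrite (_ : f = fun x => 1 * f x);
    [exact/SSSmul/sf/slow_cst|apply/funext => x; rewrite mul1r].
by rewrite (_ : g = fun x => 1 * g x);
  [exact/SSSmul/sg/slow_cst|apply/funext => x; rewrite mul1r].
Qed.

Lemma schwartzN f : schwartz f -> schwartz (fun x => - f x).
Proof.
move=> sf; rewrite (_ : (fun _ => _) = fun x => -1 * f x); first exact: schwartzZ.
by apply/funext => x; rewrite mulN1r.
Qed.

Lemma schwartzB f g : schwartz f -> schwartz g -> schwartz (fun x => f x - g x).
Proof. by move=> sf sg; apply: schwartzD => //; exact: schwartzN. Qed.

Lemma schwartz0 : schwartz (fun _ : 'rV[R]_d => 0 : R[i]).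
Proof.
apply: (@schwartz_coind (fun f => f = fun=> 0)) => //.
- by move=> _ ->; exact: cdiff_cst.
- by move=> _ -> m; exists 0 => x; rewrite normc_zero mulr0.
- by move=> _ i ->; rewrite cD_cst.
Qed.

Lemma schwartz_sum (I : Type) (s : seq I) (F : I -> 'rV[R]_d -> R[i]) :
  (forall k, schwartz (F k)) -> schwartz (fun x => \sum_(k <- s) F k x).
Proof.
move=> sF; elim: s => [|k s ih].
  by under eq_fun do (rewrite big_nil); exact: schwartz0.
by under eq_fun do (rewrite big_cons); exact: schwartzD.
Qed.

Lemma differentiable_coord i x : differentiable (fun y : 'rV[R]_d => y ord0 i) x.
Proof. exact: differentiable_coord. Qed.

Lemma derive_coord i (v x : 'rV[R]_d) :
  'D_v (fun y : 'rV[R]_d => y ord0 i) x = v ord0 i.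
Proof.
rewrite /derive; apply: cvg_lim => //; apply: cvg_near_cst.
near=> t; rewrite /= !mxE addrK /GRing.scale/= mulKf//.
near: t; exact: nbhs_dnbhs_neq.
Unshelve. all: by end_near. Qed.

Lemma slow_coord i : slow (fun x => (x ord0 i)%:C).
Proof.
exists (fun f => (exists c, f = fun=> c) \/ f = (fun x => (x ord0 i)%:C)).
split; first by right.
- move=> _ [[a ->]|->]; first exact: cdiff_cst.
  by move=> x; split; [exact: differentiable_coord|exact: differentiable_cst].
- move=> _ [[a ->]|->].
    exists 0%N, (normc a); split=> [|x]; first exact: normc_ge0.
    by rewrite expr0 mulr1.
  exists 1%N, 1; split=> // x; rewrite normcR mul1r expr1.
  by apply: le_trans (rV_coord_le _ _) _; rewrite lerDr.
- move=> _ j [[a ->]|->]; left; first by exists 0; rewrite cD_cst.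
  exists ((e_ j) ord0 i)%:C; apply/funext => x.
  by rewrite /cD derive_coord derive_cst.
Qed.

Let affine_diff (r : R) z x : differentiable (fun y : 'rV[R]_d => r *: y + z) x.
Proof. by apply: differentiableD => //; exact: differentiableZ. Qed.

Let derive_affine (phi : 'rV[R]_d -> R) (r : R) z x v :
  differentiable phi (r *: x + z) ->
  differentiable (fun y => phi (r *: y + z)) x /\
  'D_v (fun y => phi (r *: y + z)) x = r * 'D_v phi (r *: x + z).
Proof.
move=> dphi.
have dc : differentiable (phi \o (fun y : 'rV[R]_d => r *: y + z)) x.
  exact: differentiable_comp.
split; first exact: dc.
transitivity ('D_v (phi \o (fun y : 'rV[R]_d => r *: y + z)) x); first by [].
rewrite (deriveE _ dc) (diff_comp (affine_diff r z x) dphi) [LHS]/=.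
rewrite -(deriveE _ (affine_diff r z x)) (deriveE _ dphi).
have -> : 'D_v (fun y : 'rV[R]_d => r *: y + z) x = r *: v.
  have h1 : derivable (r \*: (@id 'rV[R]_d)) x v.
    by apply: derivableZ; exact: derivable_id.
  transitivity ('D_v ((r \*: (@id 'rV[R]_d)) + cst z) x); first by [].
  rewrite (deriveD h1 (derivable_cst _ _ _)) derive_cst addr0 deriveZ.
    by rewrite derive_id.
  exact: derivable_id.
by rewrite linearZ.
Qed.

Lemma schwartz_affine (r : R) z f : r != 0 -> schwartz f ->
  schwartz (fun x => f (r *: x + z)).
Proof.
move=> r0 sf.
apply: (@schwartz_coind (fun h => exists (c : R) (g : 'rV[R]_d -> R[i]), schwartz g /\
  h = fun x => c%:C * g (r *: x + z))); last first.
  by exists 1, f; split=> //; apply/funext => x; rewrite mul1r.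
- move=> _ i [c [g [sg ->]]]; exists (c * r), (cD i g); split; first exact: schwartz_cD.
  rewrite cDM; [|exact: cdiff_cst|].
    apply/funext => x; have [g1 g2] := schwartz_diff sg (r *: x + z).
    rewrite cD_cst mul0r add0r /cD (derive_affine _ g1).2 (derive_affine _ g2).2.
    by apply: complex_ext; rewrite !cReIm /=; ring.
  move=> x; have [g1 g2] := schwartz_diff sg (r *: x + z).
  by split; [exact: (derive_affine (e_ i) g1).1|exact: (derive_affine (e_ i) g2).1].
- move=> _ [c [g [sg ->]]] m; have [k kP] := schwartz_rapid sg m.
  pose b := (1 + `|z| + `|r|) / `|r|.
  have r0' : 0 < `|r| by rewrite normr_gt0.
  have b0 : 0 <= b by rewrite divr_ge0// !addr_ge0.
  exists (`|c| * (b ^+ m * k)) => x; rewrite normcM normcR mulrCA ler_wpM2l//.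
  apply: le_trans (_ : (b * (1 + `|r *: x + z|)) ^+ m * normc (g (r *: x + z)) <= _).
    rewrite ler_wpM2r ?normc_ge0// lerXn2r ?nnegrE ?mulr_ge0 ?addr_ge0//.
    rewrite /b mulrAC ler_pdivlMr//.
    have : `|r| * `|x| <= `|r *: x + z| + `|z|.
      by rewrite -normrZ -[X in `|X|](addrK z) ler_normB.
    have := normr_ge0 (r *: x + z); have := normr_ge0 z.
    by move: `|r *: x + z| `|z| `|x| r0'; move: `|r| => p q w t; nra.
  by rewrite exprMn -mulrA ler_wpM2l// exprn_ge0.
- move=> _ [c [g [sg ->]]]; apply: cdiffM; first exact: cdiff_cst.
  move=> x; have [g1 g2] := schwartz_diff sg (r *: x + z).
  by split; [exact: (derive_affine 0 g1).1|exact: (derive_affine 0 g2).1].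
Qed.

Lemma schwartz_conj f : schwartz f -> schwartz (fun x => (f x)^*).
Proof.
move=> sf.
have RJ (z : R[i]) : cRe z^* = cRe z by case: z.
have IJ (z : R[i]) : cIm z^* = - cIm z by case: z.
apply: (@schwartz_coind (fun h => exists g : 'rV[R]_d -> R[i], schwartz g /\
  h = fun x => (g x)^*)); last by exists f.
- move=> _ [g [sg ->]] x; have [g1 g2] := schwartz_diff sg x; split.
    by under eq_fun do (rewrite RJ).
  by under eq_fun do (rewrite IJ); exact: differentiableN.
- move=> _ [g [sg ->]] m; have [k kP] := schwartz_rapid sg m; exists k => x.
  by have := kP x; rewrite !normcE' RJ IJ sqrrN.
- move=> _ i [g [sg ->]]; exists (cD i g); split; first exact: schwartz_cD.
  apply/funext => x; have [g1 g2] := schwartz_diff sg x.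
  apply: complex_ext; rewrite ?RJ ?IJ /=; first by under eq_fun do (rewrite RJ).
  under eq_fun do (rewrite IJ); rewrite deriveN//; exact: diff_derivable.
Qed.

Let continuous_bounded_ball (phi : 'rV[R]_d -> R) (M : R) : continuous phi ->
  exists c : R, forall x, `|x| <= M -> phi x <= c.
Proof.
move=> cphi; pose A := [set x : 'rV[R]_d | `|x| <= M].
have [[x0 Ax0]|A0] := pselect (A !=set0); last first.
  by exists 0 => x Mx; exfalso; apply: A0; exists x.
have cA : compact A.
  apply: bounded_closed_compact.
    by exists M; split=> [|N MN x Ax]; [exact: num_real|exact: le_trans Ax (ltW MN)].
  rewrite (_ : A = (fun x : 'rV[R]_d => `|x|) @^-1` [set t | t <= M])//.
  by apply: preimage_closed; [move=> x _; exact: norm_continuous|exact: closed_le].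
have [c _ cP] := EVT_max_rV (ex_intro _ x0 Ax0) cA (continuous_subspaceT cphi).
by exists (phi c) => x Mx; apply: cP; rewrite inE.
Qed.

Lemma schwartz_compact f (M : R) : csmooth f ->
  (forall x, M < `|x| -> f x = 0) -> schwartz f.
Proof.
move=> sf fM.
apply: (@schwartz_coind (fun h => csmooth h /\ forall x, M < `|x| -> h x = 0)).
- by move=> h [sh _] x; exact: (sh [::]).
- move=> h [sh hM] m.
  have [c1 c2] : continuous (fun y => cRe (h y)) /\ continuous (fun y => cIm (h y)).
    by apply: cdiff_continuous => x; exact: (sh [::]).
  have bd (p : 'rV[R]_d -> R) : continuous p ->
      exists c : R, forall x, `|x| <= M -> `|p x| <= c.
    move=> cp; apply: (@continuous_bounded_ball (fun x => `|p x|)) => x.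
    by apply: (continuous_comp (f := p) (g := fun t : R => `|t|));
      [exact: cp|exact: norm_continuous].
  have [a aP] := bd _ c1; have [b bP] := bd _ c2.
  exists ((1 + `|M|) ^+ m * (`|a| + `|b|)) => x; have [xM|Mx] := leP `|x| M; last first.
    by rewrite hM// normc_zero mulr0 mulr_ge0// exprn_ge0// addr_ge0.
  apply: ler_pM; rewrite ?exprn_ge0 ?addr_ge0 ?normc_ge0//.
    by rewrite lerXn2r ?nnegrE ?addr_ge0// lerD2l (le_trans xM)// ler_norm.
  apply: le_trans (normc_le _) _; apply: lerD.
    exact: le_trans (aP x xM) (ler_norm _).
  exact: le_trans (bP x xM) (ler_norm _).
- move=> h i [sh hM]; split=> [l x|x Mx].
    by have := sh (rcons l i) x; rewrite /pderivs !foldr_rcons.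
  have nz : \near x, h x = 0.
    have : \forall y \near x, M < `|y|.
      have : (fun y : 'rV[R]_d => `|y|) @ x --> `|x| by exact: norm_continuous.
      move=> /cvgrPdist_lt/(_ (`|x| - M)); rewrite subr_gt0 => /(_ Mx).
      apply: filterS => y /(le_lt_trans (ler_norm _)).
      by rewrite ltrD2l ltrN2.
    by apply: filterS => y; exact: hM.
  rewrite /cD (@near_eq_derive _ _ _ _ (fun=> 0)); last first.
    by apply: filterS nz => y ->.
  rewrite derive_cst (@near_eq_derive _ _ _ _ (fun=> 0)) ?derive_cst//.
  by apply: filterS nz => y ->.
- by split.
Unshelve. all: by end_near. Qed.

End schwartz_calculus.

(** * Limits and the mean value theorem *)

Section complex_limits.
Context {R : realType}.
Implicit Types (a b : nat -> R[i]) (A B : R[i]).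

Definition ccvg a A : Prop := (fun n => normc (a n - A)) @ \oo --> (0 : R).

Lemma ccvg_le a A (u : nat -> R) : u @ \oo --> (0 : R) ->
  (forall n, normc (a n - A) <= u n) -> ccvg a A.
Proof.
move=> u0 au; apply: (@squeeze_cvgr _ _ _ _ (cst 0) u) => //; last exact: cvg_cst.
by apply: nearW => n; rewrite normc_ge0 au.
Qed.

Lemma ccvg_unique a A B : ccvg a A -> ccvg a B -> A = B.
Proof.
move=> aA aB; apply/eqP; rewrite -subr_eq0; apply/eqP/normc_eq0.
apply/eqP; rewrite eq_le normc_ge0 andbT; apply/ler_addgt0Pl => e e0.
have e20 : 0 < e / 2 by rewrite divr_gt0.
have /cvgrPdist_lt/(_ _ e20) h1 := aA; have /cvgrPdist_lt/(_ _ e20) h2 := aB.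
have [n _ /(_ n (leqnn n))[]] := filterI h1 h2.
rewrite !sub0r !normrN !ger0_norm ?normc_ge0// => k1 k2.
rewrite addr0 -[A](subrK (a n)) -addrA (le_trans (le_normcD _ _))//.
by rewrite normcB [leRHS](splitr e) lerD// ltW.
Qed.

Lemma ccvg_cst A : ccvg (fun=> A) A.
Proof.
by apply: (@ccvg_le _ _ (cst 0)) => [|n]; [exact: cvg_cst|rewrite subrr normc_zero].
Qed.

Lemma ccvgD a b A B : ccvg a A -> ccvg b B -> ccvg (fun n => a n + b n) (A + B).
Proof.
move=> aA bB; apply: (@ccvg_le _ _ (fun n => normc (a n - A) + normc (b n - B))).
  by rewrite -[0]addr0; exact: cvgD.
by move=> n; rewrite opprD addrACA le_normcD.
Qed.

Lemma ccvgMl a A B : ccvg a A -> ccvg (fun n => B * a n) (B * A).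
Proof.
move=> aA; apply: (@ccvg_le _ _ (fun n => normc B * normc (a n - A))).
  by rewrite -[0](mulr0 (normc B)); apply: cvgM => //; exact: cvg_cst.
by move=> n; rewrite -mulrBr normcM.
Qed.

Lemma ccvg_normc a A (c : R) : ccvg a A -> (forall n, normc (a n) <= c) ->
  normc A <= c.
Proof.
move=> aA ac; apply/ler_addgt0Pl => e e0.
have /cvgrPdist_lt/(_ _ e0)[n _ /(_ n (leqnn n))] := aA.
rewrite sub0r normrN ger0_norm ?normc_ge0// => /ltW h.
by rewrite -(subrK (a n) A) (le_trans (le_normcD _ _))// normcB lerD.
Qed.

Lemma eq_ccvg a b A : a =1 b -> ccvg a A -> ccvg b A.
Proof. by move=> /funext ->. Qed.

Lemma cvg_harmonic0 : (fun n => n.+1%:R^-1 : R) @ \oo --> (0 : R).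
Proof. exact: cvg_harmonic. Qed.

Lemma mean_value (f f' : R -> R) (a b : R) : (forall x : R, is_derive (x : R^o) 1 (f : R^o -> R^o) (f' x)) ->
  exists c, `|c - a| <= `|b - a| /\ f b - f a = f' c * (b - a).
Proof.
move=> df.
have H (x y : R) : x <= y -> exists2 c, x <= c <= y & f y - f x = f' c * (y - x).
  move=> xy; have [|c] := @MVT_segment R f f' x y xy (fun z _ => df z).
    by apply: derivable_within_continuous => z _; exact: ex_derive.
  by rewrite in_itv/= => cxy ->; exists c.
have [ab|/ltW ba] := leP a b.
  have [c /andP[ac cb] fE] := H _ _ ab; exists c; split=> //.
  by rewrite !ger0_norm ?subr_ge0// lerD2r.
have [c /andP[bc ca] fE] := H _ _ ba; exists c; split.
  by rewrite !ler0_norm ?subr_le0// lerN2 lerD2r.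
by rewrite -opprB fE -mulrN opprB.
Qed.

Lemma normr_sin (t : R) : `|sin t| <= `|t|.
Proof.
have [c [_]] := mean_value 0 t (fun x => is_derive_sin x).
rewrite sin0 !subr0 => ->; rewrite normrM ler_piMl//.
by rewrite ler_norml cos_geN1 cos_le1.
Qed.

Lemma cos_sub1 (t : R) : `|cos t - 1| <= t ^+ 2 / 2.
Proof.
have -> : cos t - 1 = - (2 * sin (t / 2) ^+ 2).
  have := cosD (t / 2) (t / 2); rewrite -splitr => ->.
  by have := cos2Dsin2 (t / 2); rewrite !expr2; lra.
rewrite normrN ger0_norm; last by rewrite mulr_ge0// sqr_ge0.
have : sin (t / 2) ^+ 2 <= (t / 2) ^+ 2.
  rewrite -[leLHS]real_normK ?num_real// -[leRHS]real_normK ?num_real//.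
  by rewrite lerXn2r ?nnegrE// normr_sin.
by rewrite expr_div_n; lra.
Qed.

Lemma cos_sub1_lin (t : R) : `|cos t - 1| <= `|t|.
Proof.
have := cos_sub1 t; have [t2|t2] := leP `|t| 2.
  rewrite -[t ^+ 2]real_normK ?num_real//; have := normr_ge0 t.
  by move: (`|_ - 1|) `|t| t2 => a b; nra.
move=> _; apply: le_trans (ltW t2).
rewrite ler_norml; apply/andP; split; first by have := cos_geN1 t; lra.
by have := cos_le1 t; lra.
Qed.

Lemma sin_subt (t : R) : `|sin t - t| <= t ^+ 2.
Proof.
have [c []] := mean_value 0 t (fun x : R => is_deriveB (is_derive_sin x) (is_derive_id x 1)).
rewrite !subr0 => ct; have -> : (sin - id) t = sin t - t by [].
have -> : (sin - id) (0 : R) = sin 0 - 0 by []; rewrite sin0 subr0.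
rewrite subr0 => ->; rewrite normrM expr2 -[leRHS]ger0_norm -?expr2 ?sqr_ge0//.
rewrite expr2 normrM ler_wpM2r//; apply: le_trans ct; exact: cos_sub1_lin.
Qed.

Lemma expi_taylor (t : R) : normc (expi t - 1 - (0 +i* t)) <= 2 * t ^+ 2.
Proof.
apply: le_trans (normc_le _) _; rewrite !cReIm /= subr0 !oppr0 !addr0 mulr_natl mulr2n.
apply: lerD; last exact: sin_subt.
by apply: le_trans (cos_sub1 t) _; rewrite ler_pdivrMr// ler_peMr ?sqr_ge0// ler1n.
Qed.

Lemma normc_expi_sub1 (t : R) : normc (expi t - 1) <= 2 * `|t|.
Proof.
apply: le_trans (normc_le _) _; rewrite !cReIm /= subr0 mulr_natl mulr2n.
by apply: lerD; [exact: cos_sub1_lin|exact: normr_sin].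
Qed.

End complex_limits.


(** * Differentiability of functions of several variables *)

Section several_variables.
Context {R : realType} {d : nat}.
Implicit Types (x z : 'rV[R]_d) (f : 'rV[R]_d -> R[i]).

Notation e_ i := (delta_mx ord0 i : 'rV[R]_d).

Definition lin_form (c : 'I_d -> R) (h : 'rV[R]_d) : R := \sum_i h ord0 i * c i.

Let lin_linear c : linear (lin_form c).
Proof.
move=> a u v; rewrite /lin_form scaler_sumr -big_split/=; apply: eq_bigr => i _.
by rewrite !mxE mulrDl /GRing.scale/= mulrA.
Qed.

HB.instance Definition _ c := @GRing.isLinear.Build R 'rV[R]_d R _ (lin_form c)
  (lin_linear c).

Let lin_le c h : `|lin_form c h| <= (\sum_i `|c i|) * `|h|.
Proof.
apply: le_trans (ler_norm_sum _ _ _) _; rewrite mulr_suml; apply: ler_sum => i _.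
by rewrite normrM mulrC ler_wpM2l// rV_coord_le.
Qed.

Let near_norm_le (x : 'rV[R]_d) (e : R) : 0 < e -> \forall h \near x, `|x - h| <= e.
Proof.
move=> e0; have : (fun y : 'rV[R]_d => y) @ x --> x by exact: cvg_id.
by move=> /cvgrPdist_le/(_ _ e0).
Qed.

Let lin_cvg c (x : 'rV[R]_d) :
  (fun y : 'rV[R]_d => lin_form c y : R) @ x --> (lin_form c x : R).
Proof.
have FF : Filter (nbhs x) by exact: nbhs_filter.
apply/cvgrPdist_le => e e0.
have p0 : 0 < 1 + \sum_i `|c i| by rewrite ltr_pwDl// sumr_ge0.
have := near_norm_le x (divr_gt0 e0 p0); apply: filterS => h hx.
rewrite -linearB; apply: le_trans (lin_le _ _) _.
apply: le_trans (_ : (1 + \sum_i `|c i|) * `|x - h| <= _).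
  by rewrite ler_wpM2r// lerDr.
by rewrite mulrC -ler_pdivlMr.
Qed.

Let lin_continuous c : continuous (lin_form c).
Proof. by move=> x; exact: lin_cvg. Qed.

(** A quadratic Taylor remainder gives differentiability together with the
    values of the partial derivatives. *)
Lemma quadratic_differentiable (phi : 'rV[R]_d -> R) x (c : 'I_d -> R) (K : R) :
  (forall h, `|phi (h + x) - phi x - \sum_i h ord0 i * c i| <= K * `|h| ^+ 2) ->
  differentiable phi x /\ forall i, 'D_(e_ i) phi x = c i.
Proof.
move=> hK.
have K0 : 0 <= `|K| by [].
have E : (phi : 'rV[R]_d -> R^o) \o shift x =
    cst (phi x) + (lin_form c : 'rV[R]_d -> R^o) +o_ (0 : 'rV[R]_d) id.
  apply/eqaddoP => e e0; near=> h.
  rewrite !fctE /= opprD addrA; apply: le_trans (hK h) _.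
  apply: le_trans (_ : `|K| * `|h| * `|h| <= _).
    by rewrite -mulrA -expr2 ler_wpM2r ?sqr_ge0// ler_norm.
  rewrite ler_wpM2r//; apply: le_trans (_ : (1 + `|K|) * `|h| <= _).
    by rewrite ler_wpM2r// lerDr.
  rewrite mulrC -ler_pdivlMr ?ltr_pwDl//.
  near: h; have h0 : 0 < e / (1 + `|K|) by rewrite divr_gt0// ltr_pwDl.
  have := near_norm_le 0 h0; apply: filterS => h; by rewrite sub0r normrN.
have dE := diff_unique (@lin_continuous c) E.
have dphi : differentiable phi x.
  by apply/diff_locallyP; rewrite dE; split=> //; exact: lin_continuous.
split=> // i; rewrite deriveE// dE [LHS]/= /lin_form (bigD1 i)//= !mxE !eqxx mul1r.
by rewrite big1 ?addr0// => j ji; rewrite !mxE (negPf ji) andbF mul0r.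
Unshelve. all: by end_near. Qed.

Lemma is_derive_line (phi : 'rV[R]_d -> R) x z (t : R) :
  (forall y, differentiable phi y) ->
  is_derive (t : R^o) 1 ((fun s => phi (s *: z + x)) : R^o -> R^o) ('D_z phi (t *: z + x)).
Proof.
move=> dphi; have := diff_derivable (v := z) (dphi (t *: z + x)).
have E : (fun h : R => h^-1 *: (((fun s => phi (s *: z + x)) \o shift t) (h *: 1) -
   phi (t *: z + x))) = (fun h => h^-1 *: ((phi \o shift (t *: z + x)) (h *: z) - phi (t *: z + x))).
  apply/funext => h; congr (_ *: (_ - _)).
  by rewrite /= [h *: (1 : R^o)]mulr1 scalerDl addrA.
move=> dd; apply: DeriveDef; first by rewrite /derivable E.
by rewrite /derive E.
Qed.

Lemma derive_coords (phi : 'rV[R]_d -> R) x z : differentiable phi x ->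
  'D_z phi x = \sum_i z ord0 i * 'D_(e_ i) phi x.
Proof.
move=> dphi; rewrite deriveE//.
rewrite {1}(row_sum_delta z) linear_sum; apply: eq_bigr => i _.
by rewrite linearZ deriveE.
Qed.

(** Mean value theorem along the segment from [x] to [x + z]: the derivatives
    decay, and the weight hardly changes along the segment. *)
Lemma schwartz_lipschitz f : schwartz f -> exists c : R, 0 <= c /\
  forall x z, `|z| <= 1 -> normc (f (x + z) - f x) <= c * `|z| * weight x.
Proof.
move=> sf; have /choice[b bP] : forall i, exists c : R, forall x,
    normc (cD i f x) <= c * weight x.
  by move=> i; exact/schwartz_weight/schwartz_cD.
have b0 i : 0 <= b i.
  have := le_trans (normc_ge0 _) (bP i 0); rewrite pmulr_lge0//; exact: weight_gt0.
pose c := 3 ^+ d * \sum_i b i.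
exists (2 * c); split; first by rewrite !mulr_ge0// ?exprn_ge0// sumr_ge0.
move=> x z z1.
have H (p : R[i] -> R) : (forall y, differentiable (fun y => p (f y)) y) ->
    (forall y i, `|'D_(e_ i) (fun y => p (f y)) y| <= b i * weight y) ->
    `|p (f (x + z)) - p (f x)| <= c * `|z| * weight x.
  move=> dp pb; have [t [t1]] := @mean_value R _ _ 0 1
    (fun t => is_derive_line x z t dp).
  rewrite !subr0 normr1 in t1; rewrite subr0 scale1r scale0r add0r mulr1 [z + x]addrC => ->.
  rewrite derive_coords//; apply: le_trans (ler_norm_sum _ _ _) _.
  rewrite /c -!mulrA mulr_suml mulr_sumr; apply: ler_sum => i _.
  rewrite normrM; apply: le_trans (_ : `|z| * (b i * weight (t *: z + x)) <= _).
    by apply: ler_pM => //; exact: rV_coord_le.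
  have w3 : weight (t *: z + x) <= 3 ^+ d * weight x.
    by rewrite addrC; apply: weight_shift; rewrite normrZ mulr_ile1.
  have := ler_wpM2l (mulr_ge0 (normr_ge0 z) (b0 i)) w3.
  set W := weight x; set W' := weight (_ + _); set A := 3 ^+ d.
  by rewrite (_ : A * (b i * (`|z| * W)) = `|z| * b i * (A * W)) ?mulrA//; ring.
apply: le_trans (normc_le _) _; rewrite !cReIm mulrDl mulrDl.
have [d1 d2] : (forall y, differentiable (fun y => cRe (f y)) y) /\
    (forall y, differentiable (fun y => cIm (f y)) y).
  by split=> y; have [] := schwartz_diff sf y.
rewrite !mul1r mulrDl; apply: lerD; apply: H => // y i.
  exact: le_trans (normc_cRe _) (bP i y).
exact: le_trans (normc_cIm _) (bP i y).
Qed.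

Lemma schwartz_L1_lipschitz f : schwartz f -> exists c : R, 0 <= c /\
  forall z, (norm1 (lebesgue_rV d) (fun x => (f (x + z) - f x)%R) <= (c * `|z|)%:E)%E.
Proof.
move=> sf; have [c [c0 cP]] := schwartz_lipschitz sf.
have [mf foo] := schwartz_L1 sf.
pose n1 := fine (norm1 (lebesgue_rV d) f).
have n1E : norm1 (lebesgue_rV d) f = n1%:E.
  by rewrite fineK// ge0_fin_numE ?norm1_ge0.
have n10 : 0 <= n1 by rewrite -lee_fin -n1E norm1_ge0.
have mz z : cmeas (fun x => f (x + z)).
  by have := cmeas_affine 1 z mf; under eq_fun do (rewrite scale1r).
exists (c * pi ^+ d + 2 * n1); split.
  by rewrite addr_ge0 ?mulr_ge0// exprn_ge0// pi_ge0.
move=> z; have [z1|/ltW z1] := leP `|z| 1.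
  apply: (@le_trans _ _ (norm1 (lebesgue_rV d) (fun x => ((c * `|z|)%:C * (weight x)%:C)%R))).
    apply: le_norm1.
    - exact: cmeasB.
    - by apply: cmeasM; [exact: cmeas_cst|exact: (L1_weight d).1].
    - move=> x; rewrite normcM !normcR [`|weight x|]ger0_norm ?(ltW (weight_gt0 _))//.
      by rewrite ger0_norm ?mulr_ge0// cP.
  rewrite norm1Z; last exact: (L1_weight d).1.
  rewrite /norm1; under eq_integral do rewrite normcR ger0_norm ?(ltW (weight_gt0 _))//.
  rewrite integral_weight normcR -EFinM lee_fin ger0_norm ?mulr_ge0//.
  by rewrite mulrDl mulrAC lerDl mulr_ge0// mulr_ge0.
apply: le_trans (norm1B (lebesgue_rV d) (mz z) mf) _; rewrite norm1_shift// n1E -EFinD lee_fin.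
apply: le_trans (_ : 2 * n1 * 1 <= _); first by rewrite mulr1 mulr_natl mulr2n.
apply: ler_pM => //; first by rewrite mulr_ge0.
by rewrite lerDr mulr_ge0// exprn_ge0// pi_ge0.
Qed.

End several_variables.

(** * The Fourier transform of Schwartz functions *)

Section fourier_schwartz.
Context {R : realType} {d : nat}.
Implicit Types (x y z xi : 'rV[R]_d) (f g : 'rV[R]_d -> R[i]).

Notation e_ i := (delta_mx ord0 i : 'rV[R]_d).
Notation mu := (lebesgue_rV (R := R) d).

Lemma dotpC x y : dotp x y = dotp y x.
Proof. by apply: eq_bigr => i _; rewrite mulrC. Qed.

Lemma dotpDl x y z : dotp (x + y) z = dotp x z + dotp y z.
Proof. by rewrite -big_split/=; apply: eq_bigr => i _; rewrite mxE mulrDl. Qed.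

Lemma dotpZl (r : R) x y : dotp (r *: x) y = r * dotp x y.
Proof. by rewrite mulr_sumr; apply: eq_bigr => i _; rewrite mxE mulrA. Qed.

Lemma dotpNl x y : dotp (- x) y = - dotp x y.
Proof. by rewrite -scaleN1r dotpZl mulN1r. Qed.

Lemma dotpZr (r : R) x y : dotp x (r *: y) = r * dotp x y.
Proof. by rewrite !(dotpC x) dotpZl. Qed.

Lemma dotpNr x y : dotp x (- y) = - dotp x y.
Proof. by rewrite !(dotpC x) dotpNl. Qed.

Lemma dotp0l x : dotp 0 x = 0.
Proof. by rewrite -(scale0r x) dotpZl mul0r. Qed.

Lemma dotp_delta x i : dotp (e_ i) x = x ord0 i.
Proof.
rewrite /dotp (bigD1 i)//= !mxE !eqxx mul1r big1 ?addr0// => j ji.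
by rewrite mxE (negPf ji) andbF mul0r.
Qed.

Lemma dotp_le x y : `|dotp x y| <= d%:R * (`|x| * `|y|).
Proof.
apply: le_trans (ler_norm_sum _ _ _) _; apply: le_trans (_ : \sum_(i < d) (`|x| * `|y|) <= _); last first.
  by rewrite sumr_const card_ord mulr_natl.
apply: ler_sum => i _.
by rewrite normrM ler_pM// rV_coord_le.
Qed.

Lemma measurable_dotp : measurable_fun setT (fun p : 'rV[R]_d * 'rV[R]_d => dotp p.1 p.2).
Proof.
apply: measurable_sum => i; apply: measurable_funM.
  exact: (measurableT_comp (measurable_rV_coord i) measurable_fst).
exact: (measurableT_comp (measurable_rV_coord i) measurable_snd).
Qed.

Lemma cmeas_expi d' (T : measurableType d') (h : T -> R) :
  measurable_fun setT h -> cmeas (fun t => expi (h t)).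
Proof.
move=> mh; split.
  apply: (measurableT_comp _ mh); apply: continuous_measurable_fun.
  exact: continuous_cos.
apply: (measurableT_comp _ mh); apply: continuous_measurable_fun.
exact: continuous_sin.
Qed.

Lemma cmeas_comp d1 d2 (T1 : measurableType d1) (T2 : measurableType d2)
  (F : T2 -> R[i]) (h : T1 -> T2) :
  measurable_fun setT h -> cmeas F -> cmeas (fun t => F (h t)).
Proof.
by move=> mh [F1 F2]; split; [exact: (measurableT_comp F1 mh)|exact: (measurableT_comp F2 mh)].
Qed.

(** The character of R^d with frequency [xi]. *)
Definition wave xi x : R[i] := expi (2 * pi * dotp x xi).

Lemma normc_wave xi x : normc (wave xi x) = 1. Proof. exact: normc_expi. Qed.

Lemma waveC xi x : wave xi x = wave x xi. Proof. by rewrite /wave dotpC. Qed.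

Lemma waveDr xi x y : wave xi (x + y) = wave xi x * wave xi y.
Proof. by rewrite /wave dotpDl mulrDr expiD. Qed.

Lemma waveDl xi x y : wave (x + y) xi = wave x xi * wave y xi.
Proof. by rewrite !(waveC _ xi) waveDr. Qed.

Lemma waveNl xi x : wave (- xi) x = wave xi (- x).
Proof. by rewrite /wave dotpNl dotpNr. Qed.

Lemma waveZl (r : R) xi x : wave (r *: xi) x = wave xi (r *: x).
Proof. by rewrite /wave dotpZl dotpZr. Qed.

Lemma wave0r xi : wave xi 0 = 1.
Proof. by rewrite /wave dotp0l mulr0 expi0. Qed.

Lemma wave0l x : wave 0 x = 1. Proof. by rewrite waveC wave0r. Qed.

Lemma fourierE f xi : fourier f xi = cI mu (fun x => f x * wave (- xi) x).
Proof. by rewrite /fourier /wave; apply: eq_cI => x; rewrite dotpNr mulrN. Qed.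

Lemma inv_fourierE f x : inv_fourier f x = cI mu (fun xi => f xi * wave x xi).
Proof. by rewrite /inv_fourier; apply: eq_cI => xi; rewrite /wave dotpC. Qed.

Lemma cmeas_wave xi : cmeas (wave xi).
Proof.
apply: cmeas_expi; apply: measurable_funM; first exact: measurable_cst.
exact: (measurableT_comp measurable_dotp (pair2_measurable _)).
Qed.

Lemma cmeas_wave2 : cmeas (fun p : 'rV[R]_d * 'rV[R]_d => wave p.1 p.2).
Proof.
apply: cmeas_expi; apply: measurable_funM; first exact: measurable_cst.
by under eq_fun do (rewrite dotpC); exact: measurable_dotp.
Qed.

Lemma L1_wave f xi : L1 mu f -> L1 mu (fun x => f x * wave xi x).
Proof.
move=> Lf; under eq_fun do (rewrite mulrC).
apply: (L1Mb (c := 1) Lf (cmeas_wave xi)) => x; by rewrite normc_wave.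
Qed.

Lemma inv_fourier_opp f x : inv_fourier f x = fourier f (- x).
Proof. by rewrite inv_fourierE fourierE opprK. Qed.

Lemma norm1_wave f xi : norm1 mu (fun x => f x * wave xi x) = norm1 mu f.
Proof. by apply: eq_integral => x _; rewrite normcM normc_wave mulr1. Qed.

Lemma fourier_bounded f : L1 mu f -> exists c : R, forall xi, normc (fourier f xi) <= c.
Proof.
move=> Lf; exists (2 * fine (norm1 mu f)) => xi; rewrite fourierE.
apply: normc_cI_le; first exact: L1_wave.
by rewrite norm1_wave fineK// ge0_fin_numE ?norm1_ge0//; exact: Lf.2.
Qed.

Lemma fourier_shift f z xi : L1 mu f ->
  fourier (fun x => f (x + z)) xi = wave xi z * fourier f xi.
Proof.
move=> Lf; rewrite !fourierE -cIZ; last exact: L1_wave.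
rewrite -(cI_shift z (f := fun x => wave xi z * (f x * wave (- xi) x))); last first.
  by apply: L1Z; exact: L1_wave.
apply: eq_cI => x; rewrite waveDr [wave (- xi) z]waveNl.
have : wave xi z * wave xi (- z) = 1 by rewrite -waveDr subrr wave0r.
move: (wave xi z) (wave xi (- z)) (wave _ x) (f _) => a b u v ab.
by rewrite -[LHS]mul1r -ab; ring.
Qed.

Lemma schwartz_coord f i : schwartz f -> schwartz (fun x => (x ord0 i)%:C * f x).
Proof. exact/schwartzM_slow/slow_coord. Qed.

(** The symbol [2 pi i xi_i] of the i-th derivative. *)
Definition symb i xi : R[i] := 0 +i* (2 * pi * xi ord0 i).

Lemma schwartz_symb f i : schwartz f -> schwartz (fun x => symb i x * f x).
Proof.
move=> sf; rewrite (_ : (fun _ => _) =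
    fun x => (0 +i* (2 * pi)) * ((x ord0 i)%:C * f x)); last first.
  by apply/funext => x; rewrite mulrA; congr (_ * _); apply: complex_ext;
    rewrite !cReIm /=; ring.
exact/schwartzZ/schwartz_coord.
Qed.

Lemma normc_cI_weight f (c : R) : cmeas f ->
  (forall x, normc (f x) <= c * weight x) -> normc (cI mu f) <= 2 * (c * pi ^+ d).
Proof.
move=> mf fc; apply: normc_cI_le; first exact: L1_weight_dom fc.
have c0 : 0 <= c.
  have := le_trans (normc_ge0 _) (fc 0); rewrite pmulr_lge0//; exact: weight_gt0.
rewrite EFinM -integral_weight -ge0_integralZl//; last 2 first.
- by apply/measurable_EFinP; exact: measurable_weight.
- by move=> x _; rewrite lee_fin ltW// weight_gt0.
apply: ge0_le_integral => //.
- by move=> x _; rewrite lee_fin normc_ge0.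
- exact: cmeas_Enormc.
- apply/measurable_EFinP; apply: measurable_funM => //; exact: measurable_weight.
- by move=> x _; rewrite lee_fin.
Qed.

Lemma rapid_weight2 f : rapid f -> exists c : R, forall x,
  `|x| ^+ 2 * normc (f x) <= c * weight x.
Proof.
move=> /(_ (2 + 2 * d)%N)[c cP]; exists c => x.
have w0 := weight_gt0 x; have n0 := normc_ge0 (f x).
apply: le_trans (_ : (1 + `|x|) ^+ 2 * normc (f x) <= _).
  by rewrite ler_wpM2r// lerXn2r ?nnegrE ?addr_ge0// lerDr.
have p0 : 0 <= (1 + `|x|) ^+ 2 * normc (f x) by rewrite mulr_ge0// exprn_ge0// addr_ge0.
apply: le_trans (ler_peMl p0 (weight_ge_norm x)) _.
rewrite mulrAC; apply: ler_wpM2r; first exact: ltW.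
apply: le_trans (cP x).
by rewrite exprD mulrA [_ ^+ (2 * d) * _]mulrC.
Qed.

(** Taylor's formula for the character, under the integral sign. *)
Lemma fourier_quadratic f xi : schwartz f -> exists c : R, forall h,
  normc (fourier f (h + xi) - fourier f xi +
         \sum_i (h ord0 i)%:C * fourier (fun x => symb i x * f x) xi) <= c * `|h| ^+ 2.
Proof.
move=> sf; have Lf := schwartz_L1 sf.
have [c cP] := rapid_weight2 (schwartz_rapid sf).
pose K : R := 2 * ((2 * pi) ^+ 2 * d%:R ^+ 2).
have K0 : 0 <= K by rewrite mulr_ge0// mulr_ge0// sqr_ge0.
exists (2 * (K * c * pi ^+ d)) => h.
pose s x : R := 2 * pi * dotp x (- h).
pose G x := f x * wave (- xi) x * (expi (s x) - 1 - (0 +i* (s x))).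
have Ls i : L1 mu (fun x => symb i x * f x) by exact/schwartz_L1/schwartz_symb.
have -> : fourier f (h + xi) - fourier f xi +
    \sum_i (h ord0 i)%:C * fourier (fun x => symb i x * f x) xi = cI mu G.
  rewrite !fourierE -cIB; [|exact: L1_wave..].
  rewrite (eq_bigr (fun i => cI mu (fun x =>
      (h ord0 i)%:C * (symb i x * f x * wave (- xi) x)))); last first.
    by move=> i _; rewrite fourierE -cIZ//; exact: L1_wave.
  rewrite -cI_sum; last by move=> i; apply: L1Z; exact: L1_wave.
  rewrite -cID; [|by apply: L1B; exact: L1_wave|
    by apply: L1_sum => i; apply: L1Z; exact: L1_wave].
  apply: eq_cI => x; rewrite /G.
  have -> : (0 +i* (s x)) = - \sum_i (h ord0 i)%:C * symb i x.
    apply: complex_ext; rewrite ?cReIm ?cRe_sum ?cIm_sum /=.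
      by rewrite big1 ?oppr0// => i _; rewrite !mul0r mulr0 subrr.
    rewrite /s dotpNr mulrN mulr_sumr; congr (- _); apply: eq_bigr => i _.
    by rewrite /= mul0r addr0; ring.
  rewrite opprK opprD waveDl [wave (- h) x]/wave -/(s x) mulrDr mulr_sumr.
  congr (_ + _); first by ring.
  by apply: eq_bigr => i _; ring.
have mG : cmeas G.
  apply: cmeasM; first exact: (L1_wave _ Lf).1.
  have ms : measurable_fun setT s.
    apply: measurable_funM => //.
    exact: (measurableT_comp measurable_dotp (pair2_measurable _)).
  apply: cmeasB; last by split => //=; exact: measurable_cst.
  by apply: cmeasB; [exact: cmeas_expi|exact: cmeas_cst].
apply: le_trans (normc_cI_weight mG (c := K * `|h| ^+ 2 * c) _) _.
  move=> x; rewrite !normcM normc_wave mulr1.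
  have e2 : normc (expi (s x) - 1 - (0 +i* s x)) <= K * `|h| ^+ 2 * `|x| ^+ 2.
    apply: le_trans (expi_taylor _) _.
    have s2 : s x ^+ 2 <= (2 * pi) ^+ 2 * (d%:R * (`|x| * `|h|)) ^+ 2.
      rewrite /s exprMn ler_wpM2l ?sqr_ge0//.
      rewrite -[leLHS]real_normK ?num_real// lerXn2r ?nnegrE ?mulr_ge0//.
      by have := dotp_le x (- h); rewrite normrN.
    rewrite (_ : K * _ * _ = 2 * ((2 * pi) ^+ 2 * (d%:R * (`|x| * `|h|)) ^+ 2)).
      by rewrite ler_wpM2l.
    by rewrite /K; ring.
  apply: le_trans (ler_wpM2l (normc_ge0 _) e2) _.
  rewrite mulrCA -[leRHS]mulrA; apply: ler_wpM2l; first by rewrite mulr_ge0 ?sqr_ge0.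
  by rewrite mulrC.
rewrite (_ : 2 * _ = 2 * (K * c * pi ^+ d) * `|h| ^+ 2)//; ring.
Qed.

Let cvg_norm_sub0 (u : nat -> R) (l : R) : u @ \oo --> l ->
  (fun n => `|u n - l|) @ \oo --> (0 : R).
Proof.
move=> /cvgrPdist_le ul; apply/cvgrPdist_le => e e0; have := ul _ e0.
by apply: filterS => n; rewrite sub0r normrN normr_id distrC.
Qed.

Lemma fourier_cdiff f : schwartz f -> cdiff (fourier f) /\
  forall i, cD i (fourier f) = fourier (fun x => - (symb i x * f x)).
Proof.
move=> sf.
have Fs i xi : fourier (fun x => - (symb i x * f x)) xi = - fourier (fun x => symb i x * f x) xi.
  rewrite !fourierE -cIN; last by apply: L1_wave; exact/schwartz_L1/schwartz_symb.
  by apply: eq_cI => x; rewrite mulNr.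
have H xi : let g i := - fourier (fun x => symb i x * f x) xi in
   (differentiable (fun y => cRe (fourier f y)) xi /\
    forall i, 'D_(e_ i) (fun y => cRe (fourier f y)) xi = cRe (g i)) /\
   (differentiable (fun y => cIm (fourier f y)) xi /\
    forall i, 'D_(e_ i) (fun y => cIm (fourier f y)) xi = cIm (g i)).
  move=> g; have [c cP] := fourier_quadratic xi sf.
  have E h : fourier f (h + xi) - fourier f xi - \sum_i (h ord0 i)%:C * g i =
     fourier f (h + xi) - fourier f xi + \sum_i (h ord0 i)%:C * fourier (fun x => symb i x * f x) xi.
    by congr (_ + _); rewrite -sumrN; apply: eq_bigr => i _; rewrite /g mulrN opprK.
  split; apply: (@quadratic_differentiable _ _ _ _ _ c) => h;
    apply: le_trans (cP h); rewrite -E.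
    apply: le_trans (normc_cRe _); rewrite !cReIm cRe_sum.
    by under eq_bigr do rewrite -cRe_real.
  apply: le_trans (normc_cIm _); rewrite !cReIm cIm_sum.
  by under eq_bigr do rewrite -cIm_real.
split; first by move=> xi; have [[? _] [? _]] := H xi.
move=> i; apply/funext => xi; have [[_ h1] [_ h2]] := H xi.
by rewrite Fs /cD h1 h2; apply: complex_ext.
Qed.

Definition dquot n i f x : R[i] :=
  (n.+1%:R^-1)^-1%:C * (f (x + n.+1%:R^-1 *: e_ i) - f x).

Lemma step_norm_le n i : `|n.+1%:R^-1 *: e_ i| <= n.+1%:R^-1 :> R.
Proof.
have t0 : 0 < n.+1%:R^-1 :> R by rewrite invr_gt0.
apply: rV_norm_le => [|j]; first exact: ltW.
rewrite !mxE normrM (gtr0_norm t0) ger_pMr//.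
by case: eqP; case: eqP => _ _ /=; rewrite ?normr1 ?normr0 ?ler01.
Qed.

(** The integrable domination lets difference quotients pass to the limit under
    an integral. *)
Lemma difference_quotient f i : schwartz f -> exists c : R, [/\ 0 <= c,
  forall n x, normc (dquot n i f x) <= c * weight x &
  forall x, ccvg (fun n => dquot n i f x) (cD i f x)].
Proof.
move=> sf; have [c [c0 cP]] := schwartz_lipschitz sf.
pose t n : R := n.+1%:R^-1.
have t0 n : 0 < t n by rewrite invr_gt0.
have t1 n : t n <= 1 by rewrite invf_le1// ler1n.
pose z n : 'rV[R]_d := t n *: e_ i.
have zn n : `|z n| <= t n by exact: step_norm_le.
pose q n x := (t n)^-1%:C * (f (x + z n) - f x).
have qw n x : normc (q n x) <= c * weight x.
  rewrite /q normcM normcR ger0_norm ?invr_ge0 ?(ltW (t0 n))//.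
  rewrite mulrC ler_pdivrMr//; apply: le_trans (cP x (z n) _) _.
    exact: le_trans (zn n) (t1 n).
  by rewrite mulrAC ler_wpM2l// mulr_ge0// ltW// weight_gt0.
have qlim x : ccvg (fun n => q n x) (cD i f x).
  have [d1 d2] := schwartz_diff sf x.
  have H (phi : 'rV[R]_d -> R) : differentiable phi x ->
      (fun n => (t n)^-1 * (phi (x + z n) - phi x)) @ \oo --> ('D_(e_ i) phi x : R).
    move=> dphi; have dv : derivable phi x (e_ i) by exact: diff_derivable.
    have tc : t @ \oo --> (0 : R)^'.
      move=> A hA; have hA' : nbhs (0 : R) [set x | x != 0 -> A x] := hA.
      have h : \forall n \near \oo, (t n != 0 -> A (t n)) := cvg_harmonic hA'.
      suff : \forall n \near \oo, A (t n) by [].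
      by apply: filterS h => n; apply; rewrite gt_eqF.
    have := cvg_comp t _ tc dv; apply: cvg_trans; apply: near_eq_cvg.
    by apply: nearW => n; rewrite /= /z [x + _]addrC.
  have [h1 h2] := (H _ d1, H _ d2).
  have h12 : (fun n => `|(t n)^-1 * (cRe (f (x + z n)) - cRe (f x)) -
      'D_(e_ i) (fun y => cRe (f y)) x| + `|(t n)^-1 * (cIm (f (x + z n)) - cIm (f x)) -
      'D_(e_ i) (fun y => cIm (f y)) x|) @ \oo --> (0 : R).
    by rewrite -[0]addr0; apply: cvgD; apply: cvg_norm_sub0.
  apply: (ccvg_le h12) => n; apply: le_trans (normc_le _) _.
  by rewrite /q !cReIm /= !mul0r subr0 addr0.
by exists c.
Qed.

Lemma fourier_derivative f i xi : schwartz f ->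
  fourier (cD i f) xi = symb i xi * fourier f xi.
Proof.
move=> sf; have Lf := schwartz_L1 sf; have [c [c0 qw qlim]] := difference_quotient i sf.
pose t n : R := n.+1%:R^-1.
pose z n : 'rV[R]_d := t n *: e_ i.
have zn n : `|z n| <= t n by exact: step_norm_le.
have t0 n : 0 < t n by rewrite invr_gt0.
pose q n x := dquot n i f x.
have mfz n : L1 mu (fun x => f (x + z n)).
  by have := L1_rV_affine (z n) (oner_neq0 _) Lf; under eq_fun do (rewrite scale1r).
have Fq n : fourier (q n) xi = (t n)^-1%:C * (wave xi (z n) - 1) * fourier f xi.
  rewrite -mulrA mulrBl mul1r -fourier_shift// !fourierE -cIB; [|exact: L1_wave..].
  rewrite -cIZ; last by apply: L1B; exact: L1_wave.
  by apply: eq_cI => x; rewrite /q -mulrA mulrBl.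
have L : ccvg (fun n => fourier (q n) xi) (fourier (cD i f) xi).
  rewrite fourierE; apply: (eq_ccvg (a := fun n => cI mu (fun x => q n x * wave (- xi) x))).
    by move=> n; rewrite fourierE.
  apply: (@cI_cvg _ _ _ _ _ _ (fun x => c%:C * (weight x)%:C)).
  - move=> n; apply: cmeasM; last exact: cmeas_wave.
    apply: cmeasM; first exact: cmeas_cst.
    by apply: cmeasB; [exact: (mfz n).1|exact: Lf.1].
  - by apply: cmeasM; [exact/schwartz_cmeas/schwartz_cD|exact: cmeas_wave].
  - by apply: L1Z; exact: L1_weight.
  - move=> n x; rewrite normcM normc_wave mulr1 [leRHS]normcM !normcR [`|c|]ger0_norm//.
    by rewrite [`|weight x|]ger0_norm ?(ltW (weight_gt0 _))// qw.
  - move=> x; have := ccvgMl (wave (- xi) x) (qlim x).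
    by under eq_fun do (rewrite mulrC); rewrite [X in ccvg _ X]mulrC.
apply: ccvg_unique L _.
apply: (eq_ccvg (a := fun n => fourier f xi * ((t n)^-1%:C * (wave xi (z n) - 1)))).
  by move=> n; rewrite Fq mulrC.
rewrite [symb _ _ * _]mulrC; apply: ccvgMl.
apply: (@ccvg_le _ _ _ (fun n => 2 * (2 * pi * xi ord0 i) ^+ 2 * t n)).
  rewrite -[0](mulr0 (2 * (2 * pi * xi ord0 i) ^+ 2)).
  by apply: cvgM; [exact: cvg_cst|exact: cvg_harmonic].
move=> n; have sE : 2 * pi * dotp (z n) xi = t n * (2 * pi * xi ord0 i).
  by rewrite dotpZl dotp_delta mulrCA.
have -> : (t n)^-1%:C * (wave xi (z n) - 1) - symb i xi =
    (t n)^-1%:C * (expi (t n * (2 * pi * xi ord0 i)) - 1 - (0 +i* (t n * (2 * pi * xi ord0 i)))).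
  have -> : symb i xi = (t n)^-1%:C * (0 +i* (t n * (2 * pi * xi ord0 i))).
    by apply: complex_ext; rewrite !cReIm /= ?mulr0 ?mul0r ?subr0 ?addr0// mulKf// gt_eqF.
  by rewrite -mulrBr /wave sE.
rewrite normcM normcR ger0_norm ?invr_ge0 ?(ltW (t0 n))//.
rewrite mulrC ler_pdivrMr//; apply: le_trans (expi_taylor _) _.
by rewrite exprMn; set a := (2 * pi * _) ^+ 2; rewrite (_ : 2 * (_ * a) = 2 * a * t n * t n)//; ring.
Qed.

(** The transforms of Schwartz functions form a class stable under derivatives,
    which become multiplications by coordinates; decay comes from transforming
    derivatives. *)
Lemma schwartz_fourier f : schwartz f -> schwartz (fourier f).
Proof.
move=> sf.
apply: (@schwartz_coind _ _ (fun h => exists g, schwartz g /\ h = fourier g)).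
- by move=> _ [g [sg ->]]; exact: (fourier_cdiff sg).1.
- move=> _ [g [sg ->]] m.
  have D (i : 'I_d) k g' : schwartz g' -> exists c : R, forall xi,
      `|xi ord0 i| ^+ k * normc (fourier g' xi) <= c.
    elim: k g' => [|k ih] g' sg'.
      have [c cP] := fourier_bounded (schwartz_L1 sg'); exists c => xi.
      by rewrite expr0 mul1r.
    have [c cP] := ih _ (schwartz_cD i sg'); exists c => xi; apply: le_trans (cP xi).
    rewrite fourier_derivative// exprS normcM mulrCA mulrA ler_wpM2r ?normc_ge0//.
    rewrite ler_wpM2r ?exprn_ge0//.
    rewrite normcE' /= expr0n/= add0r sqrtr_sqr normrM ler_peMl//.
    by rewrite ger0_norm; have := @pi_ge2 R; lra.
  have /choice[c cP] : forall i : 'I_d, exists c : R, forall xi,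
      `|xi ord0 i| ^+ m * normc (fourier g xi) <= c by move=> i; exact: D.
  have [c0 c0P] := fourier_bounded (schwartz_L1 sg).
  exists (2 ^+ m * (c0 + \sum_i c i)) => xi.
  have ci0 i : 0 <= c i.
    by apply: le_trans (cP i 0); rewrite mulr_ge0 ?normc_ge0// exprn_ge0.
  have c00 : 0 <= c0 by exact: le_trans (normc_ge0 _) (c0P 0).
  have [x1|x1] := leP `|xi| 1.
    apply: ler_pM; rewrite ?exprn_ge0 ?addr_ge0 ?normc_ge0//.
      by rewrite lerXn2r ?nnegrE ?addr_ge0//; lra.
    by apply: le_trans (c0P xi) _; rewrite lerDl sumr_ge0.
  have [i Ei] : exists i, `|xi| = `|xi ord0 i|.
    have : mx_norm xi != 0 by rewrite gt_eqF//; exact: lt_trans x1.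
    by move=> /mx_norm_neq0[[a i] /= E]; rewrite [a]ord1 in E; exists i.
  apply: le_trans (_ : (2 * `|xi|) ^+ m * normc (fourier g xi) <= _).
    rewrite ler_wpM2r ?normc_ge0// lerXn2r ?nnegrE ?addr_ge0 ?mulr_ge0//.
    by rewrite mulr_natl mulr2n lerD2r ltW.
  rewrite exprMn -mulrA ler_wpM2l ?exprn_ge0// Ei; apply: le_trans (cP i xi) _.
  by rewrite (bigD1 i)//= addrCA lerDl addr_ge0// sumr_ge0.
- move=> _ i [g [sg ->]]; exists (fun x => - (symb i x * g x)).
  by rewrite (fourier_cdiff sg).2; split=> //; apply: schwartzN; exact: schwartz_symb.
- by exists f.
Qed.

Lemma schwartz_opp f : schwartz f -> schwartz (fun x => f (- x)).
Proof.
have N1 : (-1 : R) != 0 by rewrite oppr_eq0 oner_eq0.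
move=> sf; have := schwartz_affine 0 N1 sf.
by under eq_fun do (rewrite addr0 scaleN1r).
Qed.

Lemma inv_fourier_fun f : inv_fourier f = fun x => fourier f (- x).
Proof. by apply/funext => x; rewrite inv_fourier_opp. Qed.

Lemma schwartz_inv_fourier f : schwartz f -> schwartz (inv_fourier f).
Proof. by move=> sf; rewrite inv_fourier_fun; exact/schwartz_opp/schwartz_fourier. Qed.

End fourier_schwartz.

(** * Fourier inversion *)

Section abel_kernel.
Context {R : realType}.
Notation lam := (@lebesgue_measure R).

Let is_derive_scale (b t : R) : is_derive (t : R^o) 1 ((fun s => b * s) : R^o -> R^o) b.
Proof. by apply: is_derive_eq; rewrite /GRing.scale/= mulr1. Qed.

Let abel_primitive (b : R) (t : R) : R := expR (- t) *
  (- 1 + (1 + b ^+ 2)^-1 * (b * sin (b * t) - cos (b * t))).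

Let is_derive_abel_primitive (b t : R) :
  is_derive (t : R^o) 1 (abel_primitive b : R^o -> R^o) (expR (- t) * (1 + cos (b * t))).
Proof.
have h1 : is_derive (t : R^o) 1 ((fun s => expR (- s)) : R^o -> R^o) (expR (- t) * -1).
  exact: (is_derive1_comp (is_derive_expR _) (is_deriveN (is_derive_id _ _))).
have h2 : is_derive (t : R^o) 1 ((fun s => sin (b * s)) : R^o -> R^o) (cos (b * t) * b).
  exact: (is_derive1_comp (is_derive_sin _) (is_derive_scale b t)).
have h3 : is_derive (t : R^o) 1 ((fun s => cos (b * s)) : R^o -> R^o) (- sin (b * t) * b).
  exact: (is_derive1_comp (is_derive_cos _) (is_derive_scale b t)).
have q0 : 1 + b ^+ 2 != 0 by rewrite gt_eqF// ltr_pwDl// sqr_ge0.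
have h4 := is_deriveM h1 (is_deriveD (is_derive_cst (-1 : R) (t : R^o) 1)
  (is_deriveZ (1 + b ^+ 2)^-1 (is_deriveB (is_deriveZ b h2) h3))).
apply: is_derive_eq h4 _.
transitivity (expR (- t) * (0 + (1 + b ^+ 2)^-1 * (b * (cos (b * t) * b) - - sin (b * t) * b)) +
  (- 1 + (1 + b ^+ 2)^-1 * (b * sin (b * t) - cos (b * t))) * (expR (- t) * -1)); first by [].
by field.
Qed.

Let continuous_damped (b : R) : continuous (fun t => expR (- t) * (1 + cos (b * t))).
Proof.
move=> t.
have h1 : is_derive (t : R^o) 1 ((fun s => expR (- s)) : R^o -> R^o) (expR (- t) * -1).
  exact: (is_derive1_comp (is_derive_expR _) (is_deriveN (is_derive_id _ _))).
have h3 : is_derive (t : R^o) 1 ((fun s => cos (b * s)) : R^o -> R^o) (- sin (b * t) * b).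
  exact: (is_derive1_comp (is_derive_cos _) (is_derive_scale b t)).
have h := is_deriveM h1 (is_deriveD (is_derive_cst (1 : R) (t : R^o) 1) h3).
by apply: differentiable_continuous; apply/derivable1_diffP; exact: (@ex_derive _ _ _ _ _ _ _ h).
Qed.

Let abel_half (b : R) :
  (\int[lam]_(t in `[0%R, +oo[) (expR (- t) * (1 + cos (b * t)))%:E =
   (1 + (1 + b ^+ 2)^-1)%:E)%E.
Proof.
have q0 : 1 + b ^+ 2 != 0 by rewrite gt_eqF// ltr_pwDl// sqr_ge0.
have cF : continuous (abel_primitive b).
  by move=> t; apply: differentiable_continuous; apply/derivable1_diffP; exact: ex_derive.
rewrite (@ge0_continuous_FTC2y _ (fun t => expR (- t) * (1 + cos (b * t))) (abel_primitive b) 0 0).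
- rewrite /abel_primitive oppr0 expR0 mulr0 sin0 cos0 -EFinB; congr EFin.
  by field.
- by move=> x _; rewrite mulr_ge0 ?expR_ge0//; have := cos_geN1 (b * x); lra.
- by apply: continuous_subspaceT; exact: continuous_damped.
- have h : (fun t : R => (1 + (`|b| + 1) * `|(1 + b ^+ 2)^-1|) * expR (- t)) t @[t --> +oo%R] --> (0 : R).
    rewrite -(mulr0 (1 + (`|b| + 1) * `|(1 + b ^+ 2)^-1|)).
    by apply: cvgM; [exact: cvg_cst|exact: cvgr_expR].
  apply/cvgr0Pnorm_le => e e0; have /cvgr0Pnorm_le/(_ _ e0) := h.
  apply: filterS => t; apply: le_trans.
  rewrite /abel_primitive normrM mulrC [leRHS]normrM.
  rewrite ler_wpM2r//; apply: le_trans (ler_normD _ _) _.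
  rewrite normrN1 [leRHS]ger0_norm ?addr_ge0 ?mulr_ge0 ?addr_ge0// lerD2l normrM.
  rewrite mulrC ler_wpM2r//; apply: le_trans (ler_normB _ _) _; apply: lerD.
    rewrite normrM ler_piMr// ler_norml; apply/andP; split; [exact: sin_geN1|exact: sin_le1].
  by rewrite ler_norml cos_geN1 cos_le1.
- by move=> x _; exact: ex_derive.
- exact: cvg_at_right_filter (cF 0).
- by move=> x _; rewrite derive1E; exact: (@derive_val _ _ _ _ _ _ _ (is_derive_abel_primitive b x)).
Qed.

Let abel_line (b : R) :
  (\int[lam]_t (expR (- `|t|) * (1 + cos (b * t)))%:E =
   (2 * (1 + (1 + b ^+ 2)^-1))%:E)%E.
Proof.
rewrite (@ge0_symfun_integralT _ (fun t => expR (- `|t|) * (1 + cos (b * t)))).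
- rewrite EFinM -abel_half -set_itvcy; congr (_ * _)%E; apply: eq_integral => t.
  by rewrite inE/= in_itv/= andbT => t0; rewrite ger0_norm.
- by move=> x; rewrite mulr_ge0 ?expR_ge0//; have := cos_geN1 (b * x); lra.
- rewrite (_ : (fun _ => _) = (fun s => expR (- s) * (1 + cos (b * s))) \o (fun t => `|t|)).
    by move=> t; apply: continuous_comp; [exact: norm_continuous|exact: continuous_damped].
  apply/funext => t /=; congr (_ * (1 + _)).
  by have [t0|t0] := leP 0 t; rewrite ?(ger0_norm t0)// ltr0_norm// mulrN cosN.
- by move=> t /=; rewrite normrN mulrN cosN.
Qed.

Let measurable_expN : measurable_fun setT (fun t : measurableTypeR R => expR (- `|t|)).
Proof.
have c : continuous (fun s : R => expR (- s)).
  move=> s; have h := is_derive1_comp (is_derive_expR _) (is_deriveN (is_derive_id (s : R^o) 1)).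
  by apply: differentiable_continuous; apply/derivable1_diffP; exact: (@ex_derive _ _ _ _ _ _ _ h).
apply: (@continuous_measurable_fun R) => t.
by apply: (continuous_comp (f := fun t : R => `|t|) (g := fun s => expR (- s)));
  [exact: norm_continuous|exact: c].
Qed.

Let integral_expN : (\int[lam]_t (expR (- `|t|))%:E = 2%:E)%E.
Proof.
have := abel_line 0.
rewrite (eq_integral (fun t : measurableTypeR R => (expR (- `|t : R|))%:E * 2%:E)%E); last first.
  by move=> t _; rewrite mul0r cos0 -EFinM.
rewrite ge0_integralZr//; last by apply/measurable_EFinP; exact: measurable_expN.
rewrite expr0n/= addr0 invr1 => h.
have : (\int[lam]_t (expR (- `|t|))%:E * 2%:E * 2^-1%:E = 2%:E)%E.
  by rewrite h -EFinM mulrAC divff ?mul1r//; congr EFin; ring.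
by rewrite -muleA -EFinM divff// mule1.
Qed.

Lemma L1_abel : L1 lam (fun t => (expR (- `|t|))%:C).
Proof.
split; first by apply: cmeasR; exact: measurable_expN.
rewrite /norm1; under eq_integral do rewrite normcR ger0_norm ?expR_ge0//.
by rewrite integral_expN ltry.
Qed.

Lemma L1_abel_expi (x : R) :
  L1 lam (fun t => (expR (- `|t|))%:C * expi (x * t)).
Proof.
under eq_fun do (rewrite mulrC).
apply: (L1Mb (c := 1) L1_abel).
  split; apply: continuous_measurable_fun => t.
    apply: (continuous_comp (f := fun t : R => x * t)); last exact: continuous_cos.
    exact: mulrl_continuous.
  apply: (continuous_comp (f := fun t : R => x * t)); last exact: continuous_sin.
  exact: mulrl_continuous.
by move=> t; rewrite normc_expi.
Qed.

(** The transform of exp(-|t|): the cosine part comes from the nonnegative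
    function exp(-|t|) (1 + cos), the sine part vanishes by reflection. *)
Lemma cI_abel (x : R) :
  cI lam (fun t => (expR (- `|t|))%:C * expi (x * t)) = (2 / (1 + x ^+ 2))%:C.
Proof.
have L := L1_abel_expi x; have [i1 i2] := L1_integrable L.
have [j1 _] := L1_integrable L1_abel.
apply: complex_ext => /=.
  under eq_Rintegral do rewrite mul0r subr0.
  have := abel_line x; under eq_integral do rewrite mulrDr mulr1 EFinD.
  have k1 : lam.-integrable setT (fun t => (expR (- `|t|) * cos (x * t))%:E).
    by apply: eq_integrable i1 => // t _; rewrite cRe_real.
  rewrite integralD//= integral_expN -(@fineK _ (integral _ _ _)) ?integrable_fin_num//.
  rewrite -EFinD => -[h]; rewrite /Rintegral.
  by apply: (addrI 2); rewrite h; ring.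
have k2 : lam.-integrable setT (fun t => (expR (- `|t|) * sin (x * t))%:E).
  by apply: eq_integrable i2 => // t _; rewrite cIm_real.
under eq_Rintegral do rewrite mul0r addr0.
set I := Rintegral _ _ _.
have mN : measurable_fun setT (fun t : measurableTypeR R => expR (- `|t|) * sin (x * t)).
  by have /measurable_int/measurable_EFinP := k2.
suff : I = - I by move=> h; lra.
rewrite /I /Rintegral -fineN -integralN ?integrable_add_def//; congr fine.
transitivity (\int[lam]_t (expR (- `|-1 * t + 0|) * sin (x * (-1 * t + 0)))%:E)%E; last first.
  by apply: eq_integral => t _; rewrite addr0 mulN1r normrN mulrN sinN mulrN EFinN.
have N1 : (-1 : R) != 0 by rewrite oppr_eq0 oner_eq0.
pose h (t : measurableTypeR R) := (expR (- `|t : R|) * sin (x * t))%:E.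
have mh : measurable_fun setT h by exact/measurable_EFinP.
rewrite integralE [RHS]integralE; congr (_ - _)%E.
  have := ge0_integral_affine_line 0 N1 (measurable_funepos mh) (fun _ => funepos_ge0 h _).
  rewrite normrN1 invr1 mul1e => <-.
  by apply: eq_integral => t _; rewrite !funeposE.
have := ge0_integral_affine_line 0 N1 (measurable_funeneg mh) (fun _ => funeneg_ge0 h _).
rewrite normrN1 invr1 mul1e => <-.
by apply: eq_integral => t _; rewrite !funenegE.
Qed.

End abel_kernel.

Section product_integrals.
Context {R : realType}.
Notation lam := (@lebesgue_measure R).

Lemma cI_rVS n (F : 'rV[R]_n.+1 -> R[i]) :
  (forall a, L1 (lebesgue_rV n) (fun y => F (row_cons (a, y)))) ->
  L1 (lebesgue_rV n.+1) F ->
  cI (lebesgue_rV n.+1) F =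
  cI lam (fun a => cI (lebesgue_rV n) (fun y => F (row_cons (a, y)))).
Proof.
move=> F1 LF; have [i1 i2] := L1_integrable LF.
have H (p : R[i] -> R) (mp : measurable_fun setT (fun x => p (F x)))
    (ip : (lebesgue_rV n.+1).-integrable setT (fun x => (p (F x))%:E))
    (ip1 : forall a, (lebesgue_rV n).-integrable setT (fun y => (p (F (row_cons (a, y))))%:E)) :
    \int[lebesgue_rV n.+1]_x p (F x) =
    \int[lam]_a (\int[lebesgue_rV n]_y p (F (row_cons (a, y)))).
  have mpe : measurable_fun setT (fun x => (p (F x))%:E : \bar R) by exact/measurable_EFinP.
  have ipc : (lam \x lebesgue_rV n)%E.-integrable setT
      ((fun x => (p (F x))%:E) \o row_cons (R := R) (n := n)).
    apply/integrableP; split; first exact: (measurableT_comp mpe measurable_row_cons).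
    have /integrableP[_] := ip.
    rewrite (@ge0_integral_pushforward _ _ _ _ _ _ measurable_row_cons
      (lam \x lebesgue_rV n)%E setT (fun x => `|(p (F x))%:E|)%E)//.
    by apply: measurableT_comp.
  rewrite /Rintegral (@integral_pushforward _ _ _ _ _ _ measurable_row_cons
    (lam \x lebesgue_rV n)%E setT (fun x => (p (F x))%:E))//.
  rewrite preimage_setT -integral12_prod_meas1//; congr fine.
  by apply: eq_integral => a _; rewrite /fubini_F/= fineK// integrable_fin_num.
apply: complex_ext; apply: H => //.
- exact: LF.1.1.
- by move=> a; exact: (L1_integrable (F1 a)).1.
- exact: LF.1.2.
- by move=> a; exact: (L1_integrable (F1 a)).2.
Qed.

Lemma cI_rV_prod n (g : 'I_n -> measurableTypeR R -> R[i]) :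
  (forall i, L1 lam (g i)) ->
  L1 (lebesgue_rV n) (fun x => \prod_i g i (x ord0 i)) /\
  cI (lebesgue_rV n) (fun x => \prod_i g i (x ord0 i)) = \prod_i cI lam (g i).
Proof.
have L1p k (g' : 'I_k -> measurableTypeR R -> R[i]) : (forall i, L1 lam (g' i)) ->
    L1 (lebesgue_rV k) (fun x => \prod_i g' i (x ord0 i)).
  move=> Lg; split.
    elim: (index_enum _) => [|i s ih].
      by under eq_fun do (rewrite big_nil); exact: cmeas_cst.
    under eq_fun do (rewrite big_cons); apply: cmeasM => //.
    exact: (cmeas_comp (measurable_rV_coord i) (Lg i).1).
  rewrite /norm1.
  have nE (x : 'rV[R]_k) : normc (\prod_i g' i (x ord0 i)) = \prod_i normc (g' i (x ord0 i)).
    by elim/big_rec2 : _ => [|i a b _ <-]; rewrite ?normc_one// normcM.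
  under eq_integral do rewrite nE.
  rewrite (@ge0_integral_rV_prod R k (fun i t => normc (g' i t))).
  - rewrite (eq_bigr (fun i => (fine (norm1 lam (g' i)))%:E)) ?prodEFin ?ltry// => i _.
    by rewrite fineK// ge0_fin_numE ?norm1_ge0//; exact: (Lg i).2.
  - by move=> i; exact/cmeas_normc/(Lg i).1.
  - by move=> i t; exact: normc_ge0.
elim: n g => [|n ih] g Lg; split; try exact: L1p.
  rewrite big_ord0 (eq_cI _ (g := fun=> 1)) => [|x]; last by rewrite big_ord0.
  by apply: complex_ext; rewrite /= /Rintegral ge0_integral_rV0//; exact: measurable_cst.
have Lr := L1p _ _ (fun i => Lg (lift ord0 i)).
rewrite big_ord_recl -(ih _ (fun i => Lg (lift ord0 i))).2 cI_rVS; last exact: L1p.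
  rewrite mulrC -cIZ//; apply: eq_cI => a; rewrite mulrC -cIZ//.
  apply: eq_cI => y; rewrite big_ord_recl row_cons0; congr (_ * _).
  by apply: eq_bigr => i _; rewrite row_consS.
move=> a; have := L1Z (g ord0 a) Lr; congr L1; apply/funext => y.
rewrite big_ord_recl row_cons0; congr (_ * _).
by apply: eq_bigr => i _; rewrite row_consS.
Qed.

End product_integrals.

Section inversion.
Context {R : realType} {d : nat}.
Implicit Types (x y z xi : 'rV[R]_d) (f g : 'rV[R]_d -> R[i]).
Notation mu := (lebesgue_rV (R := R) d).

(** The Abel kernel; unlike a Gaussian it has elementary primitives. *)
Let Phi x : R := expR (- \sum_i `|x ord0 i|).

Let PhiE x xi : (Phi xi)%:C * wave x xi =
  \prod_i ((expR (- `|xi ord0 i|))%:C * expi (2 * pi * x ord0 i * xi ord0 i)).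
Proof.
rewrite big_split/= -rmorph_prod/= -expR_sum sumrN; congr (_ * _).
rewrite /wave /dotp mulr_sumr.
elim/big_rec2 : _ => [|i a b _ <-]; first exact: expi0.
by rewrite -expiD; congr (expi (_ + _)); ring.
Qed.

Let Phi_wave x : L1 mu (fun xi => (Phi xi)%:C * wave x xi) /\
  cI mu (fun xi => (Phi xi)%:C * wave x xi) = (2 ^+ d * weight ((2 * pi) *: x))%:C.
Proof.
have [L E] := cI_rV_prod (fun i => L1_abel_expi (2 * pi * x ord0 i)).
rewrite (_ : (fun _ => _) = (fun xi : 'rV[R]_d =>
  \prod_i ((expR (- `|xi ord0 i|))%:C * expi (2 * pi * x ord0 i * xi ord0 i)))); last first.
  by apply/funext => xi; rewrite PhiE.
split; first exact: L.
rewrite E; under eq_bigr do rewrite cI_abel.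
rewrite -rmorph_prod/=; congr (_%:C).
rewrite big_split/= prodr_const card_ord; congr (_ * _).
by apply: eq_bigr => i _; rewrite mxE.
Qed.

Let Phi0 xi : 0 < Phi xi. Proof. exact: expR_gt0. Qed.
Let Phi1 xi : Phi xi <= 1.
Proof. by rewrite -expR0 ler_expR oppr_le0 sumr_ge0. Qed.

Let Phi_cvg xi : ccvg (fun n => (Phi (n.+1%:R^-1 *: xi))%:C) 1.
Proof.
apply: (@ccvg_le _ _ _ (fun n => n.+1%:R^-1 * \sum_i `|xi ord0 i|)).
  set c := \sum_i _; under eq_fun do (rewrite mulrC); rewrite -(mulr0 c).
  by apply: cvgM; [exact: cvg_cst|exact: cvg_harmonic].
have nE (a : R) : normc (a%:C - 1) = `|a - 1|.
  by rewrite (_ : _ - 1 = (a - 1)%:C) ?normcR//; apply: complex_ext => /=; rewrite ?subr0.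
move=> n; rewrite nE ler0_norm ?subr_le0 ?Phi1// opprB.
have -> : n.+1%:R^-1 * \sum_i `|xi ord0 i| = \sum_i `|(n.+1%:R^-1 *: xi) ord0 i|.
  rewrite mulr_sumr; apply: eq_bigr => i _; rewrite mxE normrM ger0_norm//.
rewrite lerBlDr -lerBlDl addrC; apply: le_trans (expR_ge1Dx _).
by rewrite addrC.
Qed.

Let mPhi : measurable_fun setT (fun xi => Phi xi).
Proof.
have := (Phi_wave 0).1.1.1; apply: eq_measurable_fun => xi _.
by rewrite wave0l mulr1.
Qed.

Let weight_le1 x : weight x <= 1.
Proof.
apply: le_trans (_ : \prod_(i < d) 1 <= _); last by rewrite big1.
apply: ler_prod => i _; rewrite invr_ge0 addr_ge0 ?sqr_ge0//=.
by rewrite invf_le1 ?ltr_pwDl ?sqr_ge0// lerDl sqr_ge0.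
Qed.

Lemma schwartz_lipschitz_sup f : schwartz f -> exists c : R, 0 <= c /\
  forall x z, normc (f (x + z) - f x) <= c * `|z|.
Proof.
move=> sf; have [c [c0 cP]] := schwartz_lipschitz sf.
have [b bP] := schwartz_bounded sf.
have b0 : 0 <= b by exact: le_trans (normc_ge0 _) (bP 0).
exists (c + 2 * b); split; first by rewrite addr_ge0// mulr_ge0.
move=> x z; have [z1|/ltW z1] := leP `|z| 1.
  apply: le_trans (cP x z z1) _; rewrite mulrDl.
  apply: le_trans (_ : c * `|z| * 1 <= _).
    by apply: ler_wpM2l; rewrite ?weight_le1 ?mulr_ge0.
  by rewrite mulr1 lerDl !mulr_ge0.
apply: le_trans (le_normcD _ _) _; rewrite normcN.
apply: le_trans (lerD (bP _) (bP _)) _.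
rewrite mulrDl; apply: le_trans (_ : 2 * b * `|z| <= _); last by rewrite lerDr mulr_ge0.
rewrite (_ : b + b = 2 * b); last by ring.
by apply: ler_peMr; rewrite ?mulr_ge0.
Qed.

Let pi20 : 2 * pi != 0 :> R.
Proof. by rewrite mulf_neq0// gt_eqF// pi_gt0. Qed.

Let A x : R[i] := (2 ^+ d * weight ((2 * pi) *: x))%:C.

Let weightN x : weight (- x) = weight x.
Proof. by apply: eq_bigr => i _; rewrite mxE sqrrN. Qed.

Let L1A : L1 mu A /\ cI mu A = 1.
Proof.
have L := L1_rV_affine 0 pi20 (L1_weight (R := R) d).
have E := cI_affine 0 pi20 (L1_weight (R := R) d).
have AE : A = fun x => (2 ^+ d)%:C * (weight ((2 * pi) *: x + 0))%:C.
  by apply/funext => x; rewrite /A addr0 rmorphM.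
rewrite AE; split; first exact: L1Z.
rewrite cIZ// E.
have -> : cI mu (fun x => (weight x)%:C) = (pi ^+ d)%:C.
  apply: complex_ext; rewrite /= /Rintegral ?integral_weight//.
  by rewrite integral0.
have p0 := @pi_gt0 R; rewrite -!rmorphM/= ger0_norm ?mulr_ge0 ?pi_ge0//.
congr (_%:C); rewrite exprMn invfM -mulrA [_ * pi ^+ d]mulVf ?expf_neq0 ?gt_eqF//.
by rewrite mulr1 mulfV ?expf_neq0.
Qed.

(** The regularised inversion integral averages [f] around [x] against an
    approximate identity. *)
Let smoothing f x (e : R) : schwartz f -> 0 < e ->
  cI mu (fun xi => (Phi (e *: xi))%:C * (fourier f xi * wave x xi)) =
  cI mu (fun z => f (e *: z + x) * A z).
Proof.
move=> sf e0; have e1 : e != 0 by rewrite gt_eqF.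
have Lf := schwartz_L1 sf; have LF := schwartz_L1 (schwartz_fourier sf).
have LPhi : L1 mu (fun xi => (Phi xi)%:C).
  by have := (Phi_wave 0).1; under eq_fun do (rewrite wave0l mulr1).
have LPe : L1 mu (fun xi => (Phi (e *: xi))%:C).
  by have := L1_rV_affine 0 e1 LPhi; under eq_fun do (rewrite addr0).
pose F (p : 'rV[R]_d * 'rV[R]_d) :=
  (Phi (e *: p.1))%:C * wave x p.1 * (f p.2 * wave p.1 (- p.2)).
have mF : cmeas F.
  apply: cmeasM; apply: cmeasM.
  - exact: (cmeas_comp measurable_fst LPe.1).
  - exact: (cmeas_comp measurable_fst (cmeas_wave x)).
  - exact: (cmeas_comp measurable_snd Lf.1).
  - apply: (cmeas_comp (h := fun p : 'rV[R]_d * 'rV[R]_d => (p.1, - p.2)) _ cmeas_wave2).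
    apply: measurable_fun_pair => //; apply: (measurableT_comp _ measurable_snd).
    have := @measurable_rV_affine R d (-1) 0.
    by under eq_fun do (rewrite addr0 scaleN1r).
have F1 xi : L1 mu (fun y => F (xi, y)).
  rewrite /F/=; apply: L1Z; have := L1_wave (- xi) Lf.
  by under eq_fun do (rewrite waveNl).
have F2 y : L1 mu (fun xi => F (xi, y)).
  have := L1Z (f y) (L1_wave (- y) (L1_wave x LPe)); congr L1; apply/funext => xi.
  by rewrite /F/= [wave xi _]waveC; ring.
have F12 : (\int[mu]_xi norm1 mu (fun y => F (xi, y)) < +oo)%E.
  have nE xi : norm1 mu (fun y => F (xi, y)) = ((Phi (e *: xi))%:E * norm1 mu f)%E.
    have := norm1Z mu ((Phi (e *: xi))%:C * wave x xi) (L1_wave (- xi) Lf).1.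
    rewrite norm1_wave normcM normc_wave normcR mulr1 ger0_norm ?(ltW (Phi0 _))// => <-.
    by apply: eq_integral => y _; rewrite /F/= waveNl.
  under eq_integral do rewrite nE.
  have foo := Lf.2; have f0 := norm1_ge0 mu f.
  rewrite ge0_integralZr//; last 2 first.
  - by apply/measurable_EFinP; have := LPe.1.1.
  - by move=> xi _; rewrite lee_fin ltW.
  rewrite -(fineK (x := norm1 mu f)) ?ge0_fin_numE// lte_mul_pinfty//.
  - by apply: integral_ge0 => xi _; rewrite lee_fin ltW.
  - rewrite ge0_fin_numE; last by apply: integral_ge0 => xi _; rewrite lee_fin ltW.
    have := LPe.2; rewrite /norm1; under eq_integral do rewrite normcR ger0_norm ?(ltW (Phi0 _))//.
    by [].
  - exact: ltry.
have -> : cI mu (fun xi => (Phi (e *: xi))%:C * (fourier f xi * wave x xi)) =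
    cI mu (fun xi => cI mu (fun y => F (xi, y))).
  apply: eq_cI => xi; rewrite fourierE /F/= cIZ; last first.
    by have := L1_wave (- xi) Lf; under eq_fun do (rewrite waveNl).
  rewrite -mulrA; congr (_ * _); rewrite mulrC; congr (_ * _).
  by apply: eq_cI => y; rewrite waveNl waveC waveNl waveC.
rewrite (cI_fubini mF F1 F2 F12).
have inner y : cI mu (fun xi => F (xi, y)) =
    (`|e| ^- d)%:C * (f y * A (e^-1 *: (x - y))).
  have := cI_affine 0 e1 (Phi_wave (e^-1 *: (x - y))).1.
  rewrite (Phi_wave _).2 -/(A _) => h.
  rewrite mulrCA -h -cIZ; last by have := L1_rV_affine 0 e1 (Phi_wave (e^-1 *: (x - y))).1.
  apply: eq_cI => xi; rewrite /F/= addr0 waveZl scalerA mulVf// scale1r.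
  by rewrite waveDl [wave xi (- y)]waveC; ring.
rewrite (eq_cI mu inner).
have [b bP] := schwartz_bounded sf.
have mAx : cmeas (fun y => f y * A (e^-1 *: (x - y))).
  apply: cmeasM; first exact: Lf.1.
  have := cmeas_affine (- e^-1) (e^-1 *: x) L1A.1.1; congr cmeas; apply/funext => y.
  by rewrite scalerBr scaleNr addrC.
have A1 : exists c : R, forall x, normc (A x) <= c.
  exists (2 ^+ d) => y; rewrite normcR ger0_norm; last first.
    by rewrite mulr_ge0 ?exprn_ge0// ltW// weight_gt0.
  by apply: ler_piMr; rewrite ?exprn_ge0 ?weight_le1.
have LG : L1 mu (fun y => f y * A (e^-1 *: (x - y))).
  have [c cP] := A1; apply: (L1_leZ mAx Lf (c := c)) => y.
  by rewrite normcM mulrC ler_wpM2r ?normc_ge0.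
rewrite cIZ// -(cI_affine x e1 LG); apply: eq_cI => z; congr (_ * _).
by rewrite opprD addrCA subrr addr0 scalerN scalerA mulVf// scale1r /A scalerN weightN.
Qed.

Lemma inv_fourierK f : schwartz f -> inv_fourier (fourier f) = f.
Proof.
move=> sf; apply/funext => x; have LF := schwartz_L1 (schwartz_fourier sf).
pose e n : R := n.+1%:R^-1.
have c1 : ccvg (fun n => cI mu (fun xi => (Phi (e n *: xi))%:C * (fourier f xi * wave x xi)))
    (inv_fourier (fourier f) x).
  rewrite inv_fourierE; apply: (@cI_cvg _ _ _ _ _ _ (fourier f)) => //.
  - move=> n; apply: cmeasM; last exact: (L1_wave x LF).1.
    apply: cmeasR; have := measurableT_comp mPhi (@measurable_rV_affine R d (e n) 0).
    by apply: eq_measurable_fun => xi _ /=; rewrite addr0.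
  - exact: (L1_wave x LF).1.
  - move=> n xi; rewrite normcM normcM normc_wave mulr1 normcR ger0_norm ?(ltW (Phi0 _))//.
    by rewrite ler_piMl ?normc_ge0.
  - move=> xi; have := ccvgMl (fourier f xi * wave x xi) (Phi_cvg xi).
    by rewrite mulr1; apply: eq_ccvg => n; rewrite mulrC.
have c2 : ccvg (fun n => cI mu (fun xi => (Phi (e n *: xi))%:C * (fourier f xi * wave x xi))) (f x).
  rewrite -[f x]mulr1 -L1A.2 -cIZ; last exact: L1A.1.
  apply: (eq_ccvg (a := fun n => cI mu (fun z => f (e n *: z + x) * A z))).
    by move=> n; rewrite smoothing// /e invr_gt0.
  have [b bP] := schwartz_bounded sf; have [c [c0 cP]] := schwartz_lipschitz_sup sf.
  apply: (@cI_cvg _ _ _ _ _ _ (fun z => b%:C * A z)).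
  - move=> n; apply: cmeasM; last exact: L1A.1.1.
    exact: (cmeas_affine _ _ (schwartz_cmeas sf)).
  - by apply: cmeasM; [exact: cmeas_cst|exact: L1A.1.1].
  - by apply: L1Z; exact: L1A.1.
  - move=> n z; rewrite !normcM ler_wpM2r ?normc_ge0// normcR.
    exact: le_trans (bP _) (ler_norm _).
  - move=> z; apply: (@ccvg_le _ _ _ (fun n => c * `|z| * normc (A z) * e n)).
      rewrite -(mulr0 (c * `|z| * normc (A z))).
      by apply: cvgM; [exact: cvg_cst|exact: cvg_harmonic].
    move=> n; rewrite -mulrBl normcM mulrAC ler_wpM2r ?normc_ge0// [e n *: z + x]addrC.
    apply: le_trans (cP _ _) _; rewrite normrZ ger0_norm ?invr_ge0//.
    by rewrite mulrCA mulrC.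
exact: ccvg_unique c1 c2.
Qed.

Lemma fourierK f : schwartz f -> fourier (inv_fourier f) = f.
Proof.
move=> sf; have E : inv_fourier f = fourier (fun x => f (- x)).
  apply/funext => x; rewrite inv_fourierE fourierE.
  have N1 : (-1 : R) != 0 by rewrite oppr_eq0 oner_eq0.
  have := cI_affine (r := -1) 0 N1 (L1_wave x (schwartz_L1 sf)).
  rewrite normrN1 expr1n invr1 mul1r => <-; apply: eq_cI => y.
  by rewrite addr0 scaleN1r waveNl.
apply/funext => x; rewrite E -[x in LHS]opprK -inv_fourier_opp inv_fourierK ?opprK//.
exact: schwartz_opp.
Qed.

End inversion.

(** * Convolutions and Fourier multipliers *)

Section convolution.
Context {R : realType} {d : nat}.
Implicit Types (x y z : 'rV[R]_d) (f g h K G : 'rV[R]_d -> R[i]) (A c : R).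
Notation mu := (lebesgue_rV (R := R) d).

(** The explicit bounds record uniformity in the dyadic scale. *)
Definition L1n c f : Prop := cmeas f /\ (norm1 mu f <= c%:E)%E.
Definition bdd A h : Prop := cmeas h /\ forall x, normc (h x) <= A.

Lemma bdd_ge0 A h : bdd A h -> 0 <= A.
Proof. by move=> [_ hA]; exact: le_trans (normc_ge0 _) (hA 0). Qed.

Lemma L1n_ge0 c f : L1n c f -> 0 <= c.
Proof. by move=> [_ fc]; rewrite -lee_fin; exact: le_trans (norm1_ge0 _ _) fc. Qed.

Lemma L1n_L1 c f : L1n c f -> L1 mu f.
Proof. by move=> [mf fc]; split => //; exact: le_lt_trans fc (ltry _). Qed.

Lemma L1_L1n f : L1 mu f -> exists c, L1n c f.
Proof.
move=> [mf foo]; exists (fine (norm1 mu f)); split => //.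
by rewrite fineK// ge0_fin_numE ?norm1_ge0.
Qed.

Lemma L1n_le c c' f : c <= c' -> L1n c f -> L1n c' f.
Proof. by move=> cc [mf fc]; split => //; apply: le_trans fc _; rewrite lee_fin. Qed.

Lemma bdd_le A A' h : A <= A' -> bdd A h -> bdd A' h.
Proof. by move=> AA [mh hA]; split => // x; exact: le_trans (hA x) AA. Qed.

Lemma L1nM A c h f : bdd A h -> L1n c f -> L1n (A * c) (fun x => h x * f x).
Proof.
move=> bh [mf fc]; have A0 := bdd_ge0 bh; case: bh => mh hA.
split; first exact: cmeasM.
apply: (@le_trans _ _ (norm1 mu (fun x => A%:C * f x)%R)).
  apply: le_norm1; [exact: cmeasM|exact/cmeasM/mf/cmeas_cst|move=> x].
  by rewrite !normcM normcR ger0_norm// ler_wpM2r ?normc_ge0.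
by rewrite norm1Z// normcR ger0_norm// EFinM lee_wpmul2l// lee_fin.
Qed.

Lemma normc_cI_n c f : L1n c f -> normc (cI mu f) <= 2 * c.
Proof. by move=> Lf; exact: normc_cI_le (L1n_L1 Lf) Lf.2. Qed.

Lemma bddD A B h k : bdd A h -> bdd B k -> bdd (A + B) (fun x => h x + k x).
Proof.
move=> [mh hA] [mk kB]; split; first exact: cmeasD.
by move=> x; exact: le_trans (le_normcD _ _) (lerD (hA x) (kB x)).
Qed.

Lemma bddN A h : bdd A h -> bdd A (fun x => - h x).
Proof. by move=> [mh hA]; split; [exact: cmeasN|move=> x; rewrite normcN]. Qed.

Lemma bddB A B h k : bdd A h -> bdd B k -> bdd (A + B) (fun x => h x - k x).
Proof. by move=> bh bk; apply: bddD => //; exact: bddN. Qed.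

Lemma bddZ A a h : bdd A h -> bdd (normc a * A) (fun x => a * h x).
Proof.
move=> [mh hA]; split; first exact/cmeasM/mh/cmeas_cst.
by move=> x; rewrite normcM ler_wpM2l ?normc_ge0.
Qed.

Lemma bdd_L1 A c h f : bdd A h -> L1n c f -> L1 mu (fun x => h x * f x).
Proof. by move=> bh Lf; exact: L1n_L1 (L1nM bh Lf). Qed.

Lemma normc_cI_bdd A c h f : bdd A h -> L1n c f ->
  normc (cI mu (fun x => h x * f x)) <= 2 * (A * c).
Proof. by move=> bh Lf; exact: normc_cI_n (L1nM bh Lf). Qed.

Lemma schwartz_bdd f : schwartz f -> exists A, bdd A f.
Proof.
move=> sf; have [A fA] := schwartz_bounded sf.
by exists A; split => //; exact: schwartz_cmeas.
Qed.

Lemma schwartz_L1n f : schwartz f -> exists c, L1n c f.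
Proof. by move=> sf; apply: L1_L1n; exact: schwartz_L1. Qed.

Let N1 : (-1 : R) != 0. Proof. by rewrite oppr_eq0 oner_eq0. Qed.

Let reflectE x K : (fun y => K (x - y)) = (fun y => K (-1 *: y + x)).
Proof. by apply/funext => y; rewrite scaleN1r addrC. Qed.

Lemma cmeas_reflect x K : cmeas K -> cmeas (fun y => K (x - y)).
Proof. by rewrite reflectE; exact: cmeas_affine. Qed.

Lemma norm1_reflect x K : cmeas K -> norm1 mu (fun y => K (x - y)) = norm1 mu K.
Proof. by move=> mK; rewrite reflectE norm1_affine// normrN1 expr1n invr1 mul1e. Qed.

Lemma cI_reflect x K : L1 mu K -> cI mu (fun y => K (x - y)) = cI mu K.
Proof. by move=> LK; rewrite reflectE cI_affine// normrN1 expr1n invr1 mul1r. Qed.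

Lemma L1n_reflect x c K : L1n c K -> L1n c (fun y => K (x - y)).
Proof. by move=> [mK Kc]; split; [exact: cmeas_reflect|rewrite norm1_reflect]. Qed.

Lemma L1n_shift z c K : L1n c K -> L1n c (fun y => K (y + z)).
Proof.
move=> [mK Kc]; split; last by rewrite norm1_shift.
by have := cmeas_affine 1 z mK; under eq_fun do (rewrite scale1r).
Qed.

Lemma cmeas_shift z K : cmeas K -> cmeas (fun y => K (y + z)).
Proof. by move=> mK; have := cmeas_affine 1 z mK; under eq_fun do (rewrite scale1r). Qed.

Lemma measurable_rV_sub : measurable_fun setT (fun p : 'rV[R]_d * 'rV[R]_d => p.1 - p.2).
Proof.
apply: measurable_fun_rV => i.
under eq_fun do (rewrite !mxE); apply: measurable_funB.
  exact: (measurableT_comp (measurable_rV_coord i) measurable_fst).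
exact: (measurableT_comp (measurable_rV_coord i) measurable_snd).
Qed.

Lemma measurable_rV_add : measurable_fun setT (fun p : 'rV[R]_d * 'rV[R]_d => p.1 + p.2).
Proof.
apply: measurable_fun_rV => i.
under eq_fun do (rewrite !mxE); apply: measurable_funD.
  exact: (measurableT_comp (measurable_rV_coord i) measurable_fst).
exact: (measurableT_comp (measurable_rV_coord i) measurable_snd).
Qed.

(** Minkowski's inequality for integrals, with the constant of [normc_cI]. *)
Lemma norm1_cI (F : 'rV[R]_d * 'rV[R]_d -> R[i]) : cmeas F ->
  (forall x, L1 mu (fun y => F (x, y))) ->
  (norm1 mu (fun x => cI mu (fun y => F (x, y))) <=
   2%:E * \int[mu]_y norm1 mu (fun x => F (x, y)))%E.
Proof.
move=> mF F1; rewrite -norm1_fubini// -ge0_integralZl//; last 2 first.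
- exact: measurable_norm1_fubini.
- by move=> x _; exact: norm1_ge0.
apply: ge0_le_integral => //.
- by move=> x _; rewrite lee_fin normc_ge0.
- exact/cmeas_Enormc/cmeas_cI.
- by apply: emeasurable_funM; [exact: measurable_cst|exact: measurable_norm1_fubini].
- by move=> x _; exact: normc_cI.
Qed.

Definition conv K h x : R[i] := cI mu (fun y => h y * K (x - y)).

(** The transpose of convolution with [K], see [conv_pair]. *)
Definition corr K G y : R[i] := cI mu (fun x => G x * K (x - y)).

Let mconv K G : cmeas K -> cmeas G ->
  cmeas (fun p : 'rV[R]_d * 'rV[R]_d => G p.2 * K (p.1 - p.2)).
Proof.
move=> mK mG; apply: cmeasM; first exact: (cmeas_comp measurable_snd mG).
exact: (cmeas_comp measurable_rV_sub mK).
Qed.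

Let mcorr K G : cmeas K -> cmeas G ->
  cmeas (fun p : 'rV[R]_d * 'rV[R]_d => G p.2 * K (p.2 - p.1)).
Proof.
move=> mK mG; apply: cmeasM; first exact: (cmeas_comp measurable_snd mG).
apply: (cmeas_comp (h := fun p : 'rV[R]_d * 'rV[R]_d => p.2 - p.1) _ mK).
apply: measurable_fun_rV => i.
under eq_fun do (rewrite !mxE); apply: measurable_funB.
  exact: (measurableT_comp (measurable_rV_coord i) measurable_snd).
exact: (measurableT_comp (measurable_rV_coord i) measurable_fst).
Qed.

Lemma conv_bdd A c K h : bdd A h -> L1n c K -> bdd (2 * (A * c)) (conv K h).
Proof.
move=> bh LK; split.
  exact: (cmeas_cI mu (mconv LK.1 bh.1)).
by move=> x; apply: normc_cI_bdd bh _; exact: L1n_reflect.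
Qed.

Lemma conv_diff A c K h x z : bdd A h -> L1 mu K ->
  L1n c (fun y => K (y + z) - K y) ->
  normc (conv K h (x + z) - conv K h x) <= 2 * (A * c).
Proof.
move=> bh /L1_L1n[k Lk] Lc; rewrite /conv -cIB.
- rewrite (eq_cI _ (g := fun y => h y * ((fun y => K (y + z) - K y) (x - y)))).
    by apply: normc_cI_bdd bh _; exact: (L1n_reflect x Lc).
  by move=> y; rewrite mulrBr addrAC.
- exact: bdd_L1 bh (L1n_reflect _ Lk).
- exact: bdd_L1 bh (L1n_reflect _ Lk).
Qed.

(** A kernel of mean zero only sees the increments of [G]. *)
Lemma corr_lipschitz c c' B (m L : R) K G : L1n c K -> bdd B K -> L1n c' G ->
  cI mu K = 0 -> (\int[mu]_z (`|z| * normc (K z))%:E <= m%:E)%E -> 0 <= L ->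
  (forall z, (norm1 mu (fun y => G (y + z) - G y)%R <= (L * `|z|)%:E)%E) ->
  L1n (2 * (L * m)) (corr K G).
Proof.
move=> LK bK LG K0 Km L0 GL; split; first exact: (cmeas_cI mu (mcorr LK.1 LG.1)).
pose F (p : 'rV[R]_d * 'rV[R]_d) := (G (p.1 + p.2) - G p.1) * K p.2.
have mF : cmeas F.
  apply: cmeasM; last exact: (cmeas_comp measurable_snd LK.1).
  apply: cmeasB; first exact: (cmeas_comp measurable_rV_add LG.1).
  exact: (cmeas_comp measurable_fst LG.1).
have L2 y : L1 mu (fun z => G (z + y) * K z).
  under eq_fun do (rewrite mulrC).
  by apply: (L1Mb (c := B) (L1n_L1 (L1n_shift y LG)) LK.1) => x; exact: bK.2.
have F1 y : L1 mu (fun z => F (y, z)).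
  have := L1B (L2 y) (L1Z (G y) (L1n_L1 LK)); congr L1.
  by apply/funext => z; rewrite /F/= [y + z]addrC mulrBl.
have -> : norm1 mu (corr K G) = norm1 mu (fun y => cI mu (fun z => F (y, z))).
  congr norm1; apply/funext => y; rewrite /corr.
  transitivity (cI mu (fun x => (fun z => G (z + y) * K z) (x + - y))).
    by apply: eq_cI => x; rewrite subrK.
  rewrite (@cI_shift R d (- y) (fun z => G (z + y) * K z) (L2 y)).
  have -> : cI mu (fun z => G (z + y) * K z) =
      cI mu (fun z => G (z + y) * K z) - cI mu (fun z => G y * K z).
    by rewrite cIZ ?K0 ?mulr0 ?subr0//; exact: L1n_L1 LK.
  rewrite -cIB//; last exact: L1Z (L1n_L1 LK).
  by apply: eq_cI => z; rewrite /F/= [y + z]addrC mulrBl.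
apply: le_trans (norm1_cI mF F1) _; rewrite EFinM lee_wpmul2l//.
apply: (@le_trans _ _ (\int[mu]_z (L%:E * (`|z| * normc (K z))%:E))%E).
  apply: ge0_le_integral => //.
  - by move=> z _; exact: norm1_ge0.
  - apply: (measurable_norm1_fubini mu (F := fun p => F (p.2, p.1))).
    apply: (cmeas_comp (h := fun p : 'rV[R]_d * 'rV[R]_d => (p.2, p.1)) _ mF).
    by apply: measurable_fun_pair.
  - apply: emeasurable_funM; first exact: measurable_cst.
    apply/measurable_EFinP; apply: measurable_funM; last exact: cmeas_normc LK.1.
    by apply: continuous_measurable_rV => x; exact: norm_continuous.
  - move=> z _; rewrite /F/=.
    rewrite (_ : norm1 _ _ = (normc (K z))%:E * norm1 mu (fun y => (G (y + z) - G y)%R))%E; last first.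
      rewrite -norm1Z; first by congr norm1; apply/funext => y; rewrite mulrC.
      by apply: cmeasB; [exact: cmeas_shift LG.1|exact: LG.1].
    apply: le_trans (lee_wpmul2l _ (GL z)) _; first by rewrite lee_fin normc_ge0.
    by rewrite -!EFinM lee_fin (_ : _ * (L * _) = L * (`|z| * normc (K z))) //; ring.
rewrite ge0_integralZl//; last 2 first.
- apply/measurable_EFinP; apply: measurable_funM; last exact: cmeas_normc LK.1.
  by apply: continuous_measurable_rV => x; exact: norm_continuous.
- by move=> z _; rewrite lee_fin mulr_ge0 ?normc_ge0.
by rewrite EFinM lee_wpmul2l.
Qed.

Lemma conv_pair A c c' B K h G : bdd A h -> L1n c K -> bdd B K -> L1n c' G ->
  cI mu (fun x => conv K h x * G x) = cI mu (fun y => h y * corr K G y).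
Proof.
move=> bh LK bK LG.
pose F (p : 'rV[R]_d * 'rV[R]_d) := (h p.2 * K (p.1 - p.2)) * G p.1.
have mF : cmeas F.
  by apply: cmeasM; [exact: mconv LK.1 bh.1|exact: (cmeas_comp measurable_fst LG.1)].
have F1 x : L1 mu (fun y => F (x, y)).
  have := L1Z (G x) (bdd_L1 bh (L1n_reflect x LK)); congr L1; apply/funext => y.
  by rewrite mulrC.
have L2 y : L1 mu (fun x => G x * K (x - y)).
  under eq_fun do (rewrite mulrC).
  apply: (L1Mb (c := B) (L1n_L1 LG)); first exact: cmeas_shift LK.1.
  by move=> x; exact: bK.2.
have F2 y : L1 mu (fun x => F (x, y)).
  have := L1Z (h y) (L2 y); congr L1; apply/funext => x.
  by rewrite /F/= -mulrA [G x * _]mulrC.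
have F12 : (\int[mu]_x norm1 mu (fun y => F (x, y)) < +oo)%E.
  apply: (@le_lt_trans _ _ (\int[mu]_x ((A * c)%:E * (normc (G x))%:E))%E).
    apply: ge0_le_integral => //.
    - by move=> x _; exact: norm1_ge0.
    - exact: measurable_norm1_fubini.
    - by apply: emeasurable_funM; [exact: measurable_cst|exact: cmeas_Enormc LG.1].
    - move=> x _; rewrite (_ : norm1 _ _ =
          (normc (G x))%:E * norm1 mu (fun y => (h y * K (x - y))%R))%E; last first.
        rewrite -norm1Z; last exact: (bdd_L1 bh (L1n_reflect x LK)).1.
        by congr norm1; apply/funext => y; rewrite mulrC.
      rewrite muleC; apply: lee_wpmul2r; first by rewrite lee_fin normc_ge0.
      exact: (L1nM bh (L1n_reflect x LK)).2.
  rewrite ge0_integralZl//; last 3 first.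
  - exact: cmeas_Enormc LG.1.
  - by move=> x _; rewrite lee_fin normc_ge0.
  - by rewrite lee_fin mulr_ge0 ?(bdd_ge0 bh) ?(L1n_ge0 LK).
  rewrite lte_mul_pinfty ?(L1n_L1 LG).2//.
  by rewrite lee_fin mulr_ge0 ?(bdd_ge0 bh) ?(L1n_ge0 LK).
transitivity (cI mu (fun x => cI mu (fun y => F (x, y)))).
  apply: eq_cI => x; rewrite /conv mulrC -cIZ; last exact: bdd_L1 bh (L1n_reflect x LK).
  by apply: eq_cI => y; rewrite /F/= mulrC.
rewrite (cI_fubini mF F1 F2 F12); apply: eq_cI => y; rewrite /corr -cIZ//.
by apply: eq_cI => x; rewrite /F/= -mulrA [G x * _]mulrC.
Qed.

End convolution.

Section multipliers.
Context {R : realType} {d : nat}.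
Implicit Types (x y z xi : 'rV[R]_d) (f g h eta : 'rV[R]_d -> R[i]) (A c : R)
  (u v : functional R d).
Notation mu := (lebesgue_rV (R := R) d).

(** The Fourier multiplier [eta] on test functions; its transpose acts on
    distributions. *)
Definition mult eta g : 'rV[R]_d -> R[i] := fourier (fun xi => eta xi * inv_fourier g xi).

Lemma schwartz_mult eta g : schwartz eta -> schwartz g -> schwartz (mult eta g).
Proof.
by move=> se sg; apply/schwartz_fourier/schwartzM => //; exact: schwartz_inv_fourier.
Qed.

Lemma mult_comp e1 e2 g : schwartz e1 -> schwartz e2 -> schwartz g ->
  mult e1 (mult e2 g) = mult (fun xi => e1 xi * e2 xi) g.
Proof.
move=> s1 s2 sg; rewrite /mult inv_fourierK; last first.
  by apply: schwartzM => //; exact: schwartz_inv_fourier.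
by congr fourier; apply/funext => xi; rewrite mulrA.
Qed.

(** Fubini's theorem: the kernel is symmetric. *)
Lemma inv_fourier_pair f g : L1 mu f -> L1 mu g ->
  cI mu (fun x => f x * inv_fourier g x) = cI mu (fun x => inv_fourier f x * g x).
Proof.
move=> Lf Lg; pose F (p : 'rV[R]_d * 'rV[R]_d) := f p.1 * (g p.2 * wave p.1 p.2).
have mF : cmeas F.
  apply: cmeasM; first exact: (cmeas_comp measurable_fst Lf.1).
  apply: cmeasM; first exact: (cmeas_comp measurable_snd Lg.1).
  exact: cmeas_wave2.
have F1 xi : L1 mu (fun x => F (xi, x)) by have := L1Z (f xi) (L1_wave xi Lg).
have F2 x : L1 mu (fun xi => F (xi, x)).
  have := L1Z (g x) (L1_wave x Lf); congr L1; apply/funext => xi.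
  by rewrite /F/= [wave x xi]waveC mulrCA.
have F12 : (\int[mu]_xi norm1 mu (fun x => F (xi, x)) < +oo)%E.
  have nE xi : norm1 mu (fun x => F (xi, x)) = ((normc (f xi))%:E * norm1 mu g)%E.
    have := norm1Z mu (f xi) (L1_wave xi Lg).1.
    by rewrite norm1_wave.
  under eq_integral do rewrite nE.
  have [c [_ gc]] := L1_L1n Lg.
  rewrite ge0_integralZr ?norm1_ge0//; last 2 first.
  - exact: cmeas_Enormc Lf.1.
  - by move=> xi _; rewrite lee_fin normc_ge0.
  apply: le_lt_trans (lee_wpmul2l (norm1_ge0 _ _) gc) _.
  have [c' [_ ec]] := L1_L1n Lf.
  apply: le_lt_trans (lee_wpmul2r _ ec) _; last by rewrite -EFinM ltry.
  exact: le_trans (norm1_ge0 _ _) gc.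
transitivity (cI mu (fun xi => cI mu (fun x => F (xi, x)))).
  apply: eq_cI => xi; rewrite inv_fourierE -cIZ; last exact: L1_wave.
  by apply: eq_cI => x; rewrite /F.
rewrite (cI_fubini mF F1 F2 F12); apply: eq_cI => x.
rewrite inv_fourierE mulrC -cIZ; last exact: L1_wave.
by apply: eq_cI => xi; rewrite /F/= [wave x xi]waveC; ring.
Qed.

(** Hence the multiplier acts on bounded representatives by convolution, see
    [brep_mult]. *)
Lemma multE eta g : schwartz eta -> schwartz g -> mult eta g = corr (inv_fourier eta) g.
Proof.
move=> se sg; apply/funext => y; rewrite /mult fourierE /corr.
have [Le Lg] := (schwartz_L1 se, schwartz_L1 sg).
rewrite (eq_cI _ (g := fun xi => (eta xi * wave (- y) xi) * inv_fourier g xi)).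
  rewrite inv_fourier_pair//; last exact: L1_wave.
  apply: eq_cI => x; rewrite mulrC !inv_fourierE; congr (_ * _); apply: eq_cI => xi.
  by rewrite waveDl; ring.
by move=> xi; rewrite mulrAC.
Qed.

(** In contrast to [represents], the bound holds at every point. *)
Definition brep A h u : Prop :=
  bdd A h /\ forall g, schwartz g -> u g = cI mu (fun x => h x * g x).

Lemma brep_mult eta c A h u : schwartz eta -> L1n c (inv_fourier eta) -> brep A h u ->
  brep (2 * (A * c)) (conv (inv_fourier eta) h) (fun g => u (mult eta g)).
Proof.
move=> se Lc [bh uE]; split; first exact: conv_bdd.
move=> g sg; rewrite uE; last exact: schwartz_mult.
have [B bK] := schwartz_bdd (schwartz_inv_fourier se).
have [c' Lg] := schwartz_L1n sg.
by rewrite multE// (conv_pair bh Lc bK Lg).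
Qed.

Lemma brepD A B h k u v : brep A h u -> brep B k v ->
  brep (A + B) (fun x => h x + k x) (fun g => u g + v g).
Proof.
move=> [bh uE] [bk vE]; split; first exact: bddD.
move=> g sg; have [c Lg] := schwartz_L1n sg.
rewrite uE// vE// -cID; [|exact: bdd_L1 bh Lg|exact: bdd_L1 bk Lg].
by apply: eq_cI => x; rewrite mulrDl.
Qed.

Lemma brep_eq A h u v : (forall g, schwartz g -> u g = v g) -> brep A h u -> brep A h v.
Proof. by move=> uv [bh uE]; split => // g sg; rewrite -uv// uE. Qed.

Lemma brep_le A B h u : A <= B -> brep A h u -> brep B h u.
Proof. by move=> AB [bh uE]; split => //; exact: bdd_le AB bh. Qed.

Lemma brep_bdd A B h u : brep A h u -> bdd B h -> brep B h u.
Proof. by move=> [_ uE] bh; split. Qed.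

Lemma bdd_brep A h : bdd A h -> brep A h (dist_of h).
Proof. by move=> bh; split. Qed.

End multipliers.

(** * Kernels at dyadic scales *)

Section kernels.
Context {R : realType} {d : nat}.
Implicit Types (x y z xi : 'rV[R]_d) (f g h eta K : 'rV[R]_d -> R[i]) (C t : R).
Notation mu := (lebesgue_rV (R := R) d).

(** [K] behaves like the L^1-normalised dilate at scale [1 / t] of a fixed
    Schwartz function. *)
Definition kernel_at C t K : Prop :=
  [/\ schwartz K, L1n C K,
      forall z, (norm1 mu (fun x => K (x + z) - K x)%R <= (C * t * `|z|)%:E)%E
    & (\int[mu]_z (`|z| * normc (K z))%:E <= (C / t)%:E)%E].

Lemma kernel_at_le C C' t K : 0 < t -> C <= C' -> kernel_at C t K -> kernel_at C' t K.
Proof.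
move=> t0 CC [sK LK Kz Km]; split => //; first exact: L1n_le LK.
- move=> z; apply: le_trans (Kz z) _; rewrite lee_fin.
  by rewrite ler_wpM2r// ler_wpM2r// ltW.
- by apply: le_trans Km _; rewrite lee_fin ler_wpM2r// invr_ge0 ltW.
Qed.

Let measurable_moment K : cmeas K ->
  measurable_fun setT (fun z : 'rV[R]_d => (`|z| * normc (K z))%:E : \bar R).
Proof.
move=> mK; apply/measurable_EFinP; apply: measurable_funM; last exact: cmeas_normc.
by apply: continuous_measurable_rV => x; exact: norm_continuous.
Qed.

Lemma schwartz_kernel_at K : schwartz K -> exists C, 0 <= C /\ kernel_at C 1 K.
Proof.
move=> sK; have [c1 L1K] := schwartz_L1n sK.
have [c2 [c20 c2P]] := schwartz_L1_lipschitz sK.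
have [c3 c3P] : exists c3, (\int[mu]_z (`|z| * normc (K z))%:E <= c3%:E)%E.
  have [c cP] := schwartz_rapid sK (2 * d).+1.
  have mK := schwartz_cmeas sK.
  have c0 : 0 <= c.
    by apply: le_trans (cP 0); rewrite mulr_ge0 ?normc_ge0// exprn_ge0// addr_ge0.
  have wc z : `|z| * normc (K z) <= c * weight z.
    have wz := weight_ge_norm z.
    apply: le_trans (_ : (1 + `|z|) ^+ (2 * d).+1 * normc (K z) * weight z <= _); last first.
      by rewrite ler_wpM2r ?cP// ltW// weight_gt0.
    rewrite (_ : _ * weight z = (1 + `|z|) * normc (K z) *
      ((1 + `|z|) ^+ (2 * d) * weight z)); last by rewrite exprS; ring.
    apply: le_trans (_ : (1 + `|z|) * normc (K z) <= _).
      by rewrite ler_wpM2r ?normc_ge0// lerDr.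
    by apply: ler_peMr => //; rewrite mulr_ge0 ?normc_ge0// addr_ge0.
  exists (c * pi ^+ d).
  apply: (@le_trans _ _ (\int[mu]_z (c%:E * (weight z)%:E))%E).
    apply: ge0_le_integral => //.
    - by move=> z _; rewrite lee_fin mulr_ge0 ?normc_ge0.
    - exact: measurable_moment.
    - by apply: emeasurable_funM; [exact: measurable_cst|apply/measurable_EFinP; exact: measurable_weight].
    - by move=> z _; rewrite -EFinM lee_fin.
  rewrite ge0_integralZl//; last 2 first.
  - by apply/measurable_EFinP; exact: measurable_weight.
  - by move=> z _; rewrite lee_fin ltW// weight_gt0.
  by rewrite integral_weight EFinM.
have c10 := L1n_ge0 L1K.
exists (c1 + c2 + `|c3|); split; first by rewrite !addr_ge0.
have := normr_ge0 c3; have := ler_norm c3; move=> c3n c3p.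
split=> //.
- by apply: L1n_le L1K; lra.
- move=> z; apply: le_trans (c2P z) _; rewrite lee_fin mulr1 ler_wpM2r//; lra.
- by apply: le_trans c3P _; rewrite lee_fin divr1; lra.
Qed.

Lemma inv_fourier_dilate eta (t : R) : 0 < t -> schwartz eta ->
  inv_fourier (fun xi => eta (t^-1 *: xi)) =
  fun x => (t ^+ d)%:C * inv_fourier eta (t *: x).
Proof.
move=> t0 se; apply/funext => x; have t1 : t != 0 by rewrite gt_eqF.
have := cI_affine (r := t^-1) 0 _ (L1_wave (t *: x) (schwartz_L1 se)).
rewrite invr_neq0// => /(_ isT); rewrite !inv_fourierE => E.
transitivity (cI mu (fun xi => eta (t^-1 *: xi + 0) * wave (t *: x) (t^-1 *: xi + 0))).
  apply: eq_cI => xi; rewrite addr0; congr (_ * _).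
  by rewrite waveZl scalerA divff// scale1r.
rewrite E; congr (_%:C * _).
by rewrite ger0_norm ?invr_ge0 ?ltW// exprVn invrK.
Qed.

Lemma kernel_at_dilate C t K : 0 < t -> kernel_at C 1 K ->
  kernel_at C t (fun x => (t ^+ d)%:C * K (t *: x)).
Proof.
move=> t0 [sK LK Kz Km]; have t1 : t != 0 by rewrite gt_eqF.
have td0 : 0 <= t ^+ d by rewrite exprn_ge0// ltW.
have sKt : schwartz (fun x => (t ^+ d)%:C * K (t *: x)).
  apply: schwartzZ; have := schwartz_affine 0 t1 sK.
  by under eq_fun do (rewrite addr0).
have nE f : cmeas f -> norm1 mu (fun x => (t ^+ d)%:C * f (t *: x)) = norm1 mu f.
  move=> mf; rewrite norm1Z; last first.
    by have := cmeas_affine t 0 mf; under eq_fun do (rewrite addr0).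
  have := norm1_affine 0 t1 mf; under eq_fun do (rewrite addr0); move=> ->.
  rewrite normcR !ger0_norm ?(ltW t0)// muleA -EFinM divff ?mul1e//.
  by rewrite expf_neq0.
split=> //.
- by split; [exact: schwartz_cmeas|rewrite nE ?LK.2//; exact: LK.1].
- move=> z; have mKz : cmeas (fun x => K (x + t *: z) - K x).
    by apply: cmeasB; [exact: cmeas_shift LK.1|exact: LK.1].
  have := nE _ mKz; have := Kz (t *: z) => h1 h2.
  rewrite mulr1 normrZ (ger0_norm (ltW t0)) mulrA in h1.
  apply: le_trans h1; rewrite -h2 le_eqVlt; apply/orP; left; apply/eqP.
  by congr norm1; apply/funext => x; rewrite scalerDr mulrBr.
- rewrite divr1 in Km.
  have := ge0_integral_affine 0 t1 (measurable_moment LK.1) (fun z => _).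
  move=> /(_ (fun z => _)) h.
  under eq_integral do rewrite normcM normcR ger0_norm//.
  rewrite (eq_integral (fun z => (t ^+ d / t)%:E * (`|t *: z + 0| * normc (K (t *: z + 0)))%:E)%E); last first.
    move=> z _; rewrite addr0 normrZ (ger0_norm (ltW t0)) -EFinM; congr EFin.
    by field.
  rewrite ge0_integralZl//; last 3 first.
  - by have := measurableT_comp (measurable_moment LK.1) (measurable_rV_affine t 0).
  - by move=> z _; rewrite lee_fin mulr_ge0 ?normc_ge0.
  - by rewrite lee_fin divr_ge0// ltW.
  rewrite h; last by move=> z; rewrite lee_fin mulr_ge0 ?normc_ge0.
  rewrite muleA -EFinM ger0_norm ?(ltW t0)//.
  rewrite (_ : t ^+ d / t * _ = t^-1); last by rewrite mulrAC divff ?mul1r// expf_neq0.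
  rewrite mulrC EFinM; apply: lee_wpmul2l => //.
  by rewrite lee_fin invr_ge0 ltW.
Qed.

Lemma dilate_kernels eta : schwartz eta -> exists C, 0 <= C /\ forall t, 0 < t ->
  kernel_at C t (inv_fourier (fun xi => eta (t^-1 *: xi))).
Proof.
move=> se; have [C [C0 CP]] := schwartz_kernel_at (schwartz_inv_fourier se).
exists C; split => // t t0; rewrite (inv_fourier_dilate t0 se).
exact: (kernel_at_dilate t0 CP).
Qed.

(** Fourier inversion at the origin. *)
Lemma cI_inv_fourier eta : schwartz eta -> cI mu (inv_fourier eta) = eta 0.
Proof.
move=> se; rewrite -{2}(fourierK se) fourierE; apply: eq_cI => x.
by rewrite oppr0 wave0l mulr1.
Qed.

End kernels.

(** * Dyadic averages *)

Section boxes.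
Context {R : realType} {d : nat}.
Notation mu := (lebesgue_rV (R := R) d).

Definition box (a b : 'I_d -> R) : set 'rV[R]_d :=
  [set x | forall i, a i <= x ord0 i < b i].

Lemma measurable_box a b : measurable (box a b).
Proof.
rewrite (_ : box a b = \bigcap_(i in [set: 'I_d])
    ((fun x : 'rV[R]_d => x ord0 i : measurableTypeR R) @^-1` `[a i, b i[)); last first.
  apply/seteqP; split=> x /= h i; first by rewrite /= in_itv/=.
  by have := h i I; rewrite /= in_itv.
apply: fin_bigcap_measurable; first exact: finite_finset.
move=> i _; rewrite -[X in measurable X]setTI.
apply: measurable_rV_coord => //; exact: measurable_itv.
Qed.

Lemma norm1_le_box f a b (c : R) : cmeas f -> 0 <= c -> (forall i, a i <= b i) ->
  (forall x, normc (f x) <= c * \1_(box a b) x) ->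
  (norm1 mu f <= (c * \prod_i (b i - a i))%:E)%E.
Proof.
move=> mf c0 ab fc.
apply: (@le_trans _ _ (\int[mu]_x (c%:E * (\1_(box a b) x)%:E))%E).
  apply: ge0_le_integral => //.
  - by move=> x _; rewrite lee_fin normc_ge0.
  - exact: cmeas_Enormc.
  - apply: emeasurable_funM; first exact: measurable_cst.
    by apply/measurable_EFinP; apply: measurable_indic; exact: measurable_box.
  - by move=> x _; rewrite -EFinM lee_fin.
rewrite ge0_integralZl//; last first.
  by apply/measurable_EFinP; apply: measurable_indic; exact: measurable_box.
rewrite integral_indic//; last exact: measurable_box.
by rewrite setIT EFinM -(box_volume ab).
Qed.

Lemma cI_box a b (c : R[i]) : (forall i, a i <= b i) ->
  L1 mu (fun x => c * (\1_(box a b) x)%:C) /\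
  cI mu (fun x => c * (\1_(box a b) x)%:C) = c * (\prod_i (b i - a i))%:C.
Proof.
move=> ab.
have mb : cmeas (fun x => (\1_(box a b) x)%:C : R[i]).
  by apply: cmeasR; apply: measurable_indic; exact: measurable_box.
have L : L1 mu (fun x => (\1_(box a b) x)%:C).
  split=> //; apply: le_lt_trans (norm1_le_box mb ler01 ab _) (ltry _) => x.
  by rewrite normcR mul1r ger0_norm.
split; first exact: L1Z.
rewrite cIZ//; congr (_ * _); apply: complex_ext; rewrite /= /Rintegral.
  rewrite integral_indic//; last exact: measurable_box.
  by rewrite setIT; apply: (congr1 fine (y := (\prod_i (b i - a i))%:E)); exact: box_volume.
by rewrite integral0.
Qed.

Lemma bounded_box (r : R) : 0 <= r -> [set x : 'rV[R]_d | `|x| < r] `<=` box (fun=> - r) (fun=> r).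
Proof.
move=> r0 x /= xr i; have := le_lt_trans (rV_coord_le x i) xr.
by rewrite ltr_norml => /andP[h1 h2]; rewrite ltW.
Qed.

End boxes.

Section averages.
Context {R : realType} {d : nat}.
Implicit Types (x y z : 'rV[R]_d) (f g h K G : 'rV[R]_d -> R[i]) (A c : R).
Variable N : nat.
Notation mu := (lebesgue_rV (R := R) d).
Notation ell := (2 ^- N : R).

Let p0 : 0 < 2 ^+ N :> R. Proof. by rewrite exprn_gt0. Qed.

(** The kernel of the averaging operator; as an integral operator with symmetric
    kernel the operator is easy to compose and to transpose. It is the dyadic average
    by [dyadic_avgE]. *)
Definition avgk x y : R[i] := (if cube_index N x == cube_index N y then 2 ^+ (N * d) else 0)%:C.

Definition avg h x : R[i] := cI mu (fun y => h y * avgk x y).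

Let lo x i : R := ell * (cube_index N x ord0 i)%:~R.
Let hi x i : R := ell * ((cube_index N x ord0 i)%:~R + 1).

Let lohi x i : hi x i - lo x i = ell.
Proof. by rewrite -mulrBr addrAC subrr add0r mulr1. Qed.

Let cubeP x y : (cube_index N x == cube_index N y) = (y \in box (lo x) (hi x)).
Proof.
apply/idP/idP => [/eqP h|].
  have : dyadic_cube N (cube_index N x) y by rewrite dyadic_cubeE /= h.
  by rewrite inE.
rewrite inE => h; apply/eqP; apply: esym.
have : dyadic_cube N (cube_index N x) y by [].
by rewrite dyadic_cubeE.
Qed.

Lemma avgkC x y : avgk x y = avgk y x.
Proof. by rewrite /avgk eq_sym. Qed.

Let avgkE x y : avgk x y = (2 ^+ (N * d))%:C * (\1_(box (lo x) (hi x)) y)%:C.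
Proof. by rewrite /avgk cubeP indicE -rmorphM/=; case: (_ \in _); rewrite ?mulr1 ?mulr0. Qed.

Let vol1 x : 2 ^+ (N * d) * \prod_i (hi x i - lo x i) = 1.
Proof.
under eq_bigr do rewrite lohi.
by rewrite prodr_const card_ord exprVn -exprM mulfV// expf_neq0.
Qed.

Let lehi x i : lo x i <= hi x i.
Proof. by rewrite -subr_ge0 lohi ltW. Qed.

Lemma cmeas_avgk2 : cmeas (fun p : 'rV[R]_d * 'rV[R]_d => avgk p.1 p.2).
Proof.
apply: cmeasR.
exact: (measurable_cube_index2 N (fun m => if m.1 == m.2 then 2 ^+ (N * d) else 0 : R)).
Qed.

Lemma cmeas_avgk x : cmeas (avgk x).
Proof. exact: (cmeas_pair1 cmeas_avgk2 x). Qed.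

Lemma L1n_avgk x : L1n 1 (avgk x).
Proof.
split; first exact: cmeas_avgk.
rewrite -(vol1 x); apply: norm1_le_box => //; first exact: cmeas_avgk.
by move=> y; rewrite avgkE normcM !normcR !ger0_norm.
Qed.

Lemma cI_avgk x : cI mu (avgk x) = 1.
Proof.
rewrite (eq_cI _ (avgkE x)) (cI_box _ (lehi x)).2.
by rewrite -rmorphM/= vol1.
Qed.

Lemma avgk_bdd x : bdd (2 ^+ (N * d)) (avgk x).
Proof.
split; first exact: cmeas_avgk.
by move=> y; rewrite /avgk normcR; case: ifP => _; rewrite ?normr0 ?ger0_norm.
Qed.

Lemma eq_avgk x x' y : cube_index N x = cube_index N x' -> avgk x y = avgk x' y.
Proof. by rewrite /avgk => ->. Qed.

(** Points of one cube are at sup-distance less than the side length. *)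
Lemma avgk_near x y : avgk x y != 0 -> `|y - x| <= ell.
Proof.
rewrite /avgk; case: ifPn => [|_]; last by rewrite eqxx.
rewrite cubeP inE => hy _.
have hx : x \in box (lo x) (hi x) by rewrite -cubeP.
rewrite inE in hx; apply: rV_norm_le => [|i]; first exact: ltW.
rewrite !mxE; have := hx i; have := hy i; have := lohi x i => h /andP[h1 h2] /andP[h3 h4].
rewrite ler_norml; lra.
Qed.

Lemma avg_bdd A h : bdd A h -> bdd (2 * A) (avg h).
Proof.
move=> bh; split.
  apply: (cmeas_cI mu (F := fun p : 'rV[R]_d * 'rV[R]_d => h p.2 * avgk p.1 p.2)).
  by apply: cmeasM; [exact: (cmeas_comp measurable_snd bh.1)|exact: cmeas_avgk2].
by move=> x; have := normc_cI_bdd bh (L1n_avgk x); rewrite mulr1.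
Qed.

Lemma L1_avgk G x : L1 mu G -> L1 mu (fun y => G y * avgk x y).
Proof.
move=> LG; under eq_fun do (rewrite mulrC).
by apply: (L1Mb LG (cmeas_avgk x) (avgk_bdd x).2).
Qed.

Let mavg G : cmeas G -> cmeas (fun p : 'rV[R]_d * 'rV[R]_d => G p.2 * avgk p.1 p.2).
Proof.
by move=> mG; apply: cmeasM; [exact: (cmeas_comp measurable_snd mG)|exact: cmeas_avgk2].
Qed.

Lemma avg_L1n c G : L1n c G -> L1n (2 * c) (avg G).
Proof.
move=> LG; split; first exact: (cmeas_cI mu (mavg LG.1)).
apply: le_trans (norm1_cI (mavg LG.1) (fun x => L1_avgk x (L1n_L1 LG))) _.
rewrite EFinM lee_wpmul2l//; apply: le_trans LG.2.
apply: ge0_le_integral => //.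
- by move=> y _; exact: norm1_ge0.
- apply: (measurable_norm1_fubini mu (F := fun p => G p.1 * avgk p.2 p.1)).
  apply: cmeasM; first exact: (cmeas_comp measurable_fst LG.1).
  have := cmeas_avgk2; under eq_fun do (rewrite avgkC); exact.
- exact: cmeas_Enormc LG.1.
- move=> y _; rewrite (norm1Z _ (G y) (f := fun x => avgk x y)); last first.
    by under eq_fun do (rewrite avgkC); exact: cmeas_avgk.
  rewrite -[leRHS]mule1; apply: lee_wpmul2l; first by rewrite lee_fin normc_ge0.
  by under eq_fun do (rewrite avgkC); exact: (L1n_avgk y).2.
Qed.

Lemma avg_pair A c h G : bdd A h -> L1n c G ->
  cI mu (fun x => avg h x * G x) = cI mu (fun y => h y * avg G y).
Proof.
move=> bh LG; pose F (p : 'rV[R]_d * 'rV[R]_d) := G p.1 * (h p.2 * avgk p.1 p.2).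
have mF : cmeas F by apply: cmeasM; [exact: (cmeas_comp measurable_fst LG.1)|exact: mavg bh.1].
have L1h x := bdd_L1 bh (L1n_avgk x).
have F1 x : L1 mu (fun y => F (x, y)) by exact: (L1Z (G x) (L1h x)).
have F2 y : L1 mu (fun x => F (x, y)).
  have := L1Z (h y) (L1_avgk y (L1n_L1 LG)); congr L1; apply/funext => x.
  by rewrite /F/= [avgk y x]avgkC mulrCA.
have F12 : (\int[mu]_x norm1 mu (fun y => F (x, y)) < +oo)%E.
  apply: (@le_lt_trans _ _ (\int[mu]_x (A%:E * (normc (G x))%:E))%E).
    apply: ge0_le_integral => //.
    - by move=> x _; exact: norm1_ge0.
    - exact: measurable_norm1_fubini.
    - by apply: emeasurable_funM; [exact: measurable_cst|exact: cmeas_Enormc LG.1].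
    - move=> x _; rewrite (norm1Z _ (G x) (L1h x).1) muleC.
      apply: lee_wpmul2r; first by rewrite lee_fin normc_ge0.
      by have := (L1nM bh (L1n_avgk x)).2; rewrite mulr1.
  rewrite ge0_integralZl//; last 3 first.
  - exact: cmeas_Enormc LG.1.
  - by move=> x _; rewrite lee_fin normc_ge0.
  - by rewrite lee_fin (bdd_ge0 bh).
  by rewrite lte_mul_pinfty ?(L1n_L1 LG).2// lee_fin (bdd_ge0 bh).
transitivity (cI mu (fun x => cI mu (fun y => F (x, y)))).
  by apply: eq_cI => x; rewrite /avg mulrC -cIZ//; exact: L1h.
rewrite (cI_fubini mF F1 F2 F12); apply: eq_cI => y.
rewrite /avg -cIZ; last exact: L1_avgk (L1n_L1 LG).
by apply: eq_cI => x; rewrite /F/= [avgk y x]avgkC mulrCA.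
Qed.

Lemma eq_avg h x x' : cube_index N x = cube_index N x' -> avg h x = avg h x'.
Proof. by move=> xx; apply: eq_cI => y; rewrite (eq_avgk y xx). Qed.

Lemma avg_idem h x : avg (avg h) x = avg h x.
Proof.
rewrite {1}/avg (eq_cI _ (g := fun y => avg h x * avgk x y)).
  by rewrite (cIZ _ (L1n_L1 (L1n_avgk x))) cI_avgk mulr1.
move=> y; rewrite /avgk; case: eqP => [h'|_]; last by rewrite !mulr0.
by rewrite (eq_avg h h').
Qed.

Lemma avg_avgk x : avg (avgk x) = avgk x.
Proof.
apply/funext => y; rewrite /avg /avgk.
case: (eqVneq (cube_index N x) (cube_index N y)) => [xy|xy].
  rewrite (eq_cI _ (g := fun w => (2 ^+ (N * d))%:C * avgk x w)).
    by rewrite (cIZ _ (L1n_L1 (L1n_avgk x))) cI_avgk mulr1.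
  move=> w; rewrite /avgk xy; case: eqP => _; last by rewrite !mulr0.
  by rewrite mulrC.
rewrite (eq_cI _ (g := fun=> 0)) ?cI0// => w.
case: eqP => [xw|_]; last by rewrite mul0r.
by case: eqP => [yw|_]; rewrite ?mulr0//; move: xy; rewrite xw yw eqxx.
Qed.

Lemma avgB A B h k : bdd A h -> bdd B k -> forall x,
  avg (fun y => h y - k y) x = avg h x - avg k x.
Proof.
move=> bh bk x; rewrite /avg -cIB; [|exact: bdd_L1 bh (L1n_avgk x)|exact: bdd_L1 bk (L1n_avgk x)].
by apply: eq_cI => y; rewrite mulrBl.
Qed.

Lemma avg_sup (w : R) A h x : bdd A h ->
  (forall z, `|z| <= ell -> normc (h (x + z) - h x) <= w) -> normc (avg h x - h x) <= 2 * w.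
Proof.
move=> bh hw; have Lk := L1n_L1 (L1n_avgk x).
have w0 : 0 <= w by apply: le_trans (hw 0 _); rewrite ?normc_ge0// normr0 ltW.
have -> : avg h x - h x = cI mu (fun y => (h y - h x) * avgk x y).
  rewrite /avg -[X in _ - X]mulr1 -(cI_avgk x) -cIZ// -cIB//; last exact: L1Z.
    by apply: eq_cI => y; rewrite mulrBl.
  exact: bdd_L1 bh (L1n_avgk x).
have bx : bdd (A + normc (h x)) (fun y => h y - h x).
  by apply: bddB bh _; split => //; exact: cmeas_cst.
have LL := bdd_L1 bx (L1n_avgk x).
rewrite -[w]mulr1; apply: normc_cI_n; split; first exact: LL.1.
apply: (@le_trans _ _ (norm1 mu (fun y => w%:C * avgk x y)%R)); last first.
  by rewrite (norm1Z mu _ (cmeas_avgk x)) normcR ger0_norm// EFinM lee_wpmul2l ?lee_fin// (L1n_avgk x).2.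
apply: le_norm1 => //; first exact: LL.1.
  by apply: cmeasM; [exact: cmeas_cst|exact: cmeas_avgk].
move=> y; rewrite !normcM normcR ger0_norm//.
have [->|/avgk_near xy] := eqVneq (avgk x y) 0; first by rewrite normc_zero !mulr0.
by rewrite ler_wpM2r ?normc_ge0//; have := hw _ xy; rewrite [x + _]addrC subrK.
Qed.

(** [(E_N - I) K] only involves increments of [K] of size at most [2^-N]. *)
Lemma avg_sub_L1n c (t : R) K : L1n c K -> 0 <= t ->
  (forall z, `|z| <= ell -> (norm1 mu (fun x => K (x + z) - K x)%R <= t%:E)%E) ->
  L1n (2 * (2 ^+ d * 2 ^+ d * t)) (fun x => avg K x - K x).
Proof.
move=> LK t0 Kt; have LK1 := L1n_L1 LK.
split; first by apply: cmeasB; [exact: (avg_L1n LK).1|exact: LK.1].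
pose F (p : 'rV[R]_d * 'rV[R]_d) := (K (p.1 + p.2) - K p.1) * avgk p.1 (p.1 + p.2).
have mF : cmeas F.
  apply: cmeasM.
    apply: cmeasB; first exact: (cmeas_comp measurable_rV_add LK.1).
    exact: (cmeas_comp measurable_fst LK.1).
  apply: (cmeas_comp (h := fun p : 'rV[R]_d * 'rV[R]_d => (p.1, p.1 + p.2)) _ cmeas_avgk2).
  by apply: measurable_fun_pair => //; exact: measurable_rV_add.
have L2 x : L1 mu (fun y => (K y - K x) * avgk x y).
  have := L1B (L1_avgk x LK1) (L1Z (K x) (L1n_L1 (L1n_avgk x))); congr L1.
  by apply/funext => y; rewrite mulrBl.
have FE x : (fun z => F (x, z)) = (fun z => (fun y => (K y - K x) * avgk x y) (1 *: z + x)).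
  by apply/funext => z; rewrite /F/= scale1r [z + x]addrC.
have F1 x : L1 mu (fun z => F (x, z)) by rewrite FE; exact: (L1_rV_affine x (oner_neq0 _) (L2 x)).
have -> : norm1 mu (fun x => avg K x - K x)%R = norm1 mu (fun x => cI mu (fun z => F (x, z))).
  congr norm1; apply/funext => x; rewrite FE (cI_affine x (oner_neq0 _) (L2 x)).
  rewrite normr1 expr1n invr1 mul1r /avg -[X in _ - X]mulr1 -(cI_avgk x).
  rewrite -cIZ; last exact: L1n_L1 (L1n_avgk x).
  rewrite -cIB; [|exact: L1_avgk|exact: L1Z (L1n_L1 (L1n_avgk x))].
  by apply: eq_cI => y; rewrite mulrBl.
apply: le_trans (norm1_cI mF F1) _; rewrite EFinM lee_wpmul2l//.
have B0 : cmeas (fun z : 'rV[R]_d => (2 ^+ (N * d) * t)%:C * (\1_(box (fun=> - (2 * ell)) (fun=> 2 * ell)) z)%:C : R[i]).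
  apply: cmeasM; first exact: cmeas_cst.
  by apply: cmeasR; apply: measurable_indic; exact: measurable_box.
apply: (@le_trans _ _ (norm1 mu (fun z : 'rV[R]_d => (2 ^+ (N * d) * t)%:C *
    (\1_(box (fun=> - (2 * ell)) (fun=> 2 * ell)) z)%:C)%R)).
  apply: ge0_le_integral => //.
  - by move=> z _; exact: norm1_ge0.
  - apply: (measurable_norm1_fubini mu (F := fun p => F (p.2, p.1))).
    apply: (cmeas_comp (h := fun p : 'rV[R]_d * 'rV[R]_d => (p.2, p.1)) _ mF).
    by apply: measurable_fun_pair.
  - exact: cmeas_Enormc.
  - move=> z _; rewrite normcM !normcR !ger0_norm ?mulr_ge0//.
    have [zl|zl] := leP `|z| ell; last first.
      rewrite (_ : norm1 _ _ = 0%E) ?lee_fin ?mulr_ge0//.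
      rewrite /norm1 -[RHS](integral0 mu setT); apply: eq_integral => x _.
      rewrite /F/= (_ : avgk _ _ = 0) ?mulr0 ?normc_zero//.
      apply/eqP; apply: contraLR zl => /avgk_near.
      by rewrite addrAC subrr add0r -leNgt.
    rewrite (_ : \1_ _ z = 1); last first.
      rewrite indicE mem_set//; apply: bounded_box; first by rewrite mulr_ge0// ltW.
      by apply: le_lt_trans zl _; rewrite ltr_pMl// ltr1n.
    rewrite mulr1.
    apply: (@le_trans _ _ (norm1 mu (fun x => (2 ^+ (N * d))%:C * (K (x + z) - K x)))%R).
      have mK : cmeas (fun x => K (x + z) - K x).
        by apply: cmeasB; [exact: cmeas_shift LK.1|exact: LK.1].
      apply: le_norm1; first exact: (cmeas_pair2 mF z).
        by apply: cmeasM => //; exact: cmeas_cst.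
      move=> x; rewrite /F/= !normcM mulrC ler_wpM2r ?normc_ge0//.
      by rewrite [leRHS]normcR ger0_norm//; exact: (avgk_bdd x).2.
    rewrite norm1Z; last by apply: cmeasB; [exact: cmeas_shift LK.1|exact: LK.1].
    by rewrite normcR ger0_norm// EFinM; apply: lee_wpmul2l => //; exact: Kt.
apply: le_trans (norm1_le_box (a := fun=> - (2 * ell)) (b := fun=> 2 * ell) (c := 2 ^+ (N * d) * t) B0 _ _ _) _.
- by rewrite mulr_ge0.
- by move=> i; rewrite -subr_ge0 opprK -mulr2n mulrn_wge0// mulr_ge0// ltW.
- by move=> z; rewrite normcM !normcR !ger0_norm// mulr_ge0.
rewrite lee_fin opprK (_ : 2 * ell + 2 * ell = 2 * (2 * ell)); last by ring.
rewrite prodr_const card_ord 2!exprMn exprVn -exprM le_eqVlt; apply/orP; left; apply/eqP.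
have : 2 ^+ (N * d) != 0 :> R by rewrite expf_neq0.
by move: (2 ^+ (N * d)) => P P0; field.
Qed.

(** Shifting by [t <= 2^-N] along an axis changes the cube of a point only in
    a slab of relative width [2^N t], where it moves to the adjacent cube. *)
Let avg_shift_step i (s t : R) c K : L1n c K -> 0 <= s <= ell -> 0 <= t ->
  (forall z, `|z| <= ell -> (norm1 mu (fun x => K (x + z) - K x)%R <= t%:E)%E) ->
  (norm1 mu (fun x => avg K (x + s *: delta_mx ord0 i) - avg K x)%R <=
   (2 * (2 ^+ N * s * t))%:E)%E.
Proof.
move=> LK /andP[s0 sl] t0 Kt; set v := _ *: _; pose w : 'rV[R]_d := ell *: delta_mx ord0 i.
have LK1 := L1n_L1 LK.
have idxw x : cube_index N (x + w) = cube_index N x + delta_mx ord0 i.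
  apply/rowP => j; rewrite !mxE eqxx/=; case: (j == i); rewrite ?mulr0 ?addr0//.
  by rewrite mulr1 mulrDr mulfV ?gt_eqF// -[1]/(1%:~R) floorDrz ?intr_int// intrKfloor.
pose slab x : R[i] := (if cube_index N (x + v) == cube_index N x then 0 else 1)%:C.
have mslab : cmeas slab.
  apply: cmeasR; have m2 := measurable_cube_index2 (R := R) N
    (fun m : 'rV[int]_d * 'rV[int]_d => if m.2 == m.1 then 0 else 1 : R).
  have mp : measurable_fun setT (fun x : 'rV[R]_d => (x, x + v)).
    apply: measurable_fun_pair => //; have := @measurable_rV_affine R d 1 v.
    by under eq_fun do (rewrite scale1r).
  exact: (measurableT_comp m2 mp).
have slabw x : slab x != 0 -> cube_index N (x + v) = cube_index N (x + w).
  rewrite /slab; case: ifPn => [|xv _]; first by rewrite eqxx.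
  rewrite idxw; apply/rowP => j; have [->|ji] := eqVneq j i; last first.
    by rewrite !mxE eqxx (negbTE ji)/= mulr0 !addr0.
  rewrite !mxE !eqxx/= mulr1; apply/floor_def; rewrite mulrDr.
  have /andP[f1 f2] := floor_itv (2 ^+ N * x ord0 i).
  have S1 : 2 ^+ N * s <= 1 by rewrite -ler_pdivlMl// mulr1.
  have S0 : 0 <= 2 ^+ N * s by rewrite mulr_ge0.
  rewrite intrD; apply/andP; split; last by move: f2; rewrite intrD; lra.
  rewrite leNgt; apply: contra xv => lt; apply/eqP/rowP => k.
  have [->|ki] := eqVneq k i; last by rewrite !mxE (negbTE ki) andbF/= mulr0 addr0.
  by rewrite !mxE !eqxx/= mulr1; apply: floor_def; rewrite mulrDr intrD; lra.
pose D y := K (y + w) - K y.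
have wl : `|w| <= ell.
  apply: rV_norm_le => [|j]; first exact: ltW.
  by rewrite !mxE eqxx/=; case: (j == i); rewrite ?mulr1 ?mulr0 ?normr0 ?ger0_norm// ltW.
have LD : L1n t D by split; [apply: cmeasB; [exact: cmeas_shift LK.1|exact: LK.1]|exact: Kt].
pose F (p : 'rV[R]_d * 'rV[R]_d) := slab p.1 * (D p.2 * avgk p.1 p.2).
have mF : cmeas F by apply: cmeasM; [exact: (cmeas_comp measurable_fst mslab)|exact: mavg LD.1].
have F1 x : L1 mu (fun y => F (x, y)) by exact: (L1Z (slab x) (L1_avgk x (L1n_L1 LD))).
have -> : norm1 mu (fun x => avg K (x + v) - avg K x)%R = norm1 mu (fun x => cI mu (fun y => F (x, y))).
  congr norm1; apply/funext => x; have [s0'|sx0] := eqVneq (slab x) 0.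
    rewrite (eq_cI _ (g := fun=> 0)) ?cI0; last by move=> y; rewrite /F/= s0' mul0r.
    move: s0'; rewrite /slab; case: eqP => [xv _|_ [/eqP]]; last by rewrite oner_eq0.
    by rewrite (eq_avg _ xv) subrr.
  have sx := slabw x sx0.
  have s1 : slab x = 1 by move: sx0; rewrite /slab; case: ifP => _; rewrite ?eqxx.
  have LKw := L1_avgk (x + w) LK1.
  rewrite (eq_avg _ sx) /avg -(cI_shift w LKw) -cIB; last exact: L1_avgk.
    apply: eq_cI => y; rewrite /F/= s1 mul1r mulrBl; congr (_ * _ - _).
    by rewrite /avgk !idxw (inj_eq (addIr _)).
  have := L1_rV_affine w (oner_neq0 _) LKw; congr L1; apply/funext => y.
  by rewrite scale1r.
apply: le_trans (norm1_cI mF F1) _; rewrite EFinM lee_wpmul2l//.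
apply: (@le_trans _ _ (\int[mu]_y ((2 ^+ N * s)%:E * (normc (D y))%:E))%E).
  apply: ge0_le_integral => //.
  - by move=> y _; exact: norm1_ge0.
  - apply: (measurable_norm1_fubini mu (F := fun p => F (p.2, p.1))).
    apply: (cmeas_comp (h := fun p : 'rV[R]_d * 'rV[R]_d => (p.2, p.1)) _ mF).
    by apply: measurable_fun_pair.
  - by apply: emeasurable_funM; [exact: measurable_cst|exact: cmeas_Enormc LD.1].
  - move=> y _; pose a j : R := if j == i then hi y i - s else lo y j.
    have ab j : a j <= hi y j.
      by rewrite /a; case: eqP => [->|_]; rewrite ?gerBl.
    have mS : cmeas (fun x => slab x * avgk x y).
      by apply: cmeasM => //; under eq_fun do (rewrite avgkC); exact: cmeas_avgk.
    rewrite (_ : norm1 _ _ = (normc (D y))%:E * norm1 mu (fun x => (slab x * avgk x y)%R))%E; last first.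
      by rewrite -norm1Z//; congr norm1; apply/funext => x; rewrite /F/= mulrCA.
    rewrite muleC; apply: lee_wpmul2r; first by rewrite lee_fin normc_ge0.
    have -> : 2 ^+ N * s = 2 ^+ (N * d) * \prod_j (hi y j - a j).
      rewrite (bigD1 i)//= {1}/a eqxx opprB addrC subrK.
      rewrite (eq_bigr (fun j => hi y j - lo y j)); last by move=> j ji; rewrite /a (negbTE ji).
      have := vol1 y; rewrite (bigD1 i)//= lohi => h.
      set Q := \prod_(_ | _) _ in h *; move: h p0; move: (2 ^+ (N * d)) (2 ^+ N) => P E h E0.
      rewrite (_ : P * (s * Q) = E * s * (P * (E^-1 * Q))); last by field; rewrite gt_eqF.
      by rewrite h mulr1.
    apply: norm1_le_box => // x.
    rewrite indicE normcM avgkC /avgk; have [xy|xy] := eqVneq; last first.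
      by rewrite normcR normr0 mulr0 mulr_ge0.
    rewrite normcR ger0_norm// mulrC ler_wpM2l//.
    rewrite /slab normcR; case: ifPn => [_|xv]; first by rewrite normr0.
    rewrite normr1 mem_set// => j; have := cubeP y x; rewrite xy eqxx => /esym/set_mem xb.
    have /andP[xl xh] := xb j; rewrite xh andbT /a; have [ji|//] := eqVneq j i.
    rewrite leNgt; apply: contra xv => lt; rewrite -xy eq_sym cubeP inE => k.
    have /andP[xl' xh'] := xb k; rewrite /v !mxE eqxx/=; have [ki|_] := eqVneq k i.
      by rewrite mulr1; move: lt xl' xh'; rewrite ji ki; lra.
    by rewrite mulr0 addr0 xl'.
rewrite ge0_integralZl//; last 3 first.
- exact: cmeas_Enormc LD.1.
- by move=> x _; rewrite lee_fin normc_ge0.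
- by rewrite lee_fin mulr_ge0.
by rewrite [(_ * t)%:E]EFinM; apply: lee_wpmul2l; [rewrite lee_fin mulr_ge0|exact: LD.2].
Qed.


Let shift_sub G z w : cmeas G ->
  (norm1 mu (fun x => G (x + (z + w)) - G x)%R <=
   norm1 mu (fun x => G (x + z) - G x)%R + norm1 mu (fun x => G (x + w) - G x)%R)%E.
Proof.
move=> mG.
have md v : cmeas (fun x => G (x + v) - G x) by apply: cmeasB => //; exact: cmeas_shift.
rewrite -(norm1_shift w (md z)).
apply: le_trans (norm1D mu (cmeas_shift w (md z)) (md w)).
rewrite le_eqVlt; apply/orP; left; apply/eqP; congr norm1; apply/funext => x.
by rewrite [RHS]addrA subrK [z + w]addrC addrA.
Qed.

Let shift_opp G z : cmeas G ->
  norm1 mu (fun x => G (x - z) - G x)%R = norm1 mu (fun x => G (x + z) - G x)%R.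
Proof.
move=> mG.
have md v : cmeas (fun x => G (x + v) - G x) by apply: cmeasB => //; exact: cmeas_shift.
rewrite -(norm1_shift z (md (- z))) -norm1N; congr norm1; apply/funext => x.
by rewrite addrK opprB.
Qed.

Let shift_mul G v n : cmeas G ->
  (norm1 mu (fun x => G (x + n%:R *: v) - G x)%R <=
   n%:R%:E * norm1 mu (fun x => G (x + v) - G x)%R)%E.
Proof.
move=> mG; elim: n => [|n ih].
  rewrite mul0e /norm1 (eq_integral (fun=> 0%E)) ?integral0// => x _.
  by rewrite scale0r addr0 subrr normc_zero.
rewrite (_ : n.+1%:R = n%:R + 1); last by rewrite -addn1 natrD.
rewrite scalerDl scale1r; apply: le_trans (shift_sub _ _ mG) _.
rewrite EFinD ge0_muleDl// mul1e; exact: leeD2r.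
Qed.

Let avg_shift_axis i (s t : R) c K : L1n c K -> 0 <= t ->
  (forall z, `|z| <= ell -> (norm1 mu (fun x => K (x + z) - K x)%R <= t%:E)%E) ->
  (norm1 mu (fun x => avg K (x + s *: delta_mx ord0 i) - avg K x)%R <=
   (2 * (2 ^+ N * `|s| * t))%:E)%E.
Proof.
move=> LK t0 Kt; have mA := (avg_L1n LK).1.
wlog s0 : s / 0 <= s => [H|].
  have [/H//|s0] := leP 0 s.
  have E : s *: delta_mx ord0 i = - (- s *: delta_mx ord0 i) :> 'rV[R]_d.
    by rewrite scaleNr opprK.
  by rewrite E (shift_opp _ mA) -normrN; apply: H; rewrite oppr_ge0 ltW.
rewrite ger0_norm//; pose n := (Num.trunc (2 ^+ N * s)).+1.
have n0 : 0 < n%:R :> R by rewrite ltr0n.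
have sn : 0 <= s / n%:R <= ell.
  rewrite divr_ge0//= ler_pdivrMr// mulrC ler_pdivlMr// mulrC ltW//.
  exact: truncnS_gt.
have := shift_mul (s / n%:R *: delta_mx ord0 i) n mA.
rewrite scalerA mulrC divfK ?gt_eqF// => /le_trans; apply.
apply: le_trans (lee_wpmul2l _ (avg_shift_step i LK sn t0 Kt)) _; first by rewrite lee_fin.
rewrite -EFinM lee_fin le_eqVlt; apply/orP; left; apply/eqP.
by field; rewrite gt_eqF.
Qed.

(** Averages jump, but only on the boundaries of the cubes: for the L^1 norm,
    shifts act on them in a Lipschitz way. *)
Lemma avg_lipschitz (t : R) c K : L1n c K -> 0 <= t ->
  (forall z, `|z| <= ell -> (norm1 mu (fun x => K (x + z) - K x)%R <= t%:E)%E) ->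
  forall z, (norm1 mu (fun x => avg K (x + z) - avg K x)%R <=
    (d%:R * (2 * (2 ^+ N * t)) * `|z|)%:E)%E.
Proof.
move=> LK t0 Kt z; have mA := (avg_L1n LK).1.
have H (r : seq 'I_d) : (norm1 mu (fun x => avg K (x + \sum_(i <- r) z ord0 i *: delta_mx ord0 i) -
    avg K x)%R <= ((size r)%:R * (2 * (2 ^+ N * t)) * `|z|)%:E)%E.
  elim: r => [|i r ih].
    rewrite big_nil /norm1 (eq_integral (fun=> 0%E)) ?integral0 ?lee_fin ?mul0r// => x _.
    by rewrite addr0 subrr normc_zero.
  rewrite big_cons; apply: le_trans (shift_sub _ _ mA) _.
  rewrite /= (_ : (size r).+1%:R = 1 + (size r)%:R); last by rewrite -add1n natrD.
  rewrite 2!mulrDl mul1r EFinD; apply: leeD => //.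
  apply: le_trans (avg_shift_axis i _ LK t0 Kt) _; rewrite lee_fin.
  rewrite (_ : 2 * (_ * _ * t) = 2 * (2 ^+ N * t) * `|z ord0 i|); last by ring.
  by apply: ler_wpM2l; rewrite ?mulr_ge0//; exact: rV_coord_le.
have := H (index_enum 'I_d).
by rewrite -row_sum_delta /index_enum -enumT size_enum_ord.
Qed.

Lemma avgk_lipschitz y z : (norm1 mu (fun x => avgk y (x + z) - avgk y x)%R <=
    (d%:R * (2 * (2 ^+ N * 2)) * `|z|)%:E)%E.
Proof.
rewrite -(avg_avgk y); apply: (avg_lipschitz (L1n_avgk y)) => // w _.
have mk := cmeas_avgk y.
apply: le_trans (norm1B mu (cmeas_shift w mk) mk) _.
rewrite norm1_shift// (_ : 2%:E = 1 + 1)%E; last by rewrite -EFinD.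
by apply: leeD; exact: (L1n_avgk y).2.
Qed.

End averages.

(** * The size of one averaged block *)

Section block.
Context {R : realType} {d : nat}.
Implicit Types (x y z : 'rV[R]_d) (h K G : 'rV[R]_d -> R[i]) (A C th t : R).
Variable N : nat.
Notation mu := (lebesgue_rV (R := R) d).
Notation E := (@avg R d N).

Let p0 : 0 < 2 ^+ N :> R. Proof. by rewrite exprn_gt0. Qed.

(** Twice averaging is averaging once and [E] is symmetric, so <(E - 1) h, G> =
    - <(E - 1) h, (E - 1) G>: both factors are small when [h] and [G] vary slowly
    on cubes. *)
Let avg_sub_pair A c h G : bdd A h -> L1n c G ->
  cI mu (fun x => (E h x - h x) * G x) =
  - cI mu (fun x => (E h x - h x) * (E G x - G x)).
Proof.
move=> bh LG; have bE := avg_bdd N bh; have LE := avg_L1n N LG.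
have i1 := bdd_L1 bE LG; have i2 := bdd_L1 bh LG.
have i3 := bdd_L1 bE LE; have i4 := bdd_L1 bh LE.
transitivity (cI mu (fun x => E h x * G x) - cI mu (fun x => h x * G x)).
  by rewrite -cIB//; apply: eq_cI => x; rewrite mulrBl.
have -> : cI mu (fun x => (E h x - h x) * (E G x - G x)) =
    (cI mu (fun x => E h x * E G x) - cI mu (fun x => h x * E G x)) -
    (cI mu (fun x => E h x * G x) - cI mu (fun x => h x * G x)).
  rewrite -(cIB i3 i4) -(cIB i1 i2) -(cIB (L1B i3 i4) (L1B i1 i2)).
  by apply: eq_cI => x; rewrite mulrBr !mulrBl.
rewrite -(avg_pair N bE LG) -(avg_pair N bh LG).
rewrite (eq_cI _ (f := fun x => E (E h) x * G x) (g := fun x => E h x * G x)).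
  by rewrite subrr sub0r opprK.
by move=> x; rewrite avg_idem.
Qed.

Let slow_on_cubes th G : Prop :=
  forall z, `|z| <= 2 ^- N -> (norm1 mu (fun x => G (x + z) - G x)%R <= th%:E)%E.

(** A function that is smooth at the scale of the cubes ([t < 2^N]) is close to
    its average; the second small factor [th] comes from the test function. *)
Lemma block_low A C t c th h K G : 0 < t -> bdd A h -> kernel_at C t K -> L1n c G ->
  0 <= th -> slow_on_cubes th G ->
  normc (cI mu (fun x => (E (conv K h) x - conv K h x) * G x)) <=
  16 * (2 ^+ d * 2 ^+ d) * (A * C * th * (t / 2 ^+ N)).
Proof.
move=> t0 bh [sK LK Kz _] LG th0 Gs; have b1 := conv_bdd bh LK.
have A0 := bdd_ge0 bh; have C0 := L1n_ge0 LK.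
rewrite (avg_sub_pair b1 LG) normcN.
have b2 : bdd (2 * (2 * (A * (C * t * 2 ^- N)))) (fun x => E (conv K h) x - conv K h x).
  split; first exact: (bddB (avg_bdd N b1) b1).1.
  move=> x; apply: avg_sup b1 _ => z zN.
  apply: conv_diff bh (L1n_L1 LK) _; split.
    by apply: cmeasB; [exact: cmeas_shift LK.1|exact: LK.1].
  apply: le_trans (Kz z) _; rewrite lee_fin; apply: ler_wpM2l => //.
  by rewrite mulr_ge0// ltW.
apply: le_trans (normc_cI_bdd b2 (avg_sub_L1n LG th0 Gs)) _.
by rewrite le_eqVlt; apply/orP; left; apply/eqP; ring.
Qed.

(** A function that oscillates below the scale of the cubes has a small average:
    its kernel has mean zero and only sees the increments of [E G]. *)
Lemma block_high A C t c th h K G : 0 < t -> bdd A h -> kernel_at C t K ->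
  cI mu K = 0 -> L1n c G -> 0 <= th -> slow_on_cubes th G ->
  normc (cI mu (fun x => E (conv K h) x * G x)) <=
  8 * d%:R * (A * C * th * (2 ^+ N / t)).
Proof.
move=> t0 bh [sK LK Kz Km] K0 LG th0 Gs; have b1 := conv_bdd bh LK.
have [B bK] := schwartz_bdd sK; have LE := avg_L1n N LG.
rewrite (avg_pair N b1 LG) (conv_pair bh LK bK LE).
have L0 : 0 <= d%:R * (2 * (2 ^+ N * th)) by rewrite !mulr_ge0.
apply: le_trans (normc_cI_bdd bh (corr_lipschitz LK bK LE K0 Km L0 (avg_lipschitz LG th0 Gs))) _.
by rewrite le_eqVlt; apply/orP; left; apply/eqP; ring.
Qed.

(** [2^-|j - N|], the gain in [block_pair] for a block of frequency [2^j]. *)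
Definition rho j : R := if (j <= N)%N then 2 ^+ j / 2 ^+ N else 2 ^+ N / 2 ^+ j.
(** How little a kernel of scale [2^-k] varies on cubes of side [2^-N]. *)
Definition sig k : R := if (k <= N)%N then 2 ^+ k / 2 ^+ N else 1.
Definition blockC : R := 16 * (2 ^+ d * 2 ^+ d) * (1 + d%:R).

Lemma rho_ge0 j : 0 <= rho j. Proof. by rewrite /rho; case: ifP => _; rewrite divr_ge0. Qed.
Lemma sig_ge0 k : 0 <= sig k. Proof. by rewrite /sig; case: ifP => _; rewrite ?divr_ge0. Qed.

Let dd1 : 1 <= 2 ^+ d * 2 ^+ d :> R.
Proof. by rewrite -exprD exprn_ege1// ler1n. Qed.

Let le_blockC1 (X : R) : 0 <= X -> 16 * (2 ^+ d * 2 ^+ d) * X <= blockC * X.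
Proof.
move=> X0; apply: ler_wpM2r => //; rewrite /blockC mulrDr mulr1 lerDl.
by rewrite !mulr_ge0.
Qed.

Let le_blockC2 (X : R) : 0 <= X -> 8 * d%:R * X <= blockC * X.
Proof.
move=> X0; apply: ler_wpM2r => //; rewrite /blockC; move: dd1; set a := _ * _ => a1.
have a0 : 0 <= a - 1 by rewrite subr_ge0.
have d0 : 0 <= d%:R :> R by [].
rewrite -subr_ge0 (_ : _ - _ = 16 * (a - 1) * (1 + d%:R) + (8 * d%:R + 16)); last by ring.
by apply: addr_ge0; [rewrite !mulr_ge0// addr_ge0|lra].
Qed.

(** The part of [E h~] beyond [h~] itself, for [j] up to the scale of the cubes. *)
Definition rest j h x : R[i] := E h x - (if (j <= N)%N then h x else 0).

Lemma block_pair j A C c th h K G : bdd A h -> kernel_at C (2 ^+ j) K ->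
  ((N < j)%N -> cI mu K = 0) -> L1n c G -> 0 <= th -> slow_on_cubes th G ->
  normc (cI mu (fun x => rest j (conv K h) x * G x)) <=
  blockC * (A * C * th * rho j).
Proof.
move=> bh kK K0 LG th0 Gs.
have A0 := bdd_ge0 bh; have C0 : 0 <= C by case: kK => _ /L1n_ge0.
have t0 : 0 < 2 ^+ j :> R by rewrite exprn_gt0.
have X0 : 0 <= A * C * th * rho j by rewrite !mulr_ge0// rho_ge0.
move: X0; rewrite /rest /rho; case: leqP => jN X0.
  by apply: le_trans (block_low t0 bh kK LG th0 Gs) _; exact: le_blockC1.
under eq_cI do rewrite subr0.
by apply: le_trans (block_high t0 bh kK (K0 jN) LG th0 Gs) _; exact: le_blockC2.
Qed.

Lemma kernel_slow_on_cubes C k K x : 0 <= C -> kernel_at C (2 ^+ k) K ->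
  slow_on_cubes (2 * C * sig k) (fun y => K (x - y)).
Proof.
move=> C0 [sK LK Kz _] z zN.
have mD : cmeas (fun y => K (y - z) - K y).
  by apply: cmeasB; [exact: cmeas_shift LK.1|exact: LK.1].
have -> : norm1 mu (fun y => K (x - (y + z)) - K (x - y))%R = norm1 mu (fun y => K (y - z) - K y)%R.
  rewrite -(norm1_reflect x mD); congr norm1; apply/funext => y.
  by rewrite opprD addrA.
rewrite /sig; case: ifP => _.
  apply: le_trans (Kz (- z)) _; rewrite normrN lee_fin.
  apply: (@le_trans _ _ (C * 2 ^+ k * 2 ^- N)); first by apply: ler_wpM2l; rewrite ?mulr_ge0.
  have Y0 : 0 <= C * (2 ^+ k / 2 ^+ N) by rewrite mulr_ge0// divr_ge0.
  by rewrite -mulrA -[2 * C * _]mulrA; lra.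
apply: le_trans (norm1B mu (cmeas_shift (- z) LK.1) LK.1) _.
rewrite norm1_shift ?mulr1; last exact: LK.1.
by rewrite mulr_natl mulr2n EFinD; apply: leeD; exact: LK.2.
Qed.

Lemma block_conv j k A C h K L x : bdd A h -> kernel_at C (2 ^+ j) K ->
  ((N < j)%N -> cI mu K = 0) -> kernel_at C (2 ^+ k) L ->
  normc (conv L (rest j (conv K h)) x) <= blockC * (A * C * (2 * C * sig k) * rho j).
Proof.
move=> bh kK K0 kL; have C0 : 0 <= C by case: kK => _ /L1n_ge0.
have [_ LL _ _] := kL.
apply: (block_pair bh kK K0 (L1n_reflect x LL)); first by rewrite !mulr_ge0// sig_ge0.
exact: kernel_slow_on_cubes.
Qed.

(** The pointwise bound: test with the averaging kernel itself, which has no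
    smoothness ([th = 2]). *)
Lemma block_sup j A C h K : bdd A h -> kernel_at C (2 ^+ j) K -> (N < j)%N ->
  cI mu K = 0 -> bdd (blockC * (A * C * 2 * rho j)) (E (conv K h)).
Proof.
move=> bh kK jN K0; have [_ LK _ _] := kK; have b1 := conv_bdd bh LK.
split; first exact: (avg_bdd N b1).1.
move=> x; have := @block_pair j A C 1 2 h K (avgk N x) bh kK (fun _ => K0) (L1n_avgk N x) (ler0n _ _).
have -> : cI mu (fun y => rest j (conv K h) y * avgk N x y) = E (conv K h) x.
  by rewrite -avg_idem; apply: eq_cI => y; rewrite /rest leqNgt jN subr0.
apply.
move=> z _; have mk := cmeas_avgk N x.
apply: le_trans (norm1B mu (cmeas_shift z mk) mk) _.
rewrite norm1_shift// (_ : 2%:E = 1 + 1)%E; last by rewrite -EFinD.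
by apply: leeD; exact: (L1n_avgk N x).2.
Qed.

End block.

(** * Bounded representatives of distributions *)

Section representatives.
Context {R : realType} {d : nat}.
Implicit Types (x y z : 'rV[R]_d) (f g h w : 'rV[R]_d -> R[i]) (A : R)
  (u v : functional R d).
Notation mu := (lebesgue_rV (R := R) d).

Let muT_gt0 : (0 < mu setT)%E.
Proof.
have ab (i : 'I_d) : (0 : R) <= 1 by [].
apply: (@lt_le_trans _ _ (mu (box (fun=> 0) (fun=> 1)))).
  by rewrite (box_volume ab) lte_fin prodr_gt0// => i _; rewrite subr0.
by apply: le_measure; rewrite ?inE//; exact: measurable_box.
Qed.

Lemma cI_ae_eq f g : cmeas f -> cmeas g -> {ae mu, forall x, f x = g x} -> cI mu f = cI mu g.
Proof.
move=> [f1 f2] [g1 g2] fg.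
by apply: complex_ext; congr fine; apply: ae_eq_integral => //;
  try exact/measurable_EFinP; apply: filterS fg => x /= -> _.
Qed.

Lemma brep_dist_Lnorm A h u : brep A h u -> (dist_Lnorm +oo u <= A%:E)%E.
Proof.
move=> [bh uE]; apply: ge_ereal_inf; exists (Lnorm mu +oo (fun x => (normc (h x))%:E)); last first.
  rewrite unlock muT_gt0; apply/ess_sup_inf.ess_supP; apply: nearW => x /=.
  by rewrite lee_fin ger0_norm ?normc_ge0//; exact: bh.2.
exists h => //; split; first exact: bh.1.
  by move=> g sg; have [c Lg] := schwartz_L1n sg; apply: L1_integrable; exact: bdd_L1 bh Lg.
by move=> g sg; rewrite uE.
Qed.

(** An essential bound becomes a bound everywhere after truncation. *)
Lemma dist_Lnorm_brep A u : (dist_Lnorm +oo u < A%:E)%E -> exists h, brep A h u.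
Proof.
move=> /ereal_inf_lt[_ [h [mh ih hu] <-]].
rewrite unlock muT_gt0 => hA.
have ae : {ae mu, forall x, normc (h x) <= A}.
  have /ess_sup_inf.ess_supP := ltW hA; apply: filterS => x /=.
  by rewrite lee_fin ger0_norm// normc_ge0.
have A0 : 0 <= A.
  rewrite leNgt; apply/negP => A0; have [N [mN N0 NP]] := ae.
  suff : (mu setT <= mu N)%E by rewrite N0 leNgt muT_gt0.
  apply: le_measure; rewrite ?inE// => x _; apply: NP => /= hx.
  by have := lt_le_trans A0 (normc_ge0 (h x)); rewrite ltNge hx.
pose k x := if normc (h x) <= A then h x else 0.
have mk : cmeas k.
  have m : measurable_fun setT (fun x => normc (h x) <= A).
    by apply: measurable_fun_ler; [exact: cmeas_normc|exact: measurable_cst].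
  split; rewrite /k.
    rewrite (_ : (fun _ => _) = (fun x => if normc (h x) <= A then cRe (h x) else 0)).
      by apply: measurable_fun_ifT => //; exact: mh.1.
    by apply/funext => x; case: ifP.
  rewrite (_ : (fun _ => _) = (fun x => if normc (h x) <= A then cIm (h x) else 0)).
    by apply: measurable_fun_ifT => //; exact: mh.2.
  by apply/funext => x; case: ifP.
exists k; split.
  by split => // x; rewrite /k; case: ifP => // _; rewrite normc_zero.
move=> g sg; rewrite -hu//; have mg := schwartz_cmeas sg.
apply: cI_ae_eq; [exact: cmeasM mh mg|exact: cmeasM|].
by apply: filterS ae => x hx; rewrite /k hx.
Qed.

Lemma represents_L1 h u g : represents h u -> schwartz g -> L1 mu (fun x => h x * g x).
Proof. by move=> [_ ih _] /ih[i1 i2]; exact: integrable_L1. Qed.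

Lemma brep_represents A h u : brep A h u -> represents h u.
Proof.
move=> [bh uE]; split; first exact: bh.1.
  by move=> g sg; have [c Lg] := schwartz_L1n sg; apply: L1_integrable; exact: bdd_L1 bh Lg.
by move=> g sg; rewrite uE.
Qed.

Lemma dyadic_avgE N f x : L1 mu (fun y => f y * avgk N x y) -> dyadic_avg N f x = avg N f x.
Proof.
move=> Lf; rewrite /dyadic_avg.
rewrite -(@fsbig_widen _ _ _ _ [set cube_index N x])//; last first.
  move=> m [_ /= mx]; rewrite /= indicE dyadic_cubeE memNset/= ?mul0r//.
  by move=> /= xm; apply: mx.
rewrite fsbig_set1 indicE dyadic_cubeE mem_set//= mul1r.
have p0 : 2 ^+ (N * d) != 0 :> R[i] by rewrite expf_neq0// pnatr_eq0.
have E : (fun y => f y * avgk N x y) = fun y =>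
    (2 ^+ (N * d)) * (if cube_index N x == cube_index N y then f y else 0).
  apply/funext => y; rewrite /avgk; case: ifP => _; last by rewrite !mulr0.
  by rewrite mulrC; congr (_ * _); rewrite rmorphXn/= rmorph_nat.
have L : L1 mu (fun y => if cube_index N x == cube_index N y then f y else 0).
  have := L1Z (2 ^+ (N * d))^-1 Lf; congr L1; apply/funext => y.
  by rewrite (congr1 (fun F => F y) E) mulKf.
rewrite /avg E cIZ//; congr (_ * _); rewrite /cintegral /cI.
congr (_ +i* _); rewrite Rintegral_mkcond; apply: eq_Rintegral => y _; rewrite patchE.
  case: ifPn => [/set_mem /= ->|]; first by rewrite eqxx.
  by case: eqP => [xy /negP[]|//]; rewrite in_setE.
case: ifPn => [/set_mem /= ->|]; first by rewrite eqxx.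
by case: eqP => [xy /negP[]|//]; rewrite in_setE.
Qed.

End representatives.

(** * Averages do not depend on the representative *)

Section du_bois_reymond.
Context {R : realType} {d : nat}.
Implicit Types (x y z : 'rV[R]_d) (f g h w : 'rV[R]_d -> R[i]) (A : R).
Variable eta0 : 'rV[R]_d -> R[i].
Hypothesis eta0P : lp_cutoff eta0.
Notation mu := (lebesgue_rV (R := R) d).

Lemma cutoff_eq1 xi : enorm xi <= 4^-1 -> eta0 xi = 1.
Proof. by case: eta0P => _ _; apply. Qed.

Lemma cutoff_eq0 xi : 3 / 8 <= enorm xi -> eta0 xi = 0.
Proof.
case: eta0P => _ supp _; apply: contraTeq => nz; rewrite -ltNge.
by apply: supp; exact: subset_closure.
Qed.

Lemma schwartz_cutoff : schwartz eta0.
Proof.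
case: eta0P => sm _ _; apply: (schwartz_compact (M := 1)) => // x x1.
apply: cutoff_eq0; apply: le_trans (norm_le_enorm x).
by apply: ltW; apply: le_lt_trans x1; rewrite ler_pdivrMr//; lra.
Qed.

Let one : 'rV[R]_d := const_mx 1.

(** A nonnegative bump supported in the open positive orthant: averages over
    half-open cubes of translates towards that orthant converge pointwise. *)
Let psi z : R[i] := eta0 (z - one) * (eta0 (z - one))^*%C.

Let psiE z : psi z = (normc (eta0 (z - one)) ^+ 2)%:C.
Proof.
rewrite /psi; case: (eta0 _) => a b; apply: complex_ext => /=; last by ring.
by rewrite sqr_sqrtr ?addr_ge0 ?sqr_ge0//; ring.
Qed.

Let schwartz_psi : schwartz psi.
Proof.
have s1 : schwartz (fun z => eta0 (z - one)).
  by have := schwartz_affine (- one) (oner_neq0 _) schwartz_cutoff;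
    under eq_fun do (rewrite scale1r).
by apply: schwartzM => //; exact: schwartz_conj.
Qed.

Let psi_supp z i : psi z != 0 -> 5 / 8 < z ord0 i < 11 / 8.
Proof.
move=> nz; have : enorm (z - one) < 3 / 8.
  rewrite ltNge; apply: contra nz => h; rewrite /psi (cutoff_eq0 h) mul0r//.
move=> /(le_lt_trans (coord_le_enorm _ i)); rewrite !mxE ltr_norml => /andP[h1 h2].
by apply/andP; split; lra.
Qed.

Let cI_psi : cI mu psi != 0.
Proof.
pose e : R := (4 * (1 + d%:R))^-1.
have e0 : 0 < e by rewrite invr_gt0 mulr_gt0// ltr_pwDl.
pose a (i : 'I_d) : R := 1 - e; pose b (i : 'I_d) : R := 1 + e.
have ab i : a i <= b i by rewrite /a /b; lra.
have L := schwartz_L1 schwartz_psi; have [i1 _] := L1_integrable L.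
have bE x : box a b x -> psi x = 1.
  move=> xb; rewrite psiE cutoff_eq1 ?normc_one ?expr1n//.
  apply: le_trans (enorm_le_norm _) _.
  rewrite mulrC -ler_pdivlMr ?ltr_pwDl// -invfM; apply: rV_norm_le => [|i]; first exact: ltW.
  have /andP[h1 h2] : 1 - e <= x ord0 i < 1 + e by exact: xb i.
  by rewrite -/e !mxE ler_norml; apply/andP; split; lra.
have p0 : 0 < \prod_i (b i - a i) by apply: prodr_gt0 => i _; rewrite /a /b; lra.
suff : \prod_i (b i - a i) <= cRe (cI mu psi).
  by move=> h; apply: contraTneq p0 => E; rewrite -leNgt (le_trans h)// E.
have iE : (\int[mu]_x (\1_(box a b) x)%:E = (\prod_i (b i - a i))%:E)%E.
  by rewrite integral_indic ?setIT//; [exact: box_volume|exact: measurable_box].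
have fin : (\int[mu]_x (cRe (psi x))%:E)%E \is a fin_num by exact: integrable_fin_num i1.
rewrite -lee_fin /= /Rintegral fineK// -iE.
apply: ge0_le_integral => //.
- by apply/measurable_EFinP; apply: measurable_indic; exact: measurable_box.
- by apply/measurable_EFinP; exact: L.1.1.
- move=> x _; rewrite lee_fin indicE; have [/set_mem xb|_] := boolP (x \in _).
    by rewrite bE.
  by rewrite psiE /= sqr_ge0.
Qed.

Lemma orthant_bump : exists psi : 'rV[R]_d -> R[i], [/\ schwartz psi,
  forall z i, psi z != 0 -> 5 / 8 < z ord0 i < 11 / 8 & cI mu psi != 0].
Proof. by exists psi; split. Qed.

(** Mollify the indicator function of the cube around [x] by the bump, and pass to
    the limit. *)
Lemma du_bois_reymond N w x : cmeas w ->
  (forall g, schwartz g -> L1 mu (fun y => w y * g y)) ->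
  (forall g, schwartz g -> cI mu (fun y => w y * g y) = 0) ->
  L1 mu (fun y => w y * avgk N x y) /\ cI mu (fun y => w y * avgk N x y) = 0.
Proof.
move=> mw Lw w0; set ind := avgk N x; have mind := cmeas_avgk N x.
have [B0 bind] : exists B, bdd B ind by eexists; exact: avgk_bdd.
pose r : R := `|x| + 3.
have r0 : 0 < r by rewrite ltr_wpDl.
pose lam : R := (4 * (1 + d%:R) * r)^-1.
have lam0 : 0 < lam by rewrite invr_gt0 !mulr_gt0// ltr_pwDl.
have d1 : 0 < 1 + d%:R :> R by rewrite ltr_pwDl.
pose W y := w y * eta0 (lam *: y).
have LW : L1 mu W.
  apply: Lw; have := schwartz_affine 0 (lt0r_neq0 lam0) schwartz_cutoff.
  by under eq_fun do (rewrite addr0).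
have W_ge y : `|y| <= r -> W y = w y.
  move=> yr; rewrite /W cutoff_eq1 ?mulr1// enormZ ger0_norm ?(ltW lam0)//.
  apply: le_trans (ler_wpM2l (ltW lam0) (enorm_le_norm y)) _.
  apply: le_trans (_ : lam * ((1 + d%:R) * r) <= _).
    by rewrite !ler_wpM2l// ltW.
  by rewrite /lam le_eqVlt; apply/orP; left; apply/eqP; field; rewrite !gt_eqF.
have ind_near y : ind y != 0 -> `|y - x| <= 1.
  move=> /avgk_near h; apply: le_trans h _.
  by rewrite invf_le1 ?exprn_gt0// exprn_ege1// ler1n.
have Lind : L1 mu (fun y => w y * ind y).
  apply: (L1_leZ _ LW (c := B0)); first exact: cmeasM.
  move=> y; rewrite normcM mulrC; have [->|/ind_near yx] := eqVneq (ind y) 0.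
    by rewrite normc_zero mul0r mulr_ge0 ?normc_ge0// (bdd_ge0 bind).
  rewrite W_ge ?ler_wpM2r ?normc_ge0//; first exact: bind.2.
  rewrite -[y](subrK x); apply: le_trans (ler_normD _ _) _; rewrite /r; lra.
split => //.
have Lpsi := schwartz_L1 schwartz_psi.
have [P bpsi] := schwartz_bdd schwartz_psi; have [cp Lnpsi] := L1_L1n Lpsi.
pose Phi n y := cI mu (fun z => ind (n.+1%:R^-1 *: z + y) * psi z).
have n0 n : 0 < n.+1%:R^-1 :> R by rewrite invr_gt0 ltr0n.
have mindn n : cmeas (fun p : 'rV[R]_d * 'rV[R]_d => ind (n.+1%:R^-1 *: p.2 + p.1)).
  apply: (cmeas_comp (h := fun p : 'rV[R]_d * 'rV[R]_d => n.+1%:R^-1 *: p.2 + p.1) _ mind).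
  apply: measurable_fun_rV => i; under eq_fun do (rewrite !mxE).
  apply: measurable_funD; last exact: (measurableT_comp (measurable_rV_coord i) measurable_fst).
  apply: measurable_funM; first exact: measurable_cst.
  exact: (measurableT_comp (measurable_rV_coord i) measurable_snd).
have Lz n y : L1 mu (fun z => ind (n.+1%:R^-1 *: z + y) * psi z).
  have bn : bdd B0 (fun z => ind (n.+1%:R^-1 *: z + y)).
    by split; [exact: (cmeas_pair1 (mindn n) y)|move=> z; exact: bind.2].
  exact: bdd_L1 bn Lnpsi.
(* the support of the bump keeps the averages local *)
have near0 n y z : r < `|y| -> ind (n.+1%:R^-1 *: z + y) * psi z = 0.
  move=> ry; have [->|pz] := eqVneq (psi z) 0; first by rewrite mulr0.
  have [->|/ind_near iz] := eqVneq (ind (n.+1%:R^-1 *: z + y)) 0; first by rewrite mul0r.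
  exfalso; move: ry; rewrite ltNge => /negP; apply.
  have z2 : `|n.+1%:R^-1 *: z| <= 2.
    rewrite normrZ ger0_norm ?(ltW (n0 n))//.
    apply: le_trans (_ : 1 * `|z| <= _).
      by rewrite ler_wpM2r// invf_le1// ler1n.
    rewrite mul1r; apply: rV_norm_le => // i.
    have := psi_supp i pz; rewrite ler_norml => /andP[h1 h2]; lra.
  have -> : y = (n.+1%:R^-1 *: z + y - x) + x - n.+1%:R^-1 *: z.
    by rewrite subrK addrAC subrr add0r.
  apply: le_trans (ler_normB _ _) _; have := ler_normD (n.+1%:R^-1 *: z + y - x) x.
  rewrite /r; lra.
have C0 : 0 <= 2 * (B0 * cp) by rewrite !mulr_ge0 ?(bdd_ge0 bind) ?(L1n_ge0 Lnpsi).
have mPhi n : cmeas (fun y => w y * Phi n y).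
  apply: cmeasM => //.
  apply: (cmeas_cI mu (F := fun p : 'rV[R]_d * 'rV[R]_d => ind (n.+1%:R^-1 *: p.2 + p.1) * psi p.2)).
  by apply: cmeasM => //; exact: (cmeas_comp measurable_snd Lpsi.1).
have PhiW n y : normc (w y * Phi n y) <= normc ((2 * (B0 * cp))%:C * W y).
  rewrite normcM [leRHS]normcM normcR (ger0_norm C0) mulrC.
  have [yr|yr] := leP `|y| r.
    rewrite W_ge// ler_wpM2r ?normc_ge0//.
    have bn : bdd B0 (fun z => ind (n.+1%:R^-1 *: z + y)).
      by split; [exact: (cmeas_pair1 (mindn n) y)|move=> z; exact: bind.2].
    exact: normc_cI_bdd bn Lnpsi.
  rewrite /Phi (eq_cI _ (g := fun=> 0)) => [|z]; last exact: near0.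
  by rewrite cI0 normc_zero mul0r mulr_ge0 ?normc_ge0.
have LPhi n : L1 mu (fun y => w y * Phi n y).
  exact: L1_le (mPhi n) (L1Z _ LW) (PhiW n).
have Phi0 n : cI mu (fun y => w y * Phi n y) = 0.
  pose t : R := n.+1%:R^-1; pose s : R := n.+1%:R.
  have s0 : s != 0 by rewrite pnatr_eq0.
  pose F (p : 'rV[R]_d * 'rV[R]_d) := ind p.1 * (w p.2 * psi (s *: (p.1 - p.2))).
  have spsi v : schwartz (fun y => psi (s *: (v - y))).
    have sN : - s != 0 by rewrite oppr_eq0.
    have := schwartz_affine (s *: v) sN schwartz_psi; congr schwartz; apply/funext => y.
    by rewrite scalerBr scaleNr addrC.
  have spsi' y : schwartz (fun v => psi (s *: (v - y))).
    have := schwartz_affine (- (s *: y)) s0 schwartz_psi; congr schwartz; apply/funext => v.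
    by rewrite scalerBr.
  have mF : cmeas F.
    apply: cmeasM; first exact: (cmeas_comp measurable_fst mind).
    apply: cmeasM; first exact: (cmeas_comp measurable_snd mw).
    have := cmeas_affine s 0 Lpsi.1; under eq_fun do (rewrite addr0).
    exact: (cmeas_comp measurable_rV_sub).
  have F1 v : L1 mu (fun y => F (v, y)) by exact: (L1Z (ind v) (Lw _ (spsi v))).
  have F2 y : L1 mu (fun v => F (v, y)).
    have [c Lc] := schwartz_L1n (spsi' y).
    have := L1Z (w y) (bdd_L1 bind Lc); congr L1; apply/funext => v.
    by rewrite /F/= mulrCA.
  have FW v y : normc (F (v, y)) <= normc (ind v * (P%:C * W y)).
    rewrite /F/=; have [yr|yr] := leP `|y| r.
      rewrite W_ge// normcM [leRHS]normcM ler_wpM2l ?normc_ge0// normcM [leRHS]normcM mulrC ler_wpM2r ?normc_ge0//.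
      by rewrite normcR ger0_norm ?(bdd_ge0 bpsi)//; exact: bpsi.2.
    rewrite mulrCA; have := near0 n y (s *: (v - y)) yr.
    rewrite scalerA mulVf// scale1r subrK => ->.
    by rewrite mulr0 normc_zero normc_ge0.
  have F12 : (\int[mu]_v norm1 mu (fun y => F (v, y)) < +oo)%E.
    have [cW LnW] := L1_L1n LW; have [ci Lni] := L1_L1n (L1n_L1 (L1n_avgk N x)).
    apply: (@le_lt_trans _ _ (\int[mu]_v ((normc (ind v))%:E * (P * cW)%:E))%E).
      apply: ge0_le_integral => //.
      - by move=> v _; exact: norm1_ge0.
      - exact: measurable_norm1_fubini.
      - by apply: emeasurable_funM; [exact: cmeas_Enormc|exact: measurable_cst].
      - move=> v _; have mPW : cmeas (fun y => P%:C * W y) by apply: cmeasM; [exact: cmeas_cst|exact: LW.1].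
        apply: le_trans (le_norm1 mu (F1 v).1 _ (FW v)) _; first by apply: cmeasM => //; exact: cmeas_cst.
        rewrite norm1Z//; apply: lee_wpmul2l; first by rewrite lee_fin normc_ge0.
        rewrite norm1Z; last exact: LW.1.
        rewrite normcR ger0_norm ?(bdd_ge0 bpsi)// EFinM.
        by apply: lee_wpmul2l; [rewrite lee_fin (bdd_ge0 bpsi)|exact: LnW.2].
    rewrite ge0_integralZr//; last 3 first.
    - exact: cmeas_Enormc.
    - by move=> v _; rewrite lee_fin normc_ge0.
    - by rewrite lee_fin mulr_ge0 ?(bdd_ge0 bpsi) ?(L1n_ge0 LnW).
    apply: le_lt_trans (lee_wpmul2r _ Lni.2) _; last by rewrite -EFinM ltry.
    by rewrite lee_fin mulr_ge0 ?(bdd_ge0 bpsi) ?(L1n_ge0 LnW).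
  have t0 : t != 0 by rewrite invr_eq0.
  have E y : w y * Phi n y = (`|t| ^- d)%:C * cI mu (fun v => F (v, y)).
    have [c Lc] := schwartz_L1n (spsi' y).
    have L := bdd_L1 bind Lc.
    rewrite /F/= (eq_cI _ (g := fun v => w y * (ind v * psi (s *: (v - y))))).
      rewrite cIZ// mulrCA -(cI_affine y t0 L); congr (_ * _); apply: eq_cI => z.
      by rewrite addrK scalerA mulfV// scale1r.
    by move=> v; rewrite mulrCA.
  rewrite (eq_cI mu E) cIZ; last first.
    have := L1Z ((`|t| ^- d)%:C^-1) (LPhi n); congr L1; apply/funext => y.
    rewrite E mulKf// (_ : 0 = 0%:C)// (inj_eq (@complexI R)) invr_eq0 expf_neq0//.
    by rewrite normr_eq0.
  rewrite -(cI_fubini mF F1 F2 F12) (eq_cI _ (g := fun=> 0)) ?cI0 ?mulr0// => v.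
  rewrite (cIZ (ind v) (Lw _ (spsi v))) w0 ?mulr0//; exact: spsi.
have c1 : ccvg (fun n => cI mu (fun y => w y * Phi n y)) (cI mu (fun y => w y * (ind y * cI mu psi))).
  apply: (@cI_cvg _ _ _ _ _ _ (fun y => (2 * (B0 * cp))%:C * W y)).
  - exact: mPhi.
  - by apply: cmeasM => //; apply: cmeasM => //; exact: cmeas_cst.
  - exact: L1Z.
  - exact: PhiW.
  - move=> y; apply: (ccvgMl (w y)).
    rewrite -cIZ//; apply: (@cI_cvg _ _ _ _ _ _ (fun z => B0%:C * psi z)).
    + by move=> n; exact: (Lz n y).1.
    + by apply: cmeasM; [exact: cmeas_cst|exact: Lpsi.1].
    + exact: L1Z.
    + move=> n z; rewrite normcM [leRHS]normcM normcR ger0_norm ?(bdd_ge0 bind)//.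
      by rewrite ler_wpM2r ?normc_ge0//; exact: bind.2.
    + move=> z; have [->|pz] := eqVneq (psi z) 0.
        by rewrite !mulr0; apply: eq_ccvg (ccvg_cst 0) => n; rewrite mulr0.
      apply: cvg_near_cst.
      have : \forall n \near \oo, forall i, cube_index N (n.+1%:R^-1 *: z + y) ord0 i = cube_index N y ord0 i.
        apply: filter_forall => i.
        have /andP[z1 z2] := psi_supp i pz; set a := 2 ^+ N * y ord0 i.
        have gap0 : 0 < (Num.floor a + 1)%:~R - a by rewrite subr_gt0 floorD1_gt.
        have p0 : 0 < 2 ^+ N * 2 :> R by rewrite mulr_gt0 ?exprn_gt0.
        have /cvgrPdist_lt H := @cvg_harmonic0 R; have := H _ (divr_gt0 gap0 p0).
        apply: filterS => n; rewrite sub0r normrN ger0_norm ?(ltW (n0 n))// ltr_pdivlMr// => h.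
        rewrite !mxE; apply/floor_def; rewrite mulrDr -/a; apply/andP; split.
          apply: le_trans (floor_le a) _; rewrite lerDr mulr_ge0// mulr_ge0 ?(ltW (n0 n))//.
          by apply: ltW; apply: lt_trans z1.
        rewrite -ltrBrDr; apply: le_lt_trans h.
        rewrite mulrCA ler_wpM2l ?(ltW (n0 n))// ler_wpM2l ?ltW ?exprn_gt0//.
        by lra.
      apply: filterS => n h; rewrite /ind /avgk (_ : cube_index N (_ + y) = cube_index N y).
        by rewrite subrr normc_zero.
      by apply/rowP => i; rewrite h.
have c2 : ccvg (fun n => cI mu (fun y => w y * Phi n y)) 0.
  by apply: eq_ccvg (ccvg_cst 0) => n; rewrite Phi0.
have := ccvg_unique c1 c2.
rewrite (eq_cI _ (g := fun y => cI mu psi * (w y * ind y))); last by move=> y; ring.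
by rewrite cIZ// => /eqP; rewrite mulf_eq0 (negbTE cI_psi)/= => /eqP.
Qed.

End du_bois_reymond.

(** * Weighted sequence norms *)

Section sequences.
Context {R : realType}.
Implicit Types (q : \bar R) (r : nat -> R) (M : R).

(** The l^q quasi-norm of [r] is at most [M], by finite sums; see [Lnorm_lqn]. *)
Definition lqn q M r : Prop :=
  match q with
  | p%:E => forall n, \sum_(k < n) r k `^ p <= M `^ p
  | _ => forall k, r k <= M
  end.

Let counting_gt0 : (0 < @counting nat R setT)%E.
Proof.
apply: (@lt_le_trans _ _ (@counting nat R [set 0%N])).
  by rewrite /counting/= asboolT// fset_set1 finmap.cardfs1.
by apply: le_measure; rewrite ?inE.
Qed.

Let le_poweR (p : R) (x y : \bar R) : 0 <= p -> (0 <= x)%E -> (x <= y)%E -> (x `^ p <= y `^ p)%E.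
Proof.
move=> p0 x0 xy; apply: gt0_ler_poweR => //; rewrite in_itv/= ?leey ?andbT//.
exact: le_trans xy.
Qed.

Let counting_ae (P : nat -> Prop) : {ae @counting nat R, forall k, P k} -> forall k, P k.
Proof.
move=> [N [mN N0 NP]] k; apply: contrapT => nPk.
have : (@counting nat R [set k] <= @counting nat R N)%E.
  by apply: le_measure; rewrite ?inE// => _ ->; exact: NP.
by rewrite N0 /counting/= asboolT// fset_set1 finmap.cardfs1 lee_fin ler10.
Qed.

Lemma Lnorm_lqn q M r : (0 < q)%E -> 0 <= M -> (forall k, 0 <= r k) ->
  (Lnorm counting q (EFin \o r) <= M%:E)%E <-> lqn q M r.
Proof.
move=> q0 M0 r0; case: q q0 => [p|_|//].
- rewrite lte_fin => p0; rewrite Lnorm_counting//.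
  have E : (\sum_(k <oo) `|(EFin \o r) k| `^ p)%E = (\sum_(k <oo) (r k `^ p)%:E)%E.
    by apply: eq_eseriesr => k _; rewrite /= ger0_norm.
  rewrite E; split => [h n|h].
    have h2 : (\sum_(k <oo) (r k `^ p)%:E <= (M `^ p)%:E)%E.
      rewrite -[leLHS]poweRe1 -?[X in (_ `^ X)%E](mulVf (lt0r_neq0 p0)).
        rewrite poweRrM -poweR_EFin.
        by apply: le_poweR => //; rewrite ?poweR_ge0// ltW.
      by apply: nneseries_ge0 => k _; rewrite lee_fin powR_ge0.
    rewrite -lee_fin -sumEFin; apply: le_trans h2.
    rewrite -(big_mkord xpredT (fun k => (r k `^ p)%:E)).
    by apply: nneseries_lim_ge => k _; rewrite lee_fin powR_ge0.
  have h2 : (\sum_(k <oo) (r k `^ p)%:E <= (M `^ p)%:E)%E.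
    apply: lime_le; first by apply: is_cvg_nneseries => k _ _; rewrite lee_fin powR_ge0.
    by apply: nearW => n; rewrite big_mkord sumEFin lee_fin.
  have p1 : 0 <= p^-1 by rewrite invr_ge0 ltW.
  have s0 : (0 <= \sum_(k <oo) (r k `^ p)%:E)%E.
    by apply: nneseries_ge0 => k _; rewrite lee_fin powR_ge0.
  apply: le_trans (le_poweR p1 s0 h2) _.
  by rewrite poweR_EFin -powRrM mulfV ?lt0r_neq0// powRr1.
- rewrite unlock counting_gt0; split => [|h].
    by move=> /ess_sup_inf.ess_supP/counting_ae h k; have := h k; rewrite /= ger0_norm.
  by apply/ess_sup_inf.ess_supP; apply: nearW => k /=; rewrite lee_fin ger0_norm.
Qed.

Lemma Lnorm_term q (f : nat -> \bar R) k : (0 < q)%E -> (forall k, 0 <= f k)%E ->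
  (f k <= Lnorm counting q f)%E.
Proof.
move=> q0 f0; case: q q0 => [p|_|//].
- rewrite lte_fin => p0; rewrite Lnorm_counting//.
  rewrite -[leLHS](@poweRe1 _)// -[X in (_ `^ X)%E](mulfV (lt0r_neq0 p0)) poweRrM.
  apply: le_poweR; rewrite ?invr_ge0 ?(ltW p0) ?poweR_ge0//.
  have := @nneseries_lim_ge R (fun k => `|f k| `^ p)%E xpredT 0 k.+1.
  move=> /(_ (fun n _ _ => poweR_ge0 _ _)); apply: le_trans.
  rewrite big_nat_recr//= gee0_abs// leeDr//.
  by apply: sume_ge0 => i _; exact: poweR_ge0.
- rewrite unlock counting_gt0; have := ess_sup_inf.ess_sup_ge (@counting nat R) (abse \o f).
  by move=> /counting_ae/(_ k) /=; rewrite gee0_abs.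
Qed.

Lemma le_Lnorm q (f g : nat -> \bar R) : (0 < q)%E -> (forall k, 0 <= f k <= g k)%E ->
  (Lnorm counting q f <= Lnorm counting q g)%E.
Proof.
move=> q0 fg.
have fa k : (`|f k| <= `|g k|)%E.
  by have /andP[f0 fk] := fg k; rewrite !gee0_abs// (le_trans f0).
case: q q0 => [p|_|//].
- rewrite lte_fin => p0; rewrite !Lnorm_counting//; apply: le_poweR.
  + by rewrite invr_ge0 ltW.
  + by apply: nneseries_ge0 => k _ _; rewrite poweR_ge0.
  + apply: lee_nneseries => [k _ _|k _]; first exact: poweR_ge0.
    by apply: le_poweR => //; rewrite ltW.
- by rewrite unlock counting_gt0; apply: ess_sup_inf.le_ess_sup; apply: nearW => k /=.
Qed.

Lemma lqn_term q M r k : (0 < q)%E -> 0 <= M -> (forall k, 0 <= r k) -> lqn q M r -> r k <= M.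
Proof.
move=> q0 M0 r0 rM; rewrite -lee_fin.
apply: le_trans (Lnorm_term (f := EFin \o r) k q0 _) _; first by move=> j; rewrite lee_fin.
exact/Lnorm_lqn.
Qed.

Lemma lqnZ q M (c : R) r : (0 < q)%E -> 0 <= c -> 0 <= M -> (forall k, 0 <= r k) ->
  lqn q M r -> lqn q (c * M) (fun k => c * r k).
Proof.
case: q => [p| |//] q0 c0 M0 r0 h; last by move=> k; rewrite ler_wpM2l.
move=> n; rewrite powRM//; under eq_bigr do rewrite powRM//.
by rewrite -mulr_sumr ler_wpM2l ?powR_ge0.
Qed.

(** Quasi-triangle inequality: (a + b)^p <= 2^p (a^p + b^p). *)
Lemma lqnD q : (0 < q)%E -> exists c : R, 0 <= c /\ forall M M' r r',
  0 <= M -> 0 <= M' -> (forall k, 0 <= r k) -> (forall k, 0 <= r' k) ->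
  lqn q M r -> lqn q M' r' -> lqn q (c * (M + M')) (fun k => r k + r' k).
Proof.
case: q => [p| |//] q0; last first.
  by exists 1; split => // M M' r r' _ _ _ _ h h' k; rewrite mul1r lerD.
rewrite lte_fin in q0; have p0 := ltW q0.
exists (2 * 2 `^ p^-1); split; first by rewrite mulr_ge0 ?powR_ge0.
move=> M M' r r' M0 M0' r0 r0' h h' n.
have ab (a b : R) : 0 <= a -> 0 <= b -> (a + b) `^ p <= 2 `^ p * (a `^ p + b `^ p).
  move=> a0 b0; wlog le_ab : a b a0 b0 / a <= b => [H|].
    by have [|/ltW] := leP a b; [exact: H|rewrite addrC [a `^ p + _]addrC; exact: H].
  apply: le_trans (_ : (2 * b) `^ p <= _).
    by apply: ge0_ler_powR => //; rewrite ?nnegrE ?addr_ge0 ?mulr_ge0// mulr_natl mulr2n lerD2r.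
  by rewrite powRM// ler_wpM2l ?powR_ge0// lerDr powR_ge0.
apply: le_trans (_ : \sum_(k < n) 2 `^ p * (r k `^ p + r' k `^ p) <= _).
  by apply: ler_sum => k _; exact: ab.
rewrite -mulr_sumr big_split/= -mulrA powRM ?mulr_ge0 ?powR_ge0 ?addr_ge0//.
rewrite ler_wpM2l ?powR_ge0// powRM ?powR_ge0 ?addr_ge0// -powRrM mulVf ?gt_eqF// powRr1//.
rewrite mulr_natl mulr2n; apply: lerD.
  by apply: le_trans (h n) _; apply: ge0_ler_powR; rewrite ?nnegrE ?addr_ge0// lerDl.
by apply: le_trans (h' n) _; apply: ge0_ler_powR; rewrite ?nnegrE ?addr_ge0// lerDr.
Qed.

Definition dist (j k : nat) : nat := (j - k + (k - j))%N.

Lemma sum_geometric_le (b : R) n : 0 <= b < 1 -> \sum_(i < n) b ^+ i <= (1 - b)^-1.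
Proof.
move=> /andP[b0 b1]; have b1' : 0 < 1 - b by rewrite subr_gt0.
rewrite -[leRHS]mul1r ler_pdivlMr// mulrC -opprB mulNr -subrX1 opprB.
by rewrite lerBlDr lerDl exprn_ge0.
Qed.

Lemma sum_dist_le (b : R) N n : 0 <= b < 1 -> \sum_(j < n) b ^+ dist j N <= 2 / (1 - b).
Proof.
move=> b01; have /andP[b0 b1] := b01.
apply: le_trans (_ : \sum_(0 <= j < N + n) b ^+ dist j N <= _).
  rewrite -(big_mkord xpredT (fun j => b ^+ dist j N)) [leRHS](big_cat_nat _ (n := n))//=.
    by rewrite lerDl sumr_ge0// => j _; rewrite exprn_ge0.
  exact: leq_addl.
rewrite (big_cat_nat _ (n := N))//=; last exact: leq_addr.
rewrite mulrDl mul1r; apply: lerD.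
  rewrite big_nat_rev/= add0n; apply: le_trans (sum_geometric_le N.+1 b01).
  rewrite big_mkord big_ord_recl /= expr0 -[leLHS]add0r lerD//.
  apply: ler_sum => j _; rewrite /bump/= /dist.
  have jN := ltn_ord j.
  by rewrite (_ : (_ + _)%N = (1 + j)%N)//; lia.
rewrite -{1}[N]add0n big_addn addKn big_mkord; apply: le_trans (sum_geometric_le n b01).
by apply: ler_sum => j _; rewrite /dist addnK (_ : (N - _)%N = 0%N) ?addn0//; lia.
Qed.

(** A geometric series, whence the uniformity in [N]. For [q = oo] boundedness
    suffices, which is the reason why [s = 0] is admissible there. *)
Lemma lqn_dist q (c : R) : (0 < q)%E -> 0 <= c <= 1 -> c < 1 \/ q = +oo%E ->
  exists M : R, 0 <= M /\ forall N, lqn q M (fun k => c ^+ dist k N).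
Proof.
move=> q0 /andP[c0 c1] cq; case: q q0 cq => [p| |//] q0 cq; last first.
  by exists 1; split => // N k; exact: exprn_ile1.
rewrite lte_fin in q0; have {}c1 : c < 1 by case: cq.
have b01 : 0 <= c `^ p < 1.
  have : c `^ p < 1 `^ p by apply: gt0_ltr_powR; rewrite ?nnegrE.
  by rewrite powR1 powR_ge0.
exists ((2 / (1 - c `^ p)) `^ p^-1); split; first exact: powR_ge0.
move=> N n; have /andP[b0 b1] := b01.
rewrite -powRrM mulVf ?gt_eqF// powRr1; last by rewrite divr_ge0// subr_ge0 ltW.
apply: le_trans (sum_dist_le N n b01); apply: ler_sum => k _.
by rewrite -powR_mulrn// -powRrM mulrC powRrM powR_mulrn ?powR_ge0.
Qed.

End sequences.

(** * Littlewood-Paley pieces *)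

Section littlewood_paley.
Context {R : realType} {d : nat}.
Implicit Types (x y z xi : 'rV[R]_d) (f g h w : 'rV[R]_d -> R[i]) (A C M : R)
  (u v : functional R d).
Variable eta0 : 'rV[R]_d -> R[i].
Hypothesis eta0P : lp_cutoff eta0.
Notation mu := (lebesgue_rV (R := R) d).
Notation eta := (lp_eta eta0).
Notation piece := (lp_piece eta0).

Let s0 := schwartz_cutoff eta0P.
Let schwartz_scale (r : R) f : r != 0 -> schwartz f -> schwartz (fun xi => f (r *: xi)).
Proof. by move=> r0 sf; have := schwartz_affine 0 r0 sf; under eq_fun do (rewrite addr0). Qed.

(** The profile of the [j]-th cutoff, and a wider one which is 1 on its support. *)
Definition prof (j : nat) xi : R[i] := if j is 0 then eta0 xi else eta0 xi - eta0 (2 *: xi).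
Definition wide (j : nat) xi : R[i] :=
  if j is 0 then eta0 (2^-1 *: xi) else eta0 (2^-1 *: xi) - eta0 (4 *: xi).
Definition fat j xi : R[i] := wide j ((2 ^+ j)^-1 *: xi).
Definition low j xi : R[i] := eta0 ((2 ^+ j)^-1 *: xi).

Lemma lp_etaE j xi : eta j xi = prof j ((2 ^+ j)^-1 *: xi).
Proof.
case: j => [|j] /=; first by rewrite expr0 invr1 scale1r.
by congr (_ - eta0 _); rewrite scalerA exprS invfM mulVKf.
Qed.

Let prof_wide j xi : prof j xi * wide j xi = prof j xi.
Proof.
have e1 : enorm xi < 3 / 8 -> eta0 (2^-1 *: xi) = 1.
  by move=> h; apply: (cutoff_eq1 eta0P); rewrite enormZ ger0_norm//; lra.
case: j => [|j] /=.
  have [h|/(cutoff_eq0 eta0P) ->] := ltP (enorm xi) (3 / 8); last by rewrite mul0r.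
  by rewrite e1 ?mulr1.
have [h|h] := ltP (enorm xi) (3 / 8); last first.
  rewrite (cutoff_eq0 eta0P h) (@cutoff_eq0 _ _ _ eta0P (2 *: xi)) ?subr0 ?mul0r//.
  by rewrite enormZ ger0_norm//; have := enorm_ge0 xi; lra.
rewrite e1//; have [h'|h'] := leP (enorm xi) (1 / 8).
  have -> : eta0 xi = 1 by apply: (cutoff_eq1 eta0P); lra.
  have -> : eta0 (2 *: xi) = 1 by apply: (cutoff_eq1 eta0P); rewrite enormZ ger0_norm//; lra.
  by rewrite subrr mul0r.
by rewrite (@cutoff_eq0 _ _ _ eta0P (4 *: xi)) ?subr0 ?mulr1// enormZ ger0_norm//; lra.
Qed.

Lemma eta_fat j xi : eta j xi * fat j xi = eta j xi.
Proof. by rewrite lp_etaE prof_wide. Qed.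

Let schwartz_prof j : schwartz (prof j).
Proof. by case: j => [|j] //=; apply: schwartzB => //; exact: schwartz_scale. Qed.

Let schwartz_wide j : schwartz (wide j).
Proof.
case: j => [|j] /=; first by apply: schwartz_scale.
by apply: schwartzB; apply: schwartz_scale.
Qed.

Let pow0 j : 0 < 2 ^+ j :> R. Proof. by rewrite exprn_gt0. Qed.

Lemma schwartz_eta j : schwartz (eta j).
Proof.
rewrite (_ : eta j = fun xi => prof j ((2 ^+ j)^-1 *: xi)).
  by apply: schwartz_scale => //; rewrite invr_eq0 gt_eqF.
by apply/funext => xi; exact: lp_etaE.
Qed.

Lemma schwartz_fat j : schwartz (fat j).
Proof. by apply: schwartz_scale => //; rewrite invr_eq0 gt_eqF. Qed.

Lemma schwartz_low j : schwartz (low j).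
Proof. by apply: schwartz_scale => //; rewrite invr_eq0 gt_eqF. Qed.

Lemma sum_eta n xi : \sum_(j < n.+1) eta j xi = low n xi.
Proof.
rewrite big_ord_recl (eq_bigr (fun j : 'I_n => low j.+1 xi - low j xi)) => [|j _].
  rewrite -(big_mkord xpredT (fun j => low j.+1 xi - low j xi)) telescope_sumr//.
  by rewrite /= /low expr0 invr1 scale1r addrC subrK.
by rewrite lift0.
Qed.

Definition Keta j := inv_fourier (eta j).
Definition Kfat j := inv_fourier (fat j).
Definition Klow j := inv_fourier (low j).

(** One constant serves all scales: there are only finitely many profiles. *)
Lemma lp_kernels : exists C, 0 <= C /\ forall j,
  [/\ kernel_at C (2 ^+ j) (Keta j), kernel_at C (2 ^+ j) (Kfat j) &
      kernel_at C (2 ^+ j) (Klow j)].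
Proof.
have [c1 [c10 h1]] := dilate_kernels (schwartz_prof 0).
have [c2 [c20 h2]] := dilate_kernels (schwartz_prof 1).
have [c3 [c30 h3]] := dilate_kernels (schwartz_wide 0).
have [c4 [c40 h4]] := dilate_kernels (schwartz_wide 1).
exists (c1 + c2 + c3 + c4); split; first by rewrite !addr_ge0.
have etaF j : eta j = fun xi => prof j ((2 ^+ j)^-1 *: xi).
  by apply/funext => xi; exact: lp_etaE.
move=> j; split.
- rewrite /Keta etaF; case: j => [|j].
    by apply: (kernel_at_le _ _ (h1 _ (pow0 0))) => //; lra.
  by apply: (kernel_at_le _ _ (h2 _ (pow0 j.+1))) => //; lra.
- rewrite /Kfat; case: j => [|j].
    by apply: (kernel_at_le _ _ (h3 _ (pow0 0))) => //; lra.
  by apply: (kernel_at_le _ _ (h4 _ (pow0 j.+1))) => //; lra.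
- by apply: (kernel_at_le _ _ (h1 _ (pow0 j))) => //; lra.
Qed.

Lemma cI_Kfat j : (0 < j)%N -> cI mu (Kfat j) = 0.
Proof.
move=> j0; rewrite cI_inv_fourier; last exact: schwartz_fat.
by case: j j0 => // j _; rewrite /fat /wide !scaler0 subrr.
Qed.

Lemma cI_Keta j : (0 < j)%N -> cI mu (Keta j) = 0.
Proof.
move=> j0; rewrite cI_inv_fourier; last exact: schwartz_eta.
by case: j j0 => // j _; rewrite /lp_eta !scaler0 subrr.
Qed.

Lemma cI_Klow j : cI mu (Klow j) = 1.
Proof.
rewrite cI_inv_fourier; last exact: schwartz_low.
rewrite /low scaler0 (cutoff_eq1 eta0P)//.
by rewrite -(scale0r (0 : 'rV[R]_d)) enormZ normr0 mul0r invr_ge0.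
Qed.

Lemma lp_pieceE j u g : piece j u g = u (mult (eta j) g).
Proof. by []. Qed.

Lemma piece_fat j u g : schwartz g -> piece j u (mult (fat j) g) = piece j u g.
Proof.
move=> sg; rewrite !lp_pieceE mult_comp//; [|exact: schwartz_eta|exact: schwartz_fat].
by congr (u (mult _ g)); apply/funext => xi; exact: eta_fat.
Qed.

Lemma piece_deq j u v : deq u v -> deq (piece j u) (piece j v).
Proof. by move=> uv g sg; apply: uv; apply: schwartz_mult => //; exact: schwartz_eta. Qed.

(** Every representative can be replaced by a convolution, which exhibits the
    smoothness of the piece at its own scale. *)
Lemma brep_fat j A C h u : kernel_at C (2 ^+ j) (Kfat j) -> brep A h (piece j u) ->
  brep (2 * (A * C)) (conv (Kfat j) h) (piece j u).
Proof.
move=> [_ LK _ _] hu.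
apply: (brep_eq _ (brep_mult (schwartz_fat j) LK hu)) => g sg.
exact: piece_fat.
Qed.

Lemma tempered_sum u (I : Type) (r : seq I) (F : I -> 'rV[R]_d -> R[i]) :
  tempered u -> (forall i, schwartz (F i)) ->
  u (fun x => \sum_(i <- r) F i x) = \sum_(i <- r) u (F i).
Proof.
move=> [lin _] sF; have u0 : u (fun=> 0) = 0.
  have := lin (-1) _ _ (schwartz0 (R := R) (d := d)) (schwartz0 (R := R) (d := d)).
  under eq_fun do (rewrite mulr0 addr0).
  by rewrite mulN1r addNr.
elim: r => [|i r ih]; first by under eq_fun do (rewrite big_nil); rewrite u0 big_nil.
have E : (fun x => \sum_(j <- i :: r) F j x) = (fun x => 1 * F i x + \sum_(j <- r) F j x).
  by apply/funext => x; rewrite big_cons mul1r.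
by rewrite E lin ?mul1r ?big_cons ?ih//; exact: schwartz_sum.
Qed.

Lemma mult_sum (I : Type) (r : seq I) (e : I -> 'rV[R]_d -> R[i]) g :
  (forall i, schwartz (e i)) -> schwartz g ->
  mult (fun xi => \sum_(i <- r) e i xi) g = (fun x => \sum_(i <- r) mult (e i) g x).
Proof.
move=> se sg; apply/funext => x; rewrite /mult fourierE.
have sE i : schwartz (fun xi => e i xi * inv_fourier g xi).
  by apply: schwartzM => //; exact: schwartz_inv_fourier.
rewrite (eq_cI _ (g := fun xi => \sum_(i <- r) (e i xi * inv_fourier g xi * wave (- x) xi))).
  rewrite cI_sum => [|i]; last by apply: L1_wave; exact: schwartz_L1.
  by apply: eq_bigr => i _; rewrite fourierE.
by move=> xi; rewrite !mulr_suml.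
Qed.

Lemma sum_pieces n u g : tempered u -> schwartz g ->
  \sum_(j < n.+1) piece j u g = u (mult (low n) g).
Proof.
move=> tu sg; rewrite -(tempered_sum _ (F := fun j : 'I_n.+1 => mult (eta j) g))//.
  rewrite -mult_sum//; last by move=> j; exact: schwartz_eta.
  by congr (u (mult _ g)); apply/funext => xi; exact: sum_eta.
by move=> j; apply: schwartz_mult => //; exact: schwartz_eta.
Qed.

Lemma piece_mult k u e g : schwartz e -> schwartz g ->
  u (mult e (mult (eta k) g)) = piece k u (mult e g).
Proof.
move=> se sg; rewrite lp_pieceE !mult_comp//; try exact: schwartz_eta.
by congr (u (mult _ g)); apply/funext => xi; rewrite mulrC.
Qed.

End littlewood_paley.

(** * Averages of distributions *)

Section complex_series.
Context {R : realType}.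
Implicit Types (f a : nat -> R[i]).

Definition csum f : R[i] :=
  (limn (fun n => \sum_(j < n) cRe (f j))) +i* (limn (fun n => \sum_(j < n) cIm (f j))).

Lemma ccvg_parts a (s t : R) : (fun n => cRe (a n)) @ \oo --> s ->
  (fun n => cIm (a n)) @ \oo --> t -> ccvg a (s +i* t).
Proof.
move=> as_ at_; apply: (@ccvg_le _ _ _ (fun n => `|cRe (a n) - s| + `|cIm (a n) - t|)).
  rewrite -[0]addr0; apply: cvgD.
    by apply/norm_cvg0P; rewrite -(subrr s); apply: cvgB => //; exact: cvg_cst.
  by apply/norm_cvg0P; rewrite -(subrr t); apply: cvgB => //; exact: cvg_cst.
by move=> n; apply: le_trans (normc_le _) _; rewrite !cReIm.
Qed.

Lemma csum_cvg f (B b : R) N : 0 <= b < 1 -> (forall j, normc (f j) <= B * b ^+ dist j N) ->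
  ccvg (fun n => \sum_(j < n) f j) (csum f).
Proof.
move=> b01 fB; have B0 : 0 <= B.
  by have := fB N; rewrite /dist subnn mulr1; apply: le_trans; exact: normc_ge0.
have H (p : R[i] -> R) : (forall z, `|p z| <= normc z) ->
    cvgn (fun n => \sum_(j < n) p (f j)).
  move=> pn; have : cvgn (series (fun j => p (f j))).
    apply: normed_cvg; apply: nondecreasing_is_cvgn.
      by apply: nondecreasing_series => n _ _; exact: normr_ge0.
    exists (B * (2 / (1 - b))) => _ [n _ <-].
    rewrite -[leLHS]/(series (fun k => `|p (f k)|) n) /series/= big_mkord.
    apply: le_trans (_ : \sum_(j < n) B * b ^+ dist j N <= _).
      by apply: ler_sum => j _; exact: le_trans (pn _) (fB j).
    by rewrite -mulr_sumr ler_wpM2l// sum_dist_le.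
  by rewrite /series; under eq_fun do (rewrite big_mkord).
apply: ccvg_parts.
  by under eq_fun do (rewrite cRe_sum); exact: (H (@cRe R)) (@normc_cRe R).
by under eq_fun do (rewrite cIm_sum); exact: (H (@cIm R)) (@normc_cIm R).
Qed.

Lemma sum_dist_bound f (B b : R) N n : 0 <= b < 1 ->
  (forall j, normc (f j) <= B * b ^+ dist j N) ->
  normc (\sum_(j < n) f j) <= B * (2 / (1 - b)).
Proof.
move=> b01 fB; have B0 : 0 <= B.
  by have := fB N; rewrite /dist subnn mulr1; apply: le_trans; exact: normc_ge0.
apply: le_trans (le_normc_sum _ _ _) _.
apply: le_trans (_ : \sum_(j < n) B * b ^+ dist j N <= _); first by apply: ler_sum.
by rewrite -mulr_sumr ler_wpM2l// sum_dist_le.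
Qed.

End complex_series.

Section averaged.
Context {R : realType} {d : nat}.
Implicit Types (x y z xi : 'rV[R]_d) (f g h w : 'rV[R]_d -> R[i]) (A M W : R)
  (u v : functional R d) (H : nat -> 'rV[R]_d -> R[i]).
Variable eta0 : 'rV[R]_d -> R[i].
Hypothesis eta0P : lp_cutoff eta0.
Notation mu := (lebesgue_rV (R := R) d).
Notation piece := (lp_piece eta0).

(** By [du_bois_reymond], as both functions represent [u]. *)
Lemma avg_represents N A h k u : represents h u -> brep A k u ->
  dyadic_avg N h = avg N k.
Proof.
move=> hu ku; apply/funext => x; have [bk uE] := ku; have [mh _ hE] := hu.
have Lk g : schwartz g -> L1 mu (fun y => k y * g y).
  by move=> sg; have [c Lg] := schwartz_L1n sg; exact: bdd_L1 bk Lg.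
have := @du_bois_reymond R d eta0 eta0P N (fun y => h y - k y) x (cmeasB mh bk.1).
have E1 g : schwartz g -> L1 mu (fun y => (h y - k y) * g y).
  move=> sg; have := L1B (represents_L1 hu sg) (Lk g sg); congr L1; apply/funext => y.
  by rewrite mulrBl.
have E2 g : schwartz g -> cI mu (fun y => (h y - k y) * g y) = 0.
  move=> sg; rewrite (eq_cI _ (g := fun y => h y * g y - k y * g y)).
    rewrite (cIB (represents_L1 hu sg) (Lk g sg)) -uE// -hE//.
    by rewrite /dist_of -[cintegral _ _]/(cI _ _) subrr.
  by move=> y; rewrite mulrBl.
move=> /(_ E1 E2)[Lw w0]; have La := bdd_L1 bk (L1n_avgk N x).
have Lh : L1 mu (fun y => h y * avgk N x y).
  by have := L1D Lw La; congr L1; apply/funext => y; rewrite mulrBl subrK.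
rewrite dyadic_avgE//; apply/eqP; rewrite -subr_eq0 /avg -(cIB Lh La); apply/eqP.
by rewrite -[RHS]w0; apply: eq_cI => y; rewrite mulrBl.
Qed.

(** [w] is the sum of the averaged pieces of [u], for every choice of
    representatives of the pieces. *)
Definition avg_spec N u w : Prop :=
  (exists W, bdd W w) /\
  forall H, (forall j, represents (H j) (piece j u)) ->
    (forall j, cmeas (dyadic_avg N (H j))) /\
    exists W, forall x, ccvg (fun n => \sum_(j < n) dyadic_avg N (H j) x) (w x) /\
      forall n, normc (\sum_(j < n) dyadic_avg N (H j) x) <= W.

Lemma avg_spec_intro N u H (A : nat -> R) w W : (forall j, brep (A j) (H j) (piece j u)) ->
  (forall x, ccvg (fun n => \sum_(j < n) avg N (H j) x) (w x)) ->
  (forall x n, normc (\sum_(j < n) avg N (H j) x) <= W) -> avg_spec N u w.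
Proof.
move=> Hu cw bw.
have mH j : cmeas (avg N (H j)) by exact: (avg_bdd N (Hu j).1).1.
split.
  exists W; split; last by move=> x; exact: ccvg_normc (cw x) (bw x).
  by apply: (cmeas_lim (f_ := fun n x => \sum_(j < n) avg N (H j) x)) cw => n; exact: cmeas_sum.
move=> h hu; have E j : dyadic_avg N (h j) = avg N (H j) by exact: avg_represents (hu j) (Hu j).
split; first by move=> j; rewrite E.
exists W => x; split; last by move=> n; under eq_bigr do rewrite E; exact: bw.
by apply: eq_ccvg (cw x) => n; apply: eq_bigr => j _; rewrite E.
Qed.

Lemma avg_spec_unique N u w w' H : (forall j, represents (H j) (piece j u)) ->
  avg_spec N u w -> avg_spec N u w' -> w = w'.
Proof.
move=> hu [_ /(_ H hu)[_ [W cw]]] [_ /(_ H hu)[_ [W' cw']]].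
by apply/funext => x; exact: ccvg_unique (cw x).1 (cw' x).1.
Qed.

(** Independent of the choice of [w] by [avg_spec_unique]. *)
Definition avg_ext N u : functional R d :=
  match pselect (exists w, avg_spec N u w) with
  | left e => dist_of (projT1 (cid e))
  | right _ => fun=> 0
  end.

Lemma avg_extE N u w H : (forall j, represents (H j) (piece j u)) ->
  avg_spec N u w -> avg_ext N u = dist_of w.
Proof.
move=> hu uw; rewrite /avg_ext; case: pselect => [e|[]]; last by exists w.
by case: cid => w' uw' /=; rewrite (avg_spec_unique hu uw' uw).
Qed.

Lemma norm1_schwartz : exists C : R, forall g, schwartz g ->
  (norm1 mu g <= C%:E * schwartz_norm (2 * d) g)%E.
Proof.
exists (pi ^+ d) => g sg; have sn0 := schwartz_norm_ge0 g (2 * d)%N.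
have [S SE] : exists S : R, schwartz_norm (2 * d) g = S%:E.
  exists (fine (schwartz_norm (2 * d) g)); rewrite fineK// ge0_fin_numE//.
  exact: sg.2.
rewrite SE in sn0 *; rewrite lee_fin in sn0.
have gw x : normc (g x) <= S * weight x.
  have h : (1 + enorm x) ^+ (2 * d) * normc (g x) <= S.
    by have := schwartz_normP g x (l := [::]) (m := (2 * d)%N) isT; rewrite SE lee_fin cpderivs_nil.
  apply: le_trans (_ : (1 + enorm x) ^+ (2 * d) * normc (g x) * weight x <= _); last first.
    by rewrite ler_wpM2r// ltW// weight_gt0.
  rewrite mulrAC -[leLHS]mul1r ler_wpM2r ?normc_ge0//; apply: le_trans (weight_ge_norm x) _.
  rewrite ler_wpM2r ?(ltW (weight_gt0 x))// lerXn2r ?nnegrE ?addr_ge0 ?enorm_ge0//.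
  by rewrite lerD2l norm_le_enorm.
have mw : cmeas (fun x : 'rV[R]_d => S%:C * (weight x)%:C).
  by apply: cmeasM; [exact: cmeas_cst|exact: (L1_weight d).1].
apply: (@le_trans _ _ (norm1 mu (fun x => S%:C * (weight x)%:C)%R)).
  apply: le_norm1 => //; first exact: schwartz_cmeas.
  by move=> x; rewrite normcM !normcR !ger0_norm// ltW// weight_gt0.
rewrite norm1Z ?normcR ?ger0_norm//; last exact: (L1_weight d).1.
rewrite muleC; apply: lee_wpmul2r; first by rewrite lee_fin.
rewrite /norm1 -integral_weight le_eqVlt; apply/orP; left; apply/eqP.
by apply: eq_integral => x _; rewrite normcR ger0_norm// ltW// weight_gt0.
Qed.

Lemma tempered_dist_of W w : bdd W w -> tempered (dist_of w).
Proof.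
move=> bw; split.
  move=> a f g sf sg; have [[cf Lf] [cg Lg]] := (schwartz_L1n sf, schwartz_L1n sg).
  have L1' := bdd_L1 bw Lf; have L2 := bdd_L1 bw Lg.
  rewrite /dist_of -![cintegral _ _]/(cI _ _) -cIZ// -cID//; last exact: L1Z.
  by apply: eq_cI => x; rewrite mulrDr mulrCA.
have [C CP] := norm1_schwartz.
exists (2 * d)%N, (2 * (W * C)) => g sg.
have Lg := schwartz_L1 sg; have W0 := bdd_ge0 bw.
have Lgw := L1Mb Lg bw.1 bw.2.
apply: le_trans (normc_cI Lgw) _; rewrite EFinM -muleA; apply: lee_wpmul2l => //.
have mW : cmeas (fun x => W%:C * g x) by apply: cmeasM; [exact: cmeas_cst|exact: Lg.1].
apply: (@le_trans _ _ (norm1 mu (fun x => W%:C * g x)%R)).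
  apply: le_norm1 => //; first exact: Lgw.1.
  by move=> x; rewrite !normcM normcR ger0_norm// ler_wpM2r ?normc_ge0//; exact: bw.2.
rewrite norm1Z ?normcR ?ger0_norm//; last exact: Lg.1.
by rewrite EFinM -muleA; apply: lee_wpmul2l; [rewrite lee_fin|exact: CP].
Qed.

Lemma avg_ext_linear N (a : R[i]) u v w w' (h h' : nat -> 'rV[R]_d -> R[i]) (A A' : nat -> R) :
  (forall j, brep (A j) (h j) (piece j u)) -> (forall j, brep (A' j) (h' j) (piece j v)) ->
  avg_spec N u w -> avg_spec N v w' ->
  avg_spec N (fun g => a * u g + v g) (fun x => a * w x + w' x) /\
  forall j, brep (normc a * A j + A' j) (fun x => a * h j x + h' j x)
    (piece j (fun g => a * u g + v g)).
Proof.
move=> hu hv uw vw.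
have Hb j : brep (normc a * A j + A' j) (fun x => a * h j x + h' j x)
    (piece j (fun g => a * u g + v g)).
  have [[b1 E1] [b2 E2]] := (hu j, hv j); split; first exact: bddD (bddZ a b1) b2.
  move=> g sg; have [c Lg] := schwartz_L1n sg; rewrite lp_pieceE -!lp_pieceE E1// E2//.
  have i1 := bdd_L1 b1 Lg; rewrite -cIZ// -cID; [|exact: L1Z|exact: bdd_L1 b2 Lg].
  by apply: eq_cI => x; rewrite mulrDl mulrA.
split => //.
have [_ [W1 c1]] := uw.2 _ (fun j => brep_represents (hu j)).
have [_ [W2 c2]] := vw.2 _ (fun j => brep_represents (hv j)).
have Ea j x : avg N (fun x => a * h j x + h' j x) x =
    a * dyadic_avg N (h j) x + dyadic_avg N (h' j) x.
  have [[b1 _] [b2 _]] := (hu j, hv j); have L := L1n_avgk N x.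
  rewrite (avg_represents N (brep_represents (hu j)) (hu j)).
  rewrite (avg_represents N (brep_represents (hv j)) (hv j)).
  rewrite /avg -cIZ; last exact: bdd_L1 b1 L.
  rewrite -cID; [|exact: L1Z (bdd_L1 b1 L)|exact: bdd_L1 b2 L].
  by apply: eq_cI => y; rewrite mulrDl mulrA.
have Es n x : \sum_(j < n) avg N (fun x => a * h j x + h' j x) x =
    a * (\sum_(j < n) dyadic_avg N (h j) x) + \sum_(j < n) dyadic_avg N (h' j) x.
  by rewrite mulr_sumr -big_split/=; apply: eq_bigr => j _; exact: Ea.
apply: (avg_spec_intro Hb (W := normc a * W1 + W2)).
  move=> x; have := ccvgD (ccvgMl a (c1 x).1) (c2 x).1.
  by apply: eq_ccvg => n; rewrite Es.
move=> x n; rewrite Es; apply: le_trans (le_normcD _ _) _.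
by rewrite normcM; apply: lerD; [rewrite ler_wpM2l ?normc_ge0// (c1 x).2|exact: (c2 x).2].
Qed.

Lemma avg_spec_series N u w (h : nat -> 'rV[R]_d -> R[i]) : avg_spec N u w -> (forall j, represents (h j) (piece j u)) ->
  forall g, schwartz g ->
  ccvg (fun n => \sum_(j < n) dist_of (dyadic_avg N (h j)) g) (dist_of w g).
Proof.
move=> [[W0 bw] uw] hu g sg; have [mh [W cw]] := uw h hu.
have [c Lg] := schwartz_L1n sg; have Lg1 := L1n_L1 Lg.
have W0' : 0 <= W by apply: le_trans ((cw 0).2 0); exact: normc_ge0.
have bh j : bdd (W + W) (dyadic_avg N (h j)).
  split => // x; have := (cw x).2 j.+1; rewrite big_ord_recr/= => h1.
  have := (cw x).2 j; set S := \sum_(_ < _) _ in h1 * => h2.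
  rewrite (_ : dyadic_avg _ _ _ = (S + dyadic_avg N (h j) x) - S); last by rewrite addrC addKr.
  by apply: le_trans (le_normcD _ _) _; rewrite normcN; exact: lerD.
apply: (eq_ccvg (a := fun n => cI mu (fun x => (\sum_(j < n) dyadic_avg N (h j) x) * g x))).
  move=> n; rewrite (eq_cI _ (g := fun x => \sum_(j < n) (dyadic_avg N (h j) x * g x))).
    by rewrite cI_sum// => j; exact: bdd_L1 (bh j) Lg.
  by move=> x; rewrite mulr_suml.
apply: (@cI_cvg _ _ _ _ _ _ (fun x => W%:C * g x)).
- by move=> n; apply: cmeasM; [exact: cmeas_sum|exact: Lg1.1].
- by apply: cmeasM; [exact: bw.1|exact: Lg1.1].
- exact: L1Z.
- move=> n x; rewrite !normcM normcR ger0_norm// ler_wpM2r ?normc_ge0//.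
  exact: (cw x).2.
- move=> x; have := ccvgMl (g x) (cw x).1; rewrite mulrC.
  by apply: eq_ccvg => n; rewrite mulrC.
Qed.

End averaged.

(** * The main estimate *)

Lemma dist_leq j N : (j <= N)%N -> dist j N = (N - j)%N.
Proof. by rewrite /dist; lia. Qed.

Section main_estimate.
Context {R : realType} {d : nat}.
Implicit Types (x y z xi : 'rV[R]_d) (f g h w : 'rV[R]_d -> R[i]) (A M W : R)
  (u v : functional R d) (H : nat -> 'rV[R]_d -> R[i]).
Variable eta0 : 'rV[R]_d -> R[i].
Hypothesis eta0P : lp_cutoff eta0.
Notation mu := (lebesgue_rV (R := R) d).
Notation piece := (lp_piece eta0).

(** [a] stands for [2^-s], so that [-1 < s <= 0] reads [1 <= a < 2]. *)
Variable a : R.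
Hypothesis a12 : 1 <= a < 2.
Let b : R := a / 2.
(** The decay rate in [k] of the estimate below: [b] for [k <= N] and [a^-1] for
    [k > N]. It is 1 exactly for [s = 0]. *)
Let c : R := Num.max a^-1 b.

Let a1 : 1 <= a. Proof. by case/andP: a12. Qed.
Let a0 : 0 < a. Proof. exact: lt_le_trans a1. Qed.
Let b01 : 0 <= b < 1.
Proof. by case/andP: a12 => h1 h2; rewrite divr_ge0 ?ltW//= ltr_pdivrMr// mul1r. Qed.
Let b0 : 0 < b. Proof. by rewrite divr_gt0. Qed.

Lemma decay_gt0 : 0 < c.
Proof. by rewrite lt_max invr_gt0 a0. Qed.

Lemma decay_le1 : c <= 1.
Proof. by rewrite ge_max invf_le1// a1/= ltW//; case/andP: b01. Qed.

Lemma decay_lt1 : 1 < a -> c < 1.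
Proof. by move=> h; rewrite gt_max invf_lt1// h/=; case/andP: b01. Qed.

Let rho_le N j : rho N j * a ^+ j <= a ^+ N * b ^+ dist j N.
Proof.
have p2 n : (2 : R) ^+ n != 0 by rewrite expf_neq0.
rewrite /rho /dist; case: leqP => jN.
  have [m ->] : exists m, N = (m + j)%N by exists (N - j)%N; rewrite subnK.
  have -> : (j - (m + j) + (m + j - j) = m)%N by lia.
  have am : 1 <= a ^+ m by rewrite exprn_ege1.
  rewrite !exprD /b expr_div_n -subr_ge0.
  rewrite (_ : _ - _ = a ^+ j / 2 ^+ m * (a ^+ m * a ^+ m - 1)); last by field; rewrite !p2.
  rewrite mulr_ge0 ?divr_ge0 ?exprn_ge0 ?(ltW a0)// subr_ge0.
  by rewrite -[1]mul1r ler_pM.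
have [m ->] : exists m, j = (m + N)%N by exists (j - N)%N; rewrite subnK// ltnW.
have -> : (m + N - N + (N - (m + N)) = m)%N by lia.
rewrite !exprD /b expr_div_n le_eqVlt; apply/orP; left; apply/eqP.
by field; rewrite !p2.
Qed.

Let sig_le N k : a ^+ N * sig N k <= a ^+ k * c ^+ dist k N.
Proof.
have p2 n : (2 : R) ^+ n != 0 by rewrite expf_neq0.
have c0 := ltW decay_gt0.
rewrite /sig /dist; case: leqP => kN.
  have [m ->] : exists m, N = (m + k)%N by exists (N - k)%N; rewrite subnK.
  have -> : (k - (m + k) + (m + k - k) = m)%N by lia.
  apply: le_trans (_ : a ^+ k * b ^+ m <= _).
    rewrite !exprD /b expr_div_n le_eqVlt; apply/orP; left; apply/eqP.
    by field; rewrite !p2.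
  apply: ler_wpM2l; first by rewrite exprn_ge0// ltW.
  by apply: lerXn2r; rewrite ?nnegrE ?(ltW b0)// /c le_max lexx orbT.
have [m ->] : exists m, k = (m + N)%N by exists (k - N)%N; rewrite subnK// ltnW.
have -> : (m + N - N + (N - (m + N)) = m)%N by lia.
rewrite mulr1 exprD mulrAC -[leLHS]mul1r; apply: ler_wpM2r; first by rewrite exprn_ge0// ltW.
rewrite -exprMn exprn_ege1// -[leLHS](mulfV (lt0r_neq0 a0)); apply: ler_wpM2l; first exact: ltW.
by rewrite /c le_max lexx.
Qed.

(** Take for [w] the sum of the averages of the smoothed blocks. Up to the scale of
    the cubes, a block and its average differ by a rest; the blocks themselves sum up to
    the low frequencies of [u], whose pieces are controlled by those of [u]. By
    [block_conv], the [k]-th piece of the [j]-th rest has size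
    [M a^j rho(j) sig(k)], and the sum over [j] is geometric around [j = N] because
    [a < 2]. *)
Lemma avg_main : exists D : R, 0 <= D /\ forall N u M H, tempered u -> 0 <= M ->
  (forall j, brep (M * a ^+ j) (H j) (piece j u)) ->
  exists w, avg_spec eta0 N u w /\
    forall k A h, brep A h (piece k u) ->
      exists h', brep (D * (A + M * a ^+ k * c ^+ dist k N)) h' (piece k (dist_of w)).
Proof.
have [C [C0 kC]] := lp_kernels eta0P.
have b1 : 0 < 1 - b by rewrite subr_gt0; case/andP: b01.
pose BC : R := @blockC R d.
have B0 : 0 <= BC by rewrite /BC /blockC !mulr_ge0// addr_ge0.
pose S : R := 2 / (1 - b).
have S0 : 0 <= S by rewrite divr_ge0// ltW.
have T1 : 0 <= BC * (2 * C * C) * S.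
  by apply: mulr_ge0 => //; apply: mulr_ge0 => //; rewrite !mulr_ge0.
exists (2 * C + BC * (2 * C * C) * S); split.
  by rewrite addr_ge0// mulr_ge0.
move=> N u M H tu M0 hH.
pose Ht j := conv (Kfat eta0 j) (H j).
have aj j : 0 <= a ^+ j by rewrite exprn_ge0// ltW.
have hHt j : brep (2 * (M * a ^+ j * C)) (Ht j) (piece j u).
  by have [_ kF _] := kC j; exact: (brep_fat eta0P kF (hH j)).
(* pieces above the scale of the cubes gain 2^(N-j), those below are finitely many *)
pose B : R := BC * (M * C * 2) * a ^+ N + 2 * (2 * (M * C)) * (a ^+ N * b ^- N).
have avgB j x : normc (avg N (Ht j) x) <= B * b ^+ dist j N.
  have bN : 0 <= b ^- N by rewrite invr_ge0 exprn_ge0// ltW.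
  have bd : 0 <= b ^+ dist j N by rewrite exprn_ge0// ltW.
  have MC : 0 <= M * C by rewrite mulr_ge0.
  rewrite /B mulrDl; have [jN|jN] := leqP j N.
    apply: le_trans (_ : 2 * (2 * (M * C)) * (a ^+ N * b ^- N) * b ^+ dist j N <= _); last first.
      by rewrite lerDr; apply: mulr_ge0 => //; apply: mulr_ge0; rewrite ?mulr_ge0.
    apply: le_trans ((avg_bdd N (hHt j).1).2 x) _.
    rewrite (_ : 2 * (2 * (M * a ^+ j * C)) = 2 * (2 * (M * C)) * a ^+ j); last by ring.
    rewrite -[leRHS]mulrA; apply: ler_wpM2l; first by rewrite !mulr_ge0.
    rewrite dist_leq//.
    rewrite -[leLHS]mulr1 -mulrA; apply: ler_pM => //; first exact: ler_weXn2l.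
    rewrite mulrC ler_pdivlMr ?exprn_gt0// mul1r.
    by apply: ler_wiXn2l; rewrite ?(ltW b0) ?leq_subr//; case/andP: b01 => _ /ltW.
  apply: le_trans (_ : BC * (M * C * 2) * a ^+ N * b ^+ dist j N <= _); last first.
    by rewrite lerDl !mulr_ge0// exprn_ge0// ltW.
  have [_ kF _] := kC j; have j0 := cI_Kfat eta0P (leq_ltn_trans (leq0n N) jN).
  apply: le_trans ((block_sup (hH j).1 kF jN j0).2 x) _.
  rewrite (_ : M * a ^+ j * C * 2 * rho N j = M * C * 2 * (rho N j * a ^+ j)); last by ring.
  rewrite (_ : BC * _ * a ^+ N * _ = BC * (M * C * 2 * (a ^+ N * b ^+ dist j N))); last by ring.
  by apply: ler_wpM2l => //; apply: ler_wpM2l; rewrite ?mulr_ge0// rho_le.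
pose w x := csum (fun j => avg N (Ht j) x).
have cw x : ccvg (fun n => \sum_(j < n) avg N (Ht j) x) (w x).
  by apply: (csum_cvg b01) => j; exact: avgB.
have bw n x : normc (\sum_(j < n) avg N (Ht j) x) <= B * S.
  by apply: (sum_dist_bound n (f := fun j => avg N (Ht j) x) b01) => j; exact: avgB.
have uw : avg_spec eta0 N u w by exact: (avg_spec_intro eta0P hHt cw (fun x n => bw n x)).
exists w; split => // k A h hk.
have [kE _ kL] := kC k; have [_ _ kLN] := kC N.
have LLow : L1n C (Klow eta0 N) by case: kLN.
have rep1 := brep_mult (schwartz_low eta0P N) LLow hk.
pose P x := \sum_(j < N.+1) Ht j x.
pose rem x := w x - P x.
have [[W0 bw0] _] := uw.
have bP : bdd (\sum_(j < N.+1) 2 * (M * a ^+ j * C)) P.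
  split; first by apply: cmeas_sum => j; exact: (hHt j).1.1.
  move=> x; apply: le_trans (le_normc_sum _ _ _) _.
  by apply: ler_sum => j _; exact: (hHt j).1.2.
have brem := bddB bw0 bP.
have LE : L1n C (Keta eta0 k) by case: kE.
have rep2 := brep_mult (schwartz_eta eta0P k) LE (bdd_brep brem).
have rep : brep (2 * (A * C) + 2 * ((W0 + \sum_(j < N.+1) 2 * (M * a ^+ j * C)) * C))
    (fun x => conv (Klow eta0 N) h x + conv (Keta eta0 k) rem x) (piece k (dist_of w)).
  apply: brep_eq (brepD rep1 rep2) => g sg.
  have sEg := schwartz_mult (schwartz_eta eta0P k) sg.
  rewrite -(piece_mult eta0P _ _ (schwartz_low eta0P N) sg) -(sum_pieces eta0P N tu sEg).
  have [c' Lc'] := schwartz_L1n sEg.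
  rewrite (eq_bigr (fun j : 'I_N.+1 => cI mu (fun x => Ht j x * mult (lp_eta eta0 k) g x))); last first.
    by move=> j _; exact: (hHt j).2.
  rewrite -cI_sum; last by move=> j; exact: bdd_L1 (hHt j).1 Lc'.
  rewrite /dist_of -![cintegral _ _]/(cI _ _) lp_pieceE /dist_of -![cintegral _ _]/(cI _ _).
  rewrite -cID; last 2 first.
  - by apply: L1_sum => j; exact: bdd_L1 (hHt j).1 Lc'.
  - exact: bdd_L1 brem Lc'.
  by apply: eq_cI => x; rewrite /rem /P mulrBl -mulr_suml addrC subrK.
exists (fun x => conv (Klow eta0 N) h x + conv (Keta eta0 k) rem x).
(* the crude bound in [rep] depends on N; improve it by summing the rests *)
apply: brep_bdd rep _.
pose rs j := rest N j (Ht j).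
have mrs j : cmeas (rs j).
  apply: cmeasB; first exact: (avg_bdd N (hHt j).1).1.
  by case: (j <= N)%N; [exact: (hHt j).1.1|exact: cmeas_cst].
have srsE n x : \sum_(j < n) rs j x =
    \sum_(j < n) avg N (Ht j) x - \sum_(j < n | (j < N.+1)%N) Ht j x.
  by rewrite sumrB; congr (_ - _); rewrite [RHS]big_mkcond.
have rsb j : exists A, bdd A (rs j).
  eexists; apply: (bddB (avg_bdd N (hHt j).1)).
  instantiate (1 := 2 * (M * a ^+ j * C)); split.
    by case: (j <= N)%N; [exact: (hHt j).1.1|exact: cmeas_cst].
  by move=> x; case: ifP => _; [exact: (hHt j).1.2|rewrite normc_zero !mulr_ge0].
have srs_le n x : normc (\sum_(j < n) rs j x) <= B * S + \sum_(j < N.+1) 2 * (M * a ^+ j * C).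
  rewrite srsE; apply: le_trans (le_normcD _ _) _; rewrite normcN; apply: lerD => //.
  apply: le_trans (le_normc_sum _ _ _) _.
  apply: (@le_trans _ _ (\sum_(j < n | (j < N.+1)%N) 2 * (M * a ^+ j * C))).
    by apply: ler_sum => j _; exact: (hHt j).1.2.
  pose G j : R := 2 * (M * a ^+ j * C); rewrite (big_ord_widen (n + N.+1) G (leq_addl _ _)).
  apply: (@le_trans _ _ (\sum_(0 <= j < n | (j < N.+1)%N) G j)); first by rewrite big_mkord.
  rewrite -[leRHS](big_mkord (fun j => j < N.+1)%N G).
  rewrite [leRHS](big_cat_nat _ (n := n)) ?leq_addr//= lerDl sumr_ge0// => j _.
  by rewrite !mulr_ge0.
have crem x : ccvg (fun n => \sum_(j < n) rs j x) (rem x).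
  apply: (eq_ccvg (a := fun n => \sum_(j < n) avg N (Ht j) x +
    - \sum_(j < n | (j < N.+1)%N) Ht j x)).
    by move=> n; rewrite srsE.
  apply: ccvgD => //; apply: cvg_near_cst; exists N.+1 => // n /= Nn.
  by rewrite /P (big_ord_widen n (fun j => Ht j x) Nn) subrr normc_zero.
have brs j x : normc (conv (Keta eta0 k) (rs j) x) <=
    BC * (2 * C * C) * (M * (sig N k * a ^+ N)) * b ^+ dist j N.
  have [_ kF _] := kC j.
  apply: le_trans (block_conv x (hH j).1 kF (fun jN => cI_Kfat eta0P (leq_ltn_trans (leq0n N) jN)) kE) _.
  rewrite -/BC (_ : BC * _ = BC * (2 * C * C) * (M * (sig N k * (rho N j * a ^+ j)))); last by ring.
  rewrite (_ : BC * _ * _ * b ^+ _ = BC * (2 * C * C) * (M * (sig N k * (a ^+ N * b ^+ dist j N)))); last by ring.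
  by do 3 (apply: ler_wpM2l; first by rewrite ?mulr_ge0 ?sig_ge0).
have cconv x : ccvg (fun n => \sum_(j < n) conv (Keta eta0 k) (rs j) x) (conv (Keta eta0 k) rem x).
  pose W1 := B * S + \sum_(j < N.+1) 2 * (M * a ^+ j * C).
  have W10 : 0 <= W1 by exact: le_trans (normc_ge0 _) (srs_le 0%N 0).
  have LEx := L1n_reflect x LE.
  have Lrs j : L1 mu (fun y => rs j y * Keta eta0 k (x - y)).
    by have [A' bA'] := rsb j; exact: bdd_L1 bA' LEx.
  apply: (eq_ccvg (a := fun n => cI mu (fun y => (\sum_(j < n) rs j y) * Keta eta0 k (x - y)))).
    move=> n; rewrite (eq_cI _ (g := fun y => \sum_(j < n) (rs j y * Keta eta0 k (x - y)))).
      by rewrite (cI_sum _ (fun j : 'I_n => Lrs j)).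
    by move=> y; rewrite mulr_suml.
  apply: (@cI_cvg _ _ _ _ _ _ (fun y => W1%:C * Keta eta0 k (x - y))).
  + by move=> n; apply: cmeasM; [exact: cmeas_sum|exact: LEx.1].
  + by apply: cmeasM; [exact: brem.1|exact: LEx.1].
  + exact: L1Z (L1n_L1 LEx).
  + move=> n y; rewrite normcM [leRHS]normcM normcR ger0_norm// ler_wpM2r ?normc_ge0//.
  + move=> y; have := ccvgMl (Keta eta0 k (x - y)) (crem y); rewrite mulrC.
    by apply: eq_ccvg => n; rewrite mulrC.
have b1c := conv_bdd hk.1 LLow.
have b2c : bdd (BC * (2 * C * C) * (M * (sig N k * a ^+ N)) * S) (conv (Keta eta0 k) rem).
  split; first exact: rep2.1.1.
  move=> x; apply: ccvg_normc (cconv x) _ => n.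
  by apply: (sum_dist_bound n (f := fun j => conv (Keta eta0 k) (rs j) x) b01) => j; exact: brs.
apply: bdd_le (bddD b1c b2c).
have A0 := bdd_ge0 hk.1; have := sig_le N k; set X := a ^+ k * _ => sX.
have X0 : 0 <= X by rewrite mulr_ge0// exprn_ge0// ltW// decay_gt0.
rewrite -[M * a ^+ k * _]mulrA -/X.
apply: le_trans (_ : 2 * (A * C) + BC * (2 * C * C) * S * (M * X) <= _).
  rewrite lerD2l (_ : _ * S = BC * (2 * C * C) * S * (M * (a ^+ N * sig N k))); last by ring.
  by apply: ler_wpM2l => //; exact: ler_wpM2l.
rewrite -subr_ge0 (_ : _ - _ = BC * (2 * C * C) * S * A + 2 * C * (M * X)); last by ring.
have C20 : 0 <= 2 * C by rewrite mulr_ge0.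
have Y0 : 0 <= M * X by exact: mulr_ge0.
by apply: addr_ge0; exact: mulr_ge0.
Qed.

End main_estimate.

(** * The uniform bounds *)

Section besov_bounds.
Context {R : realType} {d : nat}.
Implicit Types (x y z xi : 'rV[R]_d) (f g h w : 'rV[R]_d -> R[i]) (A M W s : R)
  (q : \bar R) (u v : functional R d) (H : nat -> 'rV[R]_d -> R[i]).
Variable eta0 : 'rV[R]_d -> R[i].
Hypothesis eta0P : lp_cutoff eta0.
Notation mu := (lebesgue_rV (R := R) d).
Notation piece := (lp_piece eta0).

Lemma dist_Lnorm_ge0 u : (0 <= dist_Lnorm +oo u)%E.
Proof. by apply: le_ereal_inf_tmp => _ [h _ <-]; exact: Lnorm_ge0. Qed.

Let powE s k : 2 `^ (k%:R * s) = (2 `^ (- s)) ^- k.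
Proof. by rewrite mulrC powRrM powR_mulrn ?powR_ge0// powRN exprVn invrK. Qed.

Let pow0 n : 0 < 2 ^+ n :> R. Proof. by rewrite exprn_gt0. Qed.

Let a0 s : 0 < 2 `^ (- s). Proof. by rewrite powR_gt0. Qed.

Lemma besov_seq s q u m : (0 < q)%E -> 0 <= m -> (besov_norm eta0 s +oo q u <= m%:E)%E ->
  exists r : nat -> R, [/\ forall j, 0 <= r j, lqn q m r
    & forall j, dist_Lnorm +oo (piece j u) = ((2 `^ (- s)) ^+ j * r j)%:E].
Proof.
move=> q0 m0 um; pose F j : \bar R := ((2 `^ (j%:R * s))%:E * dist_Lnorm +oo (piece j u))%E.
have F0 j : (0 <= F j)%E by rewrite mule_ge0 ?dist_Lnorm_ge0// lee_fin powR_ge0.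
have Fm j : (F j <= m%:E)%E by apply: le_trans um; exact: (Lnorm_term j q0 F0).
have Ff j : F j = (fine (F j))%:E.
  by rewrite fineK// ge0_fin_numE//; exact: le_lt_trans (Fm j) (ltry _).
exists (fun j => fine (F j)); split.
- by move=> j; rewrite -lee_fin -Ff.
- apply/Lnorm_lqn => //; first by move=> j; rewrite -lee_fin -Ff.
  apply: le_trans um; rewrite /besov_norm le_eqVlt; apply/orP; left; apply/eqP.
  by congr Lnorm; apply/funext => j; rewrite /= -Ff.
- move=> j; rewrite EFinM -Ff /F powE muleA -EFinM mulfV ?mul1e//.
Qed.

Lemma seq_besov s q u m (r : nat -> R) : (0 < q)%E -> 0 <= m -> (forall j, 0 <= r j) ->
  lqn q m r -> (forall j, dist_Lnorm +oo (piece j u) <= ((2 `^ (- s)) ^+ j * r j)%:E)%E ->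
  (besov_norm eta0 s +oo q u <= m%:E)%E.
Proof.
move=> q0 m0 r0 rm ur.
apply: le_trans (_ : (Lnorm counting q (EFin \o r) <= _)%E); last exact/Lnorm_lqn.
apply: le_Lnorm => // j; rewrite mule_ge0 ?dist_Lnorm_ge0 ?lee_fin ?powR_ge0//=.
apply: le_trans (lee_wpmul2l _ (ur j)) _; first by rewrite lee_fin powR_ge0.
by rewrite -EFinM lee_fin powE mulrA mulVf ?mul1r// expf_neq0// gt_eqF.
Qed.

Lemma besov_norm_ge0 s q u : (0 <= besov_norm eta0 s +oo q u)%E.
Proof. exact: Lnorm_ge0. Qed.

Lemma besov_reps s q u m : (0 < q)%E -> 0 <= m -> (besov_norm eta0 s +oo q u <= m%:E)%E ->
  exists H, forall j, brep ((m + 1) * (2 `^ (- s)) ^+ j) (H j) (piece j u).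
Proof.
move=> q0 m0 um; have [r [r0 rm ur]] := besov_seq q0 m0 um.
have e j : exists h, brep ((m + 1) * (2 `^ (- s)) ^+ j) h (piece j u).
  apply: dist_Lnorm_brep; rewrite ur lte_fin mulrC ltr_pM2r ?exprn_gt0//.
  by apply: le_lt_trans (lqn_term j q0 m0 r0 rm) _; rewrite ltrDl.
by exists (fun j => projT1 (cid (e j))) => j; case: cid.
Qed.

Lemma besov_fin s q u : besov eta0 s +oo q u ->
  exists m, 0 <= m /\ (besov_norm eta0 s +oo q u <= m%:E)%E.
Proof.
move=> [_ uoo]; exists (fine (besov_norm eta0 s +oo q u)).
rewrite fine_ge0 ?besov_norm_ge0// fineK//.
by rewrite ge0_fin_numE ?besov_norm_ge0.
Qed.

Lemma conv_lipschitz C t A L K f x : 0 < t -> kernel_at C t K -> bdd A f -> 0 <= L ->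
  (forall x z, normc (f (x + z) - f x) <= L * `|z|) ->
  normc (conv K f x - f x * cI mu K) <= 2 * (L * (C / t)).
Proof.
move=> t0 [sK LK _ Km] bf L0 fL; have LKx := L1n_reflect x LK.
have E : conv K f x - f x * cI mu K = cI mu (fun y => (f y - f x) * K (x - y)).
  rewrite -(cI_reflect x (L1n_L1 LK)) -cIZ; last exact: L1n_L1 LKx.
  rewrite /conv -cIB; [|exact: bdd_L1 bf LKx|exact: L1Z (L1n_L1 LKx)].
  by apply: eq_cI => y; rewrite mulrBl.
have LF : L1 mu (fun y => (f y - f x) * K (x - y)).
  have := L1B (bdd_L1 bf LKx) (L1Z (f x) (L1n_L1 LKx)); congr L1; apply/funext => y.
  by rewrite mulrBl.
rewrite E; apply: normc_cI_n; split; first exact: LF.1.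
have mK : cmeas (fun z : 'rV[R]_d => (`|z|)%:C * K z).
  apply: cmeasM; last exact: LK.1.
  by apply: cmeasR; apply: continuous_measurable_rV => z; exact: norm_continuous.
have mKr := cmeas_reflect x mK.
apply: (@le_trans _ _ (norm1 mu (fun y => L%:C * ((`|x - y|)%:C * K (x - y)))%R)).
  apply: le_norm1; first exact: LF.1.
    by apply: cmeasM; [exact: cmeas_cst|exact: mKr].
  move=> y; rewrite mulrA [leRHS]normcM normcM ler_wpM2r ?normc_ge0//.
  rewrite normcM !normcR ger0_norm// normr_id.
  by have := fL x (y - x); rewrite [x + _]addrC subrK distrC.
rewrite norm1Z// normcR ger0_norm// EFinM; apply: lee_wpmul2l => //.
rewrite (norm1_reflect x mK); apply: le_trans Km.
rewrite /norm1 le_eqVlt; apply/orP; left; apply/eqP; apply: eq_integral => z _.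
by rewrite normcM normcR normr_id.
Qed.

(** Schwartz functions are recovered from their pieces, and E_N is continuous for
    the uniform convergence of the partial sums. *)
Lemma schwartz_spec N f : schwartz f ->
  avg_spec eta0 N (dist_of f) (avg N f) /\
  exists A : nat -> R, forall j, brep (A j) (conv (Keta eta0 j) f) (piece j (dist_of f)).
Proof.
move=> sf; have [C [C0 kC]] := lp_kernels eta0P.
have [Af bf] := schwartz_bdd sf; have [L [L0 fL]] := schwartz_lipschitz_sup sf.
have hj j : brep (2 * (Af * C)) (conv (Keta eta0 j) f) (piece j (dist_of f)).
  have [[_ LK _ _] _ _] := kC j.
  exact: (brep_mult (schwartz_eta eta0P j) LK (bdd_brep bf)).
split; last by exists (fun=> 2 * (Af * C)).
have KetaL1 j : L1n C (Keta eta0 j) by have [[]] := kC j.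
have sumK n : (fun z => \sum_(j < n.+1) Keta eta0 j z) = Klow eta0 n.
  apply/funext => z; rewrite /Klow inv_fourierE.
  rewrite (eq_cI _ (g := fun xi => \sum_(j < n.+1) (lp_eta eta0 j xi * wave z xi))).
    rewrite cI_sum => [|j]; last by apply: L1_wave; apply: schwartz_L1; exact: schwartz_eta.
    by apply: eq_bigr => j _; rewrite /Keta inv_fourierE.
  by move=> xi; rewrite -(sum_eta eta0 n xi) mulr_suml.
have sumC n x : \sum_(j < n.+1) conv (Keta eta0 j) f x = conv (Klow eta0 n) f x.
  rewrite -sumK /conv -cI_sum; last by move=> j; exact: bdd_L1 bf (L1n_reflect x (KetaL1 j)).
  by apply: eq_cI => y; rewrite mulr_sumr.
have near n x : normc (conv (Klow eta0 n) f x - f x) <= 2 * (L * (C / 2 ^+ n)).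
  have [_ _ kL] := kC n.
  have := conv_lipschitz x (pow0 n) kL bf L0 fL.
  by rewrite (cI_Klow eta0P) mulr1.
have [Bf bavgf] : exists B, bdd B (avg N f) by eexists; exact: avg_bdd bf.
have avgS n x : \sum_(j < n.+1) avg N (conv (Keta eta0 j) f) x = avg N (conv (Klow eta0 n) f) x.
  rewrite /avg -cI_sum; last by move=> j; exact: bdd_L1 (hj j).1 (L1n_avgk N x).
  by apply: eq_cI => y; rewrite -mulr_suml sumC.
have b1 n : bdd (2 * (Af * C)) (conv (Klow eta0 n) f).
  by have [_ _ [_ LK _ _]] := kC n; exact: conv_bdd.
have avgn n x : normc (avg N (conv (Klow eta0 n) f) x - avg N f x) <=
    2 * (2 * (L * (C / 2 ^+ n)) * 1).
  have b2 : bdd (2 * (L * (C / 2 ^+ n))) (fun y => conv (Klow eta0 n) f y - f y).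
    by split; [exact: (bddB (b1 n) bf).1|move=> y; exact: near].
  rewrite -(avgB N (b1 n) bf); exact: normc_cI_bdd b2 (L1n_avgk N x).
apply: (avg_spec_intro eta0P hj (W := 2 * (2 * (Af * C)))).
  move=> x; rewrite /ccvg -cvg_shiftS/=.
  apply: (@ccvg_le _ (fun n => \sum_(j < n.+1) avg N (conv (Keta eta0 j) f) x) _
    (fun n => 2 * (2 * (L * C)) * (2^-1 : R) ^+ n)).
    rewrite -(mulr0 (2 * (2 * (L * C)))); apply: cvgM; first exact: cvg_cst.
    by apply: cvg_expr; rewrite ger0_norm// invf_lt1// ltr1n.
  move=> n; rewrite avgS; apply: le_trans (avgn n x) _.
  by rewrite exprVn le_eqVlt; apply/orP; left; apply/eqP; ring.
move=> x [|n]; first by rewrite big_ord0 normc_zero !mulr_ge0// (bdd_ge0 bf).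
by rewrite avgS; exact: (avg_bdd N (b1 n)).2.
Qed.

(** A Lipschitz function has pieces of size [2^-j], which is enough for all
    [s <= 0] and all [q]. *)
Lemma schwartz_pieces f : schwartz f -> exists D : R, 0 <= D /\ forall j,
  exists h, brep (D / 2 ^+ j) h (piece j (dist_of f)).
Proof.
move=> sf; have [C [C0 kC]] := lp_kernels eta0P.
have [Af bf] := schwartz_bdd sf; have [L [L0 fL]] := schwartz_lipschitz_sup sf.
exists (2 * (Af * C) + 2 * (L * C)); split.
  by rewrite addr_ge0// !mulr_ge0// (bdd_ge0 bf).
move=> j; have [kE _ _] := kC j; have [_ LK _ _] := kE.
have rep := brep_mult (schwartz_eta eta0P j) LK (bdd_brep bf).
exists (conv (Keta eta0 j) f); case: (posnP j) => [j0|j0].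
  apply: brep_le rep; rewrite j0 expr0 divr1 lerDl !mulr_ge0//.
apply: (brep_bdd rep); split; first exact: rep.1.1.
move=> x; apply: le_trans (_ : 2 * (L * (C / 2 ^+ j)) <= _); last first.
  rewrite (_ : 2 * _ = 2 * (L * C) / 2 ^+ j); last by ring.
  by rewrite ler_pM2r ?invr_gt0// lerDr !mulr_ge0 ?(bdd_ge0 bf).
have := conv_lipschitz x (pow0 j) kE bf L0 fL.
by rewrite (cI_Keta eta0P j0) mulr0 subr0.
Qed.

Let pow2_lt (x y : R) : x < y -> 2 `^ x < 2 `^ y.
Proof.
move=> xy; rewrite /powR gt_eqF// ltr_expR ltr_pM2r//.
by rewrite ln_gt0// ltr1n.
Qed.

Let pow2_ge1 s : s <= 0 -> 1 <= 2 `^ (- s).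
Proof.
move=> s0; have : 2 `^ 0 <= 2 `^ (- s) by apply: ler_powR; rewrite ?ler1n// oppr_ge0.
by rewrite powRr0.
Qed.

Lemma schwartz_besov_scale s q f : (0 < q)%E -> s <= 0 -> schwartz f ->
  exists M : R, 0 <= M /\ forall lam : R, 0 <= lam ->
    (besov_norm eta0 s +oo q (dist_of (fun x => (lam%:C * f x)%R)) <= (lam * M)%:E)%E.
Proof.
move=> q0 s0 sf; have [D [D0 Dh]] := schwartz_pieces sf.
have h01 : 0 <= (2^-1 : R) <= 1 by rewrite invr_ge0 ler0n invf_le1// ler1n.
have h1 : (2^-1 : R) < 1 \/ q = +oo%E by left; rewrite invf_lt1// ltr1n.
have [M [M0 MP]] := lqn_dist q0 h01 h1.
have e0 j : 0 <= (2^-1 : R) ^+ dist j 0 by rewrite exprn_ge0// invr_ge0.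
exists (D * M); split; first exact: mulr_ge0.
move=> lam lam0; apply: (seq_besov (r := fun j => lam * (D * (2^-1) ^+ dist j 0))) => //.
- by rewrite !mulr_ge0.
- by move=> j; rewrite !mulr_ge0.
- apply: lqnZ => //; [exact: mulr_ge0|by move=> j; rewrite mulr_ge0|].
  by apply: lqnZ => // j; rewrite exprn_ge0// invr_ge0.
move=> j; have [h [bh hE]] := Dh j.
have hl : brep (normc (lam%:C) * (D / 2 ^+ j)) (fun x => lam%:C * h x)
    (piece j (dist_of (fun x => lam%:C * f x))).
  split; first exact: bddZ.
  move=> g sg; have [c Lg] := schwartz_L1n sg.
  rewrite (eq_cI _ (g := fun x => lam%:C * (h x * g x))) => [|x]; last by rewrite mulrA.
  rewrite cIZ; last exact: bdd_L1 bh Lg.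
  rewrite -hE// !lp_pieceE /dist_of -![cintegral _ _]/(cI _ _).
  have [A bf] := schwartz_bdd sf.
  have [c' Lm] := schwartz_L1n (schwartz_mult (schwartz_eta eta0P j) sg).
  by rewrite -cIZ; [apply: eq_cI => x; rewrite mulrA|exact: bdd_L1 bf Lm].
apply: le_trans (brep_dist_Lnorm hl) _; rewrite normcR ger0_norm//.
rewrite lee_fin /dist subn0 addn0 exprVn -[leLHS]mul1r; apply: ler_wpM2r.
  by rewrite mulr_ge0// divr_ge0// exprn_ge0.
by rewrite exprn_ege1// pow2_ge1.
Qed.

Lemma schwartz_besov s q f : (0 < q)%E -> s <= 0 -> schwartz f -> besov eta0 s +oo q (dist_of f).
Proof.
move=> q0 s0 sf; have [Af bf] := schwartz_bdd sf; split; first exact: tempered_dist_of bf.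
have [M [M0 MP]] := schwartz_besov_scale q0 s0 sf.
have := MP 1 ler01; rewrite (_ : (fun x => _) = f); first by move=> h; exact: le_lt_trans h (ltry _).
by apply/funext => x; rewrite (_ : 1%:C = 1)// mul1r.
Qed.

Lemma dist_Lnorm_deq u v : deq u v -> dist_Lnorm +oo u = dist_Lnorm +oo v.
Proof.
move=> uv; congr ereal_inf; congr image; apply/funext => h; apply/propext.
by split=> -[mh ih hE]; split => // g sg; rewrite hE// uv.
Qed.

Lemma besov_norm_deq s q u v : deq u v -> besov_norm eta0 s +oo q u = besov_norm eta0 s +oo q v.
Proof.
move=> uv; congr Lnorm; apply/funext => j; congr (_ * _)%E.
by apply: dist_Lnorm_deq; exact: piece_deq.
Qed.

Let a12 s : -1 < s -> s <= 0 -> 1 <= 2 `^ (- s) < 2.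
Proof.
move=> s1 s0; apply/andP; split.
  exact: pow2_ge1.
have : 2 `^ (- s) < 2 `^ 1 by apply: pow2_lt; rewrite ltrNl.
by rewrite powRr1.
Qed.

Lemma avg_ext_besov s q N u : (0 < q)%E -> -1 < s -> s <= 0 -> besov eta0 s +oo q u ->
  exists w H (A : nat -> R), [/\ avg_spec eta0 N u w, avg_ext eta0 N u = dist_of w &
    forall j, brep (A j) (H j) (piece j u)].
Proof.
move=> q0 s1 s0 uB; have [m [m0 um]] := besov_fin uB.
have [H hH] := besov_reps q0 m0 um.
have [D [_ DP]] := avg_main eta0P (a12 s1 s0).
have m10 : 0 <= m + 1 by rewrite addr_ge0.
have [w [uw _]] := DP N u _ H uB.1 m10 hH.
exists w, H, (fun j => (m + 1) * (2 `^ (- s)) ^+ j); split => //.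
by apply: (avg_extE (H := H)) uw => j; exact: brep_represents (hH j).
Qed.

Lemma avg_ext_is_extension s q N : (0 < q)%E -> -1 < s -> s <= 0 ->
  is_extension eta0 s +oo q N (avg_ext eta0 N).
Proof.
move=> q0 s1 s0; split.
- move=> u /(avg_ext_besov N q0 s1 s0)[w [H [A [[[W bw] _] -> _]]]].
  exact: tempered_dist_of bw.
- move=> u v /(avg_ext_besov N q0 s1 s0)[w [H [A [uw -> hu]]]].
  move=> /(avg_ext_besov N q0 s1 s0)[w' [H' [A' [vw -> hv]]]] uv g sg.
  suff -> : w = w' by [].
  have E j : represents (H j) (piece j v).
    have [mh ih hE] := brep_represents (hu j); split => //.
    by move=> k sk; rewrite hE//; exact: (piece_deq eta0P j uv).
  apply: (avg_spec_unique E _ vw); split; first exact: uw.1.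
  move=> K hK; apply: uw.2 => j; have [mh ih hE] := hK j; split => // k sk.
  by rewrite hE//; apply/esym; exact: (piece_deq eta0P j uv).
- move=> a u v /(avg_ext_besov N q0 s1 s0)[w [H [A [uw -> hu]]]].
  move=> /(avg_ext_besov N q0 s1 s0)[w' [H' [A' [vw -> hv]]]] g sg.
  have [sw hw] := avg_ext_linear eta0P a hu hv uw vw.
  rewrite (avg_extE (fun j => brep_represents (hw j)) sw).
  have [[[W bw] _] [[W' bw'] _]] := (uw, vw); have [c Lg] := schwartz_L1n sg.
  have i1 := bdd_L1 bw Lg; have i2 := bdd_L1 bw' Lg.
  rewrite /dist_of -![cintegral _ _]/(cI _ _) -cIZ// -cID//; last exact: L1Z.
  by apply: eq_cI => x; rewrite mulrDl mulrA.
- move=> f sf; have [sp [A hA]] := schwartz_spec N sf.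
  rewrite (avg_extE (fun j => brep_represents (hA j)) sp) => g sg.
  suff -> : dyadic_avg N f = avg N f by [].
  by apply/funext => x; apply: dyadic_avgE; exact: L1_avgk (schwartz_L1 sf).
Qed.

Lemma avg_ext_acts_by_series s q N : (0 < q)%E -> -1 < s -> s <= 0 ->
  acts_by_series eta0 s +oo q N (avg_ext eta0 N).
Proof.
move=> q0 s1 s0 u /(avg_ext_besov N q0 s1 s0)[w [H [A [uw -> hu]]]] h hh g sg.
exact: avg_spec_series uw hh g sg.
Qed.

Lemma avg_ext_bounded s q : (0 < q)%E -> -1 < s -> s <= 0 -> s < 0 \/ q = +oo%E ->
  exists C : R, forall N, (op_norm eta0 s +oo q (avg_ext eta0 N) <= C%:E)%E.
Proof.
move=> q0 s1 s0 sq; have A12 := a12 s1 s0; set a := 2 `^ (- s) in A12.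
have [D [D0 DP]] := avg_main eta0P A12; set c := Num.max _ _ in DP.
have c0 : 0 < c by exact: decay_gt0.
have c1 : c < 1 \/ q = +oo%E.
  case: sq => [sn|]; [left|by right]; apply: decay_lt1 => //.
  have : 2 `^ 0 < a by apply: pow2_lt; rewrite oppr_gt0.
  by rewrite powRr0.
have c01 : 0 <= c <= 1 by rewrite ltW//=; exact: decay_le1.
have [M [M0 MP]] := lqn_dist q0 c01 c1.
have [cq [cq0 cqP]] := lqnD q0.
exists (D * (cq * (1 + 3 * M))) => N; apply: ge_ereal_sup => _ [u [uB u1] <-].
have [r [r0 rq ru]] := besov_seq q0 ler01 u1; rewrite -/a in ru.
have [H hH] := besov_reps q0 ler01 u1; rewrite -/a in hH.
have [w [uw wP]] := DP N u _ H uB.1 (addr_ge0 ler01 ler01) hH.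
rewrite (avg_extE (fun j => brep_represents (hH j)) uw).
have dk k : 0 < c ^+ dist k N by rewrite exprn_gt0.
have a0' k : 0 < a ^+ k by rewrite exprn_gt0// powR_gt0.
have dk3 k : 0 <= 3 * c ^+ dist k N by rewrite mulr_ge0// ltW.
have M30 : 0 <= 3 * M by rewrite mulr_ge0.
apply: (seq_besov (r := fun k => D * (r k + 3 * c ^+ dist k N))) => //.
- by rewrite !mulr_ge0// addr_ge0.
- by move=> k; rewrite mulr_ge0// addr_ge0.
- apply: lqnZ => //; first by rewrite mulr_ge0// addr_ge0.
    by move=> k; rewrite addr_ge0.
  apply: cqP => //; apply: lqnZ => // k; exact: ltW.
move=> k.
have lt : (dist_Lnorm +oo (piece k u) < (a ^+ k * (r k + c ^+ dist k N))%:E)%E.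
  by rewrite ru lte_fin ltr_pM2l// ltrDl.
have [h hk] := dist_Lnorm_brep lt; have [h' hk'] := wP _ _ _ hk.
apply: le_trans (brep_dist_Lnorm hk') _; rewrite lee_fin -/a.
by rewrite le_eqVlt; apply/orP; left; apply/eqP; ring.
Qed.

Lemma avg_uniformly_bounded s q : (0 < q)%E -> -1 < s -> s <= 0 -> s < 0 \/ q = +oo%E ->
  uniformly_bounded_extensions eta0 s +oo q.
Proof.
move=> q0 s1 s0 sq; exists (avg_ext eta0); split.
  by move=> N; split; [exact: avg_ext_is_extension|exact: avg_ext_acts_by_series].
have [C CP] := avg_ext_bounded q0 s1 s0 sq.
by apply: le_lt_trans (ltry C); apply: ge_ereal_sup => _ [N _ <-].
Qed.

End besov_bounds.

(** * Test functions concentrated in one frequency annulus *)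

Section tests.
Context {R : realType} {d : nat}.
Implicit Types (x y z xi : 'rV[R]_d) (f g h w : 'rV[R]_d -> R[i]) (A c : R)
  (u v : functional R d).
Variable eta0 : 'rV[R]_d -> R[i].
Hypothesis eta0P : lp_cutoff eta0.
Notation mu := (lebesgue_rV (R := R) d).
Notation piece := (lp_piece eta0).
Notation e_ i := (delta_mx ord0 i : 'rV[R]_d).

Let pow0 n : 0 < 2 ^+ n :> R. Proof. by rewrite exprn_gt0. Qed.
Let pow1 n : 2 ^+ n != 0 :> R. Proof. by rewrite gt_eqF. Qed.

Definition annulus xi : Prop := 3 / 16 < enorm xi < 4^-1.

(** The supports of neighbouring cutoffs overlap only outside these annuli. *)
Lemma eta_annulus j k xi : (0 < k)%N -> annulus ((2 ^+ k)^-1 *: xi) ->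
  lp_eta eta0 j xi = (j == k)%:R.
Proof.
case: k => // k _ /andP[]; rewrite enormZ ger0_norm ?invr_ge0 ?ltW// => h1 h2.
have E m : enorm ((2 ^+ m)^-1 *: xi) = enorm xi / 2 ^+ m.
  by rewrite enormZ ger0_norm ?invr_ge0 ?ltW// mulrC.
have hi m : (k < m)%N -> eta0 ((2 ^+ m)^-1 *: xi) = 1.
  move=> km; apply: (cutoff_eq1 eta0P); rewrite E; apply: le_trans (ltW h2).
  rewrite mulrC; apply: ler_wpM2r; first exact: enorm_ge0.
  by rewrite lef_pV2 ?posrE// ler_weXn2l// ler1n.
have lo m : (m <= k)%N -> eta0 ((2 ^+ m)^-1 *: xi) = 0.
  move=> mk; apply: (cutoff_eq0 eta0P); rewrite E.
  apply: le_trans (_ : enorm xi / 2 ^+ k <= _); last first.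
    by rewrite ler_wpM2l ?enorm_ge0// lef_pV2 ?posrE// ler_weXn2l// ler1n.
  rewrite exprS invfM in h1; rewrite mulrC; lra.
case: j => [|j] /=.
  by have := lo 0%N (leq0n k); rewrite expr0 invr1 scale1r.
have [jk|jk|jk] := ltngtP j k.
- by rewrite !lo ?subrr ?(ltnW jk)// eqSS ltn_eqF.
- by rewrite !hi// ?subrr ?eqSS ?gtn_eqF// ltnW.
- by rewrite jk hi// lo// subr0 eqxx.
Qed.

Definition annular g : Prop := schwartz g /\ forall xi, inv_fourier g xi != 0 -> annulus xi.

Definition test k y g x : R[i] := (2 ^+ (k * d))%:C * g (2 ^+ k *: (x - y)).

Let testE k y g : test k y g = fun x => (2 ^+ (k * d))%:C * g (2 ^+ k *: x + - (2 ^+ k *: y)).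
Proof. by apply/funext => x; rewrite /test scalerBr. Qed.

Lemma schwartz_test k y g : schwartz g -> schwartz (test k y g).
Proof. by move=> sg; rewrite testE; apply: schwartzZ; exact: schwartz_affine. Qed.

Lemma L1n_test k y c g : L1n c g -> L1n c (test k y g).
Proof.
move=> [mg gc]; rewrite testE; split; first exact/cmeasM/cmeas_affine/mg/cmeas_cst.
rewrite norm1Z; last exact: cmeas_affine.
rewrite norm1_affine// normcR !ger0_norm ?(ltW (pow0 _))// muleA -EFinM -exprM mulfV//.
by rewrite mul1e.
Qed.

(** Testing against a concentrated function is averaging a blow-up. *)
Lemma cI_test k y g f : L1 mu g -> L1 mu (fun x => f x * test k y g x) ->
  L1 mu (fun z => f ((2 ^+ k)^-1 *: z + y) * g z) ->
  cI mu (fun x => f x * test k y g x) =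
  cI mu (fun z => f ((2 ^+ k)^-1 *: z + y) * g z).
Proof.
move=> Lg L L'; have p1 : (2 ^+ k)^-1 != 0 :> R by rewrite invr_eq0.
have := cI_affine y p1 L.
rewrite ger0_norm ?invr_ge0 ?(ltW (pow0 _))// exprVn invrK => E.
have pc : (2 ^+ k ^+ d)%:C != 0 :> R[i].
  by rewrite (_ : 0 = 0%:C)// (inj_eq (@complexI R)) expf_neq0.
apply: (mulfI pc); rewrite -E -cIZ//; apply: eq_cI => z.
by rewrite /test addrK scalerA mulfV// scale1r -exprM mulrCA.
Qed.

Lemma inv_fourier_test k y g xi : schwartz g ->
  inv_fourier (test k y g) xi = wave xi y * inv_fourier g ((2 ^+ k)^-1 *: xi).
Proof.
move=> sg; have p1 : (2 ^+ k)^-1 != 0 :> R by rewrite invr_eq0.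
have L := L1_wave xi (schwartz_L1 (schwartz_test k y sg)).
have := cI_affine y p1 L; rewrite ger0_norm ?invr_ge0 ?(ltW (pow0 _))// exprVn invrK => E.
have pc : (2 ^+ k ^+ d)%:C != 0 :> R[i].
  by rewrite (_ : 0 = 0%:C)// (inj_eq (@complexI R)) expf_neq0.
rewrite !inv_fourierE; apply: (mulfI pc); rewrite -E mulrA [_%:C * wave _ _]mulrC -!mulrA.
rewrite -cIZ; last exact: L1_wave (schwartz_L1 sg).
rewrite -cIZ; last exact: L1Z (L1_wave _ (schwartz_L1 sg)).
apply: eq_cI => z; rewrite /test addrK scalerA mulfV// scale1r -exprM waveDr.
by rewrite waveZl; ring.
Qed.

Lemma mult_test k y g : (0 < k)%N -> annular g -> mult (lp_eta eta0 k) (test k y g) = test k y g.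
Proof.
move=> k0 [sg ag]; rewrite -[RHS]fourierK; last exact: schwartz_test.
congr fourier; apply/funext => xi; rewrite inv_fourier_test//.
have [->|nz] := eqVneq (inv_fourier g ((2 ^+ k)^-1 *: xi)) 0; first by rewrite !mulr0.
by rewrite (eta_annulus k k0 (ag _ nz)) eqxx mul1r.
Qed.

Lemma test_bound k y A c h g v : (0 < k)%N -> annular g -> L1n c g -> brep A h (piece k v) ->
  normc (v (test k y g)) <= 2 * (A * c).
Proof.
move=> k0 ag Lg [bh vE].
rewrite -(mult_test y k0 ag) -lp_pieceE vE; last exact: schwartz_test ag.1.
exact: normc_cI_bdd bh (L1n_test k y Lg).
Qed.

Lemma test_dist_Lnorm k y (r c : R) g v : (0 < k)%N -> annular g -> L1n c g ->
  (dist_Lnorm +oo (piece k v) <= r%:E)%E -> normc (v (test k y g)) <= 2 * (r * c).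
Proof.
move=> k0 ag Lg vr; have c0 := L1n_ge0 Lg.
apply/ler_addgt0Pl => e e0; have c1 : 0 < 2 * c + 1 by rewrite ltr_wpDl// mulr_ge0.
have [h hv] : exists h, brep (r + e / (2 * c + 1)) h (piece k v).
  by apply: dist_Lnorm_brep; apply: le_lt_trans vr _; rewrite lte_fin ltrDl divr_gt0.
apply: le_trans (test_bound y k0 ag Lg hv) _.
rewrite (_ : 2 * (_ * c) = e * (2 * c / (2 * c + 1)) + 2 * (r * c)); last by ring.
rewrite lerD2r.
by rewrite ler_piMr ?(ltW e0)// ler_pdivrMr// mul1r lerDl.
Qed.

Lemma enorm_axis (a : R) i z e : 0 <= e <= a -> enorm z <= e ->
  a - e <= enorm (a *: e_ i + z) <= a + e.
Proof.
move=> /andP[e0 ea] ze; have a0 : 0 <= a by exact: le_trans ea.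
have zi := le_trans (coord_le_enorm z i) ze.
apply/andP; split.
  apply: le_trans (coord_le_enorm _ i); rewrite !mxE !eqxx/= mulr1.
  apply: le_trans (ler_norm _); move: zi; rewrite ler_norml => /andP[h _]; lra.
rewrite -(@ler_pXn2r _ 2)// ?nnegrE ?enorm_ge0 ?addr_ge0// sqr_enorm.
have E : \sum_j (a *: e_ i + z) ord0 j ^+ 2 = a ^+ 2 + 2 * a * z ord0 i + enorm z ^+ 2.
  rewrite sqr_enorm (bigD1 i)//= [in RHS](bigD1 i)//= !mxE !eqxx/= mulr1.
  rewrite (eq_bigr (fun j => z ord0 j ^+ 2)); first by ring.
  by move=> j ji; rewrite !mxE (negbTE ji) andbF/= mulr0 add0r.
have z2 : enorm z ^+ 2 <= e ^+ 2 by rewrite lerXn2r ?nnegrE ?enorm_ge0.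
have az : a * z ord0 i <= a * e by rewrite ler_wpM2l// (le_trans (ler_norm _)).
rewrite E sqrrD mulr2n; lra.
Qed.

(** On the half-axis of [e_ i] the midpoint of [annulus] is at [7/32]; the scale 16
    makes the support fit. *)
Definition bump i xi : R[i] := eta0 (16 *: (xi - (7 / 32) *: e_ i)).

Lemma schwartz_bump i : schwartz (bump i).
Proof.
have n0 : (16 : R) != 0 by [].
have := schwartz_affine (- (16 *: ((7 / 32) *: e_ i))) n0 (schwartz_cutoff eta0P).
by congr schwartz; apply/funext => xi; rewrite /bump scalerBr.
Qed.

Lemma bump_center i : bump i ((7 / 32) *: e_ i) = 1.
Proof.
rewrite /bump subrr scaler0 (cutoff_eq1 eta0P)//.
by rewrite -(scale0r (0 : 'rV[R]_d)) enormZ normr0 mul0r invr_ge0.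
Qed.

Lemma bump_support i xi : bump i xi != 0 -> enorm (xi - (7 / 32) *: e_ i) < 3 / 128.
Proof.
move=> nz; rewrite ltNge; apply: contra nz => h; apply/eqP/(cutoff_eq0 eta0P).
by rewrite enormZ ger0_norm//; lra.
Qed.

Lemma near_axis_annulus i xi : enorm (xi - (7 / 32) *: e_ i) <= 3 / 128 -> annulus xi.
Proof.
move=> h; have h' : 0 <= (3 / 128 : R) <= 7 / 32 by apply/andP; split; lra.
have := enorm_axis i h' h; rewrite [_ + (xi - _)]addrC subrK => /andP[h1 h2].
by apply/andP; split; lra.
Qed.

Lemma bump_annulus i xi : bump i xi != 0 -> annulus xi.
Proof. by move=> /bump_support/ltW/near_axis_annulus. Qed.

Lemma annular_fourier b : schwartz b -> (forall xi, b xi != 0 -> annulus xi) ->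
  annular (fourier b).
Proof.
by move=> sb bP; split; [exact: schwartz_fourier|move=> xi; rewrite inv_fourierK//; exact: bP].
Qed.

End tests.

(** * No extension to B^0_{oo,q} for finite q *)

Section jumps.
Context {R : realType} {d : nat}.
Implicit Types (x y z xi : 'rV[R]_d) (f g h w : 'rV[R]_d -> R[i]) (A c : R)
  (u v : functional R d).
Variable eta0 : 'rV[R]_d -> R[i].
Hypothesis eta0P : lp_cutoff eta0.
Variable i : 'I_d.
Notation mu := (lebesgue_rV (R := R) d).
Notation piece := (lp_piece eta0).
Notation e_ i := (delta_mx ord0 i : 'rV[R]_d).

Let half (t : R) g y : R[i] := if t <= y ord0 i then g y else 0.

Let cmeas_half t g : cmeas g -> cmeas (half t g).
Proof.
move=> mg; have m : measurable_fun setT (fun y : 'rV[R]_d => t <= y ord0 i).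
  by apply: measurable_fun_ler; [exact: measurable_cst|exact: measurable_rV_coord].
split.
  rewrite (_ : (fun _ => _) = (fun y => if t <= y ord0 i then cRe (g y) else 0)).
    by apply: measurable_fun_ifT => //; exact: mg.1.
  by apply/funext => x; rewrite /half; case: ifP.
rewrite (_ : (fun _ => _) = (fun y => if t <= y ord0 i then cIm (g y) else 0)).
  by apply: measurable_fun_ifT => //; exact: mg.2.
by apply/funext => x; rewrite /half; case: ifP.
Qed.

Let half_le t g y : normc (half t g y) <= normc (g y).
Proof. by rewrite /half; case: ifP => // _; rewrite normc_zero normc_ge0. Qed.

Let L1_half t g : L1 mu g -> L1 mu (half t g).
Proof. by move=> Lg; exact: (L1_le (cmeas_half t Lg.1) Lg (half_le t g)). Qed.

(** If all half-space integrals vanished, so would those of [g] against step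
    functions of the i-th coordinate, hence against exponentials of it; but these
    integrals are values of the inverse Fourier transform on the i-th axis. *)
Let half_nonzero g a : schwartz g -> inv_fourier g (a *: e_ i) != 0 ->
  exists t, cI mu (half t g) != 0.
Proof.
move=> sg nz; apply: contrapT => no.
have h0 t : cI mu (half t g) = 0.
  by apply/eqP; apply: contrapT => /negP nt; apply: no; exists t.
have Lg := schwartz_L1 sg.
pose p n : R := n.+1%:R; have p0 n : 0 < p n by rewrite /p.
pose node n k : R := k%:R / p n - p n.
pose strip n k y := half (node n k) g y - half (node n k.+1) g y.
have Ls n k : L1 mu (strip n k) by apply: L1B; exact: L1_half.
pose K n := (2 * n.+1 * n.+1)%N.
pose S n y := \sum_(k < K n) expi (2 * pi * a * node n k) * strip n k y.
have S0 n : cI mu (S n) = 0.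
  rewrite /S cI_sum => [|k]; last exact: L1Z.
  apply: big1 => k _; rewrite cIZ// /strip cIB; try exact: L1_half.
  by rewrite !h0 subrr mulr0.
have node_lt n k l : (k <= l)%N -> node n k <= node n l.
  by move=> kl; rewrite lerD2r ler_pM2r ?invr_gt0// ler_nat.
have stripE n k y : strip n k y = if node n k <= y ord0 i < node n k.+1 then g y else 0.
  rewrite /strip /half; have h := node_lt n k k.+1 (leqnSn k).
  rewrite ltNge; have [h1|h1] := leP (node n k.+1) (y ord0 i).
    by rewrite (le_trans h h1) subrr.
  by rewrite andbT subr0.
(* the only strip through y *)
have Sk n (k : 'I_(K n)) y : node n k <= y ord0 i < node n k.+1 ->
    S n y = expi (2 * pi * a * node n k) * g y.
  move=> hk; rewrite /S (bigD1 k)//= stripE hk big1 ?addr0// => l lk.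
  rewrite stripE ifF ?mulr0//; apply/negP => /andP[l1 l2].
  have /andP[k1 k2] := hk; move: lk; rewrite -val_eqE /= neq_ltn => /orP[lk|lk].
    by have := lt_le_trans l2 (le_trans (node_lt n l.+1 k lk) k1); rewrite ltxx.
  by have := lt_le_trans k2 (le_trans (node_lt n k.+1 l lk) l1); rewrite ltxx.
have SE n y : normc (S n y) <= normc (g y).
  have [[k hk]|no'] := pselect (exists k : 'I_(K n), node n k <= y ord0 i < node n k.+1).
    by rewrite (Sk n k y hk) normcM normc_expi mul1r.
  rewrite /S big1 ?normc_zero ?normc_ge0// => k _; rewrite stripE ifF ?mulr0//.
  by apply/negP => hk; apply: no'; exists k.
have SE' n y : `|y ord0 i| < p n -> exists k, node n k <= y ord0 i < node n k.+1 /\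
    S n y = expi (2 * pi * a * node n k) * g y.
  rewrite ltr_norml => /andP[y1 y2]; pose X := (y ord0 i + p n) * p n.
  have X0 : 0 <= X by rewrite mulr_ge0 ?ltW// -ltrBlDr sub0r.
  have /andP[X1 X2] := truncn_itv X0; set k := Num.trunc X in X1 X2.
  have kK : (k < K n)%N.
    rewrite -(ltr_nat R) /K !natrM; apply: le_lt_trans X1 _; rewrite -/(p n) ltr_pM2r//.
    by rewrite mulr_natl mulr2n ltrD2r.
  have hk : node n k <= y ord0 i < node n k.+1.
    by rewrite /node lerBlDr ler_pdivrMr// X1 ltrBrDr ltr_pdivlMr.
  by exists k; split => //; exact: (Sk n (Ordinal kK)).
have lim : ccvg (fun n => cI mu (S n)) (inv_fourier g (a *: e_ i)).
  rewrite inv_fourierE; apply: (@cI_cvg _ _ _ _ _ _ g) => //.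
  - move=> n; rewrite /S; apply: cmeas_sum => k; apply: cmeasM; first exact: cmeas_cst.
    exact: (Ls n k).1.
  - exact: (L1_wave _ Lg).1.
  - move=> y; have G0 := normc_ge0 (g y); set t := y ord0 i.
    apply: (@ccvg_le _ _ _ (fun n => normc (g y) * (2 * `|2 * pi * a| + 2 * `|t|) * (p n)^-1)).
      rewrite -[X in _ --> X](mulr0 (normc (g y) * (2 * `|2 * pi * a| + 2 * `|t|))).
      by apply: cvgM; [exact: cvg_cst|exact: cvg_harmonic].
    move=> n; have wE : wave (a *: e_ i) y = expi (2 * pi * a * t).
      by rewrite /wave dotpZr dotpC dotp_delta mulrA.
    have [tn|tn] := ltP `|t| (p n).
      have [k [/andP[k1 k2] ->]] := SE' n y tn.
      rewrite wE mulrC -mulrBr normcM -[leRHS]mulrA; apply: ler_wpM2l => //.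
      have -> : expi (2 * pi * a * node n k) - expi (2 * pi * a * t) =
          expi (2 * pi * a * t) * (expi (2 * pi * a * (node n k - t)) - 1).
        by rewrite [RHS]mulrBr mulr1 -expiD; congr (expi _ - _); ring.
      rewrite normcM normc_expi mul1r; apply: le_trans (normc_expi_sub1 _) _.
      rewrite normrM mulrA [leRHS]mulrDl; apply: (@le_trans _ _ (2 * `|2 * pi * a| * (p n)^-1)).
        apply: ler_wpM2l; first exact: mulr_ge0.
        rewrite distrC ger0_norm ?subr_ge0// lerBlDr ltW//.
        by rewrite (lt_le_trans k2)// /node -addn1 natrD mulrDl mul1r addrAC addrC.
      by rewrite lerDl mulr_ge0// ?mulr_ge0// invr_ge0 ltW.
    apply: le_trans (le_normcD _ _) _; rewrite normcN normcM normc_wave mulr1.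
    apply: le_trans (lerD (SE n y) (lexx _)) _.
    rewrite -[leRHS]mulrA -mulr2n -[leLHS]mulr_natr; apply: (ler_wpM2l G0); rewrite mulrDl.
    apply: (@le_trans _ _ (2 * `|t| / p n)); first by rewrite ler_pdivlMr// ler_pM2l.
    by rewrite lerDr !mulr_ge0// invr_ge0 ltW.
have := ccvg_unique lim (eq_ccvg (fun n => esym (S0 n)) (ccvg_cst 0)).
by move=> E; rewrite E eqxx in nz.
Qed.

Lemma annular_half_space : exists g, annular g /\ cI mu (half 0 g) != 0.
Proof.
have [sb ab] := annular_fourier (schwartz_bump eta0P i) (@bump_annulus _ _ _ eta0P i).
have nz : inv_fourier (fourier (bump eta0 i)) ((7 / 32) *: e_ i) != 0.
  rewrite inv_fourierK; last exact: schwartz_bump.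
  by rewrite (bump_center eta0P) oner_neq0.
have [t tP] := half_nonzero sb nz; set g := fourier _ in sb ab tP.
exists (fun y => g (y + t *: e_ i)); split.
  split; first by have := schwartz_affine (t *: e_ i) (oner_neq0 _) sb; under eq_fun do (rewrite scale1r).
  move=> xi; rewrite inv_fourier_opp (fourier_shift _ _ (schwartz_L1 sb)).
  rewrite -inv_fourier_opp => h; apply: ab; apply: contra h => /eqP ->.
  by rewrite mulr0.
rewrite -(cI_shift (t *: e_ i) (L1_half t (schwartz_L1 sb))) in tP.
rewrite (eq_cI _ (g := fun y => half t g (y + t *: e_ i)))// => y.
by rewrite /half !mxE !eqxx/= mulr1 -{2}[t]add0r lerD2r.
Qed.

Let near_pow2 (C : R) : \forall k \near \oo, C * (2 ^+ k)^-1 < 2^-1.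
Proof.
have h : (fun k => C * (2^-1 : R) ^+ k) @ \oo --> (0 : R).
  rewrite -(mulr0 C); apply: cvgM; first exact: cvg_cst.
  by apply: cvg_expr; rewrite ger0_norm// invf_lt1// ltr1n.
have h2 : 0 < 2^-1 :> R by rewrite invr_gt0.
have /cvgrPdist_lt/(_ _ h2) := h; apply: filterS => k.
by rewrite sub0r normrN exprVn; apply: le_lt_trans; exact: ler_norm.
Qed.

(** An average that jumps across a face does not have small pieces: blow-ups at
    the face look like a half-space at all scales. *)
Lemma jump_not_besov N (J : R[i]) (q m : R) F : 0 < q -> 0 <= m -> J != 0 ->
  cmeas F -> (forall x, F x = if cube_index N x == 0 then J else 0) ->
  ~ (besov_norm eta0 0 +oo q%:E (dist_of F) <= m%:E)%E.
Proof.
move=> q0 m0 J0 mF FE Fm; have q0' : (0 < q%:E)%E by [].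
have [r [r0 rq ru]] := besov_seq q0' m0 Fm.
have [g [ag I0]] := annular_half_space; have [c Lg] := schwartz_L1n ag.1.
have Lg1 := L1n_L1 Lg; have c0 := L1n_ge0 Lg.
have bF : bdd (normc J) F.
  by split => // x; rewrite FE; case: ifP => _; rewrite ?normc_zero ?normc_ge0.
pose y0 : 'rV[R]_d := \row_j (if j == i then 0 else 2^-1 / 2 ^+ N).
have p0 : 0 < 2 ^+ N :> R by rewrite exprn_gt0.
have lim : ccvg (fun k => dist_of F (test k y0 g)) (J * cI mu (half 0 g)).
  have mz k : cmeas (fun z => F ((2 ^+ k)^-1 *: z + y0)) by exact: cmeas_affine.
  have bz k : bdd (normc J) (fun z => F ((2 ^+ k)^-1 *: z + y0)).
    by split => // z; exact: bF.2.
  apply: (eq_ccvg (a := fun k => cI mu (fun z => F ((2 ^+ k)^-1 *: z + y0) * g z))).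
    move=> k; rewrite -cI_test//; last exact: bdd_L1 (bz k) Lg.
    exact: bdd_L1 bF (L1n_test k y0 Lg).
  rewrite -cIZ; last exact: L1_half.
  apply: (@cI_cvg _ _ _ _ _ _ (fun z => J * g z)).
  - by move=> k; apply: cmeasM; [exact: mz|exact: Lg.1].
  - by apply: cmeasM; [exact: cmeas_cst|exact: cmeas_half Lg.1].
  - exact: L1Z.
  - by move=> k z; rewrite !normcM ler_wpM2r ?normc_ge0//; exact: (bz k).2.
  - move=> z; apply: cvg_near_cst; have := near_pow2 (2 ^+ N * `|z|); apply: filterS => k kz.
    have zj j : `|2 ^+ N * ((2 ^+ k)^-1 * z ord0 j)| < 2^-1.
      apply: (le_lt_trans _ kz); rewrite normrM (ger0_norm (ltW p0)) -mulrA.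
      apply: ler_wpM2l; first exact: ltW.
      rewrite normrM ger0_norm ?invr_ge0 ?exprn_ge0// mulrC ler_wpM2r ?invr_ge0 ?exprn_ge0//.
      exact: rV_coord_le.
    rewrite FE (_ : (_ == 0) = (0 <= z ord0 i)).
      by rewrite /half; case: ifP => _; rewrite ?mulr0 ?mul0r subrr normc_zero.
    have pk : 0 < (2 ^+ k)^-1 :> R by rewrite invr_gt0 exprn_gt0.
    apply/eqP/idP => [/rowP/(_ i)|zi].
      rewrite !mxE eqxx addr0 => h; have := floor_le (2 ^+ N * ((2 ^+ k)^-1 * z ord0 i)).
      by rewrite h !pmulr_rge0.
    apply/rowP => j; rewrite !mxE; apply/floor_def; have := zj j; rewrite ltr_norml => /andP[h1 h2].
    have [ji|ji] := eqVneq j i.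
      rewrite addr0 ji !pmulr_rge0// zi/=; move: h2; rewrite ji /=; lra.
    rewrite mulrDr (_ : 2 ^+ N * (2^-1 / 2 ^+ N) = 2^-1); last by field; rewrite gt_eqF.
    by apply/andP; split; rewrite /=; lra.
set L := J * _ in lim; have L0 : 0 < normc L.
  by rewrite normcM mulr_gt0// lt0r normc_ge0 andbT; apply/eqP => /normc_eq0/eqP;
    apply/negP.
pose e : R := normc L / 2 / (2 * (c + 1)).
have c1 : 0 < 2 * (c + 1) by rewrite mulr_gt0// ltr_wpDl.
have e0 : 0 < e by rewrite !divr_gt0.
have [k0 k0P] : exists k0, forall k, (k0 <= k)%N -> e <= r k.
  have L2 : 0 < normc L / 2 by rewrite divr_gt0.
  have /cvgrPdist_le/(_ _ L2)[n0 _ nP] := lim; exists (maxn n0 1) => k.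
  rewrite geq_max => /andP[nk k1]; have := nP k nk.
  rewrite /= sub0r normrN ger0_norm ?normc_ge0// => h.
  have Lk : normc L / 2 <= normc (dist_of F (test k y0 g)).
    have := le_normcD (L - dist_of F (test k y0 g)) (dist_of F (test k y0 g)).
    rewrite subrK normcB; lra.
  have rk : (dist_Lnorm +oo (piece k (dist_of F)) <= (r k)%:E)%E.
    by rewrite ru oppr0 powRr0 expr1n mul1r.
  have Lg' : L1n (c + 1) g by apply: L1n_le Lg; rewrite lerDl.
  have := test_dist_Lnorm eta0P y0 k1 ag Lg' rk => h3.
  by rewrite ler_pdivrMr// mulrCA; exact: le_trans Lk h3.
pose n := (Num.trunc (m `^ q / e `^ q)).+1.
have eq0 : 0 < e `^ q by rewrite powR_gt0.
have : n%:R * e `^ q <= m `^ q.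
  apply: le_trans (rq (k0 + n)%N).
  rewrite -(big_mkord xpredT (fun k => r k `^ q)) (big_cat_nat _ (n := k0))//=; last exact: leq_addr.
  rewrite -[leLHS]add0r lerD ?sumr_ge0//; first by move=> k _; exact: powR_ge0.
  rewrite -{1}[k0]add0n big_addn addKn big_mkord mulr_natl -[n in leLHS]card_ord -sumr_const.
  apply: ler_sum => k _; apply: ge0_ler_powR; rewrite ?nnegrE ?(ltW q0) ?(ltW e0)//.
  by apply: k0P; exact: leq_addl.
apply/negP; rewrite -ltNge -ltr_pdivrMr//; exact: truncnS_gt.
Qed.

(** A bump inside one cube is smooth, but its average is a multiple of the
    indicator function of that cube. *)
Lemma no_bounded_extension N (q : R) : 0 < q -> ~ admits_bounded_extension eta0 0 +oo q%:E N.
Proof.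
move=> q0 [T [[_ _ _ TS] Too]]; have q0' : (0 < q%:E)%E by [].
have [psi [spsi supp nz]] := orthant_bump eta0P.
have p0 : 0 < 2 ^+ N :> R by rewrite exprn_gt0.
pose t : R := 2 * 2 ^+ N; have t0 : t != 0 by rewrite mulf_neq0// gt_eqF.
pose f x := psi (t *: x).
have sf : schwartz f by have := schwartz_affine 0 t0 spsi; under eq_fun do (rewrite addr0).
have [M [M0 MP]] := schwartz_besov_scale eta0P q0' (lexx 0) sf.
pose lam : R := (M + 1)^-1; have M1 : 0 < M + 1 by rewrite ltr_wpDl.
have lam0 : 0 < lam by rewrite invr_gt0.
pose f1 x := lam%:C * f x; have sf1 : schwartz f1 by exact: schwartzZ.
have fB := schwartz_besov eta0P q0' (lexx 0) sf1.
have f_le1 : (besov_norm eta0 0 +oo q%:E (dist_of f1) <= 1)%E.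
  apply: le_trans (MP lam (ltW lam0)) _; rewrite lee_fin /lam mulrC ler_pdivrMr// mul1r lerDl.
  exact: ler01.
have Tf : (besov_norm eta0 0 +oo q%:E (T (dist_of f1)) <= op_norm eta0 0 +oo q%:E T)%E.
  by apply: ereal_sup_ubound; exists (dist_of f1).
have E : dyadic_avg N f1 = avg N f1.
  by apply/funext => x; apply: dyadic_avgE; exact: L1_avgk (schwartz_L1 sf1).
have := TS _ sf1; rewrite E => /(besov_norm_deq eta0P 0 q%:E) E2; rewrite {}E2 in Tf.
have [m [m0 mP]] : exists m, 0 <= m /\ (besov_norm eta0 0 +oo q%:E (dist_of (avg N f1)) <= m%:E)%E.
  have h := le_lt_trans Tf Too; exists (fine (besov_norm eta0 0 +oo q%:E (dist_of (avg N f1)))).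
  by rewrite fine_ge0 ?besov_norm_ge0// fineK// ge0_fin_numE ?besov_norm_ge0.
have f1supp x : f1 x != 0 -> cube_index N x = 0.
  move=> fx; have px : psi (t *: x) != 0 by apply: contra fx => /eqP h; rewrite /f1 /f h mulr0.
  apply/rowP => j; have /andP[h1 h2] := supp _ j px.
  move: h1 h2; rewrite !mxE /t -mulrA => h1 h2.
  by apply/floor_def; rewrite /=; apply/andP; split; lra.
have [A bf] := schwartz_bdd sf1; have bA := avg_bdd N bf.
pose J : R[i] := (2 ^+ (N * d))%:C * cI mu f1.
have FE x : avg N f1 x = if cube_index N x == 0 then J else 0.
  rewrite /avg; case: ifPn => [/eqP x0|x0].
    rewrite /J -cIZ; last exact: schwartz_L1.
    apply: eq_cI => y; rewrite mulrC; have [->|/f1supp yy] := eqVneq (f1 y) 0; first by rewrite !mulr0.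
    by rewrite /avgk x0 yy eqxx.
  rewrite (eq_cI _ (g := fun=> 0)) ?cI0// => y.
  have [->|/f1supp yy] := eqVneq (f1 y) 0; first by rewrite mul0r.
  by rewrite /avgk yy (negbTE x0) mulr0.
apply: (jump_not_besov q0 m0 _ bA.1 FE mP).
have cne (r : R) : r != 0 -> r%:C != 0 :> R[i] by move=> h; rewrite (_ : 0 = 0%:C)// (inj_eq (@complexI R)).
rewrite mulf_neq0 ?cne ?expf_neq0//.
have := cI_affine 0 t0 (schwartz_L1 spsi); under eq_fun do (rewrite addr0); move=> h.
rewrite cIZ; last exact: schwartz_L1.
rewrite (_ : cI mu f = (`|t| ^- d)%:C * cI mu psi) //.
have l0 : lam%:C != 0 :> R[i] by apply: cne; rewrite gt_eqF.
have tn : (`|t| ^- d)%:C != 0 :> R[i] by apply: cne; rewrite invr_eq0 expf_neq0// normr_eq0.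
exact: mulf_neq0 l0 (mulf_neq0 tn nz).
Qed.

End jumps.

(** * Modulation *)

Section modulation.
Context {R : realType} {d : nat}.
Implicit Types (x y z xi : 'rV[R]_d) (f g h a b : 'rV[R]_d -> R[i]).
Variable i : 'I_d.
Notation mu := (lebesgue_rV (R := R) d).
Notation e_ i := (delta_mx ord0 i : 'rV[R]_d).

Lemma fourier_pair f g : schwartz f -> schwartz g ->
  cI mu (fun x => f x * fourier g x) = cI mu (fun x => fourier f x * g x).
Proof.
move=> sf sg; have Lf := schwartz_L1 (schwartz_fourier sf).
have Lg := schwartz_L1 (schwartz_fourier sg).
by have := inv_fourier_pair Lf Lg; rewrite !inv_fourierK// => ->.
Qed.

Lemma cD_inv_fourier b x : schwartz b ->
  cD i (inv_fourier b) x = inv_fourier (fun xi => symb i xi * b xi) x.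
Proof.
move=> sb; have si := schwartz_inv_fourier sb.
rewrite -[LHS](congr1 (fun h => h x) (inv_fourierK (schwartz_cD i si))).
by congr inv_fourier; apply/funext => xi; rewrite fourier_derivative// fourierK.
Qed.

Lemma cDB f g : schwartz f -> schwartz g ->
  cD i (fun x => f x - g x) = fun x => cD i f x - cD i g x.
Proof.
move=> sf sg; have E k : schwartz k -> inv_fourier (fun xi => symb i xi * fourier k xi) = cD i k.
  move=> sk; apply/funext => x; rewrite -cD_inv_fourier ?inv_fourierK//.
  exact: schwartz_fourier.
apply/funext => x; rewrite -(E _ (schwartzB sf sg)) -(E _ sf) -(E _ sg) !inv_fourierE.
have Ls k : schwartz k -> L1 mu (fun xi => symb i xi * fourier k xi * wave x xi).
  by move=> sk; apply/L1_wave/schwartz_L1/schwartz_symb/schwartz_fourier.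
rewrite -cIB; [|exact: Ls|exact: Ls]; apply: eq_cI => xi.
rewrite (_ : fourier (fun x => f x - g x) xi = fourier f xi - fourier g xi); first by ring.
rewrite !fourierE -cIB; [|exact/L1_wave/schwartz_L1|exact/L1_wave/schwartz_L1].
by apply: eq_cI => y; ring.
Qed.

(** The product of [a] with a character, see [modulateE]. As a translation on the
    Fourier side it is visibly a Schwartz function. *)
Definition modulate (nu : R) a := inv_fourier (fun xi => fourier a (xi - nu *: e_ i)).

Let schwartz_sub b z : schwartz b -> schwartz (fun xi => b (xi - z)).
Proof.
by move=> sb; have := schwartz_affine (- z) (oner_neq0 _) sb; under eq_fun do (rewrite scale1r).
Qed.

Let inv_fourier_sub b z x : schwartz b ->
  inv_fourier (fun xi => b (xi - z)) x = wave z x * inv_fourier b x.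
Proof.
move=> sb; rewrite inv_fourier_opp (fourier_shift _ _ (schwartz_L1 sb)) -inv_fourier_opp.
by rewrite waveNl opprK waveC.
Qed.

Lemma schwartz_modulate nu a : schwartz a -> schwartz (modulate nu a).
Proof. by move=> sa; apply/schwartz_inv_fourier/schwartz_sub/schwartz_fourier. Qed.

Lemma modulateE nu a x : schwartz a -> modulate nu a x = wave (nu *: e_ i) x * a x.
Proof.
by move=> sa; rewrite /modulate inv_fourier_sub ?inv_fourierK//; exact: schwartz_fourier.
Qed.

Lemma fourier_modulate nu a xi : schwartz a ->
  fourier (modulate nu a) xi = fourier a (xi - nu *: e_ i).
Proof. by move=> sa; rewrite fourierK//; apply/schwartz_sub/schwartz_fourier. Qed.

Lemma cD_modulate nu a x : schwartz a -> cD i (modulate nu a) x =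
  wave (nu *: e_ i) x * (cD i a x + symb i (nu *: e_ i) * a x).
Proof.
move=> sa; have sb := schwartz_fourier sa; set b := fourier a in sb *.
rewrite cD_inv_fourier; last exact: schwartz_sub.
have E : (fun xi => symb i xi * b (xi - nu *: e_ i)) =
    (fun xi => (fun z => symb i z * b z + symb i (nu *: e_ i) * b z) (xi - nu *: e_ i)).
  apply/funext => xi /=; rewrite -mulrDl; congr (_ * _).
  by apply: complex_ext; rewrite /= ?addr0// !mxE; ring.
have ss := schwartz_symb i sb; have sz := schwartzZ (symb i (nu *: e_ i)) sb.
rewrite -/b E (inv_fourier_sub _ _ (schwartzD ss sz)).
congr (_ * _); rewrite -(inv_fourierK sa) -/b cD_inv_fourier// !inv_fourierE.
rewrite -cIZ; last exact/L1_wave/schwartz_L1.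
rewrite -cID; first by apply: eq_cI => xi; ring.
  exact/L1_wave/schwartz_L1.
exact/L1Z/L1_wave/schwartz_L1.
Qed.

End modulation.

(** * Averages of derivatives *)

Section derivatives.
Context {R : realType} {d : nat}.
Implicit Types (x y z xi : 'rV[R]_d) (f g h a b : 'rV[R]_d -> R[i]).
Variable i : 'I_d.
Notation mu := (lebesgue_rV (R := R) d).
Notation e_ i := (delta_mx ord0 i : 'rV[R]_d).

Let norm_axis (t : R) : `|t *: e_ i| <= `|t|.
Proof.
apply: rV_norm_le => // j; rewrite !mxE normrM ler_piMr//.
by case: eqP; case: eqP => _ _ /=; rewrite ?normr1 ?normr0 ?ler01.
Qed.

(** Integrate along the i-th axis from face to face, by the fundamental theorem.
    In terms of difference quotients: a small shift moves the boundary of the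
    cube only within a strip, where [h] is small. *)
Lemma avg_cD0 N h x : schwartz h ->
  (forall y, (exists n : int, 2 ^+ N * y ord0 i = n%:~R) -> h y = 0) ->
  avg N (cD i h) x = 0.
Proof.
move=> sh h0; have [L [L0 LP]] := schwartz_lipschitz_sup sh.
have p0 : 0 < 2 ^+ N :> R by rewrite exprn_gt0.
pose t n : R := n.+1%:R^-1; have t0 n : 0 < t n by rewrite invr_gt0.
have La := L1n_L1 (L1n_avgk N x); have ma := cmeas_avgk N x.
have [A bh] := schwartz_bdd sh.
pose D n y := avgk N x (y + - (t n *: e_ i)) - avgk N x y.
have mD n : cmeas (D n) by apply: cmeasB (cmeas_shift _ ma) ma.
pose C : R := d%:R * (2 * (2 ^+ N * 2)).
have LD n : L1n (C * t n) (D n).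
  split=> //; apply: le_trans (avgk_lipschitz _ _ _) _; rewrite lee_fin normrN.
  rewrite -/C ler_wpM2l; [by []|by rewrite /C !mulr_ge0// exprn_ge0|exact: step_norm_le].
have hD n y : normc (h y * D n y) <= normc ((L * t n)%:C * D n y).
  rewrite !normcM normcR ger0_norm ?mulr_ge0 ?(ltW (t0 n))//.
  have [->|Dn] := eqVneq (D n y) 0; first by rewrite normc_zero !mulr0.
  rewrite ler_wpM2r ?normc_ge0//.
  (* the kernels differ only if a face lies between y - t e_i and y *)
  pose m := Num.floor (2 ^+ N * y ord0 i).
  have /andP[m1 m2] : m%:~R <= 2 ^+ N * y ord0 i < (m + 1)%:~R by exact: floor_itv.
  have m3 : 2 ^+ N * (y ord0 i - t n) < m%:~R.
    rewrite ltNge; apply: contra Dn => m3; rewrite /D /avgk.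
    rewrite (_ : cube_index N (y + _) = cube_index N y) ?subrr//.
    apply/rowP => j; rewrite !mxE; have [->|ji] := eqVneq j i; last first.
      by rewrite /= mulr0 subr0.
    rewrite /= mulr1 -/m; apply/floor_def; rewrite m3/=; apply: le_lt_trans m2.
    by rewrite ler_pM2l// lerBlDr lerDl ltW.
  pose s := y ord0 i - m%:~R / 2 ^+ N.
  have s0 : 0 <= s by rewrite subr_ge0 ler_pdivrMr// mulrC.
  have st : s <= t n.
    rewrite lerBlDr -lerBlDl ltW// ltr_pdivlMr//.
    by rewrite mulrC.
  have hz : h (y - s *: e_ i) = 0; last first.
    have := LP (y - s *: e_ i) (s *: e_ i); rewrite subrK hz subr0 => h1.
    apply: le_trans h1 _; apply: ler_wpM2l => //.
    by apply: le_trans (norm_axis s) _; rewrite ger0_norm.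
  apply: h0; exists m; rewrite !mxE !eqxx /= mulr1 /s opprB addrC subrK.
  by rewrite mulrC divfK// gt_eqF.
have [c [c0 cw cl]] := difference_quotient i sh.
have lim : ccvg (fun n => cI mu (fun y => dquot n i h y * avgk N x y)) (avg N (cD i h) x).
  apply: (@cI_cvg _ _ _ _ _ _ (fun y => (2 ^+ (N * d) * c)%:C * (weight y)%:C)).
  - move=> n; apply: cmeasM ma; apply: cmeasM; first exact: cmeas_cst.
    by apply: cmeasB; [exact: cmeas_shift bh.1|exact: bh.1].
  - by apply: cmeasM ma; exact/schwartz_cmeas/schwartz_cD.
  - by apply: L1Z; exact: L1_weight.
  - move=> n y; rewrite normcM mulrC [leRHS]normcM [normc (_ * c)%:C]normcR.
    rewrite [normc (weight y)%:C]normcR (ger0_norm (ltW (weight_gt0 y))).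
    rewrite [`|_ * c|]ger0_norm ?mulr_ge0 ?exprn_ge0// -[leRHS]mulrA.
    by apply: ler_pM; rewrite ?normc_ge0 ?cw//; exact: (avgk_bdd N x).2.
  - move=> y; rewrite mulrC; apply: (eq_ccvg (a := fun n => avgk N x y * dquot n i h y)).
      by move=> n; rewrite mulrC.
    exact/ccvgMl/cl.
apply: ccvg_unique lim _.
apply: (@ccvg_le _ _ _ (fun n => 2 * L * C * t n)).
  rewrite -[X in _ --> X](mulr0 (2 * L * C)).
  by apply: cvgM; [exact: cvg_cst|exact: cvg_harmonic].
move=> n; rewrite subr0.
have LhD : L1 mu (fun y => h y * D n y) by exact: bdd_L1 bh (LD n).
have -> : cI mu (fun y => dquot n i h y * avgk N x y) = (t n)^-1%:C * cI mu (fun y => h y * D n y).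
  have L1h : L1 mu (fun y => h y * avgk N x y) by exact: bdd_L1 bh (L1n_avgk N x).
  have L2h : L1 mu (fun y => h y * avgk N x (y + - (t n *: e_ i))).
    exact: bdd_L1 bh (L1n_shift _ (L1n_avgk N x)).
  have L3h : L1 mu (fun y => h (y + t n *: e_ i) * avgk N x y).
    by have := L1_rV_affine (t n *: e_ i) (oner_neq0 _) L2h;
      under eq_fun do (rewrite scale1r addrK).
  rewrite [in RHS](eq_cI _ (g := fun y => h y * avgk N x (y + - (t n *: e_ i)) - h y * avgk N x y)); last first.
    by move=> y; rewrite /D mulrBr.
  rewrite (cIB L2h L1h) -(cI_shift (t n *: e_ i) L2h).
  rewrite [in RHS](eq_cI _ (g := fun y => h (y + t n *: e_ i) * avgk N x y)); last first.
    by move=> y; rewrite addrK.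
  rewrite -(cIB L3h L1h) -cIZ; last exact: (L1B L3h L1h).
  by apply: eq_cI => y; rewrite /dquot -/(t n); ring.
rewrite normcM normcR ger0_norm ?invr_ge0 ?(ltW (t0 n))// mulrC ler_pdivrMr//.
have LL : L1n (L * t n * (C * t n)) (fun y => (L * t n)%:C * D n y).
  apply: (L1nM (h := fun=> (L * t n)%:C) _ (LD n)); split; first exact: cmeas_cst.
  by move=> y; rewrite normcR ger0_norm// mulr_ge0// ltW.
have Lh : L1n (L * t n * (C * t n)) (fun y => h y * D n y).
  by split; [exact: LhD.1|apply: le_trans (le_norm1 mu LhD.1 LL.1 (hD n)) LL.2].
apply: le_trans (normc_cI_n Lh) _.
by rewrite le_eqVlt; apply/orP; left; apply/eqP; ring.
Qed.

Let expi2pi_int (n : int) : expi (2 * pi * n%:~R : R) = 1.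
Proof.
have P1 : expi (2 * pi : R) = 1.
  by rewrite /expi mulr_natl cos2pi sin2pi.
have Pn (k : nat) : expi (2 * pi * k%:R : R) = 1.
  elim: k => [|k ih]; first by rewrite mulr0 expi0.
  by rewrite -[k.+1%:R]natr1 (mulrDr (2 * pi)) expiD ih mulr1 P1 mulr1.
case: n => n; first exact: Pn.
have := expi0 (R := R); rewrite -(subrr (2 * pi * n.+1%:R)) expiD Pn mul1r => <-.
by congr expi; rewrite NegzE mulrNz mulrN.
Qed.

(** On the faces a modulation by a multiple of the grid frequency is trivial. *)
Lemma avg_cD_modulate N (n : nat) a x : schwartz a ->
  avg N (cD i (modulate i (n%:R * 2 ^+ N) a)) x = avg N (cD i a) x.
Proof.
move=> sa; set nu := n%:R * _; have sm := schwartz_modulate i nu sa.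
have [A bA] := schwartz_bdd (schwartz_cD i sm); have [B bB] := schwartz_bdd (schwartz_cD i sa).
apply/eqP; rewrite -subr_eq0 -(avgB N bA bB) -cDB//; apply/eqP.
apply: avg_cD0; first exact: schwartzB.
move=> y [m ym]; rewrite modulateE// (_ : wave _ _ = 1) ?mul1r ?subrr//.
rewrite /wave dotpZr dotpC dotp_delta [nu * _](_ : _ = (n%:Z * m)%:~R) ?expi2pi_int//.
by rewrite intrM -ym /nu mulrA.
Qed.

End derivatives.

(** * Oscillating superpositions *)

(** [kap] is [K^(1/q)], and 1 for [q = oo]: the norm of a block of [K] ones, wherever
    it stands. *)
Lemma lqn_block (R : realType) (q : \bar R) (K : nat) : (0 < q)%E -> (0 < K)%N ->
  exists kap : R, [/\ 0 < kap,
    forall N0 (c : R), 0 <= c ->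
      lqn q (c * kap) (fun j => if (N0 <= j < N0 + K)%N then c else 0)
  & forall (m rho : R) (r : nat -> R), 0 <= rho -> 0 <= m -> (forall k, 0 <= r k) ->
      lqn q m r -> (forall k, (0 < k <= K)%N -> rho <= r k) -> rho * kap <= m].
Proof.
case: q => [q| |] // q0 K0; last first.
  exists 1; split=> [//|N0 c c0 j|m rho r _ _ _ rm rr]; rewrite mulr1; first by case: ifP.
  by apply: le_trans (rm 1%N); apply: rr.
have {q0}q0 : 0 < q by [].
have kq : ((K%:R : R) `^ q^-1) `^ q = K%:R.
  by rewrite -powRrM mulVf ?gt_eqF// powRr1.
have k0 : 0 < (K%:R : R) `^ q^-1 by rewrite powR_gt0// ltr0n.
exists (K%:R `^ q^-1); split=> //.
  move=> N0 c c0 n /=; rewrite powRM// ?(ltW k0)// kq.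
  set F := fun j => (if (N0 <= j < N0 + K)%N then c else 0) `^ q.
  rewrite -(big_mkord xpredT F).
  apply: (@le_trans _ _ (\sum_(0 <= j < N0 + K + n) F j)).
    rewrite [leRHS](big_cat_nat (n := n))//=; last exact: leq_addl.
    by rewrite lerDl sumr_ge0// => j _; exact: powR_ge0.
  rewrite (big_cat_nat (n := N0 + K))//=; last exact: leq_addr.
  rewrite (big_cat_nat (n := N0) (p := N0 + K))//=; last exact: leq_addr.
  rewrite big_nat big1 ?add0r => [|j /andP[_ jN]]; last by rewrite /F leqNgt jN /= powR0// gt_eqF.
  rewrite [X in _ + X]big_nat [X in _ + X]big1 ?addr0 => [|j /andP[Nj _]]; last first.
    by rewrite /F [(j < _)%N]ltnNge Nj andbF powR0// gt_eqF.
  rewrite big_nat (eq_bigr (fun=> c `^ q)) => [|j jN]; last by rewrite /F jN.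
  by rewrite -big_nat sumr_const_nat addKn mulr_natr.
move=> m rho r rho0 m0 r0 rm rr; rewrite leNgt; apply/negP => mk.
have rk0 : 0 <= rho * K%:R `^ q^-1 by rewrite mulr_ge0// ltW.
have := gt0_ltr_powR q0 m0 rk0 mk; apply/negP; rewrite -leNgt powRM ?(ltW k0)// kq.
apply: le_trans (rm K.+1); rewrite big_ord_recl /= -[leLHS]add0r lerD ?powR_ge0//.
rewrite mulr_natr -[K in leLHS]card_ord -sumr_const; apply: ler_sum => k _.
apply: ge0_ler_powR; rewrite ?nnegrE ?(ltW q0)//; apply: (rr k.+1); exact: ltn_ord.
Qed.

Section superposition.
Context {R : realType} {d : nat}.
Implicit Types (x y z xi : 'rV[R]_d) (f g h a b : 'rV[R]_d -> R[i]) (u v : functional R d).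
Variable eta0 : 'rV[R]_d -> R[i].
Hypothesis eta0P : lp_cutoff eta0.
Variable i : 'I_d.
Notation mu := (lebesgue_rV (R := R) d).
Notation piece := (lp_piece eta0).
Notation e_ i := (delta_mx ord0 i : 'rV[R]_d).
Notation b := (bump eta0 i).

Let pow0 n : 0 < 2 ^+ n :> R. Proof. by rewrite exprn_gt0. Qed.
Let pow1 n : 2 ^+ n != 0 :> R. Proof. by rewrite gt_eqF. Qed.
Let sb : schwartz b. Proof. exact: schwartz_bump. Qed.
Let cne (r : R) : r != 0 -> r%:C != 0 :> R[i].
Proof. by move=> h; rewrite (_ : 0 = 0%:C)// (inj_eq (@complexI R)). Qed.

Lemma fourierZ c f xi : L1 mu f -> fourier (fun x => c * f x) xi = c * fourier f xi.
Proof.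
move=> Lf; rewrite !fourierE -cIZ; last exact: L1_wave.
by apply: eq_cI => x; rewrite mulrA.
Qed.

Lemma fourier_sum n (F : 'I_n -> 'rV[R]_d -> R[i]) xi : (forall k, L1 mu (F k)) ->
  fourier (fun x => \sum_k F k x) xi = \sum_k fourier (F k) xi.
Proof.
move=> LF; rewrite fourierE (eq_cI _ (g := fun x => \sum_k F k x * wave (- xi) x)).
  rewrite cI_sum => [|k]; last exact: L1_wave.
  by apply: eq_bigr => k _; rewrite fourierE.
by move=> x; rewrite mulr_suml.
Qed.

Definition atom k y x := inv_fourier b (2 ^+ k *: (x - y)).

Lemma schwartz_atom k y : schwartz (atom k y).
Proof.
have := schwartz_affine (- (2 ^+ k *: y)) (pow1 k) (schwartz_inv_fourier sb).
by congr schwartz; apply/funext => x; rewrite /atom scalerBr.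
Qed.

Lemma fourier_atom k y xi :
  fourier (atom k y) xi = (2 ^+ (k * d))^-1%:C * (wave (- xi) y * b ((2 ^+ k)^-1 *: xi)).
Proof.
have sA := schwartz_inv_fourier sb.
rewrite (_ : atom k y = fun x => (2 ^+ (k * d))^-1%:C * test k y (inv_fourier b) x).
  rewrite fourierZ; last exact/schwartz_L1/schwartz_test.
  congr (_ * _); rewrite -[xi in LHS]opprK -inv_fourier_opp inv_fourier_test//.
  by rewrite scalerN inv_fourier_opp opprK fourierK.
apply/funext => x; rewrite /test mulrA -rmorphM mulVf ?pow1// mul1r.
by [].
Qed.

Lemma atom_annulus k y xi : fourier (atom k y) xi != 0 -> annulus ((2 ^+ k)^-1 *: xi).
Proof.
rewrite fourier_atom => h; apply: (bump_annulus eta0P (i := i)); apply: contra h => /eqP ->.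
by rewrite !mulr0.
Qed.

(** The transform of the derivative of the basic atom is [symb i * b], so this
    test function sees that derivative: otherwise [symb i * b * b] would have vanishing
    inverse transform. *)
Lemma annular_pair : exists g, annular g /\
  cI mu (fun xi => symb i xi * b xi * inv_fourier g xi) != 0.
Proof.
have ssb := schwartz_symb i sb.
have sbb : schwartz (fun xi => symb i xi * b xi * b xi) by exact: schwartzM.
have [x0 nz] : exists x0, inv_fourier (fun xi => symb i xi * b xi * b xi) x0 != 0.
  apply: contrapT => no; have E : inv_fourier (fun xi => symb i xi * b xi * b xi) = fun=> 0.
    apply/funext => x; apply/eqP; apply: contrapT => /negP h; apply: no; exists x; exact: h.
  have := congr1 (fun h => h ((7 / 32) *: e_ i)) (fourierK sbb); rewrite E fourierE.
  rewrite (eq_cI _ (g := fun=> 0)) ?cI0 => [|x]; last by rewrite mul0r.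
  rewrite (bump_center eta0P) !mulr1 => /(congr1 (fun t : R[i] => cIm t))/=.
  rewrite !mxE !eqxx mulr1 => /esym/eqP; apply/negP.
  by rewrite !mulf_neq0 ?gt_eqF ?pi_gt0// invr_gt0.
have [sf af] := annular_fourier sb (@bump_annulus _ _ _ eta0P i).
have E xi : inv_fourier (fun x => fourier b (x - x0)) xi = wave xi x0 * b xi.
  rewrite inv_fourier_opp (fourier_shift _ _ (schwartz_L1 sf)) -inv_fourier_opp.
  by rewrite inv_fourierK// waveNl opprK.
exists (fun x => fourier b (x - x0)); split.
  split; first by have := schwartz_affine (- x0) (oner_neq0 _) sf; under eq_fun do (rewrite scale1r).
  move=> xi; rewrite E => h; apply: (bump_annulus eta0P (i := i)); apply: contra h => /eqP ->.
  by rewrite mulr0.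
move: nz; rewrite inv_fourierE; congr (_ != _); apply: eq_cI => xi.
by rewrite E waveC; ring.
Qed.

Definition atoms (K : nat) x := \sum_(k < K) atom k.+1 ((K * k)%:R *: e_ i) x.

Lemma schwartz_atoms K : schwartz (atoms K).
Proof. by apply: schwartz_sum => k; exact: schwartz_atom. Qed.

Lemma fourier_atoms K xi :
  fourier (atoms K) xi = \sum_(k < K) fourier (atom k.+1 ((K * k)%:R *: e_ i)) xi.
Proof. by rewrite fourier_sum// => k; exact/schwartz_L1/schwartz_atom. Qed.

(** The atoms sit far apart along the axis, so their sum is bounded uniformly in
    their number. *)
Lemma atoms_bdd : exists C, 0 <= C /\ forall K x, normc (atoms K x) <= C.
Proof.
have [c cP] := schwartz_rapid (schwartz_inv_fourier sb) 1%N.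
have c0 : 0 <= c by apply: le_trans (cP 0); rewrite mulr_ge0 ?normc_ge0// exprn_ge0// addr_ge0.
exists (3 * c); split; first by rewrite mulr_ge0.
case=> [|K] x; first by rewrite /atoms big_ord0 normc_zero mulr_ge0.
have K0 : 0 < K.+1%:R :> R by rewrite ltr0n.
pose D (k : 'I_K.+1) := `|x ord0 i - (K.+1 * k)%:R|.
have D0 k : 0 <= D k by exact: normr_ge0.
have AD (k : 'I_K.+1) : (1 + D k) * normc (atom k.+1 ((K.+1 * k)%:R *: e_ i) x) <= c.
  apply: le_trans (cP (2 ^+ k.+1 *: (x - (K.+1 * k)%:R *: e_ i))).
  rewrite expr1 ler_wpM2r ?normc_ge0// lerD2l.
  apply: le_trans (rV_coord_le _ i); rewrite !mxE !eqxx/= mulr1 normrM -/(D k).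
  by rewrite ger0_norm ?(ltW (pow0 _))// ler_peMl// exprn_ege1// ler1n.
have An (k : 'I_K.+1) : normc (atom k.+1 ((K.+1 * k)%:R *: e_ i) x) <=
    (if D k < K.+1%:R / 2 then c else 0) + 2 * c / K.+1%:R.
  have N0 := normc_ge0 (atom k.+1 ((K.+1 * k)%:R *: e_ i) x); have := AD k.
  have f0 : 0 <= 2 * c / K.+1%:R by rewrite !mulr_ge0// invr_ge0 ltW.
  set t := normc _ in N0 *; case: ltP => Dk h.
    apply: le_trans (_ : c <= _); last by rewrite lerDl.
    by apply: le_trans h; rewrite mulrDl mul1r lerDl mulr_ge0.
  rewrite add0r ler_pdivlMr//; apply: le_trans (_ : 2 * ((1 + D k) * t) <= _); last by rewrite ler_wpM2l.
  rewrite mulrA [leRHS]mulrC ler_wpM2l//; lra.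
have near_one : \sum_(k < K.+1) (if D k < K.+1%:R / 2 then c else 0) <= c.
  have [[k kn]|no] := pselect (exists k : 'I_K.+1, D k < K.+1%:R / 2); last first.
    by rewrite big1// => k _; case: ifP => // h; case: no; exists k.
  rewrite (bigD1 k)//= kn big1 ?addr0// => l lk; case: ifP => // ln; exfalso.
  have far (p r : 'I_K.+1) : D p < K.+1%:R / 2 -> D r < K.+1%:R / 2 -> ~~ (p < r)%N.
    rewrite /D !natrM => hp hr; apply/negP => pr.
    have : K.+1%:R * p.+1%:R <= K.+1%:R * r%:R :> R by rewrite ler_pM2l// ler_nat.
    rewrite -[p.+1%:R]natr1 mulrDr mulr1; move: hp hr; rewrite !ltr_norml => /andP[p1 p2] /andP[r1 r2].
    lra.
  by move: lk; rewrite -val_eqE /= neq_ltn (negbTE (far l k ln kn)) (negbTE (far k l kn ln)).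
apply: le_trans (le_normc_sum _ _ _) _; apply: le_trans (ler_sum _ (fun k _ => An k)) _.
have -> : 3 * c = c + \sum_(k < K.+1) 2 * c / K.+1%:R.
  rewrite sumr_const card_ord -(mulr_natr (2 * c / K.+1%:R)) divfK ?gt_eqF//; ring.
by rewrite big_split /= lerD2r.
Qed.

(** Pairing with a test at scale k+1 selects the atom of that scale. *)
Lemma atoms_test K (k : 'I_K) g : annular g ->
  cI mu (fun x => cD i (atoms K) x * test k.+1 ((K * k)%:R *: e_ i) g x) =
  (2 ^+ k.+1)%:C * cI mu (fun xi => symb i xi * b xi * inv_fourier g xi).
Proof.
move=> ag; set y := _ *: e_ i; set G := test _ _ _; have sg := ag.1.
have sG : schwartz G by exact: schwartz_test.
have sa := schwartz_atoms K.
rewrite (eq_cI _ (g := fun x => cD i (atoms K) x * fourier (inv_fourier G) x)); last first.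
  by move=> x; rewrite fourierK.
rewrite fourier_pair; [|exact: schwartz_cD|exact: schwartz_inv_fourier].
have p1 : (2 ^+ k.+1)^-1 != 0 :> R by rewrite invr_eq0.
pose H xi := symb i xi * b xi * inv_fourier g xi.
have sH : schwartz H by apply: schwartzM; [exact: schwartz_symb|exact: schwartz_inv_fourier].
have := cI_affine 0 p1 (schwartz_L1 sH).
rewrite ger0_norm ?invr_ge0 ?(ltW (pow0 _))// exprVn invrK -exprM => E.
have pc : (2 ^+ (k.+1 * d))%:C != 0 :> R[i] by exact: cne.
have L1H := L1_rV_affine 0 p1 (schwartz_L1 sH).
have LG := schwartz_L1 (schwartzM (schwartz_fourier (schwartz_cD i sa)) (schwartz_inv_fourier sG)).
apply: (mulfI pc); rewrite mulrCA -[in RHS]E.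
rewrite -(cIZ (2 ^+ k.+1)%:C L1H).
rewrite -(cIZ (2 ^+ (k.+1 * d))%:C LG).
apply: eq_cI => xi; rewrite /= addr0 fourier_derivative// fourier_atoms inv_fourier_test// /H.
have [->|nz] := eqVneq (inv_fourier g ((2 ^+ k.+1)^-1 *: xi)) 0.
  by rewrite !mulr0.
rewrite (bigD1 k)//= big1 ?addr0 => [|l lk]; last first.
  apply/eqP; apply: contrapT => /negP/atom_annulus al; have ak := ag.2 _ nz.
  have := eta_annulus eta0P k.+1 (ltn0Sn k) ak; rewrite (eta_annulus eta0P k.+1 (ltn0Sn l) al).
  rewrite eqxx eqSS eq_sym val_eqE (negbTE lk) => /eqP.
  by rewrite eq_sym oner_eq0.
rewrite fourier_atom -/y.
have -> : symb i ((2 ^+ k.+1)^-1 *: xi) = (2 ^+ k.+1)^-1%:C * symb i xi.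
  apply: complex_ext; first by rewrite /=; ring.
  by rewrite /= mxE; ring.
have w1 : wave (- xi) y * wave xi y = 1 by rewrite -waveDl addNr wave0l.
rewrite !rmorphV ?unitfE//.
have pk : (2 ^+ k.+1)%:C != 0 :> R[i] by exact: cne.
transitivity (symb i xi * b ((2 ^+ k.+1)^-1 *: xi) * inv_fourier g ((2 ^+ k.+1)^-1 *: xi) * (wave (- xi) y * wave xi y)).
  by field; rewrite pc.
by rewrite w1; field; rewrite pk.
Qed.

(** An integral number of periods along each edge of the cubes makes the modulation
    trivial on the faces; the factor 7 puts its frequency inside an annulus. *)
Definition tone K N m := cD i (modulate i ((7 * 2 ^ m)%:R * 2 ^+ N) (atoms K)).

Lemma schwartz_tone K N m : schwartz (tone K N m).
Proof. exact/schwartz_cD/schwartz_modulate/schwartz_atoms. Qed.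

(** The frequency of the tone is the centre [7/32] of the axis annulus at scale
    [N + m + 5]. *)
Lemma tone_annulus K N m xi : (K <= N)%N -> fourier (tone K N m) xi != 0 ->
  annulus ((2 ^+ (N + m + 5))^-1 *: xi).
Proof.
move=> KN; have sa := schwartz_atoms K.
rewrite fourier_derivative; last exact: schwartz_modulate.
rewrite fourier_modulate// fourier_atoms; set z := xi - _ => h.
have [k kz] : exists k : 'I_K, fourier (atom k.+1 ((K * k)%:R *: e_ i)) z != 0.
  apply: contrapT => no; move/negP: h; apply; rewrite big1 ?mulr0// => k _.
  by apply/eqP; apply: contrapT => /negP kk; apply: no; exists k.
have /andP[_] := atom_annulus kz; rewrite enormZ ger0_norm ?invr_ge0 ?(ltW (pow0 _))//.
rewrite ltr_pdivrMl// => z1.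
have z2 : enorm z <= 2 ^+ (N + m) / 4.
  apply: le_trans (ltW z1) _; rewrite ler_pM2r ?invr_gt0// ler_weXn2l ?ler1n//.
  by rewrite (leq_trans (ltn_ord k))// (leq_trans KN)// leq_addr.
apply: (near_axis_annulus (i := i)).
have -> : (2 ^+ (N + m + 5))^-1 *: xi - (7 / 32) *: e_ i = (2 ^+ (N + m + 5))^-1 *: z.
  rewrite scalerBr scalerA; congr (_ - _ *: _); rewrite natrM natrX !exprD.
  by field; rewrite !pow1.
rewrite enormZ ger0_norm ?invr_ge0 ?(ltW (pow0 _))// ler_pdivrMl// exprD.
have -> : 2 ^+ 5 = 32 :> R by ring.
by have := pow0 (N + m); lra.
Qed.

Lemma mult_annulus j k F g : schwartz F -> (0 < k)%N ->
  (forall xi, fourier F xi != 0 -> annulus ((2 ^+ k)^-1 *: xi)) -> schwartz g ->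
  cI mu (fun x => F x * mult (lp_eta eta0 j) g x) = (j == k)%:R * cI mu (fun x => F x * g x).
Proof.
move=> sF k0 Fk sg; have si := schwartz_inv_fourier sg.
have L := schwartz_L1 (schwartzM (schwartz_fourier sF) si).
rewrite fourier_pair//; last by apply: schwartzM => //; exact: schwartz_eta.
rewrite -[X in _ = _ * cI mu (fun x => F x * X x)](fourierK sg) fourier_pair// -(cIZ _ L).
apply: eq_cI => xi; have [->|/Fk] := eqVneq (fourier F xi) 0; first by rewrite !mul0r mulr0.
by move=> /(eta_annulus eta0P j k0) ->; ring.
Qed.

Lemma tone_bdd : exists C, 0 < C /\ forall K N m x,
  (forall y, normc (cD i (atoms K) y) <= 2 ^+ N) ->
  normc (tone K N m x) <= 2 ^+ (N + m + 5) * C.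
Proof.
have [c [c0 cP]] := atoms_bdd; have p0 : 0 < pi :> R := pi_gt0 R.
exists (1 + 2 * pi * (7 / 32) * c); split; first by rewrite ltr_wpDr// !mulr_ge0// ltW.
move=> K N m x DN; rewrite /tone cD_modulate; last exact: schwartz_atoms.
rewrite normcM normc_wave mul1r; apply: le_trans (le_normcD _ _) _.
rewrite mulrDr mulr1; apply: lerD.
  by apply: le_trans (DN x) _; rewrite ler_weXn2l ?ler1n// -addnA leq_addr.
rewrite normcM; set nu := _%:R * _.
have -> : normc (symb i (nu *: e_ i)) = 2 ^+ (N + m + 5) * (2 * pi * (7 / 32)).
  rewrite /normc /= !mxE !eqxx mulr1 expr0n add0r sqrtr_sqr.
  rewrite ger0_norm ?mulr_ge0 ?(ltW p0) ?ltW//.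
  rewrite /nu natrM natrX !exprD; have -> : 2 ^+ 5 = 32 :> R by ring.
  by field.
rewrite [leRHS]mulrA; apply: ler_wpM2l; last exact: cP.
by rewrite !mulr_ge0// ltW.
Qed.

Definition chord K N (lam : R) x := \sum_(m < K) lam%:C * tone K N m x.

Lemma schwartz_chord K N lam : schwartz (chord K N lam).
Proof. by apply: schwartz_sum => m; apply: schwartzZ; exact: schwartz_tone. Qed.

Lemma chord_besov K N (lam C : R) q : (0 < q)%E -> (K <= N)%N -> 0 <= lam ->
  (forall m x, normc (tone K N m x) <= 2 ^+ (N + m + 5) * C) ->
  lqn q 1 (fun j => if (N + 5 <= j < N + 5 + K)%N then lam * C else 0) ->
  (besov_norm eta0 (-1) +oo q (dist_of (chord K N lam)) <= 1)%E.
Proof.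
move=> q0 KN lam0 tC lq.
have C0 : 0 <= C.
  have := le_trans (normc_ge0 _) (tC 0%N 0).
  by rewrite pmulr_rge0.
apply: (seq_besov q0 ler01 _ lq) => [j|j]; first by case: ifP => // _; exact: mulr_ge0.
rewrite opprK powRr1//.
pose h x := \sum_(m < K) (j == N + m + 5)%N%:R * (lam%:C * tone K N m x).
apply: (brep_dist_Lnorm (h := h)); split.
  split; first by apply: cmeas_sum => m; exact/schwartz_cmeas/schwartzZ/schwartzZ/schwartz_tone.
  move=> x; case: ifPn => jb; last first.
    rewrite mulr0 /h big1 ?normc_zero// => m _; case: eqP => [jm|]; last by rewrite mul0r.
    by move/negP: jb; case; have := ltn_ord m; rewrite jm; lia.
  have mK : (j - (N + 5) < K)%N by lia.
  have jm : j = (N + Ordinal mK + 5)%N by rewrite /=; lia.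
  rewrite /h (bigD1 (Ordinal mK))//= big1 ?addr0 => [|m mm]; last first.
    case: eqP => [jm'|]; last by rewrite mul0r.
    by move/eqP: mm; case; apply: val_inj => /=; lia.
  rewrite {1}jm eqxx mul1r normcM normcR ger0_norm// mulrCA; apply: ler_wpM2l => //.
  have := tC (j - (N + 5))%N x; suff -> : (N + (j - (N + 5)) + 5)%N = j by [].
  lia.
move=> g sg; have sm := schwartz_mult (schwartz_eta eta0P j) sg.
transitivity (cI mu (fun x => \sum_(m < K) lam%:C * (tone K N m x * mult (lp_eta eta0 j) g x))).
  by apply: eq_cI => x; rewrite /chord mulr_suml; apply: eq_bigr => m _; rewrite mulrA.
have Lt m k : schwartz k -> L1 mu (fun x => tone K N m x * k x).
  by move=> sk; apply/schwartz_L1/schwartzM => //; exact: schwartz_tone.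
rewrite cI_sum => [|m]; last exact/L1Z/Lt.
rewrite [RHS](eq_cI _ (g := fun x => \sum_(m < K) (j == N + m + 5)%N%:R * (lam%:C * (tone K N m x * g x)))).
  rewrite cI_sum => [|m]; last exact/L1Z/L1Z/Lt.
  apply: eq_bigr => m _; rewrite cIZ; last exact: Lt.
  have N5 : (0 < N + m + 5)%N by rewrite addnS.
  rewrite (mult_annulus j (schwartz_tone K N m) N5 (fun xi => @tone_annulus K N m xi KN) sg).
  by rewrite (cIZ _ (L1Z _ (Lt m g sg))) (cIZ _ (Lt m g sg)); ring.
by move=> x; rewrite /h mulr_suml; apply: eq_bigr => m _; ring.
Qed.

(** Averaging does not see the modulations. *)
Lemma avg_chord K N lam x :
  avg N (chord K N lam) x = (K%:R * lam)%:C * avg N (cD i (atoms K)) x.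
Proof.
have La f : schwartz f -> L1 mu (fun y => f y * avgk N x y).
  by move=> sf; have [A bf] := schwartz_bdd sf; exact: bdd_L1 bf (L1n_avgk N x).
transitivity (\sum_(m < K) lam%:C * avg N (tone K N m) x).
  rewrite /avg (eq_cI _ (g := fun y => \sum_(m < K) lam%:C * (tone K N m y * avgk N x y))).
    rewrite cI_sum => [|m]; last exact/L1Z/La/schwartz_tone.
    by apply: eq_bigr => m _; rewrite cIZ//; exact/La/schwartz_tone.
  by move=> y; rewrite /chord mulr_suml; apply: eq_bigr => m _; rewrite mulrA.
rewrite (eq_bigr (fun=> lam%:C * avg N (cD i (atoms K)) x)); last first.
  by move=> m _; rewrite /tone avg_cD_modulate//; exact: schwartz_atoms.
by rewrite sumr_const card_ord -[LHS]mulr_natl mulrA rmorphM/= rmorph_nat.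
Qed.

(** The [K] tones of a chord lie in different frequency annuli, so its norm is
    about [K^(1/q)]; but all of them have the same average, which for fine cubes is
    about [K] times the derivative of the atoms, of norm [K * K^(1/q)]. *)
Lemma extension_blowup (q : \bar R) (M : R) : (0 < q)%E -> 0 < M ->
  exists N, forall T, is_extension eta0 (-1) +oo q N T ->
    (M%:E <= op_norm eta0 (-1) +oo q T)%E.
Proof.
move=> q0 M0; have [g [ag nz]] := annular_pair; have [c Lg0] := schwartz_L1n ag.1.
set I := cI mu _ in nz; pose p := normc I.
have p0 : 0 < p.
  by rewrite lt0r normc_ge0 andbT; apply/eqP => /normc_eq0 E; rewrite E eqxx in nz.
have c1 : 0 < c + 1 by rewrite ltr_wpDl// (L1n_ge0 Lg0).
have Lg : L1n (c + 1) g by apply: L1n_le Lg0; rewrite lerDl.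
have [C [C0 CP]] := tone_bdd.
(* K beats the constants of the estimate *)
have [K K0 KX] : exists2 K, (0 < K)%N & M * (4 * (c + 1) * C) / p < K%:R.
  by exists (Num.trunc (M * (4 * (c + 1) * C) / p)).+1 => //; exact: truncnS_gt.
have [kap [kap0 kapl kapr]] := @lqn_block R q K q0 K0.
have [lam lam0 lamE] : exists2 lam : R, 0 < lam & lam * (C * kap) = 1.
  by exists (C * kap)^-1; rewrite ?invr_gt0 ?mulr_gt0// mulVf// gt_eqF// mulr_gt0.
have sa := schwartz_atoms K; have sD := schwartz_cD i sa.
have [D bD] := schwartz_bdd sD; have D0 := bdd_ge0 bD.
have [L [L0 LP]] := schwartz_lipschitz_sup sD.
have Y2 : 0 <= 8 * L * (c + 1) / p by rewrite !mulr_ge0 ?invr_ge0// ltW.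
(* the tones must oscillate faster than the atoms, whose derivative must be almost
   constant on the cubes *)
have [N KN YN] : exists2 N, (K <= N)%N & D + 8 * L * (c + 1) / p <= 2 ^+ N.
  set Y := D + _; exists (K + (Num.trunc Y).+1)%N; first exact: leq_addr.
  apply: le_trans (ltW (truncnS_gt Y)) _; rewrite -natrX ler_nat.
  by apply: leq_trans (ltnW (ltn_expl _ (ltnSn 1))); exact: leq_addl.
have DN : D <= 2 ^+ N by apply: le_trans YN; rewrite lerDl.
exists N => T [_ _ _ TS]; pose f := chord K N lam.
have sf : schwartz f by exact: schwartz_chord.
have f1 : (besov_norm eta0 (-1) +oo q (dist_of f) <= 1)%E.
  apply: (chord_besov (C := C) q0 KN (ltW lam0)).
    by move=> m x; apply: CP => y; exact: le_trans (bD.2 y) DN.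
  have := kapl (N + 5)%N (lam * C) (mulr_ge0 (ltW lam0) (ltW C0)).
  by rewrite -mulrA lamE.
have n1 : -1 <= 0 :> R by rewrite lerN10.
have Tf : (besov_norm eta0 (-1) +oo q (T (dist_of f)) <= op_norm eta0 (-1) +oo q T)%E.
  apply: ereal_sup_ubound; exists (dist_of f) => //; split=> //.
  exact: (schwartz_besov eta0P q0 n1 sf).
have E : dyadic_avg N f = avg N f.
  by apply/funext => x; apply: dyadic_avgE; exact: L1_avgk (schwartz_L1 sf).
have := TS _ sf; rewrite E => /(besov_norm_deq eta0P (-1) q) E2; rewrite {}E2 in Tf.
rewrite leNgt; apply/negP => opM.
have [r [r0 rM ru]] := besov_seq q0 (ltW M0) (ltW (le_lt_trans Tf opM)).
pose rho := K%:R * lam * p / (4 * (c + 1)).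
have rho0 : 0 <= rho by rewrite !mulr_ge0 ?invr_ge0 ?mulr_ge0// ltW.
suff h k : (0 < k <= K)%N -> rho <= r k.
  have := kapr M rho r rho0 (ltW M0) r0 rM h; apply/negP; rewrite -ltNge.
  move: KX; rewrite ltr_pdivrMr// => KX.
  have -> : rho * kap = K%:R * p / (4 * (c + 1) * C).
    by rewrite -[RHS]mulr1 -[X in _ = _ * X]lamE /rho; field; rewrite !gt_eqF.
  by rewrite ltr_pdivlMr// !mulr_gt0.
case: k => // k /= kK; pose y := (K * Ordinal kK)%:R *: e_ i.
have vk : (dist_Lnorm +oo (piece k.+1 (dist_of (avg N f))) <= (2 ^+ k.+1 * r k.+1)%:E)%E.
  by rewrite ru opprK powRr1.
have := test_dist_Lnorm eta0P y (ltn0Sn k) ag Lg vk.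
set G := test k.+1 y g; have LG : L1n (c + 1) G by exact: L1n_test.
pose w := 2 * (L * 2 ^- N).
have bw : bdd w (fun x => avg N (cD i (atoms K)) x - cD i (atoms K) x).
  split; first by apply: cmeasB; [exact: (avg_bdd N bD).1|exact: bD.1].
  move=> x; apply: (avg_sup bD) => z zN; apply: le_trans (LP x z) _.
  exact: ler_wpM2l.
have -> : dist_of (avg N f) G = (K%:R * lam)%:C * (I * (2 ^+ k.+1)%:C +
    cI mu (fun x => (avg N (cD i (atoms K)) x - cD i (atoms K) x) * G x)).
  have LD := bdd_L1 bD LG; have Lw := bdd_L1 bw LG.
  rewrite [I * _]mulrC -(atoms_test (Ordinal kK) ag) -/y -/G -(cID LD Lw) -(cIZ _ (L1D LD Lw)).
  by apply: eq_cI => x; rewrite avg_chord; ring.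
set e := cI mu _; have e_le : normc e <= p / 2.
  apply: le_trans (normc_cI_bdd bw LG) _; rewrite /w.
  have -> : 2 * (2 * (L * 2 ^- N) * (c + 1)) = 8 * L * (c + 1) / 2 / 2 ^+ N by field; rewrite pow1.
  rewrite ler_pdivrMr//; have : 8 * L * (c + 1) / p <= 2 ^+ N by apply: le_trans YN; rewrite lerDr.
  by rewrite ler_pdivrMr//; lra.
have le2 : 1 <= 2 ^+ k.+1 :> R by rewrite exprn_ege1// ler1n.
have low : 2 ^+ k.+1 * (p / 2) <= normc (I * (2 ^+ k.+1)%:C + e).
  have := le_normcD (I * (2 ^+ k.+1)%:C + e) (- e); rewrite addrK normcN.
  rewrite normcM normcR ger0_norm ?(ltW (pow0 _))// -/p => h.
  have h2 : p / 2 <= 2 ^+ k.+1 * (p / 2) by rewrite ler_peMl// divr_ge0// ltW.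
  have h3 : 2 ^+ k.+1 * (p / 2) = p * 2 ^+ k.+1 / 2 by field.
  lra.
have Kl : 0 <= K%:R * lam by rewrite mulr_ge0// ltW.
rewrite normcM normcR ger0_norm// => h.
have := le_trans (ler_wpM2l Kl low) h.
have -> : K%:R * lam * (2 ^+ k.+1 * (p / 2)) = 2 ^+ k.+1 * (K%:R * lam * p / 2) by field.
have -> : 2 * (2 ^+ k.+1 * r k.+1 * (c + 1)) = 2 ^+ k.+1 * (r k.+1 * (2 * (c + 1))) by ring.
rewrite ler_pM2l// => h4; rewrite /rho ler_pdivrMr ?mulr_gt0//.
have -> : r k.+1 * (4 * (c + 1)) = 2 * (r k.+1 * (2 * (c + 1))) by ring.
lra.
Qed.

End superposition.

Theorem theorem1p9 (R : realType) (d : nat) (hd : (1 <= d)%N)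
    (eta0 : 'rV[R]_d -> R[i]) (heta0 : lp_cutoff eta0) :
  (forall (s : R), -1 < s -> s < 0 ->
   forall (q : \bar R), (0 < q)%E ->
     uniformly_bounded_extensions eta0 s +oo%E q)
  /\
  ((forall (N : nat) (q : \bar R), (0 < q)%E ->
      admits_bounded_extension eta0 0 +oo%E q N <-> q = +oo%E)
   /\ uniformly_bounded_extensions eta0 0 +oo%E +oo%E
   /\ (ereal_sup [set avg_norm eta0 0 +oo%E +oo%E N | N in [set: nat]]
         < +oo)%E)
  /\
  (forall (q : \bar R), (0 < q)%E ->
     ereal_sup [set avg_norm eta0 (-1) +oo%E q N | N in [set: nat]] = +oo%E).
Proof.
have [n10 n01] : -1 <= 0 :> R /\ -1 < 0 :> R by rewrite lerN10 ltrN10.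
split; [|split; [split; [|split]|]].
- by move=> s s1 s0 q q0; apply: avg_uniformly_bounded => //; [exact: ltW|left].
- move=> N q q0; split=> [|->].
    case: q q0 => [q| |] // q0 qb; exfalso.
    have {}q0 : 0 < q by [].
    exact: (@no_bounded_extension R d eta0 heta0 (Ordinal hd) N q q0 qb).
  have [C CP] := avg_ext_bounded heta0 (ltry 0) n01 (lexx 0) (or_intror erefl).
  exists (avg_ext eta0 N); split; last exact: le_lt_trans (CP N) (ltry C).
  exact: avg_ext_is_extension.
- by apply: avg_uniformly_bounded => //; right.
- have [C CP] := avg_ext_bounded heta0 (ltry 0) n01 (lexx 0) (or_intror erefl).
  apply: le_lt_trans (ltry C); apply: ge_ereal_sup => _ [N _ <-].
  apply: le_trans (CP N); apply: ereal_inf_lbound; exists (avg_ext eta0 N) => //.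
  exact: avg_ext_is_extension.
- move=> q q0; apply/eqyP => M M0.
  have [N NM] := extension_blowup heta0 (Ordinal hd) q0 M0.
  apply: le_trans (ereal_sup_ubound _); last by exists N.
  by apply: le_ereal_inf_tmp => _ [T TP <-]; exact: NM.
Qed.
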